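(* Let $e\in\omega$ be such that the infinite time Turing machine program $\varphi_e:{}^{\omega}2\to\mathbb{N}$ is total (i.e. $\varphi_e(x)$ halts for every $x\in{}^{\omega}2$). For each $x\in{}^{\omega}2$ let $\nu_x$ be the length of the computation $\varphi_e(x)$, that is, the ordinal number of steps in which it halts, and suppose that for every $x$ the ordinal $\nu_x$ is a limit ordinal with $\nu_x\ge\omega^\omega$ (ordinal exponentiation). Let $f(x)=\nu_x$. Then $P^{f}\subsetneq NP^{f}$, i.e. $P^f\subseteq NP^f$ and $P^f\neq NP^f$.
   Context: **Infinite time Turing machines.** Elements of ${}^{\omega}2$ are called reals. A machine has three tapes (output, scratch, input), each an $\omega$-sequence of cells with values in $\{0,1\}$; the cells are enumerated $\langle C_i\mid i<\omega\rangle$ so that $C_{3l},C_{3l+1},C_{3l+2}$ are the $l$-th cells of the output, scratch and input tapes respectively. One head reads and writes the triple $C_{3l},C_{3l+1},C_{3l+2}$ at its current position $l$. A program is a finite table over a finite set of states, including a start state, a special limit state $q_L$ and a halt state $q_H$: for each non-halting state $q$ and each $j\in{}^{3}2$ read, it specifies a $j'\in{}^{3}2$ to be written, a direction $X\in\{L,R\}$ in which the head moves one unit (moving left from position $0$ leaves it there), and a next state. On input $x$, at stage $0$ the input tape contains $x$, all other cells contain $0$, the head is at position $0$, and the machine is in the start state. At each stage one instruction is executed, giving the configuration at the next stage. At a limit stage $\nu$ the machine is in state $q_L$, the head is at position $0$, and the value of each cell is the $\limsup$ of its values at earlier stages. The computation continues through all the ordinals unless it halts. It halts in $\nu$ many steps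 (has length $\nu$) if the instruction executed at stage $\nu$ (where $\nu$ may be a limit) is the one that enters $q_H$; the final cell values are those after this instruction is executed. Halting computations always have countable length, so $f$ takes values in $\omega_1$. Programs are enumerated by $e\in\omega$, and $\varphi_e$ denotes the partial function computed by the $e$-th program. Write $\varphi_e(x){\downarrow}$ if the computation on input $x$ halts, and $\varphi_e(x){\downarrow}1$ if it halts with final value $1$ in the first output cell $C_0$. For reals $x,y$, $x\oplus y$ is the real with $(x\oplus y)(2n)=x(n)$ and $(x\oplus y)(2n+1)=y(n)$. **The classes.** Let $f:{}^{\omega}2\to\omega_1$ and $A\subseteq{}^{\omega}2$. (A) $A\in P^f$ if there is $e\in\omega$ such that (i) for all $x$, $x\in A$ if and only if $\varphi_e(x){\downarrow}1$, and (ii) for all $z\in{}^{\omega}2$, $\varphi_e(z)$ halts in at most $f(z)$ many steps. (B) $A\in NP^f$ if there is $e\in\omega$ such that (i) for all $x$, $x\in A$ if and only if there exists $y\in{}^{\omega}2$ with $\varphi_e(x\oplus y){\downarrow}1$, and (ii) for all $x,y\in{}^{\omega}2$, $\varphi_e(x\oplus y)$ halts in at most $f(x)$ many steps. *)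

(* Defs.v *)
From mathcomp Require Import all_boot.
From mathcomp Require Import classical_sets.

Set Implicit Arguments.
Unset Strict Implicit.
Unset Printing Implicit Defensive.

(* Ordinals.  [osup F] is the least ordinal strictly above every [F a], so a
   term denotes the rank of the corresponding well-founded tree.  Distinct
   terms may denote the same ordinal: equality of ordinals is [oeq], never
   Leibniz equality. *)
Inductive ord : Type := osup (A : Type) (F : A -> ord).

Definition odom (a : ord) : Type := let: osup A _ := a in A.
Definition okid (a : ord) : odom a -> ord :=
  match a with osup A F => F end.
Arguments okid : clear implicits.

Fixpoint ole (a b : ord) {struct a} : Prop :=
  match a, b with
  | osup A F, osup B G => forall x : A, exists y : B, ole (F x) (G y)
  end.
Definition olt (a b : ord) : Prop := exists y : odom b, ole a (okid b y).
Definition oeq (a b : ord) : Prop := ole a b /\ ole b a.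

Definition ozero : ord := osup (of_void ord).
Definition osucc (a : ord) : ord := osup (fun _ : unit => a).
Definition olimit (a : ord) : Prop :=
  olt ozero a /\ forall b, olt b a -> olt (osucc b) a.

(* Least upper bound (not strict) of a family. *)
Definition olub (A : Type) (F : A -> ord) : ord :=
  osup (fun u : {x : A & odom (F x)} => okid (F (projT1 u)) (projT2 u)).

Fixpoint oadd (a b : ord) : ord :=
  match b with
  | osup B G =>
    osup (fun u : odom a + B =>
            match u with inl x => okid a x | inr y => oadd a (G y) end)
  end.
Fixpoint omul (a b : ord) : ord :=
  match b with osup B G => olub (fun y : B => oadd (omul a (G y)) a) end.
(* Meaningful for a nonzero base only: [oexp ozero b] is 1 for every [b]. *)
Fixpoint oexp (a b : ord) : ord :=
  match b with
  | osup B G =>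
    olub (fun u : option B =>
            if u is Some y then omul (oexp a (G y)) a else osucc ozero)
  end.

Definition omega : ord := osup (fun n : nat => iter n osucc ozero).

Definition real : Type := nat -> bool.
Definition join (x y : real) : real :=
  fun n => if odd n then y n./2 else x n./2.

(* Values of the output, scratch and input cell under the head. *)
Definition triple : Type := (bool * bool * bool)%type.

(* A program with [n.+2] non-halting states; state 0 is the start state and
   state 1 the limit state.  An instruction gives the triple to write, the
   direction of the move ([true] for R, [false] for L) and the next state,
   [None] being the halt state. *)
Definition table (n : nat) : Type :=
  {ffun 'I_n.+2 * triple -> triple * bool * option 'I_n.+2}.
Definition program : Type := {n : nat & table n}.

Definition start_state n : 'I_n.+2 := ord0.
Definition limit_state n : 'I_n.+2 := lift ord0 ord0.

(* [unpickle] is onto, so every program occurs in the enumeration; numbers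
   that code no program are given one that halts at once. *)
Definition prog (e : nat) : program :=
  odflt (existT table 0 [ffun _ => ((false, false, false), false, None)])
        (unpickle e).

Record config (n : nat) : Type := Config {
  state : 'I_n.+2;
  hpos : nat;
  cell : nat -> bool
}.

Section Machine.
Variables (n : nat) (t : table n).
Implicit Type c : config n.

Definition scan c : triple :=
  (cell c (3 * hpos c), cell c (3 * hpos c).+1, cell c (3 * hpos c).+2).
Definition instr c : triple * bool * option 'I_n.+2 := t (state c, scan c).

(* Cell values after the current instruction has been executed. *)
Definition written c : nat -> bool := fun i =>
  let: (u, v, w) := (instr c).1.1 in
  if i == 3 * hpos c then u
  else if i == (3 * hpos c).+1 then v
  else if i == (3 * hpos c).+2 then w
  else cell c i.
Definition moved c : nat := if (instr c).1.2 then (hpos c).+1 else (hpos c).-1.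

Definition initial (x : real) c : Prop :=
  [/\ state c = start_state n, hpos c = 0
    & forall i, cell c i = (i %% 3 == 2) && x (i %/ 3)].
Definition step c c' : Prop :=
  [/\ (instr c).2 = Some (state c'), hpos c' = moved c & cell c' =1 written c].
(* The instruction executed in [c] enters the halt state. *)
Definition halting c : Prop := (instr c).2 = None.

(* The last condition says that each cell value is the inf over [b < a] of
   the sup over [b <= d < a] of the earlier values. *)
Definition limit_of (h : ord -> config n) (a : ord) c : Prop :=
  [/\ state c = limit_state n, hpos c = 0
    & forall i, cell c i <->
        forall b, olt b a -> exists d, [/\ ole b d, olt d a & cell (h d) i]].

(* [h] gives the configurations at the stages up to and including [nu]; by
   [step], no instruction executed before stage [nu] enters the halt state. *)
Definition history (x : real) (nu : ord) (h : ord -> config n) : Prop :=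
  forall a, ole a nu ->
    [/\ oeq a ozero -> initial x (h a),
        forall b, oeq a (osucc b) -> step (h b) (h a)
      & olimit a -> limit_of h a (h a)].

End Machine.

(* The computation of the [e]-th program on [x] halts in [nu] many steps and
   the final cell values are [z]. *)
Definition halts_with (e : nat) (x : real) (nu : ord) (z : nat -> bool) : Prop :=
  let: existT n t := prog e in
  exists h : ord -> config n,
    [/\ history t x nu h, halting t (h nu) & z =1 written t (h nu)].

Definition halts_in (e : nat) (x : real) (nu : ord) : Prop :=
  exists z, halts_with e x nu z.
Definition halts (e : nat) (x : real) : Prop := exists nu, halts_in e x nu.
Definition accepts (e : nat) (x : real) : Prop :=
  exists nu z, halts_with e x nu z /\ z 0 = true.
Definition halts_within (e : nat) (x : real) (b : ord) : Prop :=
  exists2 nu, halts_in e x nu & ole nu b.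

Local Open Scope classical_set_scope.

(* The bound [f] may be any ordinal-valued function; since halting
   computations have countable length, a function giving the lengths of such
   computations automatically takes values below omega_1. *)
Definition Pclass (f : real -> ord) : set (set real) :=
  [set A | exists e : nat,
     (forall x, A x <-> accepts e x) /\
     (forall z, halts_within e z (f z))].

Definition NPclass (f : real -> ord) : set (set real) :=
  [set A | exists e : nat,
     (forall x, A x <-> exists y, accepts e (join x y)) /\
     (forall x y, halts_within e (join x y) (f x))].

(* Main.v *)
Require Import Defs.
From mathcomp Require Import all_boot.
From mathcomp Require Import boolp classical_sets.
From mathcomp Require Import zify.

Set Implicit Arguments.
Unset Strict Implicit.
Unset Printing Implicit Defensive.

(** A witness [y] for [x] codes a function [g] on numbers, meant as a linear order of the limit stages
    of the computation of [e] on [x] together with a record of that computation and of the one, on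
    [x], of the program [P] coded by [x].  That [g] obeys the rules of the two machines is a universal
    quantifier-free statement, which the verifier tests on larger and larger tuples during its first
    omega steps: a cell flashes after each success, so its limsup at stage omega is the verdict.
    In the remaining time the verifier climbs the order, marking at each limit stage the current point:
    limit points flash cofinally often below themselves, so their marks appear just in time.  If the
    order is well-founded, the record is true and the top is reached exactly when [e] halts; the
    verifier then accepts.  If not, all marks vanish at the end of the well-founded part and the
    verifier rejects omega steps later.  This is still in time provided [e] does not halt at that
    very stage, and a clause of the certificate that counts, by natural numbers, the rounds in which all
    the bits then read have been seen ensures this.  So the set of the [x] with a witness that [P] rejects
    [x] in time belongs to NP^f, and it is not in P^f by diagonalization.  For the inclusion, a machine that
    keeps its cells on the even positions needs [2 * n] steps for [n], and halting times are limits. *)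

(** * Ordinals *)

(** A witness can name only countably many stages. The points of an honest one are therefore a
    Skolem hull: the closure of 0 under adding ω and under the choice of the stages that the clauses
    ask for. The hull may leave gaps among the limit stages before the halting time ν of e, but the
    existential demands in the clauses have been replaced by functions, so the clauses survive the
    collapse of the hull to an ordinal. The collapsed record is again the true run of e on x, and
    since a machine halts at only one stage, the climb lasts exactly ν. Countability of ν never
    enters. Well-foundedness is no universal property, hence the climb in real time; its failure
    shows only at the end κ of the well-founded part. Below κ the record is right, so e halts at κ
    or later; ν being a limit, it is κ or at least κ + ω, and the verifier needs κ + ω. A halt at κ
    depends on three cells, whence finitely many clauses, one for each triple on which e halts in
    the limit state. If it happened, a number attached to the tame points would grow without bound,
    although it stays below its value at an ill-founded point. *)

Lemma ole_refl a : ole a a.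
Proof. by elim: a => A F IH x; exists x; apply: IH. Qed.

Lemma ole_trans a b c : ole a b -> ole b c -> ole a c.
Proof.
elim: a b c => A F IH [B G] [C H] /= ab bc x.
have [y xy] := ab x; have [z yz] := bc y; exists z; exact: IH xy yz.
Qed.

Lemma oleP a b : ole a b <-> forall x, olt (okid a x) b.
Proof. by case: a b => A F [B G]. Qed.

Lemma olt_le_trans a b c : olt a b -> ole b c -> olt a c.
Proof.
move=> [y ay] /oleP /(_ y) [z yz]; exists z; exact: ole_trans ay yz.
Qed.

Lemma ole_lt_trans a b c : ole a b -> olt b c -> olt a c.
Proof. by move=> ab [y ay]; exists y; exact: ole_trans ab ay. Qed.

Lemma okid_lt a x : olt (okid a x) a.
Proof. by exists x; exact: ole_refl. Qed.

Lemma oltW a b : olt a b -> ole a b.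
Proof.
elim: a b => A F IH b [y ay]; apply/oleP => x /=.
exists y; apply: IH; move/oleP: ay; exact.
Qed.

Lemma olt_trans a b c : olt a b -> olt b c -> olt a c.
Proof. by move=> ab /oltW; exact: olt_le_trans. Qed.

Lemma olt_wf : well_founded olt.
Proof.
move=> a; suff: forall b, ole b a -> Acc olt b by apply; exact: ole_refl.
elim: a => A F IH b ba; constructor => c cb.
have [y cy] := olt_le_trans cb ba; exact: IH cy.
Qed.

Lemma olt_irr a : ~ olt a a.
Proof. by elim/(well_founded_ind olt_wf): a => a IH aa; exact: (IH a). Qed.

Lemma ole_total a b : ole a b \/ olt b a.
Proof.
elim: a b => A F IH b.
have [h|h] := pselect (forall x, olt (F x) b); first by left; apply/oleP.
right; move/existsNP: h => [x nx]; exists x => /=.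
elim: b {IH}nx (IH x) => B G IHb nx IH.
apply/oleP => y; have [|//] := IH (G y) => xy.
by case: nx; exists y.
Qed.

Lemma oleNgt a b : ole a b <-> ~ olt b a.
Proof.
split=> [ab ba|]; first exact: (olt_irr (ole_lt_trans ab ba)).
by have [|] := ole_total a b.
Qed.

Lemma oltNge a b : olt a b <-> ~ ole b a.
Proof.
split=> [ab ba|]; first exact: (olt_irr (ole_lt_trans ba ab)).
by have [|] := ole_total b a.
Qed.

Lemma ole_eqVlt a b : ole a b -> oeq a b \/ olt a b.
Proof. by move=> ab; have [ba|] := ole_total b a; [left|right]. Qed.

Lemma oeq_refl a : oeq a a.
Proof. by split; exact: ole_refl. Qed.

Lemma oeq_sym a b : oeq a b -> oeq b a.
Proof. by case. Qed.

Lemma oeq_trans a b c : oeq a b -> oeq b c -> oeq a c.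
Proof. by move=> [h1 h2] [h3 h4]; split; [exact: ole_trans h3|exact: ole_trans h2]. Qed.

Lemma olt_oeql a b c : oeq a b -> olt a c -> olt b c.
Proof. by move=> [_ ba]; exact: ole_lt_trans. Qed.

Lemma olt_oeqr a b c : oeq a b -> olt c a -> olt c b.
Proof. by move=> [ab _] ca; exact: olt_le_trans ab. Qed.

Lemma oeq_ext a b : (forall c, olt c a <-> olt c b) -> oeq a b.
Proof.
by move=> h; split; apply/oleP => x; apply/h; exact: okid_lt.
Qed.

Lemma olt_succ a b : olt a (osucc b) <-> ole a b.
Proof. by split=> [[]|ab] //; exists tt. Qed.

Lemma osucc_le a b : ole (osucc a) b <-> olt a b.
Proof. by split=> [/oleP /(_ tt)|ab] //; apply/oleP => -[]. Qed.

Lemma olt_osucc a : olt a (osucc a).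
Proof. by apply/olt_succ; exact: ole_refl. Qed.

Lemma osucc_mono a b : ole a b -> ole (osucc a) (osucc b).
Proof. by move=> ab; apply/osucc_le/olt_succ. Qed.

Lemma oeq_succ a b : oeq (osucc a) (osucc b) <-> oeq a b.
Proof.
split=> [[h1 h2]|[h1 h2]]; split; try exact: osucc_mono.
  by apply/olt_succ/osucc_le.
by apply/olt_succ/osucc_le.
Qed.

Lemma ole0 a : ole ozero a.
Proof. by apply/oleP; case. Qed.

Lemma olt0 a : ~ olt a ozero.
Proof. by case; case. Qed.

Lemma oeq0 a : oeq a ozero <-> forall b, ~ olt b a.
Proof.
split=> [[h _] b ba|h]; first exact: (@olt0 b (olt_le_trans ba h)).
by split; [apply/oleNgt/h|exact: ole0].
Qed.

Lemma olimit_oeq a b : oeq a b -> olimit a -> olimit b.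
Proof.
move=> ab [h0 hs]; split; first exact: olt_oeqr h0.
by move=> c /(olt_oeqr (oeq_sym ab)) /hs; exact: olt_oeqr.
Qed.

Lemma olimit_not_succ a b : olimit a -> ~ oeq a (osucc b).
Proof.
move=> [_ h] [h1 h2]; have /h := olt_le_trans (olt_osucc b) h2.
by move=> h3; exact: (@olt_irr a (ole_lt_trans h1 h3)).
Qed.

Lemma ord_cases a : oeq a ozero \/ (exists b, oeq a (osucc b)) \/ olimit a.
Proof.
have [a0|a0] := pselect (oeq a ozero); [by left|right].
have [|nb] := pselect (exists b, oeq a (osucc b)); [by left|right].
split; first by apply/oltNge => h; apply: a0; split => //; exact: ole0.
move=> b ba; have /osucc_le /ole_eqVlt [e|//] := ba.
by case: nb; exists b; exact: oeq_sym.
Qed.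

Notation oplus a n := (iter n osucc a).

Lemma oplus_le a n : ole a (oplus a n).
Proof.
elim: n => [|n IH]; first exact: ole_refl.
exact: ole_trans IH (oltW (olt_osucc _)).
Qed.

Lemma oplusS_lt a n : olt a (oplus a n.+1).
Proof. by apply/olt_succ; exact: oplus_le. Qed.

Lemma oplus_mono a b n : ole a b -> ole (oplus a n) (oplus b n).
Proof. by move=> ab; elim: n => [//|n IH]; exact: osucc_mono. Qed.

Lemma oplus_oeq a b n : oeq a b -> oeq (oplus a n) (oplus b n).
Proof. by move=> [? ?]; split; exact: oplus_mono. Qed.

Lemma oplus_leq a m n : m <= n -> ole (oplus a m) (oplus a n).
Proof. by move=> mn; rewrite -(subnK mn) iterD; exact: oplus_le. Qed.

Lemma oplus_ltn a m n : m < n -> olt (oplus a m) (oplus a n).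
Proof. by move=> mn; apply/osucc_le/(oplus_leq a mn). Qed.

Lemma oplus_limit a b n : olimit a -> olt b a -> olt (oplus b n) a.
Proof. by move=> [_ h] ba; elim: n => [//|n IH]; exact: h. Qed.

Lemma olt_oplus a b n : olt b (oplus a n) ->
  olt b a \/ exists2 k, k < n & oeq b (oplus a k).
Proof.
elim: n => [|n IH] /=; first by left.
move=> /olt_succ /ole_eqVlt [e|/IH [|[k kn e]]]; first by right; exists n.
  by left.
by right; exists k => //; exact: ltnW.
Qed.

(** * Zero or a limit, plus a natural number *)

Definition olim0 a := oeq a ozero \/ olimit a.

Lemma ord_decomp a : exists b n, olim0 b /\ oeq a (oplus b n).
Proof.
elim/(well_founded_ind olt_wf): a => a IH.
have [h|[[b e]|h]] := ord_cases a.
- by exists a, 0; split; [left|exact: oeq_refl].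
- have [|c [n [hc en]]] := IH b; first by apply: olt_oeqr (olt_osucc b); exact: oeq_sym.
  by exists c, n.+1; split=> //=; apply: oeq_trans e _; apply/oeq_succ.
- by exists a, 0; split; [right|exact: oeq_refl].
Qed.

(** This is a + ω; for zero or a limit a, it is the next limit stage. *)
Definition oplusw a : ord := osup (fun n : nat => oplus a n).

Lemma oplusw_limit a : olimit (oplusw a).
Proof.
split; first by exists 0; exact: ole0.
by move=> b [n bn]; exists n.+1; exact: osucc_mono.
Qed.

Lemma oplusw_lt a n : olt (oplus a n) (oplusw a).
Proof. by exists n; exact: ole_refl. Qed.

Lemma oplusw_le a b : olimit b -> olt a b -> ole (oplusw a) b.
Proof. by move=> lb ab; apply/oleP => n; exact: oplus_limit. Qed.

Lemma oplusw_mono a b : ole a b -> ole (oplusw a) (oplusw b).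
Proof. by move=> ab; apply/oleP => n; exists n; exact: oplus_mono. Qed.

Lemma omega_limit : olimit omega.
Proof. exact: (oplusw_limit ozero). Qed.

Lemma limit_omega_le a : olimit a -> ole omega a.
Proof. by move=> la; apply: oplusw_le => //; case: la. Qed.

(** * Canonical runs *)

Section Run.
Variables (n : nat) (t : table n) (x : real).
Implicit Types (c : config n) (a b : ord).

Lemma config_eq c c' : state c = state c' -> hpos c = hpos c' ->
  cell c =1 cell c' -> c = c'.
Proof. by case: c c' => [s p w] [s' p' w'] /= -> -> /funext ->. Qed.

(** A halting configuration is repeated, so that [run] is total; this is why [halts_at] must require
    that no earlier stage halts. *)
Definition nextc c : config n :=
  if (instr t c).2 is Some q then Config q (moved t c) (written t c) else c.

Definition init_config : config n :=
  Config (start_state n) 0 (fun i => (i %% 3 == 2) && x (i %/ 3)).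

(** Ordinals are trees up to [oeq], so the case distinction is semantic and the predecessor of a
    successor is merely chosen. That the choice is harmless is [run_eq]. *)
Definition run_step a (rec : forall b, olt b a -> config n) : config n :=
  match pselect (exists b, oeq a (osucc b)) with
  | left h => nextc (rec (sval (cid h)) (olt_oeqr (oeq_sym (svalP (cid h))) (olt_osucc _)))
  | right _ =>
    if pselect (olimit a) then
      Config (limit_state n) 0
        (fun i => `[< forall b, olt b a ->
           exists d, exists hd : olt d a, ole b d /\ cell (rec d hd) i >])
    else init_config
  end.

Definition run : ord -> config n := Fix olt_wf (fun _ => config n) run_step.

Lemma runE a : run a = run_step (fun b (_ : olt b a) => run b).
Proof.
rewrite /run Fix_eq // => b f g fg; congr run_step.
by apply: functional_extensionality_dep => d; apply: functional_extensionality_dep.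
Qed.

Lemma run_lim a : olimit a -> run a =
  Config (limit_state n) 0 (fun i => `[< forall b, olt b a ->
    exists d, [/\ ole b d, olt d a & cell (run d) i] >]).
Proof.
move=> la; rewrite runE /run_step.
case: (pselect (exists b, _)) => [h|nh].
  by have [b e] := h; case: (olimit_not_succ la e).
case: (pselect (olimit a)) => [la'|[]//].
apply: config_eq => //= i; apply: asbool_equiv_eq; split=> h b /h => [[d [hd [h1 h2]]]|[d [h1 h2 h3]]]; exists d => //.
Qed.

Lemma run_step_succ a b : oeq a (osucc b) -> exists b', oeq b b' /\ run a = nextc (run b').
Proof.
move=> e; rewrite runE /run_step.
case: (pselect (exists b, _)) => [h|[]]; last by exists b.
exists (sval (cid h)); split=> //; apply/oeq_succ.
exact: oeq_trans (oeq_sym e) (svalP (cid h)).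
Qed.

Lemma run_eq a b : oeq a b -> run a = run b.
Proof.
elim/(well_founded_ind olt_wf): a b => a IH b ab.
have [a0|[[c ac]|la]] := ord_cases a.
- have b0 := oeq_trans (oeq_sym ab) a0.
  have z d : oeq d ozero -> run d = init_config.
    move=> d0; rewrite runE /run_step; case: (pselect (exists b, _)) => [h|nh].
      have [d' e] := h; by case: (@olt0 d'); apply: olt_oeqr d0 _; apply: olt_oeqr (oeq_sym e) (olt_osucc _).
    by case: (pselect (olimit _)) => // -[h h2]; case: (olt0 (olt_oeqr d0 h)).
  by rewrite !z.
- have bc := oeq_trans (oeq_sym ab) ac.
  have [a' [ca' ->]] := run_step_succ ac; have [b' [cb' ->]] := run_step_succ bc.
  congr nextc; apply: IH; last exact: oeq_trans (oeq_sym ca') cb'.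
  apply: olt_oeqr (oeq_sym ac) _; apply/olt_succ; exact: (oeq_sym ca').1.
- rewrite !run_lim //; last exact: olimit_oeq la.
  apply: config_eq => //= i; apply: asbool_equiv_eq.
  split=> h c hc.
    have [|d [h1 h2 h3]] := h c; first exact: olt_oeqr (oeq_sym ab) hc.
    by exists d; split=> //; exact: olt_oeqr ab h2.
  have [|d [h1 h2 h3]] := h c; first exact: olt_oeqr ab hc.
  by exists d; split=> //; exact: olt_oeqr (oeq_sym ab) h2.
Qed.

Lemma run0 a : oeq a ozero -> run a = init_config.
Proof.
move=> d0; rewrite runE /run_step; case: (pselect (exists b, _)) => [h|nh].
  have [d' e] := h; by case: (@olt0 d'); apply: olt_oeqr d0 _; apply: olt_oeqr (oeq_sym e) (olt_osucc _).
by case: (pselect (olimit _)) => // -[h h2]; case: (olt0 (olt_oeqr d0 h)).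
Qed.

Lemma run_succ a : run (osucc a) = nextc (run a).
Proof.
have [b [ab ->]] := run_step_succ (oeq_refl (osucc a)).
by rewrite (run_eq ab).
Qed.

Lemma run_oplus a k : run (oplus a k) = iter k nextc (run a).
Proof. by elim: k => [//|k IH]; rewrite [in LHS]iterS run_succ IH. Qed.

Lemma run_limP a i : olimit a -> cell (run a) i <->
  forall b, olt b a -> exists d, [/\ ole b d, olt d a & cell (run d) i].
Proof. by move=> la; rewrite run_lim //= asboolE. Qed.

(** The conditions on a history determine each stage from the earlier ones. Existential statements
    about histories thereby become statements about the one canonical run. *)
Lemma history_run nu h : history t x nu h ->
  forall a, ole a nu -> h a = run a.
Proof.
move=> hist a; elim/(well_founded_ind olt_wf): a => a IH anu.
have [h0 hs hl] := hist a anu.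
have [a0|[[c ac]|la]] := ord_cases a.
- have [e1 e2 e3] := h0 a0; rewrite run0 //; exact: config_eq.
- have [e1 e2 e3] := hs c ac; rewrite (run_eq ac) run_succ.
  have ca : olt c a by apply: olt_oeqr (oeq_sym ac) (olt_osucc _).
  rewrite -IH //; last exact: ole_trans (oltW ca) anu.
  by rewrite /nextc e1; apply: config_eq.
- have [e1 e2 e3] := hl la; rewrite run_lim //; apply: config_eq => //= i.
  apply/idP/asboolP => [/e3 w|w].
    move=> b /w [d [h1 h2 h3]]; exists d; split=> //; rewrite -IH //.
    exact: ole_trans (oltW h2) anu.
  apply/e3 => b /w [d [h1 h2 h3]]; exists d; split=> //; rewrite IH //.
  exact: ole_trans (oltW h2) anu.
Qed.

Lemma run_history nu : (forall b, olt b nu -> ~ halting t (run b)) ->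
  history t x nu run.
Proof.
move=> nh a anu; split=> [a0|b ab|la].
- by rewrite run0.
- rewrite (run_eq ab) run_succ /nextc.
  have := nh b (olt_le_trans (olt_oeqr (oeq_sym ab) (olt_osucc _)) anu).
  by rewrite /halting /step; case: (_.2) => // q _.
- by rewrite run_lim //; split=> // i; rewrite /= asboolE.
Qed.

Definition halts_at nu :=
  halting t (run nu) /\ forall b, olt b nu -> ~ halting t (run b).

Lemma halts_at_uniq nu nu' : halts_at nu -> halts_at nu' -> oeq nu nu'.
Proof.
move=> [h1 h2] [h1' h2']; split; apply/oleNgt => h; first by case: (h2 _ h).
by case: (h2' _ h).
Qed.

End Run.

Lemma halts_withP e x nu z : let: existT n t := prog e in
  halts_with e x nu z <-> halts_at t x nu /\ z =1 written t (run t x nu).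
Proof.
rewrite /halts_with; case: (prog e) => n t; split=> [[h [hist hh hz]]|[[h1 h2] hz]].
  have hE := history_run hist.
  rewrite hE in hh hz; last exact: ole_refl.
  split=> //; split=> // b bnu; have [_ hs _] := hist (osucc b) (proj2 (osucc_le b nu) bnu).
  have := hs b (oeq_refl _); rewrite /step /halting (hE b (oltW bnu)).
  by case=> ->.
by exists (run t x); split=> //; exact: run_history.
Qed.

Lemma halts_inP e x nu :
  let: existT n t := prog e in halts_in e x nu <-> halts_at t x nu.
Proof.
have := @halts_withP e x nu; rewrite /halts_in; case: (prog e) => n t h.
split=> [[z /h []]|hh] //; exists (written t (run t x nu)); exact/h.
Qed.

Lemma acceptsP e x : let: existT n t := prog e in accepts e x <->
  exists2 nu, halts_at t x nu & written t (run t x nu) 0.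
Proof.
have := @halts_withP e x; rewrite /accepts; case: (prog e) => n t h.
split=> [[nu [z [/h [hh ->] z0]]]|[nu hh w]]; first by exists nu.
by exists nu, (written t (run t x nu)); split=> //; exact/h.
Qed.

Lemma prog_onto n (t : table n) : exists e, prog e = existT table n t.
Proof. by exists (pickle (existT table n t : program)); rewrite /prog pickleK. Qed.

(** * Tape programs *)

Definition cells := nat -> bool.
Definition row := triple -> triple * bool * option nat.
(** Default for addresses outside the code: they halt. *)
Definition row0 : row := fun t => (t, false, None).
Definition rconf := (nat * (nat * cells))%type.

Definition rscan p (w : cells) : triple := (w (3 * p), w (3 * p).+1, w (3 * p).+2).
Definition rput p (w : cells) (t : triple) : cells := fun i =>
  let: (a, b, c) := t in
  if i == 3 * p then a else if i == (3 * p).+1 then b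
  else if i == (3 * p).+2 then c else w i.
Definition rmove p (d : bool) := if d then p.+1 else p.-1.

Lemma rput_scan p w : rput p w (rscan p w) = w.
Proof.
by apply/funext => i; rewrite /rput /rscan; do 3 (case: eqP => [->//|_]).
Qed.

Section Code.
Variable code : seq row.

Definition rrow (s : rconf) := nth row0 code s.1 (rscan s.2.1 s.2.2).

Definition rstep (s : rconf) : rconf :=
  if (rrow s).2 is Some q then
    (q, (rmove s.2.1 (rrow s).1.2, rput s.2.1 s.2.2 (rrow s).1.1))
  else s.

(** The trace holds the tape before each executed step, the last tape excluded, so that traces
    concatenate. It is kept because a limsup depends on every intermediate value and not only on the
    result. *)
Inductive reach : rconf -> seq cells -> rconf -> Prop :=
| Reach0 s : reach s [::] s
| ReachS s tr s' : (rrow s).2 <> None -> reach (rstep s) tr s' ->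
    reach s (s.2.2 :: tr) s'.

Lemma reach1 pc p w q p' w' t d : nth row0 code pc (rscan p w) = (t, d, Some q) ->
  p' = rmove p d -> w' = rput p w t -> reach (pc, (p, w)) [:: w] (q, (p', w')).
Proof.
move=> e -> ->; apply: (@ReachS (pc, (p, w)) [::]); rewrite /rrow /= ?e //.
rewrite /rstep /rrow /= e; exact: Reach0.
Qed.

Lemma reach_cat s1 t1 s2 t2 s3 : reach s1 t1 s2 -> reach s2 t2 s3 ->
  reach s1 (t1 ++ t2) s3.
Proof. by elim=> [//|s tr s' h1 _ IH /IH]; exact: ReachS. Qed.

Lemma reach_iter s tr s' : reach s tr s' -> iter (size tr) rstep s = s'.
Proof. by elim=> [//|s1 t1 s2 _ _ IH] /=; rewrite -iterS iterSr. Qed.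

Lemma reach_nth s tr s' k : reach s tr s' -> k < size tr ->
  (iter k rstep s).2.2 = nth (fun _ => false) tr k /\ (rrow (iter k rstep s)).2 <> None.
Proof.
move=> h; elim: h k => [//|s1 t1 s2 h1 _ IH] [|k] //= lk.
by rewrite -iterS iterSr; exact: IH.
Qed.

Definition at_code pc (rs : seq row) :=
  forall i, i < size rs -> nth row0 code (pc + i) = nth row0 rs i.

Lemma at_code_cat pc r1 r2 : at_code pc (r1 ++ r2) ->
  at_code pc r1 /\ at_code (pc + size r1) r2.
Proof.
move=> h; split=> i hi.
  by rewrite h ?nth_cat ?hi // size_cat; lia.
by rewrite -addnA h ?nth_cat ?size_cat; [case: ltnP; [lia|rewrite addKn]|lia].
Qed.

Lemma at_code_cons pc r rs : at_code pc (r :: rs) ->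
  nth row0 code pc = r /\ at_code pc.+1 rs.
Proof.
move=> h; split; first by rewrite -[pc]addn0 h.
by move=> i hi; rewrite addSnnS h.
Qed.

End Code.

Inductive tl :=
| TRow of (triple -> triple * bool)
| TSeq of tl & tl
| TIte of (triple -> bool) & tl & tl
| TWhile of (triple -> bool) & tl.

Fixpoint tsize c := match c with
| TRow _ => 1
| TSeq a b => tsize a + tsize b
| TIte _ a b => (tsize a).+3 + tsize b
| TWhile _ a => (tsize a).+3
end.

(** Every instruction moves the head, so a test steps to the right and this row steps back. The
    opposite order would fail at position 0, where a move to the left is lost. *)
Definition row_left k : row := fun t => (t, false, Some k).

Fixpoint tcomp c pc k : seq row := match c with
| TRow f => [:: fun t => (f t, Some k)]
| TSeq a b => tcomp a pc (pc + tsize a) ++ tcomp b (pc + tsize a) k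
| TIte b c1 c2 =>
    (fun t => (t, true, Some (if b t then pc.+1 else pc.+2 + tsize c1)))
    :: row_left pc.+2 :: tcomp c1 pc.+2 k
    ++ row_left (pc.+3 + tsize c1) :: tcomp c2 (pc.+3 + tsize c1) k
| TWhile b c =>
    (fun t => (t, true, Some (if b t then pc.+1 else pc.+2 + tsize c)))
    :: row_left pc.+2 :: tcomp c pc.+2 pc ++ [:: row_left k]
end.

Lemma size_tcomp c pc k : size (tcomp c pc k) = tsize c.
Proof.
elim: c pc k => [f|a IHa b IHb|t a IHa b IHb|t a IHa] pc k //=.
- by rewrite size_cat IHa IHb.
- by rewrite size_cat /= IHa IHb; lia.
- by rewrite size_cat /= IHa addn1.
Qed.

Definition tconf := (nat * cells)%type.

Inductive exec : tl -> tconf -> seq cells -> tconf -> Prop :=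
| XRow f p w : exec (TRow f) (p, w) [:: w]
    (rmove p (f (rscan p w)).2, rput p w (f (rscan p w)).1)
| XSeq a b s1 t1 s2 t2 s3 : exec a s1 t1 s2 -> exec b s2 t2 s3 ->
    exec (TSeq a b) s1 (t1 ++ t2) s3
| XIteT (t : triple -> bool) a b p w tr s : t (rscan p w) -> exec a (p, w) tr s ->
    exec (TIte t a b) (p, w) ([:: w; w] ++ tr) s
| XIteF (t : triple -> bool) a b p w tr s : ~~ t (rscan p w) -> exec b (p, w) tr s ->
    exec (TIte t a b) (p, w) ([:: w; w] ++ tr) s
| XWhileF (t : triple -> bool) a p w : ~~ t (rscan p w) ->
    exec (TWhile t a) (p, w) [:: w; w] (p, w)
| XWhileT (t : triple -> bool) a p w tr1 s1 tr2 s2 : t (rscan p w) -> exec a (p, w) tr1 s1 ->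
    exec (TWhile t a) s1 tr2 s2 ->
    exec (TWhile t a) (p, w) ([:: w; w] ++ (tr1 ++ tr2)) s2.

Lemma reach_test code pc p w q k :
  nth row0 code pc (rscan p w) = (rscan p w, true, Some q) ->
  nth row0 code q = row_left k -> reach code (pc, (p, w)) [:: w; w] (k, (p, w)).
Proof.
move=> h1 h2; apply: (@reach_cat _ _ [:: w] (q, (p.+1, w)) [:: w]).
  by apply: reach1 h1 _ _; rewrite ?rput_scan.
by apply: (@reach1 _ _ _ _ _ _ _ (rscan p.+1 w) false); rewrite ?h2 ?rput_scan.
Qed.

Lemma exec_reach code c s tr s' pc k : exec c s tr s' ->
  at_code code pc (tcomp c pc k) -> reach code (pc, s) tr (k, s').
Proof.
move=> h; elim: h pc k => {c s tr s'}.
- move=> f p w pc k /at_code_cons [h _].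
  apply: (@reach1 _ _ _ _ _ _ _ (f (rscan p w)).1 (f (rscan p w)).2) => //.
  by rewrite h -surjective_pairing.
- move=> a b s1 t1 s2 t2 s3 _ IH1 _ IH2 pc k /at_code_cat [h1 h2].
  rewrite size_tcomp in h2; exact: reach_cat (IH1 _ _ h1) (IH2 _ _ h2).
- move=> t a b p w tr s ht _ IH pc k /= /at_code_cons [h1 /at_code_cons [h2]].
  move=> /at_code_cat [h3 _].
  apply: (@reach_cat _ _ [:: w; w] _ _ _ _ (IH _ _ h3)); by apply: reach_test; [rewrite h1 ht|exact: h2].
- move=> t a b p w tr s /negbTE ht _ IH pc k /= /at_code_cons [h1 /at_code_cons [h2]].
  move=> /at_code_cat [_]; rewrite size_tcomp => /at_code_cons [h3].
  rewrite -addSn => h4.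
  apply: (@reach_cat _ _ [:: w; w] _ _ _ _ (IH _ _ h4)); by apply: reach_test; [rewrite h1 ht|exact: h3].
- move=> t a p w /negbTE ht pc k /= /at_code_cons [h1 /at_code_cons [h2]].
  move=> /at_code_cat [_]; rewrite size_tcomp => /at_code_cons [h3 _].
  by apply: reach_test; [rewrite h1 ht|exact: h3].
- move=> t a p w tr1 s1 tr2 s2 ht _ IH1 _ IH2 pc k hat; have := hat.
  move=> /= /at_code_cons [h1 /at_code_cons [h2]].
  move=> /at_code_cat [h3 _].
  apply: (@reach_cat _ _ [:: w; w] _ _ _ _ (reach_cat (IH1 _ _ h3) (IH2 _ _ hat))).
  by apply: reach_test; [rewrite h1 ht|exact: h2].
Qed.

Section Table.
Variables (code : seq row) (n : nat).
Hypothesis code_ok : forall i t q, (nth row0 code i t).2 = Some q -> q < n.+2.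

Definition code_table : table n :=
  [ffun qt => let: r := nth row0 code (val qt.1) qt.2 in (r.1, omap (fun q => inord q) r.2)].

Definition rawc (c : config n) : rconf := (val (state c), (hpos c, cell c)).

Lemma instr_code c :
  instr code_table c = ((rrow code (rawc c)).1, omap (fun q => inord q) (rrow code (rawc c)).2).
Proof. by rewrite /instr /code_table ffunE. Qed.

Lemma halting_code c : halting code_table c <-> (rrow code (rawc c)).2 = None.
Proof. by rewrite /halting instr_code /=; case: (_.2). Qed.

Lemma written_code c : written code_table c = rput (hpos c) (cell c) (rrow code (rawc c)).1.1.
Proof. by apply/funext => i; rewrite /written instr_code. Qed.

Lemma nextc_code c : rawc (nextc code_table c) = rstep code (rawc c).
Proof.
rewrite /nextc /rstep written_code /moved instr_code /=.
case e: (rrow code (rawc c)).2 => [q|] //=.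
rewrite /rawc /= inordK //; apply: code_ok; exact: e.
Qed.

Lemma run_code x a k : rawc (run code_table x (oplus a k)) =
  iter k (rstep code) (rawc (run code_table x a)).
Proof. by rewrite run_oplus; elim: k => [//|k IH]; rewrite !iterS nextc_code IH. Qed.

End Table.

(** * Counter programs *)

Section Traces.
Implicit Types (P Q : cells -> Prop) (tr : seq cells).

Fixpoint all_tr P tr := if tr is u :: tr' then P u /\ all_tr P tr' else True.
Fixpoint has_tr P tr := if tr is u :: tr' then P u \/ has_tr P tr' else False.

Lemma all_tr_cat P t1 t2 : all_tr P (t1 ++ t2) <-> all_tr P t1 /\ all_tr P t2.
Proof. by elim: t1 => [|u t IH] /=; [tauto|rewrite IH; tauto]. Qed.

Lemma has_tr_cat P t1 t2 : has_tr P (t1 ++ t2) <-> has_tr P t1 \/ has_tr P t2.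
Proof. by elim: t1 => [|u t IH] /=; [tauto|rewrite IH; tauto]. Qed.

Lemma all_tr_nseq P n w : P w -> all_tr P (nseq n w).
Proof. by move=> h; elim: n. Qed.

Lemma all_tr_impl P Q tr : (forall u, P u -> Q u) -> all_tr P tr -> all_tr Q tr.
Proof. by move=> h; elim: tr => //= u tr IH [/h ? /IH]. Qed.

Lemma all_trP P tr k w0 : all_tr P tr -> k < size tr -> P (nth w0 tr k).
Proof. by elim: tr k => // u tr IH [|k] /= [h1 h2] //; apply: IH. Qed.

Lemma has_trP P tr w0 : has_tr P tr -> exists2 k, k < size tr & P (nth w0 tr k).
Proof.
by elim: tr => //= u tr IH [h|/IH [k]]; [exists 0|exists k.+1].
Qed.
End Traces.

Inductive cmd :=
| Skip
| Zero of nat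
| Copy of nat & nat
| Inc of nat
| Dec of nat
| Then of cmd & cmd
| Loop of nat & cmd
| IfZ of nat & cmd & cmd
| IfBit of nat & nat & cmd & cmd
| SetBit of nat & nat & bool.

Definition vars := nat -> nat.
Definition tracks := nat -> nat -> bool.
Definition store := (vars * tracks)%type.

Definition updv (s : vars) v n : vars := fun i => if i == v then n else s i.
Definition updt (T : tracks) o b (x : bool) : tracks :=
  fun o' b' => if (o' == o) && (b' == b) then x else T o' b'.

Fixpoint iterdn (f : store -> store) v n s :=
  if n is n'.+1 then iterdn f v n' (f (updv s.1 v n', s.2)) else s.

Fixpoint sem c (s : store) : store := match c with
| Skip => s
| Zero v => (updv s.1 v 0, s.2)
| Copy d i => (updv s.1 d (s.1 i), s.2)
| Inc v => (updv s.1 v (s.1 v).+1, s.2)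
| Dec v => (updv s.1 v (s.1 v).-1, s.2)
| Then a b => sem b (sem a s)
| Loop v c => iterdn (sem c) v (s.1 v) s
| IfZ v a b => if s.1 v == 0 then sem a s else sem b s
| IfBit o v a b => if s.2 o (s.1 v) then sem a s else sem b s
| SetBit o v x => (s.1, updt s.2 o (s.1 v) x)
end.

Fixpoint visdn (f : store -> store) (g : store -> tracks -> Prop) v n s T :=
  if n is n'.+1 then
    let s' := (updv s.1 v n', s.2) in g s' T \/ visdn f g v n' (f s') T
  else False.

(* The values taken by the tracks during the execution of [c]. *)
Fixpoint vis c (s : store) (T : tracks) : Prop := match c with
| Then a b => vis a s T \/ vis b (sem a s) T
| Loop v c => T = s.2 \/ visdn (sem c) (vis c) v (s.1 v) s T
| IfZ v a b => T = s.2 \/ if s.1 v == 0 then vis a s T else vis b s T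
| IfBit o v a b => T = s.2 \/ if s.2 o (s.1 v) then vis a s T else vis b s T
| SetBit o v x => T = s.2 \/ T = updt s.2 o (s.1 v) x
| _ => T = s.2
end.

Lemma vis_end c s : vis c s (sem c s).2.
Proof.
elim: c s => [|u|d i|u|u|a IHa b IHb|u a IHa|u a IHa b IHb|o u a IHa b IHb|o u x] s //=.
- by right.
- move: (s.1 u) => k; elim: k s => [|k IH] s /=; first by left.
  by right; case: (IH (sem a (updv s.1 u k, s.2))) => [->|h]; [left|right].
- by right; case: (_ == 0); [exact: IHa|exact: IHb].
- by right; case: (s.2 o _); [exact: IHa|exact: IHb].
- by right.
Qed.

Fixpoint nomod v c := match c with
| Skip | SetBit _ _ _ => true
| Zero u | Copy u _ | Inc u | Dec u => u != v
| Then a b | IfZ _ a b | IfBit _ _ a b => nomod v a && nomod v b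
| Loop u a => (u != v) && nomod v a
end.

Lemma nomodP v c s : nomod v c -> (sem c s).1 v = s.1 v.
Proof.
elim: c s => [|u|d i|u|u|a IHa b IHb|u a IHa|u a IHa b IHb|o u a IHa b IHb|o u x] s //=;
  rewrite /updv.
- by rewrite eq_sym => /negbTE ->.
- by rewrite eq_sym => /negbTE ->.
- by rewrite eq_sym => /negbTE ->.
- by rewrite eq_sym => /negbTE ->.
- by case/andP => /IHa h1 /IHb h2; rewrite h2 h1.
- case/andP; rewrite eq_sym => /negbTE h1 /IHa h2.
  by move: (s.1 u) => k; elim: k s => //= n IH s; rewrite IH h2 /= /updv h1.
- by case/andP => /IHa h1 /IHb h2; case: ifP.
- by case/andP => /IHa h1 /IHb h2; case: ifP.
Qed.

Section Machine.
Variable NV : nat.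
Local Notation K := (NV + 6).

(* Block [b] consists of [K] consecutive head positions, and its cell number [o] belongs to the track [o].
   The value of the counter [v] is the block whose cell [ov v] is on while the next one is off.  A mark is
   erased by turning the latter cell on, so that at limit stages the marks that moved are not restored. *)
Definition idx b o := b * (3 * K) + o.
(** The first six positions of a block carry the tracks 0 to 17; the counter [v] owns two cells of
    the position [6 + v]. The third cell there lies on the input tape and remains a track. *)
Definition isvar o := (18 <= o) && (o %% 3 < 2).
Definition ov v := 18 + 3 * v.
Definition goodo o := (o < 3 * K) && ~~ isvar o.

Definition trk (w : cells) : tracks := fun o b => goodo o && w (idx b o).
Definition mk (w : cells) v b := w (idx b (ov v)) && ~~ w (idx b (ov v).+1).
Definition Rel w (s : store) :=
  trk w = s.2 /\ forall v b, v < NV -> mk w v b = (b == s.1 v).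
Definition homeT (T : tracks) := forall b, T 4 b = (b == 0).
(** The first cell of a counter pair is never switched off again within an interval. So once the
    counter has left the block, its eraser must be on, which is what cleans the tape at the next
    limit stage. *)
Definition mono (u w : cells) :=
  forall v b, v < NV -> u (idx b (ov v)) -> w (idx b (ov v)).

Fixpoint ok c := match c with
| Skip => true
| Zero v | Inc v | Dec v => v < NV
| Copy d i => [&& d < NV, i < NV & d != i]
| Then a b => ok a && ok b
| Loop v a => [&& v < NV, ok a & nomod v a]
| IfZ v a b => [&& v < NV, ok a & ok b]
| IfBit o v a b => [&& goodo o, v < NV, ok a & ok b]
| SetBit o v _ => [&& goodo o, v < NV & o != 4]
end.

Lemma idx_inj b o b' o' : o < 3 * K -> o' < 3 * K -> idx b o = idx b' o' ->
  b = b' /\ o = o'.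
Proof.
rewrite /idx => h h' e.
have e1 : b = b'.
  have := congr1 (fun n => n %/ (3 * K)) e.
  by rewrite !divnMDl ?(divn_small h) ?(divn_small h') ?addn0 //; lia.
by subst b'; split=> //; lia.
Qed.

Lemma idx_pos b r : 3 * (b * K + r) = idx b (3 * r).
Proof. rewrite /idx; lia. Qed.

Definition setc w b v (m : bool) : cells := fun i =>
  if i == idx b (ov v) then true else if i == idx b (ov v).+1 then ~~ m else w i.

Lemma scan_var w b v : rscan (b * K + (6 + v)) w =
  (w (idx b (ov v)), w (idx b (ov v).+1), w (idx b (ov v).+2)).
Proof. rewrite /rscan idx_pos /idx /ov; congr (w _, w _, w _); lia. Qed.

Lemma rput_setc w b v m :
  rput (b * K + (6 + v)) w (true, ~~ m, (rscan (b * K + (6 + v)) w).2) = setc w b v m.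
Proof.
apply/funext => i; rewrite scan_var /rput /setc idx_pos /=.
have -> : 3 * (6 + v) = ov v by rewrite mulnDr.
rewrite (_ : (idx b (ov v)).+1 = idx b (ov v).+1); last by rewrite /idx; lia.
rewrite (_ : (idx b (ov v).+1).+1 = idx b (ov v).+2); last by rewrite /idx; lia.
case: eqP => // _; case: eqP => // _; by case: eqP => [->|].
Qed.

Lemma ov_lt v : v < NV -> (ov v).+2 < 3 * K.
Proof. rewrite /ov; lia. Qed.

Lemma isvar_ov v : isvar (ov v) /\ isvar (ov v).+1.
Proof. rewrite /isvar /ov; split; lia. Qed.

Lemma mono_trans u v w : mono u v -> mono v w -> mono u w.
Proof. by move=> h1 h2 x b l /(h1 _ _ l) /(h2 _ _ l). Qed.

Lemma idx_eq b o b' o' : o < 3 * K -> o' < 3 * K ->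
  (idx b o == idx b' o') = (o == o') && (b == b').
Proof.
by move=> h h'; apply/eqP/andP => [/idx_inj [] // -> ->|[/eqP -> /eqP ->]].
Qed.

Lemma mono_setc w b v m : v < NV -> mono w (setc w b v m).
Proof.
move=> vN v' b' l h; rewrite /setc; have [l1 l2] := (ov_lt vN, ov_lt l).
rewrite !idx_eq; try lia; case: ifP => // _; case: ifP => // /andP [/eqP e _].
by move: e; rewrite /ov; lia.
Qed.

Lemma trk_setc w b v m : v < NV -> trk (setc w b v m) = trk w.
Proof.
move=> vN; apply/funext => o; apply/funext => c; rewrite /trk.
case h: (goodo o) => //=; move/andP: h => [h1 h2]; rewrite /setc.
have [i1 i2] := isvar_ov v; have h3 := ov_lt vN.
case: eqP => [/idx_inj []|_]; rewrite ?h1 //; first lia.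
  by move=> _ e; rewrite e i1 in h2.
case: eqP => [/idx_inj []|_]; rewrite ?h1 //; first lia.
by move=> _ e; rewrite e i2 in h2.
Qed.

Lemma mk_setc w b v m v' b' : v < NV -> v' < NV ->
  mk (setc w b v m) v' b' = if (v' == v) && (b' == b) then m else mk w v' b'.
Proof.
move=> h h'; have o1 := ov_lt h; have o2 := ov_lt h'.
have ne : forall b b' v v', v < NV -> v' < NV -> idx b (ov v).+1 <> idx b' (ov v').
  move=> c c' u u' l1 l2 /idx_inj []; rewrite ?/ov; lia.
rewrite /mk /setc; case: (@andP (v' == v) (b' == b)) => [[/eqP -> /eqP ->]|n].
  rewrite eqxx (_ : (_ == idx b (ov v)) = false); last by apply/eqP/ne.
  by rewrite eqxx /= negbK.
have n1 : idx b' (ov v') <> idx b (ov v).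
  move=> /idx_inj []; [lia|lia|move=> e1 e2; apply: n; split; apply/eqP => //].
  by move: e2; rewrite /ov; lia.
have n2 : idx b' (ov v').+1 <> idx b (ov v).+1.
  by move=> e; apply: n1; move: e; rewrite /idx; lia.
move/eqP/negbTE: n1 => ->; move/eqP/negbTE: n2 => ->.
have -> : (idx b' (ov v') == idx b (ov v).+1) = false by apply/eqP => /esym; apply: ne.
by have -> : (idx b' (ov v').+1 == idx b (ov v)) = false by apply/eqP; apply: ne.
Qed.

(** ** Tape macros *)

Definition trow (f : triple -> triple) d := TRow (fun t => (f t, d)).
Definition tmark := fun t : triple => (true, false, t.2).
Definition tunmark := fun t : triple => (true, true, t.2).
Definition marked (t : triple) := t.1.1 && ~~ t.1.2.

Fixpoint mvs d n c := if n is n'.+1 then TSeq (trow id d) (mvs d n' c) else c.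

Lemma exec_id p w d : exec (trow id d) (p, w) [:: w] (rmove p d, w).
Proof. by have := XRow (fun t => (t, d)) p w; rewrite /= rput_scan. Qed.

Lemma exec_mvR n c p w tr s : exec c (p + n, w) tr s ->
  exec (mvs true n c) (p, w) (nseq n w ++ tr) s.
Proof.
elim: n p => [|n IH] p; first by rewrite addn0.
rewrite -addSnnS => /IH h; exact: (XSeq (exec_id p w true) h).
Qed.

Lemma exec_mvL n c p w tr s : exec c (p - n, w) tr s ->
  exec (mvs false n c) (p, w) (nseq n w ++ tr) s.
Proof.
elim: n p => [|n IH] p; first by rewrite subn0.
by rewrite -[p - n.+1]/(p - (1 + n)) subnDA subn1 => /IH h; exact: (XSeq (exec_id p w false) h).
Qed.

Definition seek v c := mvs true (6 + v)
  (TSeq (TWhile (fun t => ~~ marked t) (mvs true K.-1 (trow id true))) c).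

Lemma nseq_cat T m n (a : T) : nseq m a ++ nseq n a = nseq (m + n) a.
Proof. by elim: m => //= m ->. Qed.

Lemma exec_seek v c w x tr s : (forall b, mk w v b = (b == x)) ->
  exec c (x * K + (6 + v), w) tr s ->
  exists n, exec (seek v c) (0, w) (nseq n w ++ tr) s.
Proof.
move=> hm hc.
(* Induction on the distance [y] to the marked block, that is, backwards along the walk. *)
have key : forall y, y <= x -> exists n, exec (TWhile (fun t => ~~ marked t)
    (mvs true K.-1 (trow id true))) ((x - y) * K + (6 + v), w) (nseq n w) (x * K + (6 + v), w).
  elim=> [|y IH] yx.
    exists 2; rewrite subn0; apply: XWhileF.
    by rewrite scan_var /marked /= -/(mk w v x) hm eqxx.
  have [n h] := IH (ltnW yx); exists (2 + ((K.-1 + 1) + n)).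
  rewrite -!nseq_cat; apply: (XWhileT _ _ h).
    by rewrite scan_var /marked /= -/(mk w v _) hm; lia.
  apply: exec_mvR; have e : ((x - y) * K + (6 + v) = (((x - y.+1) * K + (6 + v)) + K.-1).+1)%N.
    have -> : x - y = (x - y.+1).+1 by lia.
    rewrite mulSn; lia.
  rewrite [in X in exec _ _ _ X]e; exact: exec_id.
have [n hw] := key x (leqnn _); rewrite subnn mul0n add0n in hw.
exists ((6 + v) + n); rewrite -nseq_cat -catA; apply: exec_mvR; exact: XSeq hw hc.
Qed.

Definition homeloop := TSeq (TWhile (fun t => ~~ t.1.2) (mvs false K.-1 (trow id false)))
  (trow id false).
Definition homec r := if r is r'.+1 then mvs false r' homeloop else mvs true 1 homeloop.

(** The home cell is the middle cell of position 1 of a block and is on in block 0 only. The head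
    tests it block by block; one more step to the left then leads to position 0, which cannot be
    recognised by moving alone. *)
Lemma exec_home r w b : homeT (trk w) ->
  exists n, exec (homec r) (b * K + r, w) (nseq n w) (0, w).
Proof.
move=> ht.
have hs c : (rscan (c * K + 1) w).1.2 = (c == 0).
  rewrite -ht /trk /rscan idx_pos /idx /goodo /isvar /=.
  have -> : 4 < 3 * K by lia.
  by congr w; lia.
have key : exists n, exec homeloop (b * K + 1, w) (nseq n w) (0, w).
  suff [n h] : exists n, exec (TWhile (fun t => ~~ t.1.2) (mvs false K.-1 (trow id false)))
      (b * K + 1, w) (nseq n w) (1, w).
    by exists (n + 1); rewrite -nseq_cat; exact: XSeq h (exec_id 1 w false).
  elim: b => [|b [n IH]].
    by exists 2; apply: XWhileF; rewrite hs.
  exists (2 + ((K.-1 + 1) + n)); rewrite -!nseq_cat; apply: (XWhileT _ _ IH).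
    by rewrite hs.
  apply: exec_mvL; have := exec_id (b.+1 * K + 1 - K.-1) w false.
  congr (exec _ _ _ (_, _)); rewrite /= mulSn; lia.
have [n h] := key; case: r => [|r].
  by exists (1 + n); rewrite -nseq_cat; apply: exec_mvR; rewrite addn0.
exists (r + n); rewrite -nseq_cat; apply: exec_mvL.
by rewrite (_ : b * K + r.+1 - r = b * K + 1) //; lia.
Qed.

Definition go a r c := mvs true (r - a) (mvs false (a - r) c).

Lemma exec_go a r c b w tr s : exec c (b * K + r, w) tr s ->
  exists n, exec (go a r c) (b * K + a, w) (nseq n w ++ tr) s.
Proof.
move=> h; exists ((r - a) + (a - r)); rewrite -nseq_cat -catA.
apply: exec_mvR; apply: exec_mvL.
by rewrite (_ : b * K + a + (r - a) - (a - r) = b * K + r) //; lia.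
Qed.

Lemma exec_markop m d b v w : let f := if m then tmark else tunmark in
  exec (trow f d) (b * K + (6 + v), w) [:: w] (rmove (b * K + (6 + v)) d, setc w b v m).
Proof.
rewrite /=; have := XRow (fun t => ((if m then tmark else tunmark) t, d)) (b * K + (6 + v)) w.
rewrite /= -rput_setc; congr (exec _ _ _ (_, rput _ _ _)); by case: m.
Qed.

(** ** Implementation of the instructions *)

Definition tskip := TSeq (trow id true) (trow id false).

Definition tzero v :=
  TSeq (seek v (TSeq (trow tunmark false) (homec (5 + v))))
       (mvs true (6 + v) (TSeq (trow tmark false) (homec (5 + v)))).
Definition tcopy d i :=
  TSeq (seek d (TSeq (trow tunmark false) (homec (5 + d))))
       (seek i (go (6 + i) (6 + d) (TSeq (trow tmark false) (homec (5 + d))))).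
Definition tinc v := seek v (TSeq (trow tunmark true)
  (mvs true K.-1 (TSeq (trow tmark false) (homec (5 + v))))).
Definition tdec v := seek v (TSeq (trow tunmark false)
  (mvs false K.-1 (TSeq (trow tmark false) (homec (5 + v))))).
Definition tifz v a b := mvs true (6 + v) (TIte marked
  (TSeq (homec (6 + v)) a) (TSeq (homec (6 + v)) b)).

Definition chan ch (t : triple) :=
  if ch == 0 then t.1.1 else if ch == 1 then t.1.2 else t.2.
Definition setch ch x (t : triple) : triple :=
  if ch == 0 then (x, t.1.2, t.2) else if ch == 1 then (t.1.1, x, t.2)
  else (t.1.1, t.1.2, x).

Definition tifbit o v a b := seek v (go (6 + v) (o %/ 3) (TIte (chan (o %% 3))
  (TSeq (homec (o %/ 3)) a) (TSeq (homec (o %/ 3)) b))).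
Definition tset o v x := seek v (go (6 + v) (o %/ 3)
  (TSeq (trow (setch (o %% 3) x) true) (homec (o %/ 3).+1))).
Definition tloop v c := mvs true (6 + v) (TSeq (TWhile (fun t => ~~ marked t)
   (TSeq (homec (6 + v)) (TSeq (tdec v) (TSeq c (mvs true (5 + v) (trow id true))))))
   (homec (6 + v))).

Fixpoint tl_of c := match c with
| Skip => tskip
| Zero v => tzero v
| Copy d i => tcopy d i
| Inc v => tinc v
| Dec v => tifz v tskip (tdec v)
| Then a b => TSeq (tl_of a) (tl_of b)
| Loop v a => tloop v (tl_of a)
| IfZ v a b => tifz v (tl_of a) (tl_of b)
| IfBit o v a b => tifbit o v (tl_of a) (tl_of b)
| SetBit o v x => tset o v x
end.

(** [bounded] allows no other values of the tracks than those in [V], and [covers] makes each of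
    them occur. Both directions are needed: a limsup is 0 because a cell stays off, and 1 because
    flashes really happen. *)
Definition covers (V : tracks -> Prop) tr (w' : cells) :=
  forall T, V T -> T = trk w' \/ has_tr (fun u => trk u = T) tr.
Definition bounded (V : tracks -> Prop) tr (w' : cells) :=
  all_tr (fun u => mono u w' /\ V (trk u)) tr.

Definition simulates c w V (s' : store) := exists tr w',
  [/\ exec c (0, w) tr (0, w'), Rel w' s', bounded V tr w' & covers V tr w'].

Lemma exec_tr c s t t' s' : exec c s t s' -> t = t' -> exec c s t' s'.
Proof. by move=> h <-. Qed.

Lemma bounded_cat V t1 w1 t2 w2 : mono w1 w2 ->
  bounded V t1 w1 -> bounded V t2 w2 -> bounded V (t1 ++ t2) w2.
Proof.
move=> m h1 h2; apply/all_tr_cat; split=> //.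
by apply: all_tr_impl h1 => u [h ?]; split=> //; exact: mono_trans h m.
Qed.

Lemma bounded_impl (V V' : tracks -> Prop) tr w : (forall T, V T -> V' T) ->
  bounded V tr w -> bounded V' tr w.
Proof. by move=> h; apply: all_tr_impl => u [? /h]. Qed.

Lemma exec_trace_ne c s tr s' : exec c s tr s' ->
  exists tr', tr = s.2 :: tr'.
Proof.
elim=> [f p w|a b s1 t1 s2 t2 s3 _ [tr' ->] _ _|t a b p w tr0 s0 _ _ _|
  t a b p w tr0 s0 _ _ _|t a p w _|t a p w t1 s1 t2 s2 _ _ _ _ _] //=.
- by exists [::].
- by exists (tr' ++ t2).
- by exists (w :: tr0).
- by exists (w :: tr0).
- by exists [:: w].
- by exists (w :: t1 ++ t2).
Qed.

Lemma bounded_mono V c s tr w s' : exec c s tr s' -> bounded V tr w -> mono s.2 w.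
Proof. by move=> /exec_trace_ne [tr' ->] [[]]. Qed.

Lemma simulates_pure c w s tr w' : exec c (0, w) tr (0, w') -> Rel w' s ->
  all_tr (fun u => mono u w' /\ trk u = s.2) tr -> simulates c w (fun T => T = s.2) s.
Proof.
move=> h r a; exists tr, w'; split=> // T ->; left.
by case: r => ->.
Qed.

Lemma simulates_seq a b w V1 V2 s1 s2 : simulates a w V1 s1 ->
  (forall w', Rel w' s1 -> simulates b w' V2 s2) ->
  simulates (TSeq a b) w (fun T => V1 T \/ V2 T) s2.
Proof.
move=> [t1 [w1 [h1 r1 b1 c1]]] /(_ _ r1) [t2 [w2 [h2 r2 b2 c2]]].
exists (t1 ++ t2), w2; split=> //; first exact: XSeq h1 h2.
  apply: (@bounded_cat _ _ w1); first exact: bounded_mono h2 b2.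
    by apply: bounded_impl b1; left.
  by apply: bounded_impl b2; right.
move=> T [/c1 [e|h]|/c2 [e|h]]; [|by right; apply/has_tr_cat; left|by left|
  by right; apply/has_tr_cat; right].
right; apply/has_tr_cat; right; have [tr' ->] := exec_trace_ne h2.
by left.
Qed.

Lemma Rel_move w s b v n : v < NV -> Rel w s -> b = s.1 v ->
  Rel (setc (setc w b v false) n v true) (updv s.1 v n, s.2).
Proof.
move=> vN r ->; have [h1 h2] := r; split; first by rewrite /= !trk_setc.
move=> v' b' h /=; rewrite !mk_setc // h2 // /updv.
by case: (v' =P v) => [->|] //=; case: eqP => //= _; case: eqP.
Qed.

(** Each assignment to a counter is a walk with two writes, one erasing the old mark and one setting
    the new; tracks are constant during it. *)
Lemma sim_move c w s v n n1 n2 n3 : v < NV -> Rel w s ->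
  let w1 := setc w (s.1 v) v false in let w2 := setc w1 n v true in
  exec c (0, w) (nseq n1 w ++ nseq n2 w1 ++ nseq n3 w2) (0, w2) ->
  simulates c w (fun T => T = s.2) (updv s.1 v n, s.2).
Proof.
move=> vN r w1 w2 h; apply: (simulates_pure (s := (updv s.1 v n, s.2)) h).
  exact: Rel_move.
have [h1 h2] := r.
apply/all_tr_cat; split; last (apply/all_tr_cat; split); apply: all_tr_nseq => /=.
- by split=> //; apply: (@mono_trans _ w1); exact: mono_setc.
- by rewrite trk_setc //; split=> //; exact: mono_setc.
- by rewrite !trk_setc //; split.
Qed.

Lemma homeT_setc w b v m : v < NV -> homeT (trk w) -> homeT (trk (setc w b v m)).
Proof. by move=> h; rewrite trk_setc. Qed.

Lemma sim_skip w s : Rel w s -> simulates tskip w (fun T => T = s.2) s.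
Proof.
move=> r; apply: (simulates_pure (tr := [:: w; w]) (w' := w)) => //.
  exact: (XSeq (exec_id 0 w true) (exec_id 1 w false)).
by have [h _] := r; do !split.
Qed.

Lemma rmove_left b v : rmove (b * K + (6 + v)) false = b * K + (5 + v).
Proof. rewrite /rmove; lia. Qed.

Lemma sim_zero v w s : v < NV -> Rel w s -> homeT s.2 ->
  simulates (tzero v) w (fun T => T = s.2) (updv s.1 v 0, s.2).
Proof.
move=> vN r; have [rt rv] := r; rewrite -rt => ht.
set w1 := setc w (s.1 v) v false; set w2 := setc w1 0 v true.
have ht1 : homeT (trk w1) by exact: homeT_setc.
have ht2 : homeT (trk w2) by exact: homeT_setc.
have [n1 h1] := exec_home (5 + v) (s.1 v) ht1.
have [n2 h2] := exec_home (5 + v) 0 ht2.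
have h3 : exec (TSeq (trow tunmark false) (homec (5 + v)))
  (s.1 v * K + (6 + v), w) ([:: w] ++ nseq n1 w1) (0, w1).
  apply: XSeq (exec_markop false false _ _ _) _.
  by rewrite rmove_left.
have [n3 h4] := exec_seek (rv v ^~ vN) h3.
rewrite rt; apply: (@sim_move _ _ _ _ _ (n3 + 1) (n1 + ((6 + v) + 1)) n2) => //.
rewrite -/w1 -/w2.
have h5 : exec (mvs true (6 + v) (TSeq (trow tmark false) (homec (5 + v)))) (0, w1)
    (nseq (6 + v) w1 ++ ([:: w1] ++ nseq n2 w2)) (0, w2).
  apply: exec_mvR; apply: (XSeq (exec_markop true false 0 v w1)).
  by rewrite -/w2 rmove_left.
by apply: exec_tr (XSeq h4 h5) _; rewrite -!nseq_cat -!catA.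
Qed.

Lemma sim_copy d i w s : d < NV -> i < NV -> d != i -> Rel w s -> homeT s.2 ->
  simulates (tcopy d i) w (fun T => T = s.2) (updv s.1 d (s.1 i), s.2).
Proof.
move=> dN iN di r; have [rt rv] := r; rewrite -rt => ht.
set w1 := setc w (s.1 d) d false; set w2 := setc w1 (s.1 i) d true.
have ht1 : homeT (trk w1) by exact: homeT_setc.
have ht2 : homeT (trk w2) by exact: homeT_setc.
have [n1 h1] := exec_home (5 + d) (s.1 d) ht1.
have [n2 h2] := exec_home (5 + d) (s.1 i) ht2.
have h3 : exec (TSeq (trow tunmark false) (homec (5 + d)))
  (s.1 d * K + (6 + d), w) ([:: w] ++ nseq n1 w1) (0, w1).
  apply: XSeq (exec_markop false false _ _ _) _.
  by rewrite rmove_left.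
have [n3 h4] := exec_seek (rv d ^~ dN) h3.
rewrite rt.
have h5 : exec (TSeq (trow tmark false) (homec (5 + d))) (s.1 i * K + (6 + d), w1)
    ([:: w1] ++ nseq n2 w2) (0, w2).
  by apply: XSeq (exec_markop true false _ d w1) _; rewrite rmove_left.
have [n4 h6] := exec_go (6 + i) h5.
have hm b : mk w1 i b = (b == s.1 i).
  by rewrite mk_setc // rv // eq_sym (negbTE di).
have [n5 h7] := exec_seek hm h6.
apply: (@sim_move _ _ _ _ _ (n3 + 1) (n1 + (n5 + (n4 + 1))) n2) => //.
by apply: exec_tr (XSeq h4 h7) _; rewrite -!nseq_cat -!catA.
Qed.

Lemma sim_inc v w s : v < NV -> Rel w s -> homeT s.2 ->
  simulates (tinc v) w (fun T => T = s.2) (updv s.1 v (s.1 v).+1, s.2).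
Proof.
move=> vN r; have [rt rv] := r; rewrite -rt => ht.
set w1 := setc w (s.1 v) v false; set w2 := setc w1 (s.1 v).+1 v true.
have ht2 : homeT (trk w2) by do 2 apply: homeT_setc => //.
have [n2 h2] := exec_home (5 + v) (s.1 v).+1 ht2.
have h5 : exec (TSeq (trow tmark false) (homec (5 + v)))
    ((s.1 v).+1 * K + (6 + v), w1) ([:: w1] ++ nseq n2 w2) (0, w2).
  by apply: XSeq (exec_markop true false _ v w1) _; rewrite rmove_left.
have h3 : exec (TSeq (trow tunmark true) (mvs true K.-1
     (TSeq (trow tmark false) (homec (5 + v)))))
  (s.1 v * K + (6 + v), w) ([:: w] ++ (nseq K.-1 w1 ++ ([:: w1] ++ nseq n2 w2))) (0, w2).
  apply: XSeq (exec_markop false true _ _ _) _.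
  apply: exec_mvR; move: h5; congr (exec _ (_, _) _ _).
  rewrite /rmove mulSn; lia.
have [n3 h4] := exec_seek (rv v ^~ vN) h3.
rewrite rt; apply: (@sim_move _ _ _ _ _ (n3 + 1) (K.-1 + 1) n2) => //.
by apply: exec_tr h4 _; rewrite -!nseq_cat -!catA.
Qed.

Lemma sim_dec v w s n : v < NV -> Rel w s -> homeT s.2 -> s.1 v = n.+1 ->
  simulates (tdec v) w (fun T => T = s.2) (updv s.1 v n, s.2).
Proof.
move=> vN r; have [rt rv] := r; rewrite -rt => ht sn.
set w1 := setc w (s.1 v) v false; set w2 := setc w1 n v true.
have ht2 : homeT (trk w2) by do 2 apply: homeT_setc => //.
have [n2 h2] := exec_home (5 + v) n ht2.
have h5 : exec (TSeq (trow tmark false) (homec (5 + v)))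
    (n * K + (6 + v), w1) ([:: w1] ++ nseq n2 w2) (0, w2).
  by apply: XSeq (exec_markop true false _ v w1) _; rewrite rmove_left.
have h3 : exec (TSeq (trow tunmark false) (mvs false K.-1
     (TSeq (trow tmark false) (homec (5 + v)))))
  (s.1 v * K + (6 + v), w) ([:: w] ++ (nseq K.-1 w1 ++ ([:: w1] ++ nseq n2 w2))) (0, w2).
  apply: XSeq (exec_markop false false _ _ _) _.
  apply: exec_mvL; move: h5; congr (exec _ (_, _) _ _).
  rewrite /rmove sn mulSn; lia.
have [n3 h4] := exec_seek (rv v ^~ vN) h3.
rewrite rt; apply: (@sim_move _ _ _ _ _ (n3 + 1) (K.-1 + 1) n2) => //.
by apply: exec_tr h4 _; rewrite -!nseq_cat -!catA.
Qed.

(** A test only walks about before its branch is executed, so it adds the initial value of the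
    tracks and nothing else. *)
Lemma simulates_prefix c c' w V s' T0 : trk w = T0 ->
  (forall tr s, exec c (0, w) tr s -> exists n, exec c' (0, w) (nseq n w ++ tr) s) ->
  simulates c w V s' -> simulates c' w (fun T => T = T0 \/ V T) s'.
Proof.
move=> e h [tr [w' [h1 r b c1]]]; have [n h2] := h _ _ h1.
have b' : bounded (fun T => T = T0 \/ V T) tr w' by apply: bounded_impl b; right.
exists (nseq n w ++ tr), w'; split=> //.
  apply/all_tr_cat; split=> //.
  by apply: all_tr_nseq; split; [exact: bounded_mono h1 b|left].
move=> T [->|/c1 [t|t]]; [right; apply/has_tr_cat; right|by left|].
  by have [tr' ->] := exec_trace_ne h1; left.
by right; apply/has_tr_cat; right.
Qed.

Lemma mk_scan0 w s v : v < NV -> Rel w s -> marked (rscan (6 + v) w) = (s.1 v == 0).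
Proof.
move=> vN [_ h]; have := scan_var w 0 v; rewrite mul0n add0n => ->.
by rewrite /marked /= -/(mk w v 0) h // eq_sym.
Qed.

Lemma sim_ifz v a b w s V s' : v < NV -> Rel w s -> homeT s.2 ->
  simulates (if s.1 v == 0 then a else b) w V s' ->
  simulates (tifz v a b) w (fun T => T = s.2 \/ V T) s'.
Proof.
move=> vN r; have [rt rv] := r; rewrite -rt => ht.
apply: simulates_prefix => // tr s1 h.
have [n1 h1] := exec_home (6 + v) 0 ht; rewrite mul0n add0n in h1.
exists ((6 + v) + (2 + n1)); rewrite -!nseq_cat -!catA; apply: exec_mvR.
have := mk_scan0 vN r; rewrite add0n.
case: ifP h => sv h hs; [apply: XIteT; rewrite ?hs //|apply: XIteF; rewrite ?hs //];
  exact: XSeq h1 h.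
Qed.

Lemma scan_trk w b o : goodo o -> chan (o %% 3) (rscan (b * K + o %/ 3) w) = trk w o b.
Proof.
move=> g; rewrite /trk g /= /rscan idx_pos /chan.
have : o %% 3 = 0 \/ o %% 3 = 1 \/ o %% 3 = 2 by lia.
by case=> [|[|]] e; rewrite e /=; congr w; rewrite /idx; lia.
Qed.

Lemma sim_ifbit o v a b w s V s' : goodo o -> v < NV -> Rel w s -> homeT s.2 ->
  simulates (if s.2 o (s.1 v) then a else b) w V s' ->
  simulates (tifbit o v a b) w (fun T => T = s.2 \/ V T) s'.
Proof.
move=> g vN r; have [rt rv] := r; rewrite -rt => ht.
apply: simulates_prefix => // tr s1 h.
have [n1 h1] := exec_home (o %/ 3) (s.1 v) ht.
have [] : exists n, exec (go (6 + v) (o %/ 3) (TIte (chan (o %% 3))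
  (TSeq (homec (o %/ 3)) a) (TSeq (homec (o %/ 3)) b)))
   (s.1 v * K + (6 + v), w) (nseq n w ++ tr) s1.
  have hs := scan_trk w (s.1 v) g.
  have h2 : exec (TIte (chan (o %% 3))
     (TSeq (homec (o %/ 3)) a) (TSeq (homec (o %/ 3)) b))
     (s.1 v * K + o %/ 3, w) ([:: w; w] ++ (nseq n1 w ++ tr)) s1.
    case: ifP h => sv h; [apply: XIteT; rewrite ?hs ?sv //|apply: XIteF; rewrite ?hs ?sv //];
      exact: XSeq h1 h.
  have [n2 h3] := exec_go (6 + v) h2; exists (n2 + (2 + n1)).
  by apply: exec_tr h3 _; rewrite -!nseq_cat -!catA.
move=> n h2; have [n2 h3] := exec_seek (rv v ^~ vN) h2; exists (n2 + n).
by apply: exec_tr h3 _; rewrite -!nseq_cat -!catA.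
Qed.

Definition setb (w : cells) b o x : cells := fun i => if i == idx b o then x else w i.

Lemma rput_setb w b o x : goodo o ->
  rput (b * K + o %/ 3) w (setch (o %% 3) x (rscan (b * K + o %/ 3) w)) = setb w b o x.
Proof.
move=> g; apply/funext => i; rewrite /rput /setb /setch /rscan idx_pos.
have : o %% 3 = 0 \/ o %% 3 = 1 \/ o %% 3 = 2 by lia.
set x0 := idx b (3 * (o %/ 3)) => ho.
have eo : idx b o = x0 + o %% 3 by rewrite /x0 /idx; lia.
case: (i =P x0) => [->|n0]; last (case: (i =P x0.+1) => [->|n1];
  last (case: (i =P x0.+2) => [->|n2])); case: ho eo => [|[|]] -> ->;
  rewrite ?addn0 ?addn1 ?addn2 /= ?eqxx //; try by (case: eqP => //; lia).
Qed.

Lemma Rel_setb w b o x s : goodo o -> Rel w s ->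
  Rel (setb w b o x) (s.1, updt s.2 o b x) /\ mono w (setb w b o x).
Proof.
move=> /andP [g1 g2] [h1 h2].
have ne b' o' : o' < 3 * K -> isvar o' -> (idx b' o' == idx b o) = false.
  move=> l v; rewrite idx_eq //; case: eqP => //= e; by rewrite -e v in g2.
split; last first.
  move=> v b' vN; have l := ov_lt vN; have [i1 _] := isvar_ov v.
  by rewrite /setb ne //; lia.
split=> /=.
  rewrite -h1; apply/funext => o'; apply/funext => b'; rewrite /trk /updt /setb.
  case g': (goodo o') => /=; last first.
    by case: eqP => // e; rewrite e /goodo g1 g2 in g'.
  by rewrite idx_eq //; case/andP: g'.
move=> v b' vN; rewrite /mk /setb.
have [i1 i2] := isvar_ov v; have l := ov_lt vN.
by rewrite !ne // -?h2 //; lia.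
Qed.

Lemma sim_set o v x w s : goodo o -> v < NV -> o != 4 -> Rel w s -> homeT s.2 ->
  simulates (tset o v x) w (fun T => T = s.2 \/ T = updt s.2 o (s.1 v) x)
    (s.1, updt s.2 o (s.1 v) x).
Proof.
move=> g vN o4 r; have [rt rv] := r; rewrite -rt => ht.
have [r1 m1] := Rel_setb (s.1 v) x g r; set w1 := setb w _ _ _ in r1 m1.
have ht1 : homeT (trk w1).
  have [-> _] := r1; rewrite -rt /= => b; rewrite /updt.
  by rewrite eq_sym (negbTE o4) /= ht.
have [n1 h1] := exec_home (o %/ 3).+1 (s.1 v) ht1.
have h2 : exec (TSeq (trow (setch (o %% 3) x) true) (homec (o %/ 3).+1))
   (s.1 v * K + o %/ 3, w) ([:: w] ++ nseq n1 w1) (0, w1).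
  have := XRow (fun t => (setch (o %% 3) x t, true)) (s.1 v * K + o %/ 3) w.
  rewrite /= rput_setb // => h; apply: XSeq h _.
  by rewrite -addnS.
have [n2 h3] := exec_go (6 + v) h2.
have [n3 h4] := exec_seek (rv v ^~ vN) h3.
exists (nseq (n3 + (n2 + 1)) w ++ nseq n1 w1), w1; split.
- by apply: exec_tr h4 _; rewrite -!nseq_cat -!catA.
- by rewrite rt.
- apply/all_tr_cat; split; apply: all_tr_nseq; split=> //; first by left.
  by right; rewrite (proj1 r1) rt.
move=> T [->|->]; last by left; rewrite (proj1 r1) rt.
by right; apply/has_tr_cat; left; rewrite addnA addn1; left.
Qed.

(** The loop test is made at the cell of the counter in block 0, where a mark means zero. Each pass
    decreases the counter before the body and returns there, which is the recursion of [iterdn]. *)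
Lemma sim_while v c (f : store -> store) (V : store -> tracks -> Prop) n :
  v < NV ->
  (forall w s, Rel w s -> homeT s.2 ->
    [/\ simulates c w (V s) (f s), homeT (f s).2, (f s).1 v = s.1 v & V s (f s).2]) ->
  forall w s, Rel w s -> homeT s.2 -> s.1 v = n ->
  exists tr w', [/\ exec (TWhile (fun t => ~~ marked t)
     (TSeq (homec (6 + v)) (TSeq (tdec v) (TSeq c (mvs true (5 + v) (trow id true))))))
     (6 + v, w) tr (6 + v, w'), Rel w' (iterdn f v n s),
     bounded (fun T => T = s.2 \/ visdn f V v n s T) tr w' &
     covers (fun T => T = s.2 \/ visdn f V v n s T) tr w'].
Proof.
move=> vN hc; elim: n => [|n IH] w s r ht sv.
  exists [:: w; w], w; have [rt _] := r.
  split=> //; first by apply: XWhileF; rewrite (mk_scan0 vN r) sv.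
    by do !split=> //; left.
  by move=> T [->|//]; left.
have ht0 : homeT (trk w) by case: r => ->.
have [n0 h0] := exec_home (6 + v) 0 ht0; rewrite mul0n add0n in h0.
have [t1 [w1 [h1 r1 b1 c1]]] := sim_dec vN r ht sv.
set s1 := (updv s.1 v n, s.2) in r1.
have [[t2 [w2 [h2 r2 b2 c2]]] ht2 e2 ve] := hc w1 s1 r1 ht.
have sn : (f s1).1 v = n by rewrite e2 /= /updv eqxx.
have [t3 [w3 [h3 r3 b3 c3]]] := IH w2 (f s1) r2 ht2 sn.
have h2' : exec (mvs true (5 + v) (trow id true)) (0, w2) (nseq (5 + v) w2 ++ [:: w2])
   (6 + v, w2).
  by apply: exec_mvR; exact: exec_id.
have m3 : mono w2 w3 by have := bounded_mono h3 b3.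
have m2 : mono w1 w2 by have := bounded_mono h2 b2.
exists ([:: w; w] ++ ((nseq n0 w ++ (t1 ++ (t2 ++ (nseq (5 + v) w2 ++ [:: w2])))) ++ t3)), w3.
have [rt _] := r; have [rt2 _] := r2.
have m1 : mono w w1 by have := bounded_mono h1 b1.
split=> //.
- apply: (@XWhileT _ _ _ _ _ (6 + v, w2) _ _ _ _ h3).
    by rewrite (mk_scan0 vN r) sv.
  exact: (XSeq h0 (XSeq h1 (XSeq h2 h2'))).
- have m : mono w w3 by apply: mono_trans m1 (mono_trans m2 m3).
  have hw : mono w w3 /\ (trk w = s.2 \/ visdn f V v n.+1 s (trk w)) by split=> //; left.
  have b1' : bounded (fun T => T = s.2 \/ visdn f V v n.+1 s T) t1 w3.
    apply: all_tr_impl b1 => u [u1 u2]; split; last by left.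
    exact: mono_trans u1 (mono_trans m2 m3).
  have b2' : bounded (fun T => T = s.2 \/ visdn f V v n.+1 s T) t2 w3.
    apply: all_tr_impl b2 => u [u1 u2]; split; last by right; left.
    exact: mono_trans u1 m3.
  have b3' : bounded (fun T => T = s.2 \/ visdn f V v n.+1 s T) t3 w3.
    apply: all_tr_impl b3 => u [u1 u2]; split=> //; right.
    by case: u2 => [->|u2]; [left|right].
  apply/all_tr_cat; split; first by do !split; try exact: (proj2 hw).
  apply/all_tr_cat; split=> //.
  apply/all_tr_cat; split; first exact: all_tr_nseq.
  apply/all_tr_cat; split=> //.
  apply/all_tr_cat; split=> //.
  have h : mono w2 w3 /\ (trk w2 = s.2 \/ visdn f V v n.+1 s (trk w2)).
    by split=> //; right; left; rewrite rt2.
  by apply/all_tr_cat; split; [exact: all_tr_nseq|].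
- move=> T [->|[/c2|h]].
  + by right; left.
  + move=> [->|h]; right; apply/has_tr_cat; right; apply/has_tr_cat; left;
      apply/has_tr_cat; right; apply/has_tr_cat; right; apply/has_tr_cat;
      [right|by left].
    by left.
  + have [->|h'] := c3 T (or_intror h); [by left|right].
    by apply/has_tr_cat; right; apply/has_tr_cat; right.
Qed.

(** [ok] forbids writing on track 4, so the home mark survives. *)
Lemma homeT_sem c s : ok c -> homeT s.2 -> homeT (sem c s).2.
Proof.
elim: c s => [|u|d i|u|u|a IHa b IHb|u a IHa|u a IHa b IHb|o u a IHa b IHb|o u x] s //=.
- by case/andP => /IHa h1 /IHb h2 /h1 /h2.
- case/and3P => _ h _; move: (s.1 u) => k; elim: k s => //= k IH s ht.
  by apply: IH; apply: IHa.
- by case/and3P => _ /IHa h1 /IHb h2; case: ifP => _; [exact: h1|exact: h2].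
- by case/and4P => _ _ /IHa h1 /IHb h2; case: ifP => _; [exact: h1|exact: h2].
- by case/and3P => _ _ o4 ht b; rewrite /updt eq_sym (negbTE o4) /= ht.
Qed.

Lemma simulates_ext c w V V' s : (forall T, V T <-> V' T) ->
  simulates c w V s -> simulates c w V' s.
Proof. by move=> h; rewrite (_ : V' = V) //; apply/funext => T; apply/propext; rewrite h. Qed.

Lemma tl_of_correct c w s : ok c -> Rel w s -> homeT s.2 ->
  simulates (tl_of c) w (vis c s) (sem c s).
Proof.
elim: c w s => [|u|d i|u|u|a IHa b IHb|u a IHa|u a IHa b IHb|o u a IHa b IHb|o u x] w s /=.
- by move=> _ r _; exact: sim_skip.
- by move=> h r ht; exact: sim_zero.
- by case/and3P => h1 h2 h3 r ht; exact: sim_copy.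
- by move=> h r ht; exact: sim_inc.
- move=> h r ht; apply: (@simulates_ext _ _ (fun T => T = s.2 \/ T = s.2)); first tauto.
  apply: sim_ifz => //; case: eqP => [e|ne].
    rewrite (_ : (_, _) = s); first exact: sim_skip.
    rewrite [RHS]surjective_pairing; congr pair; apply/funext => i; rewrite /updv.
    by case: eqP => // ->; rewrite e.
  by apply: sim_dec => //; case: (s.1 u) ne.
- case/andP => h1 h2 r ht; apply: simulates_seq; first exact: IHa.
  by move=> w' r'; apply: IHb => //; exact: homeT_sem.
- case/and3P => uN ha nm r ht.
  have hc w0 s0 : Rel w0 s0 -> homeT s0.2 -> [/\ simulates (tl_of a) w0 (vis a s0) (sem a s0),
     homeT (sem a s0).2, (sem a s0).1 u = s0.1 u & vis a s0 (sem a s0).2].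
    by move=> r0 ht0; split; [exact: IHa|exact: homeT_sem|exact: nomodP|exact: vis_end].
  have [tr [w' [h r' b c]]] := sim_while uN hc r ht (erefl _).
  have ht' : homeT (trk w').
    have -> := proj1 r'; apply: (@homeT_sem (Loop u a)) => //=; exact/and3P.
  have [n2 h2] := exec_home (6 + u) 0 ht'; rewrite mul0n add0n in h2.
  have rw := proj1 r; have rw' := proj1 r'.
  exists (nseq (6 + u) w ++ (tr ++ nseq n2 w')), w'; split=> //.
  + by apply: exec_mvR; apply: XSeq h h2.
  + apply/all_tr_cat; split.
      apply: all_tr_nseq; split; [exact: bounded_mono h b|by left].
    apply/all_tr_cat; split=> //; apply: all_tr_nseq; split=> //.
    by have := vis_end (Loop u a) s; rewrite rw'.
  + move=> T /c [->|t]; [by left|right].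
    by apply/has_tr_cat; right; apply/has_tr_cat; left.
- case/and3P => h1 h2 h3 r ht; apply: sim_ifz => //.
  by case: ifP => _; [exact: IHa|exact: IHb].
- case/and4P => h1 h2 h3 h4 r ht; apply: sim_ifbit => //.
  by case: ifP => _; [exact: IHa|exact: IHb].
- by case/and3P => h1 h2 h3 r ht; exact: sim_set.
Qed.

End Machine.

(** * Compiling expressions *)

Definition npair a b := (a + b) * (a + b) + a.

(** The code lies between the consecutive squares of [a + b] and [a + b + 1], so it determines the
    sum and then [a]. The pairing is not onto; it is chosen because counters compute it by repeated
    addition. *)
Lemma pair_inj a b c d : npair a b = npair c d -> a = c /\ b = d.
Proof.
rewrite /npair => e.
have h : a + b = c + d.
  by case: (ltngtP (a + b) (c + d)) => // h; nia.
by rewrite h in e; lia.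
Qed.

Inductive expr :=
| EVar of nat
| ENum of nat
| EAdd of expr & expr
| ESub of expr & expr
| EPair of expr & expr
| EBit of nat & expr
| EG of expr.

(* The least [j < n] with [P j], plus one; zero if there is none. *)
Definition first (P : nat -> bool) n :=
  if has P (iota 0 n) then (find P (iota 0 n)).+1 else 0.

Lemma first0 (P : nat -> bool) n : (first P n == 0) = ~~ has P (iota 0 n).
Proof. by rewrite /first; case: ifP. Qed.

Lemma firstS (P : nat -> bool) n j : first P n = j.+1 -> [/\ j < n, P j & forall i, i < j -> ~~ P i].
Proof.
rewrite /first; case: ifP => // h [<-]; split.
- by move: h; rewrite has_find size_iota.
- by have := nth_find 0 h; rewrite nth_iota // -{2}(size_iota 0 n) -has_find.
- move=> i l; have := before_find 0 l; rewrite nth_iota ?add0n => [->//|].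
  by apply: leq_trans l _; rewrite -{2}(size_iota 0 n) find_size.
Qed.

Lemma first_none (P : nat -> bool) n : first P n = 0 <-> forall j, j < n -> ~~ P j.
Proof.
split=> [/eqP|h].
  by rewrite first0 => /hasPn h j l; apply: h; rewrite mem_iota.
by apply/eqP; rewrite first0; apply/hasPn => j; rewrite mem_iota => /h.
Qed.

Lemma first_eq (P : nat -> bool) n j : j < n -> P j -> (forall i, i < j -> ~~ P i) -> first P n = j.+1.
Proof.
move=> l p h; case e: (first P n) => [|k].
  by have := proj1 (first_none _ _) e j l; rewrite p.
have [h1 h2 h3] := firstS e; case: (ltngtP j k) => [/h3|/h|->//]; first by rewrite p.
by rewrite h2.
Qed.

(** Cell 11 of a block is the input cell of position 3. The blocks will have even length, so this
    position is odd in the whole tape and the track holds bits of the witness. *)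
Definition gbit (T : tracks) n j := T 11 (npair n j).

Fixpoint evv (T : tracks) (r : vars) e : nat := match e with
| EVar i => r i
| ENum n => n
| EAdd a b => evv T r a + evv T r b
| ESub a b => evv T r a - evv T r b
| EPair a b => npair (evv T r a) (evv T r b)
| EBit o a => T o (evv T r a)
| EG a => (first (gbit T (evv T r a)) (r 0)).-1
end.

(* The number of look-ups of [g] that failed for lack of fuel. *)
Fixpoint evp (T : tracks) (r : vars) e : nat := match e with
| EVar i => 0
| ENum n => 0
| EAdd a b | ESub a b | EPair a b => evp T r a + evp T r b
| EBit o a => evp T r a
| EG a => evp T r a + (first (gbit T (evv T r a)) (r 0) == 0)
end.

Definition gof (T : tracks) n : nat :=
  match pselect (exists j, gbit T n j) with left h => ex_minn h | right _ => 0 end.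

Fixpoint evi (g : nat -> nat) (T : tracks) (r : vars) e : nat := match e with
| EVar i => r i
| ENum n => n
| EAdd a b => evi g T r a + evi g T r b
| ESub a b => evi g T r a - evi g T r b
| EPair a b => npair (evi g T r a) (evi g T r b)
| EBit o a => T o (evi g T r a)
| EG a => g (evi g T r a)
end.

Lemma first_gof T n f : first (gbit T n) f != 0 -> (first (gbit T n) f).-1 = gof T n.
Proof.
case e: (first _ _) => [//|j] _ /=; have [h1 h2 h3] := firstS e.
rewrite /gof; case: pselect => [h|[]]; last by exists j.
case: ex_minnP => k p mn; apply/eqP; rewrite eqn_leq mn // andbT leqNgt.
by apply/negP => /h3; rewrite p.
Qed.

(** A search that succeeds within the fuel returns the least hit whatever the fuel was; failed
    searches, which evaluate to 0, are excluded by the count. *)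
Lemma evv_evi T r e : evp T r e = 0 -> evv T r e = evi (gof T) T r e.
Proof.
elim: e => //= [a IHa b IHb|a IHa b IHb|a IHa b IHb|o a IHa|a IHa].
- by move=> h; rewrite IHa ?IHb //; lia.
- by move=> h; rewrite IHa ?IHb //; lia.
- by move=> h; rewrite IHa ?IHb //; lia.
- by move=> h; rewrite IHa.
- move=> /eqP; rewrite addn_eq0 eqb0 => /andP [/eqP /IHa e h].
  by rewrite first_gof // e.
Qed.

Definition gtotal (T : tracks) := forall n, exists j, gbit T n j.

(** Counter 0 is the fuel, which changes from round to round, and counters 1 and 4 collect failures,
    so no expression may mention them. *)
Fixpoint evok d e : bool := match e with
| EVar i => [&& i < d, i != 0, i != 1 & i != 4]
| ENum _ => true
| EAdd a b | ESub a b | EPair a b => evok d a && evok d b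
| EBit o a => evok d a
| EG a => evok d a
end.

Lemma ev_ext T d r r' e : evok d e -> r 0 = r' 0 ->
  (forall i, i < d -> i != 0 -> i != 1 -> i != 4 -> r i = r' i) ->
  evv T r e = evv T r' e /\ evp T r e = evp T r' e.
Proof.
move=> h e0 hr; elim: e h => //= [i|a IHa b IHb|a IHa b IHb|a IHa b IHb|o a IHa|a IHa].
- by case/and4P => h1 h2 h3 h4; rewrite hr.
- by case/andP => /IHa [-> ->] /IHb [-> ->].
- by case/andP => /IHa [-> ->] /IHb [-> ->].
- by case/andP => /IHa [-> ->] /IHb [-> ->].
- by move=> /IHa [-> ->].
- by move=> /IHa [-> ->]; rewrite e0.
Qed.

Lemma evok_leq d d' e : d <= d' -> evok d e -> evok d' e.
Proof.
move=> l; elim: e => //= [i|a IHa b IHb|a IHa b IHb|a IHa b IHb].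
- by case/and4P => h -> -> ->; rewrite (leq_trans h).
- by case/andP => /IHa -> /IHb ->.
- by case/andP => /IHa -> /IHb ->.
- by case/andP => /IHa -> /IHb ->.
Qed.

Lemma evi_ext g T d r r' e : evok d e ->
  (forall i, i < d -> i != 0 -> i != 1 -> i != 4 -> r i = r' i) ->
  evi g T r e = evi g T r' e.
Proof.
move=> h hr; elim: e h => //= [i|a IHa b IHb|a IHa b IHb|a IHa b IHb|o a IHa|a IHa].
- by case/and4P => h1 h2 h3 h4; rewrite hr.
- by case/andP => /IHa -> /IHb ->.
- by case/andP => /IHa -> /IHb ->.
- by case/andP => /IHa -> /IHb ->.
- by move=> /IHa ->.
- by move=> /IHa ->.
Qed.

Lemma first_eventually (P : nat -> bool) : (exists j, P j) -> exists F, forall f, F <= f -> first P f != 0.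
Proof.
move=> [j p]; exists j.+1 => f l; rewrite first0 negbK; apply/hasP; exists j => //.
by rewrite mem_iota.
Qed.

Lemma evp_eventually T d r e : evok d e -> gtotal T -> exists F, forall f, F <= f ->
  evp T (updv r 0 f) e = 0.
Proof.
move=> h tot; elim: e h => /= [i|n|a IHa b IHb|a IHa b IHb|a IHa b IHb|o a IHa|a IHa];
  try by [exists 0].
- case/andP => /IHa [F hF] /IHb [F' hF']; exists (maxn F F') => f.
  by rewrite geq_max => /andP [/hF -> /hF' ->].
- case/andP => /IHa [F hF] /IHb [F' hF']; exists (maxn F F') => f.
  by rewrite geq_max => /andP [/hF -> /hF' ->].
- case/andP => /IHa [F hF] /IHb [F' hF']; exists (maxn F F') => f.
  by rewrite geq_max => /andP [/hF -> /hF' ->].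
- by move=> /IHa.
- move=> h; have [F hF] := IHa h.
  have [F' hF'] := first_eventually (tot (evi (gof T) T r a)).
  exists (maxn F F') => f; rewrite geq_max => /andP [/hF e /hF' e'].
  rewrite e add0n evv_evi //.
  rewrite (@evi_ext _ _ d _ r) //; first by rewrite /updv /= (negbTE e').
  by move=> i _ /negbTE i0 _ _; rewrite /updv i0.
Qed.

Definition pairc d a b := foldr Then Skip
 [:: Copy d a; Copy d.+1 b; Loop d.+1 (Inc d); Copy d.+1 d; Zero d.+2;
     Loop d.+1 (Then (Copy d.+3 d) (Loop d.+3 (Inc d.+2)));
     Copy d.+1 a; Loop d.+1 (Inc d.+2); Copy d d.+2].

Fixpoint ecomp e d : cmd := match e with
| EVar i => Copy d i
| ENum n => Then (Zero d) (iter n (Then (Inc d)) Skip)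
| EAdd a b => Then (ecomp a d) (Then (ecomp b d.+1) (Loop d.+1 (Inc d)))
| ESub a b => Then (ecomp a d) (Then (ecomp b d.+1) (Loop d.+1 (Dec d)))
| EPair a b => Then (ecomp a d) (Then (ecomp b d.+1) (Then (pairc d.+2 d d.+1) (Copy d d.+2)))
| EBit o a => Then (ecomp a d) (IfBit o d (Then (Zero d) (Inc d)) (Zero d))
| EG a => foldr Then Skip
   [:: ecomp a d; Zero d.+1; Copy d.+2 0;
       Loop d.+2 (Then (pairc d.+3 d d.+2)
         (IfBit 11 d.+3 (Then (Copy d.+1 d.+2) (Inc d.+1)) Skip));
       IfZ d.+1 (Inc 1) (Dec d.+1); Copy d d.+1]
end.

Lemma iterdn_ind f v (I : nat -> store -> Prop) n s : I n s ->
  (forall k s, k < n -> I k.+1 s -> I k (f (updv s.1 v k, s.2))) -> I 0 (iterdn f v n s).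
Proof.
elim: n s => //= n IH s h hs; apply: IH; first exact: hs.
by move=> k s' l; apply: hs; exact: ltnW.
Qed.

Lemma sem_skip s : sem Skip s = s. Proof. by []. Qed.
Lemma sem_zero v s : sem (Zero v) s = (updv s.1 v 0, s.2). Proof. by []. Qed.
Lemma sem_copy d i s : sem (Copy d i) s = (updv s.1 d (s.1 i), s.2). Proof. by []. Qed.
Lemma sem_inc v s : sem (Inc v) s = (updv s.1 v (s.1 v).+1, s.2). Proof. by []. Qed.
Lemma sem_dec v s : sem (Dec v) s = (updv s.1 v (s.1 v).-1, s.2). Proof. by []. Qed.
Lemma sem_then a b s : sem (Then a b) s = sem b (sem a s). Proof. by []. Qed.
Lemma sem_loop v c s : sem (Loop v c) s = iterdn (sem c) v (s.1 v) s. Proof. by []. Qed.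
Lemma sem_ifz v a b s : sem (IfZ v a b) s = if s.1 v == 0 then sem a s else sem b s.
Proof. by []. Qed.
Lemma sem_ifbit o v a b s :
  sem (IfBit o v a b) s = if s.2 o (s.1 v) then sem a s else sem b s.
Proof. by []. Qed.
Lemma sem_setbit o v x s : sem (SetBit o v x) s = (s.1, updt s.2 o (s.1 v) x).
Proof. by []. Qed.
Opaque sem.

Ltac upd := rewrite /= /updv /=; repeat (case: eqP => ?; try lia); try lia; try done.

Lemma sem_loop_inc v u s : u != v ->
  sem (Loop v (Inc u)) s = (updv (updv s.1 u (s.1 u + s.1 v)) v 0, s.2).
Proof.
move=> uv; rewrite sem_loop; pose I k (s' : store) := s'.2 = s.2 /\ s'.1 = updv (updv s.1 u (s.1 u + (s.1 v - k))) v k.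
suff [h1 h2] : I 0 (iterdn (sem (Inc u)) v (s.1 v) s).
  by rewrite [LHS]surjective_pairing h1 h2 subn0.
apply: iterdn_ind.
  by split=> //; apply/funext => i; rewrite subnn addn0; upd; congr s.1.
move=> k s' l [h1 h2]; rewrite sem_inc; split=> //; apply/funext => i; rewrite /= h2; upd.
Qed.

Lemma sem_loop_dec v u s : u != v ->
  sem (Loop v (Dec u)) s = (updv (updv s.1 u (s.1 u - s.1 v)) v 0, s.2).
Proof.
move=> uv; rewrite sem_loop; pose I k (s' : store) := s'.2 = s.2 /\ s'.1 = updv (updv s.1 u (s.1 u - (s.1 v - k))) v k.
suff [h1 h2] : I 0 (iterdn (sem (Dec u)) v (s.1 v) s).
  by rewrite [LHS]surjective_pairing h1 h2 subn0.
apply: iterdn_ind.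
  by split=> //; apply/funext => i; rewrite subnn subn0; upd; congr s.1.
move=> k s' l [h1 h2]; rewrite sem_dec; split=> //; apply/funext => i; rewrite /= h2; upd.
Qed.

Lemma sem_loop_mul (v a c u : nat) s : uniq [:: v; a; c; u] ->
  let s' := sem (Loop v (Then (Copy c a) (Loop c (Inc u)))) s in
  [/\ s'.2 = s.2, s'.1 u = s.1 u + s.1 v * s.1 a &
      forall i, i \notin [:: v; c; u] -> s'.1 i = s.1 i].
Proof.
move=> + s'; rewrite /= !inE !negb_or => /and4P [/and3P [va vc vu] /andP [ac au] cu _].
pose I k (s' : store) := [/\ s'.2 = s.2, s'.1 v = k, s'.1 u = s.1 u + (s.1 v - k) * s.1 a &
      forall i, i \notin [:: v; c; u] -> s'.1 i = s.1 i].
suff [h1 _ h3 h4] : I 0 s' by split=> //; rewrite h3 subn0.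
rewrite /s' sem_loop; apply: iterdn_ind; first by split=> //; rewrite subnn addn0.
move=> k t l [h1 h2 h3 h4].
have uc : u != c by rewrite eq_sym.
have := @sem_loop_inc c u (updv (updv t.1 v k) c (t.1 a), t.2) uc.
have ea : updv t.1 v k a = s.1 a.
  by rewrite /updv eq_sym (negbTE va) h4 // !inE !negb_or eq_sym va ac au.
rewrite (_ : t.1 a = s.1 a) => [e|]; last first.
  by rewrite h4 // !inE !negb_or eq_sym va ac au.
rewrite sem_then sem_copy /= ea e; split=> //=.
- by upd.
- have -> : s.1 v - k = (s.1 v - k.+1).+1 by lia.
  by rewrite mulSn /updv eqxx; upd.
- move=> i; rewrite !inE !negb_or => /and3P [i1 i2 i3].
  by rewrite -(h4 i) ?inE ?negb_or ?i1 ?i2 ?i3 //; upd.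
Qed.

Lemma sem_pairc d a b s : a < d -> b < d ->
  [/\ (sem (pairc d a b) s).2 = s.2,
      (sem (pairc d a b) s).1 d = npair (s.1 a) (s.1 b) &
      forall i, i < d -> (sem (pairc d a b) s).1 i = s.1 i].
Proof.
move=> ad bd; rewrite /pairc /foldr.
have e1 : d != d.+1 by lia.
have e2 : uniq [:: d.+1; d; d.+3; d.+2] by rewrite /= !inE; lia.
have e3 : d.+2 != d.+1 by lia.
rewrite !sem_then !sem_copy (sem_loop_inc _ e1).
set s1 := sem (Zero d.+2) _.
have s1v i : s1.1 i = if i == d.+2 then 0 else if (i == d) || (i == d.+1) then s.1 a + s.1 b else s.1 i.
  by rewrite /s1 sem_zero; upd.
have [h1 h2 h3] := sem_loop_mul s1 e2.
set s2 := sem (Loop d.+1 (Then _ _)) s1 in h1 h2 h3 *.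
rewrite (sem_loop_inc _ e3) !sem_skip /=; split.
- by rewrite h1.
- have -> : updv (updv (updv s2.1 d.+1 (s2.1 a)) d.+2
     (updv s2.1 d.+1 (s2.1 a) d.+2 + updv s2.1 d.+1 (s2.1 a) d.+1)) d.+1 0 d.+2 =
     s2.1 d.+2 + s2.1 a by upd.
  rewrite /updv eqxx h2 h3 ?s1v; last by rewrite !inE; lia.
  rewrite !eqxx /= (_ : (d == d.+2) = false); last by lia.
  rewrite (_ : (d.+1 == d.+2) = false); last by lia.
  rewrite orbT (_ : (a == d.+2) = false); last by lia.
  rewrite (_ : (a == d) || (a == d.+1) = false); last by lia.
  by rewrite /npair; lia.
- move=> i id.
  have -> : s.1 i = s2.1 i.
    rewrite h3 ?s1v; last by rewrite !inE; lia.
    by upd.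
  by upd.
Qed.

Opaque pairc.

Lemma first_step (P : nat -> bool) k n r : k < n ->
  (if r is j.+1 then [/\ k.+1 <= j < n, P j & forall i, k < i < j -> ~~ P i]
   else forall j, k < j < n -> ~~ P j) ->
  let r' := if P k then k.+1 else r in
  if r' is j.+1 then [/\ k <= j < n, P j & forall i, k <= i < j -> ~~ P i]
   else forall j, k <= j < n -> ~~ P j.
Proof.
move=> kn h r'; rewrite /r'; case: ifP => pk.
  split=> //; first by rewrite leqnn.
  by move=> i; lia.
case: r h {r'} => [|j] h.
  move=> j /andP [l1 l2]; case: (k =P j) => [<-|ne]; first by rewrite pk.
  by apply: h; lia.
case: h => h1 h2 h3; split=> //; first by lia.
move=> i /andP [l1 l2]; case: (k =P i) => [<-|ne]; first by rewrite pk.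
by apply: h3; lia.
Qed.

Lemma first_final (P : nat -> bool) n r :
  (if r is j.+1 then [/\ 0 <= j < n, P j & forall i, 0 <= i < j -> ~~ P i]
   else forall j, 0 <= j < n -> ~~ P j) -> r = first P n.
Proof.
case: r => [|j] => [h|[h1 h2 h3]]; first by apply/esym/first_none.
by apply/esym/first_eq.
Qed.

(* The search loops record, for descending [k], the last hit so far. *)
Lemma sem_search v u d c (P : nat -> bool) s : v < d -> u < d -> v != u -> s.1 u = 0 ->
  (forall k s', k < s.1 v -> s'.2 = s.2 -> s'.1 v = k ->
    (forall i, i < d -> i != v -> i != u -> s'.1 i = s.1 i) ->
    [/\ (sem c s').2 = s.2, (sem c s').1 u = if P k then k.+1 else s'.1 u &
      forall i, i < d -> i != v -> i != u -> (sem c s').1 i = s.1 i]) ->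
  [/\ (sem (Loop v c) s).2 = s.2, (sem (Loop v c) s).1 u = first P (s.1 v) &
    forall i, i < d -> i != v -> i != u -> (sem (Loop v c) s).1 i = s.1 i].
Proof.
move=> vd ud vu su hc; rewrite sem_loop.
pose I k (s' : store) := [/\ s'.2 = s.2,
  if s'.1 u is j.+1 then [/\ k <= j < s.1 v, P j & forall i, k <= i < j -> ~~ P i]
   else forall j, k <= j < s.1 v -> ~~ P j &
  forall i, i < d -> i != v -> i != u -> s'.1 i = s.1 i].
suff [h1 h2 h3] : I 0 (iterdn (sem c) v (s.1 v) s) by split=> //; apply: first_final.
apply: iterdn_ind; first by split=> //; rewrite su => j; lia.
move=> k t kn [h1 h2 h3].
have [|i id iv iu|e1 e2 e3] := hc k (updv t.1 v k, t.2) kn h1.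
- by rewrite /updv /= eqxx.
- by rewrite /updv /= (negbTE iv) h3.
split=> //; rewrite e2 /=; have -> : updv t.1 v k u = t.1 u by rewrite /updv eq_sym (negbTE vu).
exact: first_step h2.
Qed.

Lemma sem_num d n s : sem (iter n (Then (Inc d)) Skip) s = (updv s.1 d (s.1 d + n), s.2).
Proof.
elim: n s => [|n IH] s.
  rewrite sem_skip addn0 [LHS]surjective_pairing; congr Datatypes.pair.
  by apply/funext => i; upd; congr s.1.
rewrite iterS sem_then IH sem_inc; congr Datatypes.pair; apply/funext => i; upd.
Qed.

(** The counters from [d] on serve as a stack: the value is left in [d], and below it only the
    failure count 1 changes. *)
Lemma sem_comp e d s : 4 < d -> evok d e ->
  [/\ (sem (ecomp e d) s).2 = s.2,
      (sem (ecomp e d) s).1 d = evv s.2 s.1 e,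
      (sem (ecomp e d) s).1 1 = s.1 1 + evp s.2 s.1 e &
      forall i, i < d -> i != 1 -> (sem (ecomp e d) s).1 i = s.1 i].
Proof.
elim: e d s => [i|n|a IHa b IHb|a IHa b IHb|a IHa b IHb|o a IHa|a IHa] d s d4 /=.
- case/and4P => h1 h2 h3 h4; rewrite sem_copy; split=> //=; try by upd.
  by move=> j jd j1; upd.
- rewrite sem_then sem_zero sem_num; split=> //=; try by upd.
  by move=> j jd j1; upd.
- case/andP => oa ob; rewrite !sem_then.
  have [a1 a2 a3 a4] := IHa d s d4 oa; set s1 := sem _ s in a1 a2 a3 a4 *.
  have [b1 b2 b3 b4] := IHb d.+1 s1 (ltnW d4) (evok_leq (leqnSn d) ob).
  set s2 := sem _ s1 in b1 b2 b3 b4 *.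
  have dd : d != d.+1 by lia.
  rewrite (sem_loop_inc _ dd) /=.
  have [eb1 eb2] : evv s.2 s1.1 b = evv s.2 s.1 b /\ evp s.2 s1.1 b = evp s.2 s.1 b.
    by apply: (ev_ext _ ob) => [|i id _ i1 _]; apply: a4 => //; lia.
  split.
  + by rewrite b1.
  + rewrite /updv eqxx (negbTE dd) b4 // ?a2 ?b2 ?a1 ?eb1 //; lia.
  + have -> : updv (updv s2.1 d (s2.1 d + s2.1 d.+1)) d.+1 0 1 = s2.1 1 by upd.
    by rewrite b3 a3 a1 eb2; lia.
  + move=> i id i1; rewrite -a4 // -b4 //; [upd|lia].
- case/andP => oa ob; rewrite !sem_then.
  have [a1 a2 a3 a4] := IHa d s d4 oa; set s1 := sem _ s in a1 a2 a3 a4 *.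
  have [b1 b2 b3 b4] := IHb d.+1 s1 (ltnW d4) (evok_leq (leqnSn d) ob).
  set s2 := sem _ s1 in b1 b2 b3 b4 *.
  have dd : d != d.+1 by lia.
  rewrite (sem_loop_dec _ dd) /=.
  have [eb1 eb2] : evv s.2 s1.1 b = evv s.2 s.1 b /\ evp s.2 s1.1 b = evp s.2 s.1 b.
    by apply: (ev_ext _ ob) => [|i id _ i1 _]; apply: a4 => //; lia.
  split.
  + by rewrite b1.
  + rewrite /updv eqxx (negbTE dd) b4 // ?a2 ?b2 ?a1 ?eb1 //; lia.
  + have -> : updv (updv s2.1 d (s2.1 d - s2.1 d.+1)) d.+1 0 1 = s2.1 1 by upd.
    by rewrite b3 a3 a1 eb2; lia.
  + move=> i id i1; rewrite -a4 // -b4 //; [upd|lia].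
- case/andP => oa ob; rewrite !sem_then.
  have [a1 a2 a3 a4] := IHa d s d4 oa; set s1 := sem _ s in a1 a2 a3 a4 *.
  have [b1 b2 b3 b4] := IHb d.+1 s1 (ltnW d4) (evok_leq (leqnSn d) ob).
  set s2 := sem _ s1 in b1 b2 b3 b4 *.
  have [eb1 eb2] : evv s.2 s1.1 b = evv s.2 s.1 b /\ evp s.2 s1.1 b = evp s.2 s.1 b.
    by apply: (ev_ext _ ob) => [|i id _ i1 _]; apply: a4 => //; lia.
  have [|| c1 c2 c3] := @sem_pairc d.+2 d d.+1 s2; [lia|lia|].
  set s3 := sem _ s2 in c1 c2 c3 *; rewrite sem_copy /=; split.
  + by rewrite c1 b1.
  + by rewrite /updv eqxx c2 b4 ?b2 ?a2 ?a1 ?eb1 //; lia.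
  + have -> : updv s3.1 d (s3.1 d.+2) 1 = s3.1 1 by upd.
    by rewrite c3 ?b3 ?a3 ?a1 ?eb2; lia.
  + move=> i id i1; rewrite -a4 // -b4 //; last lia.
    by rewrite -c3; [upd|lia].
- move=> oa; rewrite sem_then.
  have [a1 a2 a3 a4] := IHa d s d4 oa; set s1 := sem _ s in a1 a2 a3 a4 *.
  rewrite sem_ifbit a1 a2; case: ifP => hb; rewrite ?sem_then ?sem_zero ?sem_inc; split=> //=.
  + by rewrite /updv eqxx.
  + by rewrite -a3; upd.
  + by move=> i id i1; rewrite -a4 //; upd.
  + by rewrite /updv eqxx.
  + by rewrite -a3; upd.
  + by move=> i id i1; rewrite -a4 //; upd.
- move=> oa; rewrite sem_then.
  have [a1 a2 a3 a4] := IHa d s d4 oa; set s1 := sem _ s in a1 a2 a3 a4 *.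
  rewrite 2!sem_then sem_zero sem_copy.
  set s2 := (_, _) : store.
  have s2v i : s2.1 i = if i == d.+2 then s.1 0 else if i == d.+1 then 0 else s1.1 i.
    have e0 : s1.1 0 = s.1 0 by apply: a4; lia.
    by rewrite /s2 -e0; upd.
  have s22 : s2.2 = s.2 by rewrite /s2 /= a1.
  clearbody s2.
  rewrite sem_then; set body := Then (pairc _ _ _) _.
  have := @sem_search d.+2 d.+1 d.+3 body (gbit s.2 (evv s.2 s.1 a)) s2.
  have e2 : s2.1 d.+2 = s.1 0 by rewrite s2v eqxx.
  case; try lia; first by rewrite s2v; upd.
    move=> k t kl t2 tv tr; rewrite /body sem_then.
    have [|| c1 c2 c3] := @sem_pairc d.+3 d d.+2 t; [lia|lia|].
    set s3 := sem _ t in c1 c2 c3 *.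
    have td : t.1 d = evv s.2 s.1 a by rewrite tr ?s2v; try lia; upd.
    rewrite sem_ifbit c1 c2 t2 s22 /gbit tv td; case: ifP => hb;
      rewrite ?sem_then ?sem_copy ?sem_inc ?sem_skip; split=> //=.
    + by rewrite c1 t2 s22.
    + by rewrite /updv eqxx c3 ?tv //; lia.
    + by move=> i i1 i2 i3; rewrite -tr // -c3 //; upd.
    + by rewrite c1 t2 s22.
    + by rewrite c3 //; lia.
    + by move=> i i1 i2 i3; rewrite -tr // -c3 //; lia.
  set s4 := sem _ s2; rewrite e2 => c1 c2 c3.
  rewrite sem_then sem_ifz c2; case: ifP => hb; rewrite ?sem_inc ?sem_dec sem_then sem_copy sem_skip;
    split=> /=.
  + by rewrite c1 s22.
  + by rewrite /updv eqxx (_ : (d.+1 == 1) = false) ?c2; [rewrite (eqP hb)|lia].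
  + rewrite /updv (_ : (1 == d) = false); last lia.
    rewrite eqxx c3 ?s2v; try lia.
    rewrite (_ : (1 == d.+2) = false); last lia.
    by rewrite (_ : (1 == d.+1) = false); [rewrite a3; lia|lia].
  + move=> i id i1; rewrite -a4 //.
    have -> : s1.1 i = s4.1 i by rewrite c3 ?s2v; try lia; upd.
    by upd.
  + by rewrite c1 s22.
  + by rewrite /updv !eqxx c2.
  + have e1 : s4.1 1 = s1.1 1 by rewrite c3 ?s2v; try lia; upd.
    transitivity (s4.1 1); first by upd.
    by rewrite e1 a3; lia.
  + move=> i id i1; rewrite -a4 //.
    have -> : s1.1 i = s4.1 i by rewrite c3 ?s2v; try lia; upd.
    by upd.
Qed.

(** Height of the stack. The numbers 6 and 7 allow for the four scratch counters of [pairc], which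
    start at [d.+2] for a pair and at [d.+3] for a look-up. *)
Fixpoint dep e : nat := match e with
| EVar _ | ENum _ => 1
| EAdd a b | ESub a b => maxn (dep a) (dep b).+1
| EPair a b => maxn (maxn (dep a) (dep b).+1) 6
| EBit _ a => dep a
| EG a => maxn (dep a) 7
end.

Fixpoint bits NV e : bool := match e with
| EVar _ | ENum _ => true
| EAdd a b | ESub a b | EPair a b => bits NV a && bits NV b
| EBit o a => goodo NV o && bits NV a
| EG a => bits NV a
end.

Transparent pairc.
Lemma ok_pairc NV d a b : a < d -> b < d -> d + 4 <= NV -> ok NV (pairc d a b).
Proof. by move=> *; rewrite /pairc /=; lia. Qed.

Lemma nomod_pairc v d a b : v < d -> nomod v (pairc d a b).
Proof. by move=> *; rewrite /pairc /=; lia. Qed.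

Fixpoint nosets c := match c with
| SetBit _ _ _ => false
| Then a b | IfZ _ a b | IfBit _ _ a b => nosets a && nosets b
| Loop _ a => nosets a
| _ => true
end.

Lemma nosets_pairc d a b : nosets (pairc d a b).
Proof. by []. Qed.
Opaque pairc.

Lemma dep_gt0 e : 0 < dep e.
Proof. by elim: e => //= *; lia. Qed.

Lemma ok_comp NV e d : evok d e -> bits NV e -> 1 < d -> d + dep e <= NV -> ok NV (ecomp e d).
Proof.
elim: e d => [i|n|a IHa b IHb|a IHa b IHb|a IHa b IHb|o a IHa|a IHa] d /=.
- by lia.
- by move=> _ _ _ h; apply/andP; split; [lia|elim: n => //= n ->; lia].
- case/andP => oa ob /andP [ba bb] d1 h; have := dep_gt0 b; rewrite IHa ?IHb ?(evok_leq _ ob) //; lia.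
- case/andP => oa ob /andP [ba bb] d1 h; have := dep_gt0 b; rewrite IHa ?IHb ?(evok_leq _ ob) //; lia.
- case/andP => oa ob /andP [ba bb] d1 h.
  by rewrite IHa ?IHb ?(evok_leq _ ob) ?ok_pairc //; lia.
- move=> oa /andP [g ba] d1 h; have := dep_gt0 a; rewrite IHa // g /=; lia.
- move=> oa ba d1 h; rewrite IHa ?ok_pairc ?nomod_pairc //; try lia.
  have g : goodo NV 11 by rewrite /goodo /isvar /=; lia.
  by rewrite g /=; lia.
Qed.

Lemma nomod_comp v e d : v < d -> v != 1 -> nomod v (ecomp e d).
Proof.
elim: e d => [i|n|a IHa b IHb|a IHa b IHb|a IHa b IHb|o a IHa|a IHa] d vd v1 /=.
- by lia.
- by apply/andP; split; [lia|elim: n => //= n ->; lia].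
- by rewrite IHa ?IHb //; lia.
- by rewrite IHa ?IHb //; lia.
- by rewrite IHa ?IHb ?nomod_pairc //; lia.
- by rewrite IHa //; lia.
- by rewrite IHa ?nomod_pairc //; lia.
Qed.

Lemma nosets_comp e d : nosets (ecomp e d).
Proof.
elim: e d => [i|n|a IHa b IHb|a IHa b IHb|a IHa b IHb|o a IHa|a IHa] d //=;
  rewrite ?IHa ?IHb ?nosets_pairc //.
by elim: n.
Qed.

Transparent sem.
Lemma nosets_sem c s : nosets c -> (sem c s).2 = s.2.
Proof.
elim: c s => [|u|d i|u|u|a IHa b IHb|u a IHa|u a IHa b IHb|o u a IHa b IHb|o u x] s //=.
- by case/andP => /IHa ha /IHb hb; rewrite hb ha.
- move=> /IHa h; move: (s.1 u) => k; elim: k s => //= k IH s.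
  by rewrite IH h.
- by case/andP => /IHa ha /IHb hb; case: ifP.
- by case/andP => /IHa ha /IHb hb; case: ifP.
Qed.

Lemma nosets_vis c s T : nosets c -> vis c s T <-> T = s.2.
Proof.
elim: c s => [|u|d i|u|u|a IHa b IHb|u a IHa|u a IHa b IHb|o u a IHa b IHb|o u x] s //=.
- case/andP => na nb; rewrite IHa // IHb // nosets_sem //; tauto.
- move=> na; split=> [[//|]|->]; last by left.
  move: (s.1 u) => k; elim: k s => //= k IH s; rewrite IHa //= => -[//|/IH].
  by rewrite nosets_sem.
- case/andP => na nb; case: ifP => _; rewrite ?IHa ?IHb //; tauto.
- case/andP => na nb; case: ifP => _; rewrite ?IHa ?IHb //; tauto.
Qed.

Lemma vis_start c s : vis c s s.2.
Proof. by elim: c s => //= *; left. Qed.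

Lemma vis_then a b s T : vis (Then a b) s T <-> vis a s T \/ vis b (sem a s) T.
Proof. by []. Qed.
Lemma vis_pure_then a b s T : nosets a ->
  vis (Then a b) s T <-> vis b (sem a s) T.
Proof.
move=> na; rewrite vis_then nosets_vis //; split; [case=> // ->|by right].
by rewrite -(nosets_sem s na); exact: vis_start.
Qed.
Lemma vis_ifz v a b s T :
  vis (IfZ v a b) s T <-> if s.1 v == 0 then vis a s T else vis b s T.
Proof.
rewrite /=; split; last by right.
by case=> // ->; case: ifP => _; exact: vis_start.
Qed.
Lemma vis_ifbit o v a b s T :
  vis (IfBit o v a b) s T <-> if s.2 o (s.1 v) then vis a s T else vis b s T.
Proof.
rewrite /=; split; last by right.
by case=> // ->; case: ifP => _; exact: vis_start.
Qed.
Lemma vis_set o v x s T :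
  vis (SetBit o v x) s T <-> T = s.2 \/ T = updt s.2 o (s.1 v) x.
Proof. by []. Qed.
Opaque sem vis.

(** * The body of the main loop *)

Fixpoint evr lo d e : bool := match e with
| EVar i => lo <= i < d
| ENum _ => true
| EAdd a b | ESub a b | EPair a b => evr lo d a && evr lo d b
| EBit _ a => evr lo d a
| EG a => evr lo d a
end.

Lemma evr_evok lo d e : 4 < lo -> evr lo d e -> evok d e.
Proof.
move=> l; elim: e => //= [i|a IHa b IHb|a IHa b IHb|a IHa b IHb]; first by lia.
- by case/andP => /IHa -> /IHb.
- by case/andP => /IHa -> /IHb.
- by case/andP => /IHa -> /IHb.
Qed.

Lemma evr_ext lo T d r r' e : evr lo d e -> r 0 = r' 0 ->
  (forall i, lo <= i < d -> r i = r' i) ->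
  evv T r e = evv T r' e /\ evp T r e = evp T r' e.
Proof.
move=> h e0 hr; elim: e h => //= [i|a IHa b IHb|a IHa b IHb|a IHa b IHb|o a IHa|a IHa].
- by move=> h1; rewrite hr.
- by case/andP => /IHa [-> ->] /IHb [-> ->].
- by case/andP => /IHa [-> ->] /IHb [-> ->].
- by case/andP => /IHa [-> ->] /IHb [-> ->].
- by move=> /IHa [-> ->].
- by move=> /IHa [-> ->]; rewrite e0.
Qed.

Fixpoint allc xs c := if xs is x :: xs' then Then (Copy x 3) (Loop x (allc xs' c)) else c.
Definition testc e d := Then (ecomp e d) (Loop d (Inc 4)).

Section Body.
Variables (NV D : nat) (phi : expr).
Hypothesis D10 : 10 <= D.
Hypothesis phi_vars : evr 10 D phi.
Hypothesis phi_bits : bits NV phi.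
Hypothesis phi_dep : D + dep phi <= NV.
Hypothesis NV_big : 20 <= NV.

Definition holds_at T (r : vars) := evv T r phi = 0 /\ evp T r phi = 0.

Lemma holds_at_ext T r r' : r 0 = r' 0 -> (forall i, 10 <= i < D -> r i = r' i) ->
  holds_at T r -> holds_at T r'.
Proof. by move=> h0 h; rewrite /holds_at; have [-> ->] := evr_ext T phi_vars h0 h. Qed.

(** Failures are only ever added, so the two counts are zero at the end exactly if no instance of
    [phi] failed. In the loop over [x] the invariant [I k] covers the instances with the value of
    [x] at least [k], since loops count downwards. *)
Lemma sem_allc xs s : {subset xs <= iota 10 (D - 10)} -> uniq xs ->
  let s' := sem (allc xs (testc phi D)) s in
  [/\ s'.2 = s.2,
      forall i, i < D -> i \notin xs -> i != 1 -> i != 4 -> s'.1 i = s.1 i &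
      s'.1 1 + s'.1 4 = 0 <-> s.1 1 + s.1 4 = 0 /\
        forall r, r 0 = s.1 0 -> (forall i, 10 <= i < D -> i \notin xs -> r i = s.1 i) ->
          (forall x, x \in xs -> r x < s.1 3) -> holds_at s.2 r].
Proof.
elim: xs s => [|x xs IH] s sub un s'.
  have D4 : 4 < D by lia.
  have [a1 a2 a3 a4] := sem_comp s D4 (evr_evok (isT : 4 < 10) phi_vars).
  have n4 : 4 != D by lia.
  rewrite /s' /= /testc sem_then (sem_loop_inc _ n4) /=; set t := sem _ s in a1 a2 a3 a4 *.
  split=> //.
    by move=> i id _ i1 i4; rewrite -a4 //; upd.
  have -> : updv (updv t.1 4 (t.1 4 + t.1 D)) D 0 1 = t.1 1 by upd.
  have -> : updv (updv t.1 4 (t.1 4 + t.1 D)) D 0 4 = t.1 4 + t.1 D by upd.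
  rewrite a3 a2 a4 //; split=> [h|[h h2]].
    split; first by lia.
    move=> r r0 hr _; apply: (@holds_at_ext _ s.1); first by rewrite r0.
      by move=> i hi; rewrite hr.
    by split; lia.
  by have [] := h2 s.1; rewrite // => h3 h4; lia.
have xin : 10 <= x < D by have := sub x (mem_head _ _); rewrite mem_iota; lia.
have sub' : {subset xs <= iota 10 (D - 10)} by move=> y yx; apply: sub; rewrite inE yx orbT.
have [xn un'] : x \notin xs /\ uniq xs by apply/andP.
have IH' t := IH t sub' un'.
have n3 : 3 \notin xs by apply/negP => /sub'; rewrite mem_iota.
have n0 : 0 \notin xs by apply/negP => /sub'; rewrite mem_iota.
rewrite /s' /= sem_then sem_copy sem_loop.
set s0 := (_, _) : store; rewrite (_ : s0.1 x = s.1 3); last by rewrite /= /updv eqxx.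
pose I k (t : store) := [/\ t.2 = s.2,
  forall i, i < D -> i \notin x :: xs -> i != 1 -> i != 4 -> t.1 i = s.1 i &
   t.1 1 + t.1 4 = 0 <-> s.1 1 + s.1 4 = 0 /\
        forall r, r 0 = s.1 0 -> (forall i, 10 <= i < D -> i \notin x :: xs -> r i = s.1 i) ->
          k <= r x < s.1 3 -> (forall y, y \in xs -> r y < s.1 3) -> holds_at s.2 r].
suff [h1 h2 h3] : I 0 (iterdn (sem (allc xs (testc phi D))) x (s.1 3) s0).
  split=> //; rewrite h3; split=> -[e h]; split=> // r r0 hr.
    by move=> hx; apply: h => // [|y yx]; apply: hx; rewrite inE ?eqxx // yx orbT.
  by move=> hx hy; apply: h => // y; rewrite inE => /orP [/eqP ->//|/hy].
apply: iterdn_ind.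
  split=> //.
    by move=> i id; rewrite inE negb_or => /andP [ix _] i1 i4; rewrite /= /updv (negbTE ix).
  rewrite /= /updv (_ : (1 == x) = false); last by lia.
  rewrite (_ : (4 == x) = false); last by lia.
  by split=> [h|[]] //; split=> // r r0 hr; lia.
move=> k t kn [h1 h2 h3].
have [e1 e2 e3] := IH' (updv t.1 x k, t.2).
split; first by rewrite e1.
  move=> i id; rewrite inE negb_or => /andP [ix ixs] i1 i4.
  by rewrite e2 //= /updv (negbTE ix) h2 // inE negb_or ix ixs.
rewrite e3 /=.
have u i : i != x -> updv t.1 x k i = t.1 i by rewrite /updv => /negbTE ->.
have ne i : 10 <= i < D -> [/\ i < D, i != 1 & i != 4] by clear; move=> h; split; lia.
have x1 : 1 != x by lia.
have x4 : 4 != x by lia.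
have x3 : 3 != x by lia.
have x0 : 0 != x by lia.
rewrite !u // h3.
have t3 : t.1 3 = s.1 3 by rewrite h2 // ?inE ?negb_or ?n3 ?andbT; lia.
have t0 : t.1 0 = s.1 0 by rewrite h2 // ?inE ?negb_or ?n0 ?andbT //; lia.
rewrite t3 t0 h1; split=> [[[a1 a2] a3]|[a1 a2]].
  split=> // r r0 hr /andP [kx xn3] hy.
  move: kx; rewrite leq_eqVlt => /orP [/eqP kx|kx]; last by apply: a2; rewrite ?kx.
  apply: a3 => // i hi ixs; case: (i =P x) => [->|/eqP ix]; first by rewrite /updv eqxx.
  have [i1 i2 i3] := ne i hi.
  by rewrite u // h2 ?hr // inE negb_or ix.
split.
  by split=> // r r0 hr /andP [hx hx'] hy; apply: a2 => //; rewrite hx' (ltnW hx).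
move=> r r0 hr hy; apply: a2 => //.
  move=> i hi; rewrite inE negb_or => /andP [ix ixs]; have [i1 i2 i3] := ne i hi.
  by rewrite hr // u // h2 // inE negb_or ix.
by rewrite hr // /updv eqxx leqnn.
Qed.

Definition eqE a b := EAdd (ESub a b) (ESub b a).
Definition xs := iota 10 (D - 10).

(* Track 0: the top is reached; 1: the flag tested at limit stages; 3: the second phase has begun;
   4: block 0; 11: the graph of [g]; 12: the current point; 15: the sizes of the tuples already checked.
   Counters 0: fuel; 1: failed look-ups; 2: loop; 3: point or size; 4: failed tests; 5: zero; 6, 7: the
   next point and the point to announce; 8: test; from 10 on: the variables of [phi]. *)
Definition find_unchecked := foldr Then Skip
  [:: Copy 2 0; Zero 3; Loop 2 (IfBit 15 2 Skip (Then (Copy 3 2) (Inc 3)))].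
Definition find_current := foldr Then Skip
  [:: Copy 2 0; Zero 3; Loop 2 (IfBit 12 2 (Then (Copy 3 2) (Inc 3)) Skip)].
Definition gnx := EG (EPair (ENum 1) (EVar 3)).
Definition gp := EG (EPair (ENum 2) (EVar 3)).

Definition flash_z := Then (SetBit 15 3 true) (Then (SetBit 1 5 true) (SetBit 1 5 false)).
(** The next point is marked after the flashes, so that no flash can erase it. An announced top
    flashes track 0 as well, since the answer too must appear at the very limit stage of the top.
    The flag raised at the end keeps later rounds of the same interval idle. *)
Definition advance := foldr Then Skip
  [:: SetBit 12 3 false;
      IfZ 7 Skip (Then (SetBit 12 7 true) (SetBit 12 7 false));
      ecomp (eqE (EVar 7) (ENum 2)) 8;
      IfZ 8 (Then (SetBit 0 5 true) (SetBit 0 5 false)) Skip;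
      SetBit 12 6 true;
      ecomp (eqE (EVar 6) (ENum 2)) 8;
      IfZ 8 (SetBit 0 5 true) Skip;
      SetBit 1 5 true].

Definition check_next := Then find_unchecked (IfZ 3 Skip (Then (Dec 3)
  (Then (Zero 1) (Then (Zero 4) (Then (allc xs (testc phi D))
    (IfZ 1 (IfZ 4 flash_z Skip) Skip)))))).
Definition run_next := IfBit 1 5 Skip (Then find_current (IfZ 3 Skip (Then (Dec 3)
  (Then (Zero 1) (Then (ecomp gnx 6) (Then (ecomp gp 7) (IfZ 1 advance Skip))))))).
(** Every round starts again with one more unit of fuel, so any search that can succeed succeeds
    from some round on. *)
Definition clear := foldr (fun v => Then (Zero v)) (Inc 0) (iota 1 NV.-1).
Definition body := Then (IfBit 3 5 run_next check_next) clear.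

Definition fresh f : vars := fun i => if i == 0 then f else 0.

Lemma sem_find (o : nat) (neg : bool) f T :
  let c := foldr Then Skip [:: Copy 2 0; Zero 3; Loop 2
    (if neg then IfBit o 2 Skip (Then (Copy 3 2) (Inc 3))
     else IfBit o 2 (Then (Copy 3 2) (Inc 3)) Skip)] in
  let s' := sem c (fresh f, T) in
  [/\ s'.2 = T, s'.1 3 = first (fun j => neg (+) T o j) f &
      forall i, i != 2 -> i != 3 -> s'.1 i = fresh f i].
Proof.
move=> c s'; rewrite /s' /c /foldr !sem_then sem_copy sem_zero sem_skip.
set s1 := (_, _) : store; set b := (if neg then _ else _).
have s12 : s1.1 2 = f by rewrite /s1 /= /updv.
have s13 : s1.1 3 = 0 by rewrite /s1 /= /updv.
have s1T : s1.2 = T by [].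
have s1i i : i != 2 -> i != 3 -> s1.1 i = fresh f i.
  by rewrite /s1 /= /updv => /negbTE -> /negbTE ->.
clearbody s1.
have key d : 3 < d -> [/\ (sem (Loop 2 b) s1).2 = s1.2, (sem (Loop 2 b) s1).1 3 = first (fun j => neg (+) T o j) (s1.1 2) &
    forall i, i < d -> i != 2 -> i != 3 -> (sem (Loop 2 b) s1).1 i = s1.1 i].
  move=> d3; apply: (@sem_search 2 3 d) => //; try lia.
  move=> k t kl t2 tv tr; have hn : neg = true \/ neg = false by (case: (neg); [left|right]).
  case: hn => hn; rewrite /b hn sem_ifbit t2 tv s1T /=; case: (T o k) => /=;
    rewrite ?sem_then ?sem_copy ?sem_inc ?sem_skip; split=> //=; try (by rewrite t2); try (by rewrite /updv eqxx tv);
    by move=> i i1 i2 i3; rewrite -tr // /updv; upd.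
have [h1 h2 _] := key 4 isT; split=> //; [by rewrite h1|by rewrite h2 s12|].
move=> i i2 i3; have [_ _ h3] := key (i + 4) (leq_addl _ _).
by rewrite h3 ?s1i //; lia.
Qed.

Lemma sem_clear s : (sem clear s).2 = s.2 /\
  forall i, i < NV -> (sem clear s).1 i = fresh (s.1 0).+1 i.
Proof.
have key l t : 0 \notin l -> let t' := sem (foldr (fun v => Then (Zero v)) (Inc 0) l) t in
    t'.2 = t.2 /\ forall i, t'.1 i = if i == 0 then (t.1 0).+1 else if i \in l then 0 else t.1 i.
  elim: l t => [|v l IH] t /=; first by rewrite sem_inc.
  rewrite inE negb_or => /andP [v0 nl]; rewrite sem_then sem_zero.
  have [h1 h2] := IH (updv t.1 v 0, t.2) nl; split; first by rewrite h1.
  move=> i; rewrite h2 /= /updv inE; case: eqP => // _.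
    by rewrite (negbTE v0).
  by case: (i =P v) => //= _; case: ifP.
have n0 : 0 \notin iota 1 NV.-1 by rewrite mem_iota.
have [h1 h2] := key _ s n0; split=> // i iN; rewrite h2 mem_iota /fresh.
by case: eqP => // i0; rewrite (_ : 1 <= i < 1 + NV.-1) //; lia.
Qed.

Lemma nosets_clear : nosets clear.
Proof. by rewrite /clear; elim: (iota _ _). Qed.

Lemma nosets_allc l : nosets (allc l (testc phi D)).
Proof. by elim: l => //=; rewrite nosets_comp. Qed.

Definition checked (T : tracks) f j := forall r, r 0 = f ->
  (forall i, 10 <= i < D -> r i < j) -> holds_at T r.

Lemma vis_body s T : vis body s T <-> vis (IfBit 3 5 run_next check_next) s T.
Proof.
rewrite /body vis_then (nosets_vis (sem (IfBit 3 5 run_next check_next) s) T nosets_clear).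
split; last by left.
by case=> // ->; exact: vis_end.
Qed.

Lemma sem_body s : (sem body s).2 = (sem (IfBit 3 5 run_next check_next) s).2 /\
  forall i, i < NV -> (sem body s).1 i = fresh ((sem (IfBit 3 5 run_next check_next) s).1 0).+1 i.
Proof. by rewrite /body sem_then; exact: sem_clear. Qed.

Lemma check_nextP f T : let s' := sem check_next (fresh f, T) in
  let P := exists2 j, first (fun j => ~~ T 15 j) f = j.+1 & checked T f j in
  s'.1 0 = f /\
  [\/ ~ P /\ s'.2 = T /\ (forall U, vis check_next (fresh f, T) U -> U = T) |
   exists j, let T1 := updt T 15 j true in let T2 := updt T1 1 0 true in
     let T3 := updt T2 1 0 false in
     [/\ first (fun j => ~~ T 15 j) f = j.+1, checked T f j, s'.2 = T3,
       vis check_next (fresh f, T) T2 &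
       forall U, vis check_next (fresh f, T) U -> U = T \/ U = T1 \/ U = T2 \/ U = T3]].
Proof.
move=> s' P.
have [h1 h2 h3] := sem_find 15 true f T; rewrite -/find_unchecked in h1 h2 h3.
have nf : nosets find_unchecked by [].
rewrite /s' /check_next !sem_then sem_ifz.
have hv U : vis check_next (fresh f, T) U <-> _ := vis_pure_then _ _ _ nf.
set s1 := sem _ _ in h1 h2 h3 hv *.
have hv' U := iff_trans (hv U) (vis_ifz _ _ _ _ _).
have e3 : s1.1 3 = first (fun j => ~~ T 15 j) f by rewrite h2; congr first.
case: eqP hv' => [e0|e0] hv'.
  rewrite sem_skip h3 //; split=> //; left; split.
    by move=> [j]; rewrite -e3 e0.
  by split=> // U /hv' /nosets_vis -> //.
have [j ej] : exists j, s1.1 3 = j.+1 by case: (s1.1 3) e0 => // j _; exists j.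
rewrite !sem_then sem_dec !sem_zero ej /=.
have nd : nosets (Dec 3) by [].
have nz v : nosets (Zero v) by [].
have hv2 U := iff_trans (hv' U) (iff_trans (vis_pure_then _ _ _ nd)
  (iff_trans (vis_pure_then _ _ _ (nz 1)) (iff_trans (vis_pure_then _ _ _ (nz 4))
   (vis_pure_then _ _ _ (nosets_allc xs))))).
move: hv2; rewrite sem_dec !sem_zero ej /= => hv2 {hv hv'}.
set s2 := (updv _ 4 0, _) : store in hv2 *.
have sub : {subset xs <= iota 10 (D - 10)} by [].
have [a1 a2 a3] := sem_allc s2 sub (iota_uniq _ _).
set s3 := sem _ s2 in a1 a2 a3 hv2 *.
have inx i : (i \in xs) = (10 <= i < D) by rewrite mem_iota; lia.
have s20 : s2.1 0 = f by rewrite /s2 /= /updv /= h3.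
have s30 : s3.1 0 = f by rewrite a2 ?inx //; lia.
have s35 : s3.1 5 = 0 by rewrite a2 ?inx //; try lia; rewrite /s2 /= /updv /= h3.
have s33 : s3.1 3 = j by rewrite a2 ?inx //; try lia.
have s32 : s3.2 = T by rewrite a1 /s2 /= h1.
have hc : s3.1 1 + s3.1 4 = 0 <-> checked T f j.
  have e2 : s2.2 = T by rewrite /s2 /= h1.
  rewrite a3 s20 e2; split=> [[_ h] r r0 hr|h].
    by apply: h => // i; rewrite inx => hi; [move=> /negP|exact: hr].
  split=> // r r0 _ hr; apply: h => // i hi; apply: hr; by rewrite inx.
have nP : (forall k, first (fun j0 => ~~ T 15 j0) f = k.+1 -> k = j).
  by move=> k; rewrite -e3 ej => -[].
have hv3 U := iff_trans (hv2 U) (vis_ifz _ _ _ _ _).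
rewrite sem_ifz; case: eqP hv3 => [z1|z1] hv3; last first.
  rewrite sem_skip; split=> //; left; split.
    by move=> [k /nP ->] /hc; lia.
  by split=> // U /hv3 /nosets_vis ->.
have hv4 U := iff_trans (hv3 U) (vis_ifz _ _ _ _ _).
rewrite sem_ifz; case: eqP hv4 => [z4|z4] hv4; last first.
  rewrite sem_skip; split=> //; left; split.
    by move=> [k /nP ->] /hc; lia.
  by split=> // U /hv4 /nosets_vis ->.
rewrite /flash_z !sem_then !sem_setbit /= s35 s33 s32; split=> //; right; exists j.
split=> //.
- by rewrite -e3.
- by apply/hc; lia.
- apply/hv4; rewrite /flash_z !vis_then sem_setbit !vis_set sem_setbit /= s35 s33 s32.
  by right; left; right.
- move=> U /hv4; rewrite /flash_z !vis_then sem_setbit !vis_set sem_setbit /= s35 s33 s32.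
  tauto.
Qed.
(** The successive values of the tracks during [advance]. Where a branch is skipped, a value repeats
    an earlier one, so that one list of values serves all cases. *)
Definition adv1 (T : tracks) m := updt T 12 m false.
Definition adv2 T m p := if p == 0 then adv1 T m else updt (adv1 T m) 12 p true.
Definition adv3 T m p := if p == 0 then adv1 T m else updt (adv2 T m p) 12 p false.
Definition adv4 T m p := if p == 2 then updt (adv3 T m p) 0 0 true else adv3 T m p.
Definition adv5 T m p := if p == 2 then updt (adv4 T m p) 0 0 false else adv3 T m p.
Definition adv6 T m p n := updt (adv5 T m p) 12 n true.
Definition adv7 T m p n := if n == 2 then updt (adv6 T m p n) 0 0 true else adv6 T m p n.
Definition adv8 T m p n := updt (adv7 T m p n) 1 0 true.

Lemma evv_eqE T r u n : (evv T r (eqE (EVar u) (ENum n)) == 0) = (r u == n).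
Proof. rewrite /=; lia. Qed.

Lemma sem_eqtest u n s : 5 < u < 8 -> let s' := sem (ecomp (eqE (EVar u) (ENum n)) 8) s in
  [/\ s'.2 = s.2, (s'.1 8 == 0) = (s.1 u == n) & forall i, i < 8 -> i != 1 -> s'.1 i = s.1 i].
Proof.
move=> hu s'; have [|h1 h2 _ h4] := @sem_comp (eqE (EVar u) (ENum n)) 8 s isT; first by rewrite /=; lia.
by split=> //; rewrite h2 evv_eqE.
Qed.

Opaque ecomp.

Lemma semT a b t t' r : sem a t = t' -> sem b t' = r -> sem (Then a b) t = r.
Proof. by rewrite sem_then => ->. Qed.

Lemma advanceP s m p n T : s.1 3 = m -> s.1 5 = 0 -> s.1 6 = n -> s.1 7 = p -> s.2 = T ->
  [/\ (sem advance s).2 = adv8 T m p n, (sem advance s).1 0 = s.1 0 &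
   forall U, vis advance s U <->
     U = T \/ U = adv1 T m \/ U = adv2 T m p \/ U = adv3 T m p \/ U = adv4 T m p
     \/ U = adv5 T m p \/ U = adv6 T m p n \/ U = adv7 T m p n \/ U = adv8 T m p n].
Proof.
move=> s3 s5 s6 s7 sT.
pose s1 := (s.1, adv1 T m) : store.
have e1 : sem (SetBit 12 3 false) s = s1 by rewrite sem_setbit s3 sT.
pose s2 := (s.1, adv3 T m p) : store.
have e2 : sem (IfZ 7 Skip (Then (SetBit 12 7 true) (SetBit 12 7 false))) s1 = s2.
  rewrite sem_ifz /= s7 /s2 /adv3 /adv2; case: ifP => h; first by rewrite sem_skip.
  by rewrite sem_then !sem_setbit /= s7 ?h.
have [s4 e4] : exists t, sem (ecomp (eqE (EVar 7) (ENum 2)) 8) s2 = t by eexists.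
have [b1 b2 b3] := @sem_eqtest 7 2 s2 isT; rewrite e4 in b1 b2 b3.
pose s5' := (s4.1, adv5 T m p) : store.
have e5 : sem (IfZ 8 (Then (SetBit 0 5 true) (SetBit 0 5 false)) Skip) s4 = s5'.
  rewrite sem_ifz b2 /= s7 /s5' /adv5 /adv4; case: ifP => h.
    by rewrite sem_then !sem_setbit /= b3 // b1 /= s5.
  by rewrite sem_skip [LHS]surjective_pairing b1.
pose s6' := (s4.1, adv6 T m p n) : store.
have e6 : sem (SetBit 12 6 true) s5' = s6' by rewrite sem_setbit /= b3 //= s6.
have [s7' e7] : exists t, sem (ecomp (eqE (EVar 6) (ENum 2)) 8) s6' = t by eexists.
have [c1 c2 c3] := @sem_eqtest 6 2 s6' isT; rewrite e7 in c1 c2 c3.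
pose s8 := (s7'.1, adv7 T m p n) : store.
have e8 : sem (IfZ 8 (SetBit 0 5 true) Skip) s7' = s8.
  rewrite sem_ifz c2 /= b3 //= s6 /s8 /adv7; case: ifP => h.
    by rewrite !sem_setbit /= c3 //= b3 // c1 /= s5.
  by rewrite sem_skip [LHS]surjective_pairing c1.
have e9 : sem (SetBit 1 5 true) s8 = (s7'.1, adv8 T m p n).
  by rewrite sem_setbit /= c3 //= b3 //= s5.
have ns u : nosets (ecomp (eqE (EVar u) (ENum 2)) 8) by exact: nosets_comp.
have E : sem advance s = (s7'.1, adv8 T m p n).
  rewrite /advance /foldr.
  exact: (semT e1 (semT e2 (semT e4 (semT e5 (semT e6 (semT e7
    (semT e8 (semT e9 (sem_skip _))))))))).
split; first by rewrite E.
  by rewrite E /= c3 //= b3.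
move=> U.
have visT a b t t' A B : sem a t = t' -> (vis a t U <-> A) -> (vis b t' U <-> B) ->
    (vis (Then a b) t U <-> A \/ B) by move=> <- h1 h2; rewrite vis_then h1 h2.
have v2 : vis (IfZ 7 Skip (Then (SetBit 12 7 true) (SetBit 12 7 false))) s1 U <->
    U = adv1 T m \/ U = adv2 T m p \/ U = adv3 T m p.
  rewrite vis_ifz /= s7 /adv3 /adv2; case: (p == 0).
    by rewrite (nosets_vis _ _ (isT : nosets Skip)) /=; tauto.
  by rewrite vis_then !vis_set sem_setbit /= s7; tauto.
have v4 : vis (IfZ 8 (Then (SetBit 0 5 true) (SetBit 0 5 false)) Skip) s4 U <->
    U = adv3 T m p \/ U = adv4 T m p \/ U = adv5 T m p.
  rewrite vis_ifz b2 /= s7 /adv5 /adv4; case: (p == 2); last first.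
    by rewrite (nosets_vis _ _ (isT : nosets Skip)) b1 /=; tauto.
  by rewrite vis_then !vis_set sem_setbit /= b3 //= s5 b1 /=; tauto.
have v6 : vis (IfZ 8 (SetBit 0 5 true) Skip) s7' U <-> U = adv6 T m p n \/ U = adv7 T m p n.
  rewrite vis_ifz c2 /= b3 //= s6 /adv7; case: (n == 2); last first.
    by rewrite (nosets_vis _ _ (isT : nosets Skip)) c1 /=; tauto.
  by rewrite vis_set /= c3 //= b3 //= s5 c1 /=.
have v5 := vis_set 12 6 true s5' U; rewrite /= b3 //= s6 in v5.
have v7 := vis_set 1 5 true s8 U; rewrite /= c3 //= b3 //= s5 in v7.
have v1 := vis_set 12 3 false s U; rewrite s3 sT in v1.
have vt2 := nosets_vis s2 U (ns 7).
have vt6 := nosets_vis s6' U (ns 6).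
have v9 := nosets_vis (s7'.1, adv8 T m p n) U (isT : nosets Skip).
have H := visT _ _ _ _ _ _ e1 v1 (visT _ _ _ _ _ _ e2 v2 (visT _ _ _ _ _ _ e4 vt2
  (visT _ _ _ _ _ _ e5 v4 (visT _ _ _ _ _ _ e6 v5 (visT _ _ _ _ _ _ e7 vt6
  (visT _ _ _ _ _ _ e8 v6 (visT _ _ _ _ _ _ e9 v7 v9))))))).
rewrite /advance /foldr; apply: (iff_trans H); rewrite /s2 /s6' /= -/(adv1 T m) -/(adv6 T m p n) -/(adv8 T m p n).
by clear; tauto.
Qed.

Lemma run_nextP f T : let s' := sem run_next (fresh f, T) in
  let nf m := first (gbit T (npair 1 m)) f in let pf m := first (gbit T (npair 2 m)) f in
  s'.1 0 = f /\
  [\/ (T 1 0 \/ first (T 12) f = 0 \/ exists m, first (T 12) f = m.+1 /\ (nf m = 0 \/ pf m = 0))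
     /\ s'.2 = T /\ (forall U, vis run_next (fresh f, T) U -> U = T) |
   exists m n p, [/\ ~~ T 1 0, first (T 12) f = m.+1, nf m = n.+1, pf m = p.+1 &
     s'.2 = adv8 T m p n /\
     forall U, vis run_next (fresh f, T) U <->
     U = T \/ U = adv1 T m \/ U = adv2 T m p \/ U = adv3 T m p \/ U = adv4 T m p
     \/ U = adv5 T m p \/ U = adv6 T m p n \/ U = adv7 T m p n \/ U = adv8 T m p n]].
Proof.
move=> s' nf pf; rewrite /s' /run_next sem_ifbit /=.
have hv U : vis run_next (fresh f, T) U <-> _ := vis_ifbit _ _ _ _ _ _.
rewrite /= in hv; case: ifP hv => z hv.
  rewrite sem_skip; split=> //; left; split; first by left.
  by split=> // U /hv /nosets_vis ->.
have [h1 h2 h3] := sem_find 12 false f T; rewrite -/find_current in h1 h2 h3.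
have nfc : nosets find_current by [].
rewrite sem_then; set s1 := sem _ _ in h1 h2 h3 *.
have hv1 U := iff_trans (hv U) (iff_trans (vis_pure_then _ _ _ nfc) (vis_ifz _ _ _ _ _)).
have e3 : s1.1 3 = first (T 12) f by rewrite h2; congr first.
rewrite sem_ifz; rewrite -/s1 in hv1; case: eqP hv1 => [e0|e0] hv1.
  rewrite sem_skip h3 //; split=> //; left; split; first by right; left; rewrite -e3.
  by split=> // U /hv1 /nosets_vis -> //.
have [m em] : exists m, s1.1 3 = m.+1 by case: (s1.1 3) e0 => // m _; exists m.
rewrite 4!sem_then sem_dec sem_zero em /=.
have nd : nosets (Dec 3) by [].
have nz : nosets (Zero 1) by [].
have hv2 U := iff_trans (hv1 U) (iff_trans (vis_pure_then _ _ _ nd)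
  (iff_trans (vis_pure_then _ _ _ nz) (iff_trans (vis_pure_then _ _ _ (nosets_comp gnx 6))
   (iff_trans (vis_pure_then _ _ _ (nosets_comp gp 7)) (vis_ifz _ _ _ _ _))))).
move: hv2; rewrite sem_dec sem_zero em /= => hv2 {hv hv1}.
set s2 := (updv _ 1 0, _) : store in hv2 *.
have s2T : s2.2 = T by exact: h1.
have s20 : s2.1 0 = f by rewrite /s2 /= /updv /= h3.
have s25 : s2.1 5 = 0 by rewrite /s2 /= /updv /= h3.
have s23 : s2.1 3 = m by [].
have s21 : s2.1 1 = 0 by [].
clearbody s2.
have [a1 a2 a3 a4] := @sem_comp gnx 6 s2 isT isT.
have [s3 e3'] : exists t, sem (ecomp gnx 6) s2 = t by eexists.
rewrite e3' in a1 a2 a3 a4 hv2 *.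
have [b1 b2 b3 b4] := @sem_comp gp 7 s3 isT isT.
have [s4 e4] : exists t, sem (ecomp gp 7) s3 = t by eexists.
rewrite e4 in b1 b2 b3 b4 hv2 *.
have s33 : s3.1 3 = m by rewrite a4.
have s30 : s3.1 0 = f by rewrite a4.
have s3T : s3.2 = T by rewrite a1.
have p1 : s4.1 1 = (nf m == 0) + (pf m == 0).
  by rewrite b3 a3 s21 /= s20 s30 s23 s33 s3T s2T.
have s46 : s4.1 6 = (nf m).-1 by rewrite b4 // a2 /= s20 s23 s2T.
have s47 : s4.1 7 = (pf m).-1 by rewrite b2 /= s30 s33 s3T.
have s40 : s4.1 0 = f by rewrite b4.
have s45 : s4.1 5 = 0 by rewrite b4 // a4.
have s43 : s4.1 3 = m by rewrite b4.
have s4T : s4.2 = T by rewrite b1.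
rewrite sem_ifz; case: eqP hv2 => [q|q] hv2; last first.
  rewrite sem_skip; split=> //; left; split; last by split=> // U /hv2 /nosets_vis ->.
  right; right; exists m; split; first by rewrite -e3.
  by move: q; rewrite p1; case: eqP => [|_]; [left|case: eqP => [|//]; right].
have [n en] : exists n, nf m = n.+1 by case: (nf m) p1 => [|k] e; [lia|exists k].
have [p ep] : exists p, pf m = p.+1 by case: (pf m) p1 => [|k] e; [lia|exists k].
rewrite en /= in s46; rewrite ep /= in s47.
have [c1 c2 c3] := advanceP s43 s45 s46 s47 s4T.
split; first by rewrite c2.
right; exists m, n, p; split; [by []|by rewrite -e3|exact: en|exact: ep|].
by split=> // U; exact: iff_trans (hv2 U) (c3 U).
Qed.

Lemma ok_allc l : {subset l <= iota 10 (D - 10)} -> uniq l -> ok NV (allc l (testc phi D)).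
Proof.
have h0 := dep_gt0 phi.
elim: l => [|x l IH] sub /=.
  rewrite (ok_comp (evr_evok _ phi_vars)) //=; lia.
case/andP => xl ul; have xi : 10 <= x < D.
  by have := sub x (mem_head _ _); rewrite mem_iota; lia.
rewrite IH //; last by move=> y yl; apply: sub; rewrite inE yl orbT.
have nm : nomod x (allc l (testc phi D)).
  elim: l xl {IH sub ul} => [|y l IH] /=; first by rewrite nomod_comp; lia.
  by rewrite inE negb_or => /andP [xy /IH ->]; lia.
by rewrite nm /=; lia.
Qed.

Lemma ok_body : ok NV body.
Proof.
have g o : o < 18 -> goodo NV o by rewrite /goodo /isvar; lia.
have ec : ok NV clear.
  rewrite /clear; have : all (fun v => v < NV) (iota 1 NV.-1).
    by apply/allP => v; rewrite mem_iota; lia.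
  by elim: (iota _ _) => [|v l IH] /= => [_|/andP [-> /IH]//]; lia.
have e1 : ok NV (ecomp gnx 6) by apply: ok_comp => //=; lia.
have e2 : ok NV (ecomp gp 7) by apply: ok_comp => //=; lia.
have e3 : ok NV (ecomp (eqE (EVar 7) (ENum 2)) 8) by apply: ok_comp => //=; lia.
have e4 : ok NV (ecomp (eqE (EVar 6) (ENum 2)) 8) by apply: ok_comp => //=; lia.
have e5 : ok NV (allc xs (testc phi D)) by apply: ok_allc => //; exact: iota_uniq.
have l v : v < 20 -> v < NV by move=> h; exact: leq_trans h NV_big.
have okT a b : ok NV a -> ok NV b -> ok NV (Then a b) by move=> h1 h2; apply/andP.
have okI v a b : v < NV -> ok NV a -> ok NV b -> ok NV (IfZ v a b).
  by move=> h1 h2 h3; apply/and3P.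
have okB o v a b : goodo NV o -> v < NV -> ok NV a -> ok NV b -> ok NV (IfBit o v a b).
  by move=> h1 h2 h3 h4; apply/and4P.
have okS o v x : o < 18 -> v < 20 -> o != 4 -> ok NV (SetBit o v x).
  by move=> h1 h2 h3; apply/and3P; split; [exact: g|exact: l|].
have okL v a : v < NV -> ok NV a -> nomod v a -> ok NV (Loop v a).
  by move=> h1 h2 h3; apply/and3P.
have okC d i : d < 20 -> i < 20 -> d != i -> ok NV (Copy d i).
  by move=> h1 h2 h3; apply/and3P; split; [exact: l|exact: l|].
have okV v : v < 20 -> ok NV (Zero v) /\ ok NV (Inc v) /\ ok NV (Dec v).
  by move=> h; split; [|split]; exact: l.
have [z1 _] := okV 1 isT; have [z3 [i3 d3]] := okV 3 isT; have [z4 _] := okV 4 isT.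
have e6 : ok NV advance.
  rewrite /advance /foldr; apply: (okT); first exact: (okS).
  apply: (okT); first by (apply: (okI); [exact: l|by []|apply: (okT); exact: (okS)]).
  apply: (okT); first exact: e3.
  apply: (okT); first by (apply: (okI); [exact: l|apply: (okT); exact: (okS)|by []]).
  apply: (okT); first exact: (okS).
  apply: (okT); first exact: e4.
  apply: (okT); first by (apply: (okI); [exact: l|exact: (okS)|by []]).
  by apply: (okT); first exact: (okS).
have e7 : ok NV find_current.
  rewrite /find_current /foldr; apply: (okT); first exact: (okC).
  apply: (okT); first exact: z3.
  apply: (okT); last by [].
  apply: (okL); [exact: l| |by []].
  apply: (okB); [exact: g|exact: l| |by []].
  by apply: (okT); [exact: (okC)|exact: i3].
have e8 : ok NV find_unchecked.
  rewrite /find_unchecked /foldr; apply: (okT); first exact: (okC).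
  apply: (okT); first exact: z3.
  apply: (okT); last by [].
  apply: (okL); [exact: l| |by []].
  apply: (okB); [exact: g|exact: l|by []|].
  by apply: (okT); [exact: (okC)|exact: i3].
have e9 : ok NV flash_z.
  rewrite /flash_z; apply: (okT); first exact: (okS).
  by apply: (okT); exact: (okS).
have r1 : ok NV run_next.
  rewrite /run_next; apply: (okB); [exact: g|exact: l|by []|].
  apply: (okT); first exact: e7.
  apply: (okI); [exact: l|by []|].
  apply: (okT); first exact: d3.
  apply: (okT); first exact: z1.
  apply: (okT); first exact: e1.
  apply: (okT); first exact: e2.
  by apply: (okI); [exact: l|exact: e6|].
have r2 : ok NV check_next.
  rewrite /check_next; apply: (okT); first exact: e8.
  apply: (okI); [exact: l|by []|].
  apply: (okT); first exact: d3.
  apply: (okT); first exact: z1.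
  apply: (okT); first exact: z4.
  apply: (okT); first exact: e5.
  apply: (okI); [exact: l| |by []].
  by apply: (okI); [exact: l|exact: e9|].
by rewrite /body; apply: (okT) => //; apply: (okB); [exact: g|exact: l| |].
Qed.

End Body.

(** * Assembling the table of the verifier *)

Lemma tsize_gt0 c : 0 < tsize c.
Proof. by elim: c => //= *; lia. Qed.

Lemma tcomp_targets c pc k i t q : i < tsize c ->
  (nth row0 (tcomp c pc k) i t).2 = Some q -> q = k \/ pc <= q < pc + tsize c.
Proof.
elim: c pc k i => [f|a IHa b IHb|s a IHa b IHb|s a IHa] pc k i /=.
- by case: i => // _ [<-]; left.
- move=> li; rewrite nth_cat size_tcomp; case: ltnP => h /=.
    move=> /IHa => /(_ h) [->|]; last by right; lia.
    by have := tsize_gt0 b; right; lia.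
  by move=> /IHb [|->|]; [lia|left|right; lia].
- case: i => [_ /= [<-]|[_ /= [<-]|i li]]; rewrite ?/=; try by right; case: (s t); lia.
  rewrite /= nth_cat size_tcomp; case: ltnP => h.
    by move=> /IHa => /(_ h) [->|]; [left|right; lia].
  case e: (i - tsize a) => [|j] /=; first by case=> <-; have := tsize_gt0 b; right; lia.
  by move=> /IHb [|->|]; [lia|left|right; lia].
- case: i => [_ /= [<-]|[_ /= [<-]|i li]]; rewrite ?/=; try by right; case: (s t); lia.
  rewrite /= nth_cat size_tcomp; case: ltnP => h.
    by move=> /IHa => /(_ h) [->|]; right; lia.
  case e: (i - tsize a) => [|j] /=; first by case=> <-; left.
  by rewrite nth_nil.
Qed.

Lemma tcomp_fires c pc k i t : i < tsize c -> (nth row0 (tcomp c pc k) i t).2 <> None.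
Proof.
elim: c pc k i => [f|a IHa b IHb|s a IHa b IHb|s a IHa] pc k i /=.
- by case: i.
- by move=> li; rewrite nth_cat size_tcomp; case: ltnP => h; [apply: IHa|apply: IHb; lia].
- case: i => [|[|i]] //= li; rewrite nth_cat size_tcomp; case: ltnP => h; first exact: IHa.
  by case e: (i - tsize a) => [|j] //=; apply: IHb; lia.
- case: i => [|[|i]] //= li; rewrite nth_cat size_tcomp; case: ltnP => h; first exact: IHa.
  by case e: (i - tsize a) => [|j] //=; lia.
Qed.

Opaque tcomp tsize tl_of.

Section Program.
Variables (NV D : nat) (phi : expr).
Hypothesis D10 : 10 <= D.
Hypothesis phi_vars : evr 10 D phi.
Hypothesis phi_bits : bits NV phi.
Hypothesis phi_dep : D + dep phi <= NV.
Hypothesis NV_big : 20 <= NV.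
Local Notation K := (NV + 6).
Local Notation body := (body NV D phi).

Fixpoint mks n c := if n is n'.+1 then TSeq (trow tmark true) (mks n' c) else c.

(** Run at the start and after each limit stage, where the limsup leaves the counters of block 0 in
    an unknown state: it lowers the flag, sets the home mark and marks all counters as 0. Blocks
    further right must already be free of marks. *)
Definition prologue := TSeq (trow (fun t => (t.1.1, false, t.2)) true)
  (TSeq (trow (fun t => (t.1.1, true, t.2)) true)
    (mvs true 4 (mks NV (mvs false (5 + NV) (trow id false))))).
(** The first omega steps play the part of the point 0, whose successor is the point 1; so block 1
    is marked at once. *)
Definition enter_start := TSeq prologue
  (tl_of NV (Then (Inc 3) (Then (SetBit 12 3 true) (Dec 3)))).
Definition enter_limit := TSeq prologue (tl_of NV (SetBit 3 5 true)).

Definition main_pc := 2 + tsize enter_start.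
Definition limit_pc := main_pc + tsize (tl_of NV body).
Definition start_row : row := fun t => (t, false, Some 2).
(** At a limit stage the head reads tracks 0, 1 and 2 of block 0. Cell 0 is also the first output
    cell, so a reached top is already the accepting answer; without top and flag the machine
    rejects. *)
Definition limit_row : row := fun t =>
  if t.1.1 then ((true, t.1.2, t.2), false, None)
  else if t.1.2 then (t, false, Some limit_pc) else ((false, false, t.2), false, None).
Definition code := [:: start_row; limit_row] ++ tcomp enter_start 2 main_pc
  ++ tcomp (tl_of NV body) main_pc main_pc ++ tcomp enter_limit limit_pc main_pc.

Definition nstates := tsize enter_start + tsize (tl_of NV body) + tsize enter_limit.

Lemma nth_code i : nth row0 code (2 + i) = nth row0 (tcomp enter_start 2 main_pc
  ++ tcomp (tl_of NV body) main_pc main_pc ++ tcomp enter_limit limit_pc main_pc) i.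
Proof. by []. Qed.

Lemma code_ok i t q : (nth row0 code i t).2 = Some q -> q < nstates.+2.
Proof.
have h1 := tsize_gt0 (tl_of NV body); have h2 := tsize_gt0 enter_limit.
case: i => [[<-]//|[|i]].
  rewrite /= /limit_row; case: ifP => // _; case: ifP => // _ [<-].
  by rewrite /limit_pc /main_pc /nstates; lia.
rewrite -[i.+2]/(2 + i) nth_code.
rewrite nth_cat !size_tcomp; case: ltnP => h.
  by move=> /(tcomp_targets h); rewrite /main_pc /nstates; lia.
rewrite nth_cat !size_tcomp; case: ltnP => h'.
  by move=> /(tcomp_targets h'); rewrite /main_pc /nstates; lia.
case: (ltnP (i - tsize enter_start - tsize (tl_of NV body)) (tsize enter_limit)) => h''.
  by move=> /(tcomp_targets h''); rewrite /limit_pc /main_pc /nstates; lia.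
by rewrite nth_default ?size_tcomp.
Qed.

Lemma nth_cat2 T (d : T) a b c i : i < size b ->
  nth d (a ++ b ++ c) (size a + i) = nth d b i.
Proof. by move=> h; rewrite nth_cat ltnNge leq_addr /= addKn nth_cat h. Qed.

Lemma nth_cat3 T (d : T) a b c i : nth d (a ++ b ++ c) (size a + (size b + i)) = nth d c i.
Proof.
by rewrite nth_cat ltnNge leq_addr /= addKn nth_cat ltnNge leq_addr /= addKn.
Qed.

Lemma nth_cat1 T (d : T) a b i : i < size a -> nth d (a ++ b) i = nth d a i.
Proof. by move=> h; rewrite nth_cat h. Qed.

Lemma code_start : at_code code 2 (tcomp enter_start 2 main_pc).
Proof. by move=> i hi; rewrite nth_code; apply: nth_cat1. Qed.

Lemma code_main : at_code code main_pc (tcomp (tl_of NV body) main_pc main_pc).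
Proof.
move=> i hi; rewrite -(nth_cat2 row0 (tcomp enter_start 2 main_pc)
  (tcomp enter_limit limit_pc main_pc) hi).
rewrite -nth_code [size (tcomp enter_start 2 main_pc)]size_tcomp; congr nth.
Qed.

Lemma code_limit : at_code code limit_pc (tcomp enter_limit limit_pc main_pc).
Proof.
move=> i _; rewrite -(nth_cat3 row0 (tcomp enter_start 2 main_pc)
  (tcomp (tl_of NV body) main_pc main_pc) (tcomp enter_limit limit_pc main_pc)).
rewrite -nth_code [size (tcomp enter_start 2 main_pc)]size_tcomp.
rewrite [size (tcomp (tl_of NV body) main_pc main_pc)]size_tcomp.
have e a b c d : a + b + c + d = a + (b + (c + d)) by lia.
congr (nth row0 code _); exact: e.
Qed.

(** ** Entering the main loop *)

(** Together with [homes], what a limsup has to leave behind for the prologue to work: block 0 is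
    rewritten anyway, the others must not contain marks. *)
Definition clean (w : cells) := forall v b, v < NV -> 0 < b -> ~~ mk NV w v b.
Definition homes (w : cells) := forall b, 0 < b -> ~~ w (idx NV b 4).

Fixpoint marks n (w : cells) := if n is n'.+1 then marks n' (setc NV w 0 (NV - n) true) else w.

Lemma marks_facts n w : n <= NV -> [/\ mono NV w (marks n w), trk NV (marks n w) = trk NV w &
  forall v b, v < NV -> mk NV (marks n w) v b =
    if (b == 0) && (NV - n <= v) then true else mk NV w v b].
Proof.
elim: n w => [|n IH] w nN.
  by split=> // v b vN; rewrite (_ : _ && _ = false) //; lia.
have vN : NV - n.+1 < NV by lia.
have [h1 h2 h3] := IH (setc NV w 0 (NV - n.+1) true) (ltnW nN); split.
- by apply: mono_trans h1; exact: mono_setc.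
- by rewrite h2 trk_setc.
- move=> v b l; rewrite h3 // mk_setc //; case: (b =P 0) => [->|_] /=; last by rewrite andbF.
  rewrite andbT; case: (v =P NV - n.+1) => [->|ne]; first by rewrite leqnn; case: ifP.
  by congr (if _ then _ else _); lia.
Qed.

Lemma exec_mks n c w tr s : n <= NV -> exec c (K, marks n w) tr s ->
  exists tr0, exec (mks n c) (6 + (NV - n), w) (tr0 ++ tr) s /\
    all_tr (fun u => mono NV u (marks n w) /\ trk NV u = trk NV w) tr0.
Proof.
elim: n w => [|n IH] w nN hc.
  by rewrite subn0 addnC; exists [::].
have [|tr0 [h a]] := IH (setc NV w 0 (NV - n.+1) true) (ltnW nN); first exact: hc.
have h1 := @exec_markop NV true true 0 (NV - n.+1) w.
rewrite /rmove mul0n add0n in h1.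
exists (w :: tr0); split.
  apply: (XSeq h1); rewrite (_ : (6 + (NV - n.+1)).+1 = 6 + (NV - n)) //; lia.
have vN : NV - n.+1 < NV by lia.
split; last by apply: all_tr_impl a => u [u1 ->]; split=> //; rewrite trk_setc.
by have [h2 _ _] := @marks_facts n.+1 w nN.
Qed.

Lemma goodo_small o : o < 18 -> goodo NV o.
Proof. rewrite /goodo /isvar; lia. Qed.

Lemma trk_setb w o b x : goodo NV o -> trk NV (setb NV w b o x) = updt (trk NV w) o b x.
Proof.
move=> g; have r : Rel NV w (fun v => 0, trk NV w) \/ True by right.
apply/funext => o'; apply/funext => b'; rewrite /trk /updt /setb.
case g': (goodo NV o') => /=; last first.
  by case: eqP => // e; rewrite e g in g'.
by rewrite idx_eq //; [case/andP: g'|case/andP: g].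
Qed.

Lemma setb_var w o b x i : goodo NV o -> i < 3 * K -> isvar i ->
  forall b', setb NV w b o x (idx NV b' i) = w (idx NV b' i).
Proof.
move=> /andP [g1 g2] l v b'; rewrite /setb idx_eq //; case: eqP => //= e.
by rewrite -e v in g2.
Qed.

Lemma mono_setb w o b x : goodo NV o -> mono NV w (setb NV w b o x).
Proof.
move=> g v b' vN; have := ov_lt vN; have [i1 _] := isvar_ov v => l.
by rewrite setb_var //; lia.
Qed.

Lemma mk_setb w o b x v b' : goodo NV o -> v < NV -> mk NV (setb NV w b o x) v b' = mk NV w v b'.
Proof.
move=> g vN; have := ov_lt vN; have [i1 i2] := isvar_ov v => l.
by rewrite /mk !setb_var //; lia.
Qed.

Definition T_init (T : tracks) := updt (updt T 1 0 false) 4 0 true.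

Lemma exec_prologue w : clean w -> homes w -> exists tr w',
  [/\ exec prologue (0, w) tr (0, w'), Rel NV w' (fresh 0, T_init (trk NV w)),
      homeT (T_init (trk NV w)) &
      bounded NV (fun T => [\/ T = trk NV w, T = updt (trk NV w) 1 0 false | T = T_init (trk NV w)]) tr w'].
Proof.
move=> hc hh.
pose w1 := setb NV w 0 1 false; pose w2 := setb NV w1 0 4 true.
have g1 : goodo NV 1 by exact: goodo_small.
have g4 : goodo NV 4 by exact: goodo_small.
have [m1 t1 k1] := @marks_facts NV w2 (leqnn _).
have tw2 : trk NV w2 = T_init (trk NV w) by rewrite !trk_setb.
have h3 : exec (mvs false (5 + NV) (trow id false)) (K, marks NV w2)
    (nseq (5 + NV) (marks NV w2) ++ [:: marks NV w2]) (0, marks NV w2).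
  apply: exec_mvL; rewrite (_ : K - (5 + NV) = 1); last by lia.
  exact: (exec_id 1 _ false).
have [tr0 [h4 a4]] := exec_mks (leqnn _) h3; rewrite subnn addn0 in h4.
have h5 : exec (mvs true 4 (mks NV (mvs false (5 + NV) (trow id false)))) (2, w2)
  (nseq 4 w2 ++ (tr0 ++ (nseq (5 + NV) (marks NV w2) ++ [:: marks NV w2]))) (0, marks NV w2).
  by apply: exec_mvR.
have e1 : exec (trow (fun t => (t.1.1, false, t.2)) true) (0, w) [:: w] (1, w1).
  rewrite /w1 -(@rput_setb NV w 0 1 false g1).
  exact: (XRow (fun t : triple => ((t.1.1, false, t.2), true)) 0 w).
have e2 : exec (trow (fun t => (t.1.1, true, t.2)) true) (1, w1) [:: w1] (2, w2).
  rewrite /w2 -(@rput_setb NV w1 0 4 true g4).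
  exact: (XRow (fun t : triple => ((t.1.1, true, t.2), true)) 1 w1).
exists ([:: w] ++ ([:: w1] ++ (nseq 4 w2 ++ (tr0 ++ (nseq (5 + NV) (marks NV w2) ++ [:: marks NV w2]))))).
exists (marks NV w2).
have m2 : mono NV w1 w2 by exact: mono_setb.
have m0 : mono NV w w1 by exact: mono_setb.
have m12 := mono_trans m2 m1; have m02 := mono_trans m0 m12.
split.
- exact: XSeq e1 (XSeq e2 h5).
- split; first by rewrite t1 tw2.
  move=> v b vN; rewrite k1 // subnn andbT /= /fresh !mk_setb //.
  have -> : (if v == 0 then 0 else 0) = 0 by case: ifP.
  by case: b => //= b; apply/negbTE/hc.
- move=> b; rewrite /T_init /updt /=; case: b => //= b.
  by rewrite /trk g4 /=; apply/negbTE/hh.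
- set V := (fun T => _); pose P u := mono NV u (marks NV w2) /\ V (trk NV u).
  have V3 : V (T_init (trk NV w)) by exact: Or33.
  have P0 : P w by split=> //; exact: Or31.
  have P1 : P w1 by split=> //; rewrite trk_setb //; exact: Or32.
  have P2 : all_tr P (nseq 4 w2) by apply: all_tr_nseq; split=> //; rewrite tw2.
  have P3 : all_tr P tr0 by apply: all_tr_impl a4 => u [u1 u2]; split=> //; rewrite u2 tw2.
  have P4' : P (marks NV w2) by split=> //; rewrite t1 tw2.
  have P4 : all_tr P (nseq (5 + NV) (marks NV w2)) by exact: all_tr_nseq.
  have P5 : all_tr P (nseq (5 + NV) (marks NV w2) ++ [:: marks NV w2]).
    by apply/all_tr_cat; split.
  have P6 : all_tr P (tr0 ++ (nseq (5 + NV) (marks NV w2) ++ [:: marks NV w2])).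
    by apply/all_tr_cat; split.
  have P7 : all_tr P (nseq 4 w2 ++ (tr0 ++ (nseq (5 + NV) (marks NV w2) ++ [:: marks NV w2]))).
    by apply/all_tr_cat; split.
  by split=> //; split.
Qed.

(** ** The infinite loop *)

Fixpoint Tseq T0 f := if f is f'.+1 then (sem body (fresh f', Tseq T0 f')).2 else T0.

Definition ccells (s : rconf) : cells := s.2.2.

(** An interval of omega steps after its entry: round [f] begins at time [tm f] with the tape [w f],
    and the tracks seen during it are exactly those of [vis]. *)
Definition loops (c : nat -> rconf) k0 T0 := exists (tm : nat -> nat) (w : nat -> cells),
  [/\ tm 0 = k0, forall f, tm f < tm f.+1,
     forall k, k <= k0 -> mono NV (ccells (c k)) (w 0) &
     forall f, [/\ ccells (c (tm f)) = w f, Rel NV (w f) (fresh f, Tseq T0 f),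
       forall k, tm f <= k <= tm f.+1 -> (rrow code (c k)).2 <> None /\
         mono NV (ccells (c k)) (w f.+1) /\ vis body (fresh f, Tseq T0 f) (trk NV (ccells (c k))) &
       forall U, vis body (fresh f, Tseq T0 f) U ->
         exists2 k, tm f <= k <= tm f.+1 & trk NV (ccells (c k)) = U]].

Lemma Rel_ext w s s' : s.2 = s'.2 -> (forall i, i < NV -> s.1 i = s'.1 i) ->
  Rel NV w s -> Rel NV w s'.
Proof. by move=> e h [r1 r2]; split; [rewrite r1|move=> v b vN; rewrite r2 // h]. Qed.

Lemma main_fires s : s.1 = main_pc -> (rrow code s).2 <> None.
Proof.
move=> e; rewrite /rrow e -[main_pc]addn0 code_main ?size_tcomp; last exact: tsize_gt0.
exact/tcomp_fires/tsize_gt0.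
Qed.

Lemma one_iteration w f T : Rel NV w (fresh f, T) -> homeT T ->
  exists n w', let c k := iter k (rstep code) (main_pc, (0, w)) in
   [/\ 0 < n, c n = (main_pc, (0, w')), Rel NV w' (fresh f.+1, (sem body (fresh f, T)).2),
       forall k, k <= n -> (rrow code (c k)).2 <> None /\ mono NV (ccells (c k)) w' /\
          vis body (fresh f, T) (trk NV (ccells (c k))) &
       forall U, vis body (fresh f, T) U -> exists2 k, k <= n & trk NV (ccells (c k)) = U].
Proof.
move=> r ht; have okb := ok_body D10 phi_vars phi_bits phi_dep NV_big.
have [tr [w' [h r' b cv]]] := tl_of_correct okb r ht.
have hr := exec_reach h code_main.
exists (size tr), w' => c.
have cE : c (size tr) = (main_pc, (0, w')) := reach_iter hr.
have [g1 g2] := sem_body D10 phi_vars phi_bits phi_dep NV_big (fresh f, T).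
have r2 : Rel NV w' (fresh f.+1, (sem body (fresh f, T)).2).
  apply: Rel_ext r' => // i iN; rewrite g2 //; congr (fresh _.+1 _).
  rewrite sem_ifbit /=; case: ifP => _.
    by have [] := run_nextP D10 phi_vars phi_bits phi_dep NV_big f T.
  by have [] := check_nextP D10 phi_vars phi_bits phi_dep NV_big f T.
have w0 : cells := fun _ => false.
split=> //.
- by have [tr' ->] := exec_trace_ne h.
- move=> k; rewrite leq_eqVlt => /orP [/eqP ->|l].
    rewrite cE /ccells /=; split; first exact: main_fires.
    by split=> //; rewrite (proj1 r'); exact: vis_end.
  have [e1 e2] := reach_nth hr l; split=> //; rewrite /ccells e1.
  by have := all_trP (fun _ => false) b l.
- move=> U /cv [->|/has_trP]; first by exists (size tr); rewrite // cE.
  move=> /(_ (fun _ => false)) [k l e]; exists k; first exact: ltnW.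
  by rewrite /ccells (proj1 (reach_nth hr l)).
Qed.

Lemma homeT_Tseq T0 f : homeT T0 -> homeT (Tseq T0 f).
Proof.
have okb := ok_body D10 phi_vars phi_bits phi_dep NV_big.
by move=> h; elim: f => //= f IH; apply: (homeT_sem okb).
Qed.

Lemma loopsI c k0 w0 T0 : (forall k, c k.+1 = rstep code (c k)) ->
  c k0 = (main_pc, (0, w0)) -> Rel NV w0 (fresh 0, T0) -> homeT T0 ->
  (forall k, k <= k0 -> mono NV (ccells (c k)) w0) -> loops c k0 T0.
Proof.
move=> cS ck r0 ht hm.
have citer k j : c (k + j) = iter j (rstep code) (c k).
  by elim: j => [|j IH]; rewrite ?addn0 // addnS cS IH.
pose good (x : nat * (nat * cells)) :=
  c x.2.1 = (main_pc, (0, x.2.2)) /\ Rel NV x.2.2 (fresh x.1, Tseq T0 x.1).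
pose next (x y : nat * (nat * cells)) := good x -> [/\ good y, y.1 = x.1.+1, x.2.1 < y.2.1,
  forall k, x.2.1 <= k <= y.2.1 -> (rrow code (c k)).2 <> None /\
     mono NV (ccells (c k)) y.2.2 /\ vis body (fresh x.1, Tseq T0 x.1) (trk NV (ccells (c k))) &
  forall U, vis body (fresh x.1, Tseq T0 x.1) U ->
     exists2 k, x.2.1 <= k <= y.2.1 & trk NV (ccells (c k)) = U].
(* The triples of round, time and tape are built by choice; [next] is conditional on [good], so a
   default serves for the other triples. *)
have /boolp.choice [F hF] : forall x, exists y, next x y.
  move=> [f [k w]]; rewrite /next /good /=.
  have [[h1 h2]|ng] := pselect (c k = (main_pc, (0, w)) /\ Rel NV w (fresh f, Tseq T0 f)); last first.
    by exists (0, (0, w0)).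
  have [n [w' [n0 e1 e2 e3 e4]]] := one_iteration h2 (homeT_Tseq f ht).
  exists (f.+1, (k + n, w')) => _; split=> //=.
  - by rewrite citer h1.
  - by rewrite -addn1 leq_add2l.
  - move=> j /andP [j1 j2]; have := e3 (j - k); rewrite -h1 -citer subnKC //; apply; lia.
  - by move=> U /e4 [j l e]; exists (k + j); [lia|rewrite citer h1].
pose X f := iter f F (0, (k0, w0)).
have gX f : good (X f) /\ (X f).1 = f.
  elim: f => [|f [IH1 IH2]]; first by split.
  by have [h1 h2 _ _ _] := hF _ IH1; rewrite /X iterS -/(X f) h2 IH2.
exists (fun f => (X f).2.1), (fun f => (X f).2.2); split=> //.
  by move=> f; have [_ _ h _ _] := hF _ (proj1 (gX f)).
move=> f; have [g1 e1] := gX f; have [_ _ h1 h2 h3] := hF _ g1.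
rewrite e1 in h2 h3; split=> //.
- by rewrite (proj1 g1).
- by have := proj2 g1; rewrite e1.
Qed.

Lemma enter (pc0 pc1 : nat) pro w :
  (nth row0 code pc0 (rscan 0 w)) = (rscan 0 w, false, Some pc1) ->
  at_code code pc1 (tcomp (TSeq prologue (tl_of NV pro)) pc1 main_pc) ->
  ok NV pro -> clean w -> homes w ->
  (forall T, let s' := sem pro (fresh 0, T) in forall i, i < NV -> s'.1 i = fresh 0 i) ->
  let T1 := T_init (trk NV w) in let T0 := (sem pro (fresh 0, T1)).2 in
  let c k := iter k (rstep code) (pc0, (0, w)) in
  exists k0, loops c k0 T0 /\ forall k, k <= k0 -> (rrow code (c k)).2 <> None /\
    (trk NV (ccells (c k)) = trk NV w \/ trk NV (ccells (c k)) = updt (trk NV w) 1 0 false \/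
     vis pro (fresh 0, T1) (trk NV (ccells (c k)))).
Proof.
move=> hrow hat okp hc hh hpro T1 T0 c.
have [tr1 [w1 [h1 r1 ht1 b1]]] := exec_prologue hc hh.
have [tr2 [w2 [h2 r2 b2 cv2]]] := tl_of_correct okp r1 ht1.
have m2 : mono NV w1 w2 by have := bounded_mono h2 b2.
have hr0 : reach code (pc0, (0, w)) [:: w] (pc1, (0, w)).
  by apply: (reach1 hrow) => //; rewrite rput_scan.
have hr := reach_cat hr0 (exec_reach (XSeq h1 h2) hat).
set tr := [:: w] ++ (tr1 ++ tr2) in hr.
have cE : c (size tr) = (main_pc, (0, w2)) := reach_iter hr.
have r2' : Rel NV w2 (fresh 0, T0).
  by apply: Rel_ext r2 => // i iN; exact: hpro.
have ht : homeT T0 by exact: (@homeT_sem NV pro (fresh 0, T1) okp ht1).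
have m1 : mono NV w w1 by have := bounded_mono h1 b1.
pose P u := mono NV u w2 /\ (trk NV u = trk NV w \/
     trk NV u = updt (trk NV w) 1 0 false \/ vis pro (fresh 0, T1) (trk NV u)).
have ball : all_tr P tr.
  have q1 : all_tr P tr1.
    apply: all_tr_impl b1 => u [u1 u2]; split; first exact: mono_trans u1 m2.
    case: u2 => [->|->|->]; [by left|by right; left|right; right; exact: vis_start].
  have q2 : all_tr P tr2.
    by apply: all_tr_impl b2 => u [u1 u2]; split=> //; right; right.
  have q0 : P w by split; [exact: mono_trans m1 m2|left].
  exact: (conj q0 (proj2 (all_tr_cat _ _ _) (conj q1 q2))).
exists (size tr); split.
  apply: (@loopsI _ _ w2) => //.
  move=> k; rewrite leq_eqVlt => /orP [/eqP ->|l]; first by rewrite cE.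
  have [e1 _] := reach_nth hr l; rewrite /ccells e1.
  by have [] := all_trP (fun _ => false) ball l.
move=> k; rewrite leq_eqVlt => /orP [/eqP ->|l].
  rewrite cE; split; first exact: main_fires.
  by right; right; rewrite /ccells /= (proj1 r2'); exact: vis_end.
have [e1 e2] := reach_nth hr l; split=> //; rewrite /ccells e1.
by have [] := all_trP (fun _ => false) ball l.
Qed.

(** By [mono] a first cell that is on stays on, and at the start of a later round the counter stands
    elsewhere, so the eraser must be on. In the limsup both cells are then on, which is not a
    mark. *)
Lemma loops_clean c k0 T0 : loops c k0 T0 -> forall k v b, v < NV -> 0 < b ->
  exists2 k', k <= k' & ccells (c k) (idx NV b (ov v)) -> ccells (c k') (idx NV b (ov v).+1).
Proof.
move=> [tm [w [t0 tS hm hf]]] k v b vN b0.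
have mw f j : mono NV (w f) (w (f + j)).
  elim: j => [|j IH]; first by rewrite addn0.
  rewrite addnS; apply: mono_trans IH _; have [e _ h _] := hf (f + j).
  by have [|_ []] := h (tm (f + j)); [rewrite leqnn ltnW|rewrite e].
have tmf f : f <= tm f by elim: f => // f IH; exact: leq_ltn_trans IH (tS f).
have [f [kf mf]] : exists f, k <= tm f /\ mono NV (ccells (c k)) (w f).
  case: (leqP k k0) => [l|l]; first by exists 0; rewrite t0; split=> //; exact: hm.
  have [f f1 f2] : exists2 f, tm f <= k & k < tm f.+1.
    have ex : exists f, k < tm f by exists k.+1; exact: leq_trans (tmf k.+1).
    case: (ex_minnP ex) => -[|f] h mn; first by rewrite t0 in h; lia.
    by exists f => //; rewrite leqNgt; apply/negP => /mn; rewrite ltnn.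
  exists f.+1; split; first exact: ltnW.
  by have [_ _ h _] := hf f; have [|_ []] := h k; [lia|].
(* At the start of round [f] counter 0 stands on block [f] and the others on block 0; the one round
   that would meet block [b] is avoided. *)
pose f' := if f == b then f.+1 else f.
have f'b : f' != b by rewrite /f'; case: (f =P b) => [->|/eqP //]; lia.
have lf : f <= f' by rewrite /f'; case: ifP.
exists (tm f').
  apply: leq_trans kf _; rewrite -(subnKC lf); elim: (f' - f) => [|j IH]; first by rewrite addn0.
  by rewrite addnS; apply: leq_trans IH (ltnW (tS _)).
have [e [_ r] _ _] := hf f'; rewrite e => hk.
have : w f' (idx NV b (ov v)) by rewrite -(subnKC lf); apply: mw => //; exact: mf.
move=> ho; have := r v b vN; rewrite /mk ho /= /fresh.
have -> : (b == (if v == 0 then f' else 0)) = false by case: ifP => _; [rewrite eq_sym (negbTE f'b)|lia].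
by move/negbFE.
Qed.

End Program.

(** * Formulas that read the input tape only *)

Fixpoint inputs e : bool := match e with
| EVar _ | ENum _ => true
| EAdd a b | ESub a b | EPair a b => inputs a && inputs b
| EBit o a => (o %% 3 == 2) && inputs a
| EG a => inputs a
end.

Definition same_inputs (T T' : tracks) := forall o, o %% 3 = 2 -> T o = T' o.

Lemma gbit_inputs T T' n : same_inputs T T' -> gbit T n = gbit T' n.
Proof. by move=> h; apply/funext => j; rewrite /gbit h. Qed.

Lemma ev_inputs T T' r e : same_inputs T T' -> inputs e ->
  evv T r e = evv T' r e /\ evp T r e = evp T' r e.
Proof.
move=> h; elim: e => //= [a IHa b IHb|a IHa b IHb|a IHa b IHb|o a IHa|a IHa].
- by case/andP => /IHa [-> ->] /IHb [-> ->].
- by case/andP => /IHa [-> ->] /IHb [-> ->].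
- by case/andP => /IHa [-> ->] /IHb [-> ->].
- by case/andP => /eqP o2 /IHa [-> ->]; rewrite h.
- by move=> /IHa [-> ->]; rewrite (gbit_inputs _ h).
Qed.

Lemma evi_inputs T T' g r e : same_inputs T T' -> inputs e -> evi g T r e = evi g T' r e.
Proof.
move=> h; elim: e => //= [a IHa b IHb|a IHa b IHb|a IHa b IHb|o a IHa|a IHa].
- by case/andP => /IHa -> /IHb ->.
- by case/andP => /IHa -> /IHb ->.
- by case/andP => /IHa -> /IHb ->.
- by case/andP => /eqP o2 /IHa ->; rewrite h.
- by move=> /IHa ->.
Qed.

Lemma gof_inputs T T' : same_inputs T T' -> gof T = gof T'.
Proof. by move=> h; apply/funext => n; rewrite /gof (gbit_inputs _ h). Qed.

(** Only finitely many tuples have their entries below [j], so the largest of their thresholds works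
    for all of them. *)
Lemma uniform_bound d j (P : nat -> vars -> Prop) :
  (forall f r r', (forall i, i < d -> r i = r' i) -> P f r -> P f r') ->
  (forall r, exists F, forall f, F <= f -> P f r) ->
  exists F, forall f r, F <= f -> (forall i, i < d -> r i < j) -> P f r.
Proof.
move=> hext hP.
elim: d P hext hP => [|d IH] P hext hP.
  have [F hF] := hP (fun _ => 0); exists F => f r /hF h _; apply: hext h; by [].
have [||F hF] := IH (fun f r => forall n, n < j -> P f (updv r d n)).
- move=> f r r' e h n /h; apply: hext => i; rewrite ltnS leq_eqVlt /updv.
  by case: eqP => //= _ /e.
- move=> r; have [F hF] := boolp.choice (fun n => hP (updv r d n)).
  exists (\max_(n < j) F n) => f h n nj; apply: hF; apply: leq_trans h.
  exact: (leq_bigmax (Ordinal nj)).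
exists F => f r l hr; have := hF f r l (fun i h => hr i (ltnW h)) (r d) (hr d (ltnSn d)).
by apply: hext => i _; rewrite /updv; case: eqP => [->|].
Qed.

(** * One interval of omega steps *)

Section Interval.
Variables (NV D : nat) (phi : expr).
Hypothesis D10 : 10 < D.
Hypothesis phi_vars : evr 10 D phi.
Hypothesis phi_bits : bits NV phi.
Hypothesis phi_inputs : inputs phi.
Hypothesis phi_dep : D + dep phi <= NV.
Hypothesis NV_big : 20 <= NV.
Hypothesis phi_total : forall T r, evp T r phi = 0 -> exists j, gbit T (r 10) j.
Let D10' : 10 <= D := ltnW D10.
Local Notation body := (body NV D phi).
Local Notation code := (code NV D phi).
Local Notation Tseq := (Tseq NV D phi).
Local Notation loops := (loops NV D phi).

Definition Phi T := forall r, evi (gof T) T r phi = 0.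

(** Whatever holds of all late rounds holds of all late steps. The case [F = 0] covers every step
    after the entry. *)
Lemma loops_late c k0 T0 : loops c k0 T0 -> forall F, exists k1, (F = 0 -> k1 = k0) /\
  forall k, k1 <= k -> exists f, F <= f /\ (rrow code (c k)).2 <> None /\
    vis body (fresh f, Tseq T0 f) (trk NV (ccells (c k))).
Proof.
move=> [tm [w [t0 tS hm hf]]] F.
have tmf f : f <= tm f by elim: f => // f IH; exact: leq_ltn_trans IH (tS f).
have tmm f j : tm f <= tm (f + j).
  by elim: j => [|j IH]; rewrite ?addn0 // addnS; apply: leq_trans IH (ltnW (tS _)).
exists (tm F); split; first by move=> ->.
move=> k hk; have ex : exists f, k < tm (F + f).
  by exists k.+1; apply: leq_trans (tmf _); lia.
case: (ex_minnP ex) => -[|f] h mn; first by rewrite addn0 in h; lia.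
have h2 : tm (F + f) <= k by rewrite leqNgt; apply/negP => /mn; rewrite ltnn.
exists (F + f); split; first exact: leq_addr.
have [_ _ g _] := hf (F + f); rewrite addnS in h.
by have [|h3 [_ h4]] := g k; first by rewrite h2 ltnW.
Qed.

Lemma loops_hit c k0 T0 : loops c k0 T0 -> forall f U, vis body (fresh f, Tseq T0 f) U ->
  exists2 k, f <= k & trk NV (ccells (c k)) = U.
Proof.
move=> [tm [w [t0 tS hm hf]]] f U hU.
have tmf g : g <= tm g by elim: g => // g IH; exact: leq_ltn_trans IH (tS g).
have [_ _ _ h] := hf f; have [k /andP [k1 _] e] := h U hU.
by exists k => //; exact: leq_trans (tmf f) k1.
Qed.

Definition frame (T U : tracks) := forall o, o \notin [:: 0; 1; 12; 15] -> U o = T o.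

Lemma frame_updt T o b x : o \in [:: 0; 1; 12; 15] -> frame T (updt T o b x).
Proof.
move=> h o' h'; apply/funext => b'; rewrite /updt.
by case: eqP => //= e; rewrite e h in h'.
Qed.

Lemma frame_trans T U V : frame T U -> frame U V -> frame T V.
Proof. by move=> h1 h2 o ho; rewrite h2 // h1. Qed.

Lemma frame_inputs T U : frame T U -> same_inputs U T.
Proof. by move=> h o e; apply: h; rewrite !inE; case: o e => [|[|o]] //; lia. Qed.

Lemma frame_step T U o b x : o \in [:: 0; 1; 12; 15] -> frame T U -> frame T (updt U o b x).
Proof. by move=> h1 h2; apply: frame_trans h2 _; exact: frame_updt. Qed.

Lemma adv_frames T m p n :
  [/\ frame T (adv1 T m), frame T (adv2 T m p), frame T (adv3 T m p), frame T (adv4 T m p) &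
   frame T (adv5 T m p)] /\
  [/\ frame T (adv6 T m p n), frame T (adv7 T m p n) & frame T (adv8 T m p n)].
Proof.
have f1 : frame T (adv1 T m) by exact: frame_updt.
have f2 : frame T (adv2 T m p) by rewrite /adv2; case: ifP => // _; exact: frame_step.
have f3 : frame T (adv3 T m p) by rewrite /adv3; case: ifP => // _; exact: frame_step.
have f4 : frame T (adv4 T m p) by rewrite /adv4; case: ifP => // _; exact: frame_step.
have f5 : frame T (adv5 T m p) by rewrite /adv5; case: ifP => // _; exact: frame_step.
have f6 : frame T (adv6 T m p n) by exact: frame_step.
have f7 : frame T (adv7 T m p n) by rewrite /adv7; case: ifP => // _; exact: frame_step.
by do !split => //; exact: frame_step.
Qed.

Lemma vis_body_phase s T U : vis body (s, T) U <->
  if T 3 (s 5) then vis run_next (s, T) U else vis (check_next D phi) (s, T) U.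
Proof. by rewrite vis_body vis_ifbit. Qed.

Lemma sem_body_phase s T : (sem body (s, T)).2 =
  if T 3 (s 5) then (sem run_next (s, T)).2 else (sem (check_next D phi) (s, T)).2.
Proof.
have [-> _] := sem_body D10' phi_vars phi_bits phi_dep NV_big (s, T).
by rewrite sem_ifbit /=; case: ifP.
Qed.

Lemma vis_frame f T U : vis body (fresh f, T) U -> frame T U.
Proof.
move=> /vis_body_phase /=; case: ifP => _.
  have [_ [[_ [_ h]]|]] := run_nextP D10' phi_vars phi_bits phi_dep NV_big f T.
    by move=> /h ->.
  move=> [m [n [p [_ _ _ _ [_ h]]]]] /h.
  have [[f1 f2 f3 f4 f5] [f6 f7 f8]] := adv_frames T m p n.
  by do 8 (case=> [->//|]); move=> ->.
have [_ [[_ [_ h]]|]] := check_nextP D10' phi_vars phi_bits phi_dep NV_big f T.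
  by move=> /h ->.
move=> [j [_ _ _ _ h]] /h.
have f1 : frame T (updt T 15 j true) by exact: frame_updt.
have f2 : frame T (updt (updt T 15 j true) 1 0 true) by exact: frame_step.
have f3 := frame_trans f2 (@frame_updt _ 1 0 false isT).
by do 3 (case=> [->//|]); move=> ->.
Qed.

Lemma Tseq_frame T0 f : frame T0 (Tseq T0 f).
Proof.
elim: f => //= f IH; apply: frame_trans IH _; apply: (@vis_frame f).
exact: vis_end.
Qed.

(** ** The checking phase *)

Section Check.
Variable T0 : tracks.
Hypothesis T03 : T0 3 0 = false.
Hypothesis T015 : forall j, T0 15 j = false.
Hypothesis T01 : T0 1 0 = false.

Let T3 f : Tseq T0 f 3 0 = false.
Proof. by rewrite (@Tseq_frame T0 f 3). Qed.

Let inp f : same_inputs (Tseq T0 f) T0.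
Proof. exact: frame_inputs (Tseq_frame T0 f). Qed.

Lemma checked_inputs T T' g j : same_inputs T T' ->
  checked D phi T g j <-> checked D phi T' g j.
Proof.
move=> h; have e r := ev_inputs r h phi_inputs; rewrite /checked /holds_at.
by split=> hc r r0 /(hc r r0); have [-> ->] := e r.
Qed.

Let I f n := (forall j, Tseq T0 f 15 j = (j < n)) /\ (forall b, Tseq T0 f 1 b = T0 1 b) /\
  (forall o, o \in [:: 0; 12] -> Tseq T0 f o = T0 o).

Lemma check_step f n : I f n ->
  (~ (n < f /\ checked D phi T0 f n) /\ I f.+1 n /\
     (forall U, vis body (fresh f, Tseq T0 f) U -> U = Tseq T0 f)) \/
  [/\ n < f, checked D phi T0 f n, I f.+1 n.+1,
     (exists2 U, vis body (fresh f, Tseq T0 f) U & U 1 0) &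
     (forall U, vis body (fresh f, Tseq T0 f) U -> U 0 = T0 0 /\ U 12 = T0 12)].
Proof.
move=> [i1 [i2 i3]].
have fE j : first (fun j => ~~ Tseq T0 f 15 j) f = j.+1 <-> j = n /\ n < f.
  split=> [/firstS [h1 h2 h3]|[-> nf]].
    have jn : j = n.
      apply/eqP; rewrite eqn_leq; apply/andP; split; rewrite leqNgt; last by rewrite -i1.
      by apply/negP => /h3; rewrite i1 ltnn.
    by rewrite -jn.
  by apply: first_eq => //; rewrite ?i1 ?ltnn // => i l; rewrite i1 l.
have [_ hor] := check_nextP D10' phi_vars phi_bits phi_dep NV_big f (Tseq T0 f).
have hv U : vis body (fresh f, Tseq T0 f) U <-> vis (check_next D phi) (fresh f, Tseq T0 f) U.
  by rewrite vis_body_phase /= T3.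
have hs : Tseq T0 f.+1 = (sem (check_next D phi) (fresh f, Tseq T0 f)).2.
  by rewrite /= sem_body_phase /= T3.
case: hor => [[nP [e h]]|[j [e1 e2 e3 e4 e5]]].
  left; split.
    move=> [nf hc]; apply: nP; exists n; first exact/fE.
    by apply/(checked_inputs f n (inp f)).
  by split; [rewrite /I hs e|move=> U /hv /h].
right; have [jn nf] := proj1 (fE j) e1; rewrite jn in e2 e3 e4 e5.
split=> //.
- by apply/(checked_inputs f n (inp f)).
- rewrite /I hs e3; split.
    move=> i; rewrite /updt /= i1; case: (i =P n) => [->|ne]; first by rewrite ltnSn.
    by lia.
  split.
    by move=> b; rewrite /updt /=; case: eqP => [->|_]; rewrite ?T01 ?i2.
  by move=> o ho; apply/funext => b; rewrite -(i3 o ho); move: ho; rewrite !inE => /orP [] /eqP ->.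
- by eexists; first by apply/hv; exact: e4.
- have c0 : Tseq T0 f 0 = T0 0 by exact: i3.
  have c12 : Tseq T0 f 12 = T0 12 by exact: i3.
  move=> U /hv /e5.
  by do 3 (case=> [->|]; first by rewrite -c0 -c12); move=> ->; rewrite -c0 -c12.
Qed.

Lemma check_inv f : exists n, I f n.
Proof.
elim: f => [|f [n h]]; first by exists 0; split=> // j; rewrite /= T015.
by have [[_ [h1 _]]|[_ _ h1 _ _]] := check_step h; [exists n|exists n.+1].
Qed.

Lemma check_all : (forall k, exists2 f, k <= f &
    exists2 U, vis body (fresh f, Tseq T0 f) U & U 1 0) ->
  forall j, exists f, checked D phi T0 f j.
Proof.
move=> hinf.
have grow : forall n, exists f, I f n /\ forall j, j < n -> exists f, checked D phi T0 f j.
  elim=> [|n [f [hI hch]]].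
    by exists 0; split=> //; split=> // j; rewrite /= T015.
  have [g fg [U hU U1]] := hinf f.
  have key : forall d, (I (f + d) n) \/
      exists g, I g n.+1 /\ forall j, j < n.+1 -> exists f, checked D phi T0 f j.
    elim=> [|d [IH|IH]]; [by left; rewrite addn0| |by right].
    rewrite addnS; have [[_ [h1 _]]|[_ h2 h1 _ _]] := check_step IH; [by left|right].
    exists (f + d).+1; split=> // j; rewrite ltnS leq_eqVlt => /orP [/eqP ->|/hch //].
    by exists (f + d).
  have [hg|//] := key (g - f); rewrite subnKC // in hg.
  have [[_ [_ h]]|[h1 h2 h3 _ _]] := check_step hg.
    by move: U1; rewrite (h U hU); have [_ [-> _]] := hg; rewrite T01.
  exists g.+1; split=> // j; rewrite ltnS leq_eqVlt => /orP [/eqP ->|/hch //].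
  by exists g.
by move=> j; have [f [_ h]] := grow j.+1; exact: h.
Qed.

(** The least unchecked size stays the same until the fuel suffices for it, and then it flashes. *)
Lemma check_flashes : (forall j, exists F, forall f, F <= f -> checked D phi T0 f j) ->
  forall k, exists2 f, k <= f & exists2 U, vis body (fresh f, Tseq T0 f) U & U 1 0.
Proof.
move=> hch k; have [n hn] := check_inv k; have [F hF] := hch n.
have key : forall d, I (k + d) n \/
    exists2 f, k <= f & exists2 U, vis body (fresh f, Tseq T0 f) U & U 1 0.
  elim=> [|d [IH|IH]]; [by left; rewrite addn0| |by right].
  rewrite addnS; have [[_ [h1 _]]|[_ _ _ h1 _]] := check_step IH; [by left|right].
  by exists (k + d); [exact: leq_addr|].
have [h|//] := key (maxn F n.+1).
have [[h1 _]|[_ _ _ h1 _]] := check_step h.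
  by case: h1; split; [lia|apply: hF; lia].
by exists (k + maxn F n.+1); [exact: leq_addr|].
Qed.

Lemma check_still f U : vis body (fresh f, Tseq T0 f) U -> U 0 = T0 0 /\ U 12 = T0 12.
Proof.
move=> hU; have [n h] := check_inv f.
have [[_ [_ h1]]|[_ _ _ _ h1]] := check_step h; last exact: h1.
by rewrite (h1 U hU); have [_ [_ h2]] := h; rewrite !h2.
Qed.

Lemma checked_Phi : (forall j, exists f, checked D phi T0 f j) -> Phi T0 /\ gtotal T0.
Proof.
move=> hch.
have bound r : exists j, forall i, 10 <= i < D -> r i < j.
  exists (\max_(i < D) r i).+1 => i /andP [_ iD]; rewrite ltnS.
  exact: (leq_bigmax (Ordinal iD)).
have key r : exists f, evv T0 (updv r 0 f) phi = 0 /\ evp T0 (updv r 0 f) phi = 0.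
  have [j hj] := bound r; have [f hf] := hch j; exists f; apply: hf => //.
  by move=> i hi; rewrite /updv (_ : (i == 0) = false); [exact: hj|lia].
split=> [r|n].
  have [f [e1 e2]] := key r; rewrite -[RHS]e1 evv_evi //.
  apply: (@evi_ext _ _ D); first exact: evr_evok phi_vars.
  by move=> i _ i_0 _ _; rewrite /updv (negbTE i_0).
(* An evaluation without failed look-ups, at the assignment with constant value [n], has found a
   value of the coded function at [n]. *)
have [f [_ e2]] := key (fun _ => n); have [j hj] := phi_total e2.
by exists j.
Qed.

Lemma Phi_checked : Phi T0 -> gtotal T0 ->
  forall j, exists F, forall f, F <= f -> checked D phi T0 f j.
Proof.
move=> hP tot j.
have evo := evr_evok (isT : 4 < 10) phi_vars.
have [||F hF] := @uniform_bound D j.+1 (fun f r => holds_at phi T0 (updv r 0 f)).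
- move=> f r r' e; apply: (holds_at_ext phi_vars) => // i hi.
  by rewrite /updv; case: eqP => // _; apply: e; case/andP: hi.
- move=> r; have [F hF] := evp_eventually r evo tot; exists F => f /hF e; split=> //.
  by rewrite evv_evi // -[RHS](hP r); apply: (@evi_ext _ _ D).
exists F => f fF r r0 hr.
pose r' i := if 10 <= i then r i else 0.
apply: (@holds_at_ext _ _ phi_vars _ (updv r' 0 f)).
- by rewrite /updv eqxx r0.
- by move=> i /andP [i1 i2]; rewrite /updv /r' i1 (_ : (i == 0) = false) //; lia.
apply: hF => // i iD; rewrite /r'; case: ifP => // i10.
by apply: ltnW; rewrite ltnS; apply: hr; rewrite i10.
Qed.
End Check.

(** * The climbing phase *)

Section RunPhase.
Variables (T0 : tracks) (m : nat).
Hypothesis T03 : T0 3 0.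
Hypothesis T01 : T0 1 0 = false.
Hypothesis T012 : forall b, T0 12 b = (b == m).
Hypothesis tot : gtotal T0.
Let n := gof T0 (npair 1 m).
Let p := gof T0 (npair 2 m).
Let adv := adv8 T0 m p n.

(** [f0] is the first fuel with which the current point and its two look-ups are found. Before it
    nothing is written, and afterwards the flag blocks every further round. *)
Lemma run_phase : exists f0, [/\ forall f, f <= f0 -> Tseq T0 f = T0,
  forall f, f0 < f -> Tseq T0 f = adv,
  forall f, f < f0 -> forall U, vis body (fresh f, T0) U -> U = T0,
  forall f, f0 < f -> forall U, vis body (fresh f, adv) U -> U = adv &
  forall U, vis body (fresh f0, T0) U <-> 
     U = T0 \/ U = adv1 T0 m \/ U = adv2 T0 m p \/ U = adv3 T0 m p \/ U = adv4 T0 m p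
     \/ U = adv5 T0 m p \/ U = adv6 T0 m p n \/ U = adv7 T0 m p n \/ U = adv8 T0 m p n].
Proof.
pose run f := run_nextP D10' phi_vars phi_bits phi_dep NV_big f.
have hv f (T U : tracks) : T 3 0 -> vis body (fresh f, T) U <-> vis run_next (fresh f, T) U.
  by move=> h; rewrite vis_body_phase /= h.
have hs f (T : tracks) : T 3 0 -> (sem body (fresh f, T)).2 = (sem run_next (fresh f, T)).2.
  by move=> h; rewrite sem_body_phase /= h.
have adv30 : adv 3 0.
  have [_ [_ _ h]] := adv_frames T0 m p n; by rewrite /adv h.
have adv10 : adv 1 0 by rewrite /adv /adv8 /updt !eqxx.
have stay f : (sem body (fresh f, adv)).2 = adv /\ forall U, vis body (fresh f, adv) U -> U = adv.
  rewrite hs //; have [_ [[_ [e h]]|]] := run f adv.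
    by split=> // U /hv -/(_ adv30) /h.
  by move=> [? [? [? []]]]; rewrite adv10.
pose act f := (sem body (fresh f, T0)).2 = adv /\ forall U, vis body (fresh f, T0) U <-> 
     U = T0 \/ U = adv1 T0 m \/ U = adv2 T0 m p \/ U = adv3 T0 m p \/ U = adv4 T0 m p
     \/ U = adv5 T0 m p \/ U = adv6 T0 m p n \/ U = adv7 T0 m p n \/ U = adv8 T0 m p n.
pose idle f := (sem body (fresh f, T0)).2 = T0 /\ forall U, vis body (fresh f, T0) U -> U = T0.
have dich f : idle f \/ act f.
  have [_ [[_ [e h]]|[m' [n' [p' [_ em en ep [e h]]]]]]] := run f T0; [left|right].
    by split; [rewrite hs|move=> U /hv -/(_ T03) /h].
  have mm : m' = m by apply/eqP; rewrite -T012; have [] := firstS em.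
  rewrite mm in en ep e h.
  have nn : n' = n by rewrite /n -(@first_gof T0 (npair 1 m) f) en.
  have pp : p' = p by rewrite /p -(@first_gof T0 (npair 2 m) f) ep.
  rewrite nn pp in e h.
  by split; [rewrite hs|move=> U; rewrite hv].
have ex : exists f, `[< act f >].
  have [F1 h1] := first_eventually (tot (npair 1 m)).
  have [F2 h2] := first_eventually (tot (npair 2 m)).
  exists (F1 + F2 + m.+1); apply/asboolP.
  case: (dich (F1 + F2 + m.+1)) => // -[e _]; move: e.
  set f := F1 + F2 + m.+1; rewrite hs //.
  have [_ [[[h0|[e|[m' [e1 e2]]]] [_ _]]|]] := run f T0.
  - by rewrite T01 in h0.
  - have mf : m < f by rewrite /f; lia.
    by have := proj1 (first_none _ _) e m mf; rewrite T012 eqxx.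
  - have mm : m' = m by apply/eqP; rewrite -T012; have [] := firstS e1.
    have := h1 f; have := h2 f; rewrite -mm; case: e2 => ->; rewrite eqxx.
      by move=> _ h; have := h _; rewrite /f; lia.
    by move=> h; have := h _; rewrite /f; lia.
  - move=> [m' [n' [p' [_ _ _ _ [e _]]]]]; rewrite e => h.
    by have := T01; rewrite -h /adv8 /updt !eqxx.
case: (ex_minnP ex) => f0 /asboolP [a1 a2] mn.
have idl f : f < f0 -> idle f.
  move=> l; case: (dich f) => // h.
  by have := mn f; rewrite leqNgt l => h'; exfalso; apply/notF/h'/asboolP.
have e1 f : f <= f0 -> Tseq T0 f = T0.
  elim: f => // f IH l; rewrite /= IH ?(ltnW l) //; by have [] := idl f l.
have e2 f : Tseq T0 (f0.+1 + f) = adv.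
  elim: f => [|f IH]; first by rewrite addn0 /= e1 ?a1.
  have e : Tseq T0 (f0.+1 + f).+1 = (sem body (fresh (f0.+1 + f), Tseq T0 (f0.+1 + f))).2 by [].
  by rewrite addnS e IH; have [] := stay (f0.+1 + f).
exists f0; split=> //.
- by move=> f l; rewrite -(subnKC l) e2.
- by move=> f /idl [].
- by move=> f _; have [] := stay f.
Qed.

End RunPhase.

(** Without a current point the flag, lowered by the prologue, is never raised, so the machine
    rejects at the next limit stage. *)
Lemma empty_phase (T0 : tracks) : T0 3 0 -> (forall b, T0 12 b = false) ->
  forall f, Tseq T0 f = T0 /\ forall U, vis body (fresh f, T0) U -> U = T0.
Proof.
move=> t3 t12.
have key f : (sem body (fresh f, T0)).2 = T0 /\ forall U, vis body (fresh f, T0) U -> U = T0.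
  have [_ [[_ [e h]]|]] := run_nextP D10' phi_vars phi_bits phi_dep NV_big f T0.
    split; first by rewrite sem_body_phase /= t3.
    by move=> U /vis_body_phase /=; rewrite t3 => /h.
  by move=> [m' [n' [p' [_ e]]]]; have [] := firstS e; rewrite t12.
by move=> f; have [h1 h2] := key f; split=> //; elim: f {h1 h2} => //= f ->; have [] := key f.
Qed.

Let good o : o < 18 -> goodo NV o := @goodo_small _ _ _ D10' phi_vars phi_bits phi_dep NV_big o.

(** * What an interval of omega steps shows *)

Definition conf pc w k := iter k (rstep code) (pc, (0, w)).
Definition ctrk pc w k := trk NV (ccells (conf pc w k)).
Definition same_outer (T U : tracks) := forall o b,
  o \notin [:: 0; 1; 3; 12; 15] -> (o, b) != (4, 0) -> U o b = T o b.

Lemma same_outer_trans T U V : same_outer T U -> same_outer U V -> same_outer T V.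
Proof. by move=> h1 h2 o b ho hb; rewrite h2 // h1. Qed.

Lemma same_outer_updt T o b x : o \in [:: 0; 1; 3; 12; 15] -> same_outer T (updt T o b x).
Proof.
move=> h o' b' h' _; rewrite /updt.
by case: eqP => //= e; rewrite e h in h'.
Qed.

Lemma same_outer_init T : same_outer T (T_init T).
Proof.
move=> o b ho hb; rewrite /T_init /updt; move: ho hb; rewrite xpair_eqE !inE !negb_or.
by case/and5P => _ /negbTE -> _ _ _; case: eqP => //= _; case: eqP.
Qed.

Lemma frame_same_outer T U : frame T U -> same_outer T U.
Proof.
move=> h o b ho _; rewrite h //; apply: contra ho; rewrite !inE.
by move=> /or4P [] ->; rewrite ?orbT.
Qed.

Lemma same_outer_inputs T U : same_outer T U -> same_inputs U T.
Proof.
move=> h o o2; apply/funext => b; apply: h; last by rewrite xpair_eqE; case: eqP o2 => // ->.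
by rewrite !inE; case: o o2 => [|[|[|[|o]]]] //; lia.
Qed.

(** The part of the behaviour that is the same for all intervals: it is what the following limit
    stage needs in order to find a usable tape. *)
Definition ordinary pc w := [/\ forall k, (rrow code (conf pc w k)).2 <> None,
  forall k, same_inputs (ctrk pc w k) (trk NV w),
  forall k b, 0 < b -> ~~ ccells (conf pc w k) (idx NV b 4) &
  forall k v b, v < NV -> 0 < b -> exists2 k', k <= k' &
    ccells (conf pc w k) (idx NV b (ov v)) -> ccells (conf pc w k') (idx NV b (ov v).+1)].

Lemma ordinaryI pc w T0 k0 : loops (conf pc w) k0 T0 -> homes NV w -> same_outer (trk NV w) T0 ->
  (forall k, k <= k0 -> (rrow code (conf pc w k)).2 <> None /\ same_outer (trk NV w) (ctrk pc w k)) ->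
  ordinary pc w.
Proof.
move=> hl hh h0 h1.
have key k : (rrow code (conf pc w k)).2 <> None /\ same_outer (trk NV w) (ctrk pc w k).
  case: (leqP k k0) => [/h1 //|l].
  have [k1 [e h]] := loops_late hl 0; rewrite (e erefl) in h.
  have [f [_ [hf hv]]] := h k (ltnW l); split=> //.
  apply: same_outer_trans h0 _; apply: frame_same_outer.
  exact: frame_trans (Tseq_frame T0 f) (vis_frame hv).
have g4 : goodo NV 4 by exact: good.
split.
- by move=> k; have [] := key k.
- by move=> k; exact: (same_outer_inputs (proj2 (key k))).
- move=> k b b0; have [_ h] := key k.
  have n4 : (4, b) != (4, 0) by rewrite xpair_eqE; case: (b =P 0) b0 => // ->.
  by have := h 4 b isT n4; rewrite /ctrk /trk g4 !andTb => ->; exact: hh.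
- exact: (loops_clean D10' phi_vars phi_bits phi_dep NV_big hl).
Qed.

Lemma ordinary_start w : clean NV w -> homes NV w -> (forall b, trk NV w 12 b = false) ->
  (forall b, trk NV w 15 b = false) -> trk NV w 0 0 = false -> trk NV w 3 0 = false ->
  [/\ ordinary 0 w, forall k b, ctrk 0 w k 12 b -> b = 1,
    forall k, ~~ ctrk 0 w k 0 0,
    exists k0, forall k, k0 <= k -> ctrk 0 w k 12 1 &
    if `[< Phi (trk NV w) /\ gtotal (trk NV w) >] then forall k, exists2 k', k <= k' & ctrk 0 w k' 1 0
    else exists k0, forall k, k0 <= k -> ~~ ctrk 0 w k 1 0].
Proof.
move=> hc hh h12 h15 h0 h3.
pose pro := Then (Inc 3) (Then (SetBit 12 3 true) (Dec 3)).
have okp : ok NV pro by rewrite /= good //; lia.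
have hpro (T : tracks) : let s' := sem pro (fresh 0, T) in forall i, i < NV -> s'.1 i = fresh 0 i.
  move=> s' i _; rewrite /s' /pro !sem_then sem_dec sem_setbit sem_inc /= /updv.
  by case: eqP => // ->.
have [k0] := @enter NV D phi D10' phi_vars phi_bits phi_dep NV_big 0 2 pro w erefl
  (@code_start NV D phi) okp hc hh hpro.
set T1 := T_init _; set T0 := (sem _ _).2 => -[hl he].
have T0E : T0 = updt T1 12 1 true by rewrite /T0 /pro !sem_then sem_dec sem_setbit sem_inc.
have hv U : vis pro (fresh 0, T1) U -> U = T1 \/ U = T0.
  have p1 : nosets (Inc 3) by [].
  have p2 : nosets (Dec 3) by [].
  rewrite /pro vis_pure_then // vis_then vis_set (nosets_vis _ _ p2) sem_setbit sem_inc T0E /=.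
  by case=> [//|->]; right.
have T0o : same_outer (trk NV w) T0.
  by rewrite T0E; apply: same_outer_trans (same_outer_init _) _; exact: same_outer_updt.
have early k : k <= k0 -> (rrow code (conf 0 w k)).2 <> None /\
    [\/ ctrk 0 w k = trk NV w, ctrk 0 w k = updt (trk NV w) 1 0 false, ctrk 0 w k = T1 | ctrk 0 w k = T0].
  move=> /he [f e]; split=> //; case: e => [|[|/hv [|]]] e;
    [exact: Or41|exact: Or42|exact: Or43|exact: Or44].
have late := loops_late hl.
have t12 b : T0 12 b = (b == 1).
  by rewrite T0E /updt /= /T1 /T_init /updt /= h12; case: eqP.
have t00 : T0 0 0 = false by rewrite T0E.
have still k : k0 <= k -> ctrk 0 w k 0 = T0 0 /\ ctrk 0 w k 12 = T0 12.
  move=> l; have [k1 [e h]] := late 0; rewrite (e erefl) in h.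
  by have [f [_ [_ /check_still]]] := h k l; apply; rewrite T0E.
have B1 k b : ctrk 0 w k 12 b -> b = 1.
  case: (leqP k k0) => [/early [_ []] ->|/ltnW /still [_ ->]].
  - by rewrite h12.
  - by rewrite /updt /= h12.
  - by rewrite /T1 /T_init /updt /= h12.
  - by rewrite t12 => /eqP.
  - by rewrite t12 => /eqP.
have V0 k : ctrk 0 w k 0 0 = false.
  case: (leqP k k0) => [/early [_ []] ->|/ltnW /still [-> _]] //.
split.
- apply: (ordinaryI hl hh T0o) => k /early [f h]; split=> //; case: h => ->.
  + by [].
  + exact: same_outer_updt.
  + exact: same_outer_init.
  + exact: T0o.
- exact: B1.
- by move=> k; rewrite V0.
- by exists k0 => k /still [_ ->]; rewrite t12.
have T03 : T0 3 0 = false by rewrite T0E.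
have T015 j : T0 15 j = false by rewrite T0E /updt /= /T1 /T_init /updt /= h15.
have T01 : T0 1 0 = false by rewrite T0E.
have inp : same_inputs T0 (trk NV w) by exact: same_outer_inputs.
have PE : (Phi (trk NV w) /\ gtotal (trk NV w)) <-> (Phi T0 /\ gtotal T0).
  rewrite /Phi /gtotal (gof_inputs inp); split=> -[h1 h2]; split=> [r|n].
  - by rewrite (evi_inputs _ _ inp phi_inputs).
  - by rewrite (gbit_inputs _ inp).
  - by rewrite -(evi_inputs _ _ inp phi_inputs).
  - by rewrite -(gbit_inputs _ inp).
case: asboolP => /PE h.
  move=> k; case: h => hP hg.
  have hch j : exists F, forall f, F <= f -> checked D phi T0 f j by apply: Phi_checked.
  have [f kf [U hU U1]] := check_flashes T03 T015 T01 hch k.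
  by have [k' fk e] := loops_hit hl hU; exists k'; [exact: leq_trans kf fk|rewrite /ctrk e].
apply: contrapT => hn; apply: h.
suff hch : forall j, exists f, checked D phi T0 f j by apply: checked_Phi.
apply: (check_all T03 T015 T01) => F.
have [k1 [_ h]] := late F.
have [k k1k kz] : exists2 k, k1 <= k & ctrk 0 w k 1 0.
  apply: contrapT => hn'; apply: hn; exists k1 => k l; apply/negP => hz.
  by apply: hn'; exists k.
by have [f [Ff [_ hU]]] := h k k1k; exists f => //; exists (ctrk 0 w k).
Qed.

Lemma limit_loops w : clean NV w -> homes NV w -> trk NV w 0 0 = false -> trk NV w 1 0 ->
  let T1 := T_init (trk NV w) in let T0 := updt T1 3 0 true in
  exists k0, loops (conf 1 w) k0 T0 /\ [/\ same_outer (trk NV w) T0, ordinary 1 w &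
    forall k, k <= k0 -> 
    [\/ ctrk 1 w k = trk NV w, ctrk 1 w k = updt (trk NV w) 1 0 false, ctrk 1 w k = T1 | ctrk 1 w k = T0]].
Proof.
move=> hc hh h0 h1 T1 T0.
have okp : ok NV (SetBit 3 5 true) by rewrite /= good //; lia.
have hpro (T : tracks) : let s' := sem (SetBit 3 5 true) (fresh 0, T) in
    forall i, i < NV -> s'.1 i = fresh 0 i by [].
have w0 : w 0 = false by rewrite -h0 /trk good //.
have w1 : w 1 by move: h1; rewrite /trk good.
have hrow : nth row0 code 1 (rscan 0 w) = (rscan 0 w, false, Some (limit_pc NV D phi)).
  by rewrite /= /limit_row /rscan /= w0 w1.
have [k0 [hl he]] := @enter NV D phi D10' phi_vars phi_bits phi_dep NV_big 1 _ _ w hrow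
  (code_limit D10' phi_vars phi_bits phi_dep NV_big) okp hc hh hpro.
have T0o : same_outer (trk NV w) T0.
  by apply: same_outer_trans (same_outer_init _) _; exact: same_outer_updt.
have early k : k <= k0 -> (rrow code (conf 1 w k)).2 <> None /\
    [\/ ctrk 1 w k = trk NV w, ctrk 1 w k = updt (trk NV w) 1 0 false, ctrk 1 w k = T1 | ctrk 1 w k = T0].
  move=> /he [f e]; split=> //; case: e => [|[|/vis_set [|]]] e;
    [exact: Or41|exact: Or42|exact: Or43|exact: Or44].
exists k0; split=> //; split=> //; last by move=> k /early [].
apply: (ordinaryI hl hh T0o) => k /early [f h]; split=> //; case: h => ->.
+ by [].
+ exact: same_outer_updt.
+ exact: same_outer_init.
+ exact: T0o.
Qed.

Lemma ordinary_empty w : clean NV w -> homes NV w -> trk NV w 0 0 = false -> trk NV w 1 0 ->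
  (forall b, trk NV w 12 b = false) ->
  [/\ ordinary 1 w, forall k b, ~~ ctrk 1 w k 12 b, forall k, ~~ ctrk 1 w k 0 0 &
    exists k0, forall k, k0 <= k -> ~~ ctrk 1 w k 1 0].
Proof.
move=> hc hh h0 h1 h12.
have [k0 [hl [T0o ord early]]] := limit_loops hc hh h0 h1.
set T1 := T_init _ in hl T0o early; set T0 := updt T1 _ _ _ in hl T0o early.
have t12 b : T0 12 b = false by rewrite /T0 /updt /= /T1 /T_init /updt /= h12.
have t3 : T0 3 0 by rewrite /T0 /updt eqxx.
have still k : k0 <= k -> ctrk 1 w k = T0.
  move=> l; have [k1 [e h]] := loops_late hl 0; rewrite (e erefl) in h.
  have [f [_ [_]]] := h k l; have [-> hU] := empty_phase t3 t12 f; exact: hU.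
split=> //.
- move=> k b; case: (leqP k k0) => [/early [] ->|/ltnW /still ->]; rewrite ?t12 //.
  + by rewrite h12.
  + by rewrite /updt /= h12.
  + by rewrite /T1 /T_init /updt /= h12.
- move=> k; case: (leqP k k0) => [/early [] ->|/ltnW /still ->] //; first by rewrite h0.
  by rewrite /updt /= h0.
  by rewrite /T1 /T_init /updt /= h0.
  by rewrite /T0 /T1 /T_init /updt /= h0.
  by rewrite /T0 /T1 /T_init /updt /= h0.
- by exists k0 => k /still ->.
Qed.

Lemma adv_track (T : tracks) m p n U : T 12 =1 pred1 m -> T 0 0 = false ->
  U = T \/ U = adv1 T m \/ U = adv2 T m p \/ U = adv3 T m p \/ U = adv4 T m p
     \/ U = adv5 T m p \/ U = adv6 T m p n \/ U = adv7 T m p n \/ U = adv8 T m p n ->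
  (forall b, U 12 b -> [\/ b = m, b = p /\ p <> 0 | b = n]) /\ (U 0 0 -> p = 2 \/ n = 2).
Proof.
move=> hB hV h.
have u (T' : tracks) o b x o' b' : updt T' o b x o' b' = if (o' == o) && (b' == b) then x else T' o' b' by [].
have a1 b : adv1 T m 12 b -> b = m by rewrite /adv1 u hB /=; case: eqP.
have a2 b : adv2 T m p 12 b -> b = m \/ b = p /\ p <> 0.
  rewrite /adv2; case: eqP => [_ /a1|p0]; first by left.
  by rewrite u /=; case: eqP => [->|_ /a1]; [right|left].
have a3 b : adv3 T m p 12 b -> b = m \/ b = p /\ p <> 0.
  rewrite /adv3; case: eqP => [_ /a1|p0]; first by left.
  by rewrite u /=; case: eqP => [//|_ /a2].
have e4 b : adv4 T m p 12 b = adv3 T m p 12 b by rewrite /adv4; case: eqP.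
have e5 b : adv5 T m p 12 b = adv3 T m p 12 b by rewrite /adv5 /adv4; case: eqP.
have a6 b : adv6 T m p n 12 b -> [\/ b = m, b = p /\ p <> 0 | b = n].
  rewrite /adv6 u /=; case: eqP => [e _|_]; first exact: Or33.
  by rewrite e5 => /a3 []; [exact: Or31|exact: Or32].
have e7 b : adv7 T m p n 12 b = adv6 T m p n 12 b by rewrite /adv7; case: eqP.
have e8 b : adv8 T m p n 12 b = adv6 T m p n 12 b by rewrite /adv8 u e7.
have v1 : adv1 T m 0 0 = false by rewrite /adv1 u.
have v2 : adv2 T m p 0 0 = false by rewrite /adv2; case: ifP => //; rewrite u.
have v3 : adv3 T m p 0 0 = false by rewrite /adv3; case: ifP => //; rewrite u.
have v4 : adv4 T m p 0 0 -> p = 2 by rewrite /adv4; case: eqP => //; rewrite v3.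
have v5 : adv5 T m p 0 0 = false by rewrite /adv5; case: eqP => //; rewrite u.
have v6 : adv6 T m p n 0 0 = false by rewrite /adv6 u.
have v7 : adv7 T m p n 0 0 -> n = 2 by rewrite /adv7; case: eqP => //; rewrite v6.
have v8 : adv8 T m p n 0 0 -> n = 2 by rewrite /adv8 u.
have w23 b : b = m \/ b = p /\ p <> 0 -> [\/ b = m, b = p /\ p <> 0 | b = n].
  by case; [exact: Or31|exact: Or32].
case: h => [->|[->|[->|[->|[->|[->|[->|[->|->]]]]]]]]; split=> [b|].
- by rewrite hB => /eqP; exact: Or31.
- by rewrite hV.
- by move/a1; exact: Or31.
- by rewrite v1.
- by move/a2/w23.
- by rewrite v2.
- by move/a3/w23.
- by rewrite v3.
- by rewrite e4 => /a3/w23.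
- by move/v4; left.
- by rewrite e5 => /a3/w23.
- by rewrite v5.
- exact: a6.
- by rewrite v6.
- by rewrite e7 => /a6.
- by move/v7; right.
- by rewrite e8 => /a6.
- by move/v8; right.
Qed.

Lemma ordinary_single w m : clean NV w -> homes NV w -> trk NV w 0 0 = false -> trk NV w 1 0 ->
  (forall b, trk NV w 12 b = (b == m)) -> gtotal (trk NV w) ->
  let n := gof (trk NV w) (npair 1 m) in let p := gof (trk NV w) (npair 2 m) in
  ordinary 1 w /\
  [/\ forall k b, ctrk 1 w k 12 b -> [\/ b = m, b = p /\ p <> 0 | b = n],
    p <> 0 -> exists k, ctrk 1 w k 12 p,
    p = 2 -> exists k, ctrk 1 w k 0 0,
    forall k, ctrk 1 w k 0 0 -> p = 2 \/ n = 2 &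
    exists k0, forall k, k0 <= k -> [/\ ctrk 1 w k 1 0, ctrk 1 w k 0 0 = (n == 2) &
      forall b, ctrk 1 w k 12 b = (b == n)]].
Proof.
move=> hc hh h0 h1 h12 tot n p.
have [k0 [hl [T0o ord early]]] := limit_loops hc hh h0 h1.
set T1 := T_init _ in hl T0o early; set T0 := updt T1 _ _ _ in hl T0o early.
have inp : same_inputs T0 (trk NV w) by exact: same_outer_inputs.
have t12 b : T0 12 b = (b == m) by rewrite /T0 /updt /= /T1 /T_init /updt /= h12.
have t3 : T0 3 0 by rewrite /T0 /updt eqxx.
have t1 : T0 1 0 = false by [].
have t0 : T0 0 0 = false by rewrite /T0 /T1 /T_init /updt /= h0.
have tot0 : gtotal T0 by move=> i; rewrite (gbit_inputs _ inp).
have [f0 []] := run_phase t3 t1 t12 tot0; rewrite (gof_inputs inp) -/n -/p.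
move=> e1 e2 v1 v2 v3.
have cases k : [\/ ctrk 1 w k = trk NV w, ctrk 1 w k = updt (trk NV w) 1 0 false, ctrk 1 w k = T1
    | vis body (fresh f0, T0) (ctrk 1 w k)].
  case: (leqP k k0) => [/early []|l].
  - exact: Or41.
  - exact: Or42.
  - exact: Or43.
  - by move=> ->; apply: Or44; apply/v3; left.
  apply: Or44; apply/v3.
  have [k1 [e h]] := loops_late hl 0; rewrite (e erefl) in h.
  have [f [_ [_ hv]]] := h k (ltnW l).
  case: (ltngtP f f0) => ff; rewrite -/(ctrk 1 w k) in hv.
  - by left; rewrite e1 ?(ltnW ff) // in hv; exact: v1 hv.
  - by do 8 right; rewrite e2 // in hv; exact: v2 hv.
  - by rewrite ff e1 // in hv; apply/v3.
have hit U : vis body (fresh f0, T0) U -> exists k, ctrk 1 w k = U.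
  by move=> hU; have [|k _ e] := @loops_hit _ _ _ hl f0 U; [rewrite e1|exists k].
split=> //; split.
- move=> k b; case: (cases k) => [->|->|->|].
  + by rewrite h12 => /eqP; exact: Or31.
  + by rewrite /updt /= h12 => /eqP; exact: Or31.
  + by rewrite /T1 /T_init /updt /= h12 => /eqP; exact: Or31.
  + by move/v3 => hU; have [h _] := adv_track t12 t0 hU; exact: h.
- move=> p0; have [|k e] := hit (adv2 T0 m p); first by apply/v3; do 2 right; left.
  by exists k; rewrite e /adv2; case: eqP => // _; rewrite /updt !eqxx.
- move=> p2; have [|k e] := hit (adv4 T0 m p); first by apply/v3; do 4 right; left.
  by exists k; rewrite e /adv4 p2 /updt !eqxx.
- move=> k; case: (cases k) => [->|->|->|].
  + by rewrite h0.
  + by rewrite /updt /= h0.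
  + by rewrite /T1 /T_init /updt /= h0.
  + by move/v3 => hU; have [_ h] := adv_track t12 t0 hU; exact: h.
have [k1 [_ h]] := loops_late hl f0.+1.
exists k1 => k /h [f [ff [_ hv]]]; rewrite e2 // in hv.
rewrite -/(ctrk 1 w k) in hv; rewrite (v2 f ff _ hv).
have u (T' : tracks) o b x o' b' : updt T' o b x o' b' = if (o' == o) && (b' == b) then x else T' o' b' by [].
have v5 : adv5 T0 m p 0 0 = false.
  rewrite /adv5; case: (p =P 2) => _; first by rewrite u.
  by rewrite /adv3 /adv2 /adv1; case: (p =P 0) => _; rewrite !u.
split.
- by rewrite /adv8 u.
- by rewrite /adv8 u /= /adv7; case: eqP => _; rewrite ?u //= /adv6 u /= v5.
- move=> b; have e7 : adv8 T0 m p n 12 b = adv6 T0 m p n 12 b.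
    by rewrite /adv8 u /= /adv7; case: eqP.
  rewrite e7 /adv6 u /=; case: eqP => // bn.
  have e5 : adv5 T0 m p 12 b = adv3 T0 m p 12 b by rewrite /adv5 /adv4; case: eqP.
  rewrite e5 /adv3 /adv2 /adv1; case: (p =P 0) => p0; rewrite !u /= t12.
    by case: eqP.
  by case: (b =P p) => //; case: eqP.
Qed.
End Interval.

Opaque prologue.

(** * Ordinal times of the points of an order *)

Section Times.
Variable lt : nat -> nat -> Prop.

(** The supremum of the [tm j] + ω over the points below [m], that is, ω times the rank of [m]: the
    stage at which the climb reaches [m]. *)
Fixpoint tmA m (h : Acc lt m) {struct h} : ord :=
  osup (fun u : {j | lt j m} * nat => oplus (tmA (Acc_inv h (proj2_sig u.1))) u.2).

Definition tm m := if pselect (Acc lt m) is left h then tmA h else ozero.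

Lemma tmAE m (h : Acc lt m) : tm m = tmA h.
Proof.
by rewrite /tm; case: (pselect _) => // h'; rewrite (Prop_irrelevance h h').
Qed.

Lemma olt_tm m a : Acc lt m ->
  olt a (tm m) <-> exists j n, lt j m /\ ole a (oplus (tm j) n).
Proof.
move=> h; rewrite (tmAE h); case: h => h.
split=> [[[[j jm] n] /= l]|[j [n [jm l]]]].
  by exists j, n; split=> //; rewrite (tmAE (h j jm)).
by exists (exist _ j jm, n) => /=; rewrite (tmAE (h j jm)) in l.
Qed.

(** The stage at which the intervals of all the points of [C] are over. *)
Definition cut (C : nat -> Prop) : ord :=
  osup (fun u : {j | C j} * nat => oplus (tm (sval u.1)) u.2).

Lemma olt_cut C a : olt a (cut C) <-> exists j n, C j /\ ole a (oplus (tm j) n).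
Proof.
split=> [[[[j jm] n] /= l]|[j [n [jm l]]]]; first by exists j, n.
by exists (exist _ j jm, n).
Qed.

Lemma tm_cut m : Acc lt m -> oeq (tm m) (cut (lt^~ m)).
Proof.
by move=> h; apply: oeq_ext => a; rewrite olt_tm // olt_cut.
Qed.

Lemma cut_limit C : C 0 -> olimit (cut C).
Proof.
move=> C0; split; first by apply/olt_cut; exists 0, 0; split=> //; exact: ole0.
move=> b /olt_cut [j [n [Cj l]]]; apply/olt_cut; exists j, n.+1; split=> //.
Qed.

Lemma tm_lt i j n : Acc lt j -> lt i j -> olt (oplus (tm i) n) (tm j).
Proof. by move=> h l; apply/olt_tm => //; exists i, n; split=> //; exact: ole_refl. Qed.

Lemma cut_lt C j n : C j -> olt (oplus (tm j) n) (cut C).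
Proof. by move=> h; apply/olt_cut; exists j, n; split=> //; exact: ole_refl. Qed.

Hypothesis lt_trans : forall i j k, lt i j -> lt j k -> lt i k.

Lemma between_oplus a d n : ole a d -> ole d (oplus a n) -> exists k, oeq d (oplus a k).
Proof.
move=> h1 /olt_succ h2; have [h|[k _ e]] := @olt_oplus _ _ n.+1 h2; last by exists k.
by case: (olt_irr (ole_lt_trans h1 h)).
Qed.

(** Some [tm j] plus a number is at least [d]; if [d] is not in the interval of [j], it is before
    [tm j], and the induction applies to [j]. *)
Lemma stage_tm m d : Acc lt m -> olt d (tm m) -> exists j k, lt j m /\ oeq d (oplus (tm j) k).
Proof.
move=> h; elim: h => {}m hA IH.
move=> /(olt_tm _ (Acc_intro m hA)) [j [n [jm l]]].
have [tjd|l2] := ole_total (tm j) d.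
  by have [k e] := between_oplus tjd l; exists j, k.
have [i [k [ij e]]] := IH j jm l2; exists i, k; split=> //; exact: lt_trans ij jm.
Qed.

Lemma stage_cut (C : nat -> Prop) d : (forall j, C j -> Acc lt j) ->
  (forall i j, C j -> lt i j -> C i) -> olt d (cut C) ->
  exists j k, C j /\ oeq d (oplus (tm j) k).
Proof.
move=> hA hd /olt_cut [j [n [Cj l]]].
have [tjd|l2] := ole_total (tm j) d.
  by have [k e] := between_oplus tjd l; exists j, k.
have [i [k [ij e]]] := stage_tm (hA j Cj) l2; exists i, k; split=> //; exact: hd Cj ij.
Qed.
End Times.

(* [p c = m] means that the point [c] announces the limit point [m].  By [p_num] and [p_rec], only
   finitely many [c] below a point [j < m] announce [m], while by [lt_kind] they are cofinal in [m]. *)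
Record ladder (lt : nat -> nat -> Prop) (nx p : nat -> nat) : Prop := Ladder {
  lt_irr : forall i, ~ lt i i;
  lt_trans : forall i j k, lt i j -> lt j k -> lt i k;
  lt_total : forall i j, [\/ i = j, lt i j | lt j i];
  lt_0 : forall m, m <> 0 -> lt 0 m;
  lt_2 : forall m, m <> 2 -> lt m 2;
  nx_0 : nx 0 = 1;
  nx_gt : forall m, m <> 2 -> lt m (nx m);
  nx_next : forall m i, lt m i -> i = nx m \/ lt (nx m) i;
  p_lt : forall c, p c <> 0 -> lt c (p c);
  p_num : forall c, p c <> 0 -> p c < c;
  p_rec : forall c i, p c <> 0 -> i < c -> lt i (p c) -> lt i c;
  lt_kind : forall m, m <> 0 -> (exists2 j, lt j m & m = nx j) \/
    ((forall j, lt j m -> lt (nx j) m) /\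
     forall b, lt b m -> exists2 c, b = c \/ lt b c & lt c m /\ p c = m)
}.

Section Ladder.
Variables (lt : nat -> nat -> Prop) (nx p : nat -> nat).
Hypothesis L : ladder lt nx p.

Lemma lt_0N j : ~ lt j 0.
Proof.
move=> l; have [e|e] := pselect (j = 0); first by rewrite e in l; case: (lt_irr L l).
by case: (lt_irr L (lt_trans L l (lt_0 L e))).
Qed.

Lemma not_top j m : lt j m -> j <> 2.
Proof.
move=> l e; rewrite e in l; have [e2|n2] := pselect (m = 2).
  by rewrite e2 in l; exact: (lt_irr L l).
exact: (lt_irr L (lt_trans L l (lt_2 L n2))).
Qed.

Lemma Acc_0 : Acc lt 0.
Proof. by constructor => j /lt_0N. Qed.

Lemma Acc_nx j : Acc lt j -> Acc lt (nx j).
Proof.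
move=> h; constructor => i l; have [->//|l2|l2] := lt_total L i j; first exact: (Acc_inv h l2).
have [e|l3] := nx_next L l2; first by rewrite e in l; case: (lt_irr L l).
by case: (lt_irr L (lt_trans L l l3)).
Qed.

Lemma tm_0 : oeq (tm lt 0) ozero.
Proof. by apply/oeq0 => b /(olt_tm _ Acc_0) [j [k [jm l]]]; case: (lt_0N jm). Qed.

Lemma tm_limit m : Acc lt m -> m <> 0 -> olimit (tm lt m).
Proof.
move=> h m0; apply: olimit_oeq (oeq_sym (tm_cut h)) _; exact: cut_limit (lt_0 L m0).
Qed.

Lemma below_wild b : ~ Acc lt b -> exists2 m, ~ Acc lt m & lt m b.
Proof.
move=> nb; apply: contrapT => h; apply: nb; constructor => m l.
by apply: contrapT => nm; apply: h; exists m.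
Qed.

Lemma tm_le i j k : Acc lt j -> ole (tm lt j) (oplus (tm lt i) k) -> ~ lt i j.
Proof. by move=> h l ij; exact: (olt_irr (ole_lt_trans l (tm_lt k h ij))). Qed.
End Ladder.

(** * The run of the verifier through the limit stages *)

Section Machine.
Variables (NV D : nat) (phi : expr).
Hypothesis D10 : 10 < D.
Hypothesis phi_vars : evr 10 D phi.
Hypothesis phi_bits : bits NV phi.
Hypothesis phi_inputs : inputs phi.
Hypothesis phi_dep : D + dep phi <= NV.
Hypothesis NV_big : 20 <= NV.
Hypothesis phi_total : forall T r, evp T r phi = 0 -> exists j, gbit T (r 10) j.
Let D10' : 10 <= D := ltnW D10.
Local Notation K := (NV + 6).
Local Notation code := (code NV D phi).
Local Notation conf := (conf NV D phi).
Local Notation ctrk := (ctrk NV D phi).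
Local Notation ordinary := (ordinary NV D phi).

Definition machine : table (nstates NV D phi) := code_table code (nstates NV D phi).

Variable x : real.
Let R a := cell (run machine x a).
Let Tr a := trk NV (R a).

Lemma raw_step a pc : rawc (run machine x a) = (pc, (0, R a)) ->
  forall k, rawc (run machine x (oplus a k)) = conf pc (R a) k.
Proof.
move=> h k; rewrite run_code ?h //; exact: (code_ok D10' phi_vars phi_bits phi_dep NV_big).
Qed.

Lemma R_oplus a pc : rawc (run machine x a) = (pc, (0, R a)) ->
  forall k, R (oplus a k) = ccells (conf pc (R a) k).
Proof. by move=> /raw_step h k; rewrite -h. Qed.

Lemma Tr_oplus a pc : rawc (run machine x a) = (pc, (0, R a)) ->
  forall k, Tr (oplus a k) = ctrk pc (R a) k.
Proof. by move=> h k; rewrite /Tr (R_oplus h). Qed.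

Lemma Tr_oeq a b : oeq a b -> Tr a = Tr b.
Proof. by move=> e; rewrite /Tr /R (run_eq _ _ e). Qed.

Definition orderly a := exists2 pc, rawc (run machine x a) = (pc, (0, R a)) & ordinary pc (R a).

Lemma orderly_run a k : orderly a -> ~ halting machine (run machine x (oplus a k)).
Proof.
move=> [pc h [h1 _ _ _]] /halting_code; rewrite (raw_step h); exact: h1.
Qed.

Lemma raw0 a : oeq a ozero -> rawc (run machine x a) = (0, (0, R a)).
Proof. by move=> a0; rewrite /R (run0 _ _ a0). Qed.

Lemma raw_lim a : olimit a -> rawc (run machine x a) = (1, (0, R a)).
Proof. by move=> la; rewrite /R (run_lim _ _ la). Qed.

Lemma Tr_lim a o b : olimit a -> Tr a o b <->
  forall c, olt c a -> exists d, [/\ ole c d, olt d a & Tr d o b].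
Proof.
move=> la; rewrite /Tr /trk /R; split=> [/andP [g /(run_limP _ _ _ la) h] c /h [d [h1 h2 h3]]|h].
  by exists d; rewrite g.
have [d [_ _ /andP [g _]]] := h ozero (proj1 la).
rewrite g /=; apply/run_limP => // c /h [d' [h1 h2 /andP [_ h3]]].
by exists d'.
Qed.

Lemma fresh_limit a : olimit a ->
  (forall d, olt d a -> exists b k, [/\ oeq d (oplus b k), ole b a, orderly b & same_inputs (Tr b) (Tr ozero)]) ->
  [/\ clean NV (R a), homes NV (R a) & same_inputs (Tr a) (Tr ozero)].
Proof.
move=> la h; have lc i : R a i <-> _ := run_limP _ _ i la.
split.
- move=> v b vN b0; apply/negP => /andP [/lc h1 /negP h2]; apply: h2; apply/lc => c ca.
  have [d [cd da hd]] := h1 c ca.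
  have [e [k [de ea [pc he [_ _ _ ho]] _]]] := h d da.
  have [k' kk' hk] := ho k v b vN b0.
  exists (oplus e k'); split.
  + by apply: ole_trans cd _; apply: ole_trans (proj1 de) _; exact: oplus_leq.
  + apply: oplus_limit => //; apply: ole_lt_trans da; apply: ole_trans (oplus_le e k) _; exact: (proj2 de).
  + by rewrite -/(R _) (R_oplus he); apply: hk; rewrite -(R_oplus he) /R -(run_eq _ _ de).
- move=> b b0; apply/negP => /lc h1.
  have [d [_ da hd]] := h1 ozero (proj1 la).
  have [e [k [de ea [pc he [_ _ ho _]] _]]] := h d da.
  by have := ho k b b0; rewrite -(R_oplus he) /R -(run_eq _ _ de) hd.
- move=> o o2; apply/funext => b; apply/idP/idP.
    move=> /Tr_lim -/(_ la) h1; have [d [_ da hd]] := h1 ozero (proj1 la).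
    have [e [k [de ea [pc he [_ hi _ _]] si]]] := h d da.
    have := hi k o o2; rewrite -(Tr_oplus he) -(Tr_oeq de) => e1.
    by rewrite -(si o o2) [Tr e]/Tr -e1.
  move=> h1; apply/Tr_lim => // c ca; exists c; split=> //; first exact: ole_refl.
  have [e [k [de ea [pc he [_ hi _ _]] si]]] := h c ca.
  have := hi k o o2; rewrite -(Tr_oplus he) -(Tr_oeq de) => ->.
  by rewrite -[trk NV (R e)]/(Tr e) si.
Qed.

Let nx m := gof (Tr ozero) (npair 1 m).
Let p m := gof (Tr ozero) (npair 2 m).

Definition stage_at a j := [/\ olimit a, clean NV (R a), homes NV (R a), same_inputs (Tr a) (Tr ozero) &
  [/\ forall b, Tr a 12 b = (b == j), Tr a 1 0 & Tr a 0 0 = (j == 2)]].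

(** What the interval of the point [j] contributes to later limsups: which marks may appear, which
    flashes do appear, and the tracks 0 and 12 that remain at the end. *)
Definition passes a j := (orderly a /\ same_inputs (Tr a) (Tr ozero)) /\
  [/\ forall k b, Tr (oplus a k) 12 b -> [\/ b = j, b = p j /\ p j <> 0 | b = nx j],
    p j <> 0 -> exists k, Tr (oplus a k) 12 (p j),
    p j = 2 -> exists k, Tr (oplus a k) 0 0,
    forall k, Tr (oplus a k) 0 0 -> p j = 2 \/ nx j = 2 &
    (forall k, exists2 k', k <= k' & Tr (oplus a k') 1 0) /\
    exists k0, forall k, k0 <= k -> Tr (oplus a k) 0 0 = (nx j == 2) /\
      forall b, Tr (oplus a k) 12 b = (b == nx j)].

Lemma stage_passes a j : gtotal (Tr ozero) -> stage_at a j -> j <> 2 -> passes a j.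
Proof.
move=> tot [la hc hh hi [hB hz hV]] j2.
have hV' : Tr a 0 0 = false by rewrite hV; case: eqP.
have tot' : gtotal (Tr a) by move=> i; rewrite (gbit_inputs _ hi).
have he := raw_lim la.
have [ho []] := ordinary_single D10 phi_vars phi_bits phi_inputs phi_dep NV_big hc hh hV' hz hB tot'.
rewrite -[trk NV (R a)]/(Tr a) (gof_inputs hi) -/(nx j) -/(p j).
move=> h1 h2 h3 h4 [k0 h5].
have e k : Tr (oplus a k) = ctrk 1 (R a) k := Tr_oplus he k.
split; first by split=> //; exists 1.
split.
- by move=> k b; rewrite e => /h1.
- by move=> /h2 [k hk]; exists k; rewrite e.
- by move=> /h3 [k hk]; exists k; rewrite e.
- by move=> k; rewrite e => /h4.
split.
  move=> k; exists (maxn k k0); first exact: leq_maxl.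
  by rewrite e; have [] := h5 (maxn k k0) (leq_maxr _ _).
by exists k0 => k /h5 [_ v B]; rewrite e.
Qed.

Lemma start_clean : [/\ clean NV (R ozero), homes NV (R ozero) &
  forall o b, o %% 3 != 2 -> Tr ozero o b = false].
Proof.
have hR i : R ozero i = (i %% 3 == 2) && x (i %/ 3).
  by rewrite /R (run0 _ _ (oeq_refl _)).
have im b o : idx NV b o %% 3 = o %% 3.
  by rewrite /idx (_ : b * (3 * K) = b * K * 3) ?modnMDl // mulnCA mulnC.
split.
- move=> v b _ _; rewrite /mk hR im /ov (_ : 18 + 3 * v = (6 + v) * 3); last by lia.
  by rewrite modnMl.
- by move=> b _; rewrite hR im.
- by move=> o b /negbTE h; rewrite /Tr /trk hR im h !andbF.
Qed.

Lemma start_orderly : orderly ozero.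
Proof.
have [hc hh h] := start_clean; exists 0; first exact: raw0 (oeq_refl _).
by have [b|b|||ho _ _ _ _] := ordinary_start D10 phi_vars phi_bits phi_inputs phi_dep NV_big phi_total hc hh; try exact: h.
Qed.

Lemma start_passes : Phi phi (Tr ozero) -> gtotal (Tr ozero) -> nx 0 = 1 -> p 0 = 0 -> passes ozero 0.
Proof.
move=> hP hg n0 p0; have [hc hh h] := start_clean.
have [b|b||| _ hB hV [k0 hE]] := ordinary_start D10 phi_vars phi_bits phi_inputs phi_dep NV_big phi_total hc hh; try exact: h.
case: asboolP => [_ hz|[]]; last by split.
have e k : Tr (oplus ozero k) = ctrk 0 (R ozero) k := Tr_oplus (raw0 (oeq_refl _)) k.
split; first by split; [exact: start_orderly|].
rewrite n0 p0; split=> //.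
- by move=> k b; rewrite e => /hB ->; exact: Or33.
- by move=> k; rewrite e => hv; have := hV k; rewrite hv.
split; first by move=> k; have [k' kk hk] := hz k; exists k'; rewrite ?e.
exists k0 => k /hE hk; rewrite e; split; first exact: negbTE (hV k).
by move=> b; apply/idP/eqP => [/hB //|->].
Qed.

Lemma start_rejects : ~ (Phi phi (Tr ozero) /\ gtotal (Tr ozero)) ->
  [/\ forall k b, Tr (oplus ozero k) 12 b -> b = 1, forall k, ~~ Tr (oplus ozero k) 0 0 &
    exists k0, forall k, k0 <= k -> ~~ Tr (oplus ozero k) 1 0].
Proof.
move=> hn; have [hc hh h] := start_clean.
have [b|b||| _ hB hV _] := ordinary_start D10 phi_vars phi_bits phi_inputs phi_dep NV_big phi_total hc hh; try exact: h.
case: asboolP => // _ [k0 hz].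
have e k : Tr (oplus ozero k) = ctrk 0 (R ozero) k := Tr_oplus (raw0 (oeq_refl _)) k.
split=> [k b|k|]; rewrite ?e //; first exact: hB.
by exists k0 => k; rewrite e; exact: hz.
Qed.

Lemma orderly_oeq a b : oeq a b -> orderly a -> orderly b.
Proof. by move=> e [pc h1 h2]; exists pc; rewrite /R -(run_eq _ _ e). Qed.

Lemma passes_oeq a b j : oeq a b -> passes a j -> passes b j.
Proof.
move=> e [[h0 h0'] h].
have e' k : Tr (oplus a k) = Tr (oplus b k) by apply: Tr_oeq; exact: oplus_oeq.
split; first by split; [exact: orderly_oeq e h0|rewrite -(Tr_oeq e)].
case: h => h1 h2 h3 h4 [h5 [k0 h6]]; split.
- by move=> k b'; rewrite -e'; exact: h1.
- by move=> /h2 [k hk]; exists k; rewrite -e'.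
- by move=> /h3 [k hk]; exists k; rewrite -e'.
- by move=> k; rewrite -e'; exact: h4.
split; first by move=> k; have [k' kk hk] := h5 k; exists k'; rewrite -?e'.
by exists k0 => k; rewrite -e'; exact: h6.
Qed.

(** * Climbing the well-founded part *)

Section Climb.
Variable lt : nat -> nat -> Prop.
Hypothesis L : ladder lt nx p.
Local Notation tm := (tm lt).
Local Notation cut := (cut lt).
Let ltT := lt_trans L.

Lemma down_fresh (C : nat -> Prop) : C 0 -> (forall i j, C j -> lt i j -> C i) ->
  (forall j, C j -> Acc lt j) -> (forall j, C j -> passes (tm j) j) ->
  [/\ olimit (cut C), clean NV (R (cut C)), homes NV (R (cut C)) & same_inputs (Tr (cut C)) (Tr ozero)].
Proof.
move=> C0 hd hA hF; have lk := cut_limit lt C0.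
have [|h1 h2 h3] := fresh_limit lk; last by split.
move=> d /(stage_cut ltT hA hd) [j [k [Cj e]]]; have [[h1 h2] _] := hF j Cj.
exists (tm j), k; split=> //; exact: oltW (cut_lt _ 0 Cj).
Qed.

Lemma down_running (C : nat -> Prop) : (forall i j, C j -> lt i j -> C i) ->
  (forall j, C j -> Acc lt j) -> (forall j, C j -> passes (tm j) j) ->
  forall d, olt d (cut C) -> ~ halting machine (run machine x d).
Proof.
move=> hd hA hF d /(stage_cut ltT hA hd) [j [k [Cj e]]].
by have [[h1 _] _] := hF j Cj; rewrite (run_eq _ _ e); exact: orderly_run.
Qed.

Section Cut.
Variable C : nat -> Prop.
Hypothesis C0 : C 0.
Hypothesis C2 : ~ C 2.
Hypothesis Cnx : forall j, C j -> C (nx j).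
Hypothesis Cdown : forall i j, C j -> lt i j -> C i.
Hypothesis CA : forall j, C j -> Acc lt j.
Hypothesis CF : forall j, C j -> passes (tm j) j.

Let lk : olimit (cut C) := cut_limit lt C0.
Let ltnx j : C j -> lt j (nx j).
Proof. by move=> h; apply: (nx_gt L) => e; apply: C2; rewrite -e. Qed.

(** [C] is closed under the next point, so the finitely many points of [C] with numbers up to [M]
    are exceeded by a point of [C]. *)
Lemma cut_bound M : exists2 i, C i & forall j, j <= M -> C j -> lt j i.
Proof.
elim: M => [|M [i Ci h]].
  by exists (nx 0); [exact: Cnx|move=> j; rewrite leqn0 => /eqP -> /ltnx].
have [CM|nM] := pselect (C M.+1); last first.
  by exists i => // j; rewrite leq_eqVlt => /orP [/eqP ->|/h].
have [e|l|l] := lt_total L i M.+1.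
- exists (nx i); first exact: Cnx.
  move=> j; rewrite leq_eqVlt => /orP [/eqP -> _|/h hj /hj l]; first by rewrite -e; exact: ltnx.
  exact: ltT l (ltnx Ci).
- exists (nx M.+1); first exact: Cnx.
  move=> j; rewrite leq_eqVlt => /orP [/eqP -> _|/h hj /hj l']; first exact: ltnx.
  exact: ltT l' (ltT l (ltnx CM)).
- by exists i => // j; rewrite leq_eqVlt => /orP [/eqP ->|/h].
Qed.

(** If [j] announces a point beyond [m] and has a larger number than [m], then by [p_rec] it lies
    beyond [m], hence outside [C]. So only the finitely many points numbered up to [m] can do so
    from within [C]. *)
Lemma cut_records m : ~ C m -> exists2 i, C i & forall j, C j -> lt m (p j) -> p j <> 0 -> lt j i.
Proof.
move=> nm; have [i Ci h] := cut_bound m; exists i => // j Cj l p0; apply: h => //.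
rewrite leqNgt; apply/negP => mj; apply: nm; exact: Cdown Cj (p_rec L p0 mj l).
Qed.

(** From the interval of [i] on the cell is off, so its limsup is 0. *)
Lemma cut_off o b : (exists2 i, C i & forall j k, C j -> Tr (oplus (tm j) k) o b -> lt j i) ->
  Tr (cut C) o b = false.
Proof.
move=> [i Ci h]; apply/negP => /Tr_lim -/(_ lk) hl.
have [d [id dk hd]] := hl (tm i) (cut_lt lt 0 Ci).
have [j [k [Cj e]]] := stage_cut ltT CA Cdown dk.
rewrite (Tr_oeq e) in hd.
exact: (tm_le (CA Ci) (ole_trans id (proj1 e)) (h _ _ Cj hd)).
Qed.

Lemma cut_z : Tr (cut C) 1 0.
Proof.
apply/Tr_lim => // c /(stage_cut ltT CA Cdown) [j [k [Cj e]]].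
have [_ [_ _ _ _ [h _]]] := CF Cj; have [k' kk hk] := h k.
exists (oplus (tm j) k'); split=> //; last exact: cut_lt.
exact: ole_trans (proj1 e) (oplus_leq _ kk).
Qed.

(** A point of [C] is marked only in intervals of points before its successor. A point above some
    [m] outside [C] can only be announced, and [cut_records] bounds these announcements. The point
    not covered is a least one outside [C]. *)
Lemma cut_B b : C b \/ (exists2 m, ~ C m & lt m b) -> Tr (cut C) 12 b = false.
Proof.
move=> hb; apply: cut_off; case: hb => [Cb|[m nm mb]].
  exists (nx b); first exact: Cnx.
  move=> j k Cj; have [_ [h _ _ _ _]] := CF Cj => /h [->|[bp p0]|->].
  - exact: ltnx.
  - by apply: ltT (ltnx Cb); rewrite bp; exact: (p_lt L p0).
  - by apply: ltT (ltnx Cj) _; exact: ltnx (Cnx Cj).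
have nb : ~ C b by move=> Cb; exact: nm (Cdown Cb mb).
have [i Ci hi] := cut_records nm; exists i => // j k Cj; have [_ [h _ _ _ _]] := CF Cj => /h [e|[e p0]|e].
- by case: nb; rewrite e.
- by apply: hi => //; rewrite -e.
- by case: nb; rewrite e; exact: Cnx.
Qed.

Lemma cut_V m : ~ C m -> lt m 2 -> Tr (cut C) 0 0 = false.
Proof.
move=> nm m2; apply: cut_off; have [i Ci hi] := cut_records nm.
exists i => // j k Cj; have [_ [_ _ _ h _]] := CF Cj => /h [e|e].
  by apply: hi; rewrite ?e.
by case: C2; rewrite -e; exact: Cnx.
Qed.
End Cut.

Hypothesis phi_true : Phi phi (Tr ozero).
Hypothesis g_total : gtotal (Tr ozero).

Lemma passes0 : passes (tm 0) 0.
Proof.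
apply: passes_oeq (oeq_sym (tm_0 L)) _; apply: start_passes => //; first exact: (nx_0 L).
by apply: contrapT => h; have := p_num L h.
Qed.

(** Well-founded induction: the intervals of all points below [m] behave as described, so the limsup
    at [tm m] can be computed from them. *)
Lemma climb m : Acc lt m -> m <> 0 -> stage_at (tm m) m.
Proof.
elim=> {}m hA IH m0.
have Am : Acc lt m by constructor.
have hF j : lt j m -> passes (tm j) j.
  move=> l; have [->|j0] := pselect (j = 0); first exact: passes0.
  by apply: stage_passes => //; [exact: IH|exact: (not_top L l)].
have C0 : lt 0 m by exact: (lt_0 L).
have Cd i j : lt j m -> lt i j -> lt i m by move=> jm ij; exact: ltT ij jm.
have CA j : lt j m -> Acc lt j by exact: hA.
have e := tm_cut Am.
have [lk hc hh hi] := down_fresh C0 Cd CA hF.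
have eR : R (tm m) = R (cut (lt^~ m)) by rewrite /R (run_eq _ _ e).
have eT : Tr (tm m) = Tr (cut (lt^~ m)) by rewrite /Tr eR.
split.
- exact: olimit_oeq (oeq_sym e) lk.
- by rewrite eR.
- by rewrite eR.
- by rewrite eT.
(* For a next point [m] of [j] the interval of [j] is the last one before [tm m], and its final
   tracks 0 and 12 are the limsup. For a limit point the announcements decide. *)
rewrite eT; have [[j jm mj]|[Cnx fs]] := lt_kind L m0.
  have [_ [_ _ _ _ [h5 [k0 h6]]]] := hF j jm.
  have low i : lt i m -> i = j \/ lt i j.
    move=> im; have [->|l|l] := lt_total L i j; [by left|by right|].
    have [e'|l'] := nx_next L l; first by rewrite mj -e' in im; case: (lt_irr L im).
    by rewrite -mj in l'; case: (lt_irr L (ltT im l')).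
  have late c : olt c (cut (lt^~ m)) -> exists k, ole c (oplus (tm j) k).
    move=> /(stage_cut ltT CA Cd) [i [k [/low im e1]]]; case: im => [ij|ij].
      by exists k; rewrite -ij; exact: (proj1 e1).
    by exists 0; apply: ole_trans (proj1 e1) _; exact: oltW (tm_lt k (CA j jm) ij).
  have ev o b v : (forall k, k0 <= k -> Tr (oplus (tm j) k) o b = v) -> Tr (cut (lt^~ m)) o b = v.
    move=> h; apply/idP/idP => [/Tr_lim -/(_ lk) hl|hv].
      have [d [cd dk hd]] := hl _ (cut_lt lt k0 jm).
      have [i [k [/low im e1]]] := stage_cut ltT CA Cd dk.
      case: im => [ij|ij]; last first.
        case: (@olt_irr (oplus (tm j) k0)); apply: ole_lt_trans (ole_trans cd (proj1 e1)) _.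
        by apply: olt_le_trans (oplus_le _ _); exact: tm_lt (CA j jm) ij.
      rewrite -(h k) -?ij -?(Tr_oeq e1) // leqNgt; apply/negP => kk.
      rewrite ij in e1; exact: (olt_irr (ole_lt_trans (ole_trans cd (proj1 e1)) (oplus_ltn _ kk))).
    apply/Tr_lim => // c /late [k ck]; exists (oplus (tm j) (maxn k k0)); split.
    - by apply: ole_trans ck _; apply: oplus_leq; exact: leq_maxl.
    - exact: cut_lt.
    - by rewrite h ?leq_maxr.
  split.
  - by move=> b; apply: ev => k /h6 [_ ->]; rewrite mj.
  - apply/Tr_lim => // c /late [k ck]; have [k' kk hk] := h5 k.
    exists (oplus (tm j) k'); split=> //; last exact: cut_lt.
    exact: ole_trans ck (oplus_leq _ kk).
  - by apply: ev => k /h6 [-> _]; rewrite mj.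
have C2 : ~ lt 2 m by move=> l; exact: (not_top L l).
have nm : ~ lt m m by exact: (lt_irr L).
(* Announcements of [m] occur after every earlier stage, so the mark of [m] is on at the limit;
   [cut_B] switches off all others. *)
have far c : olt c (cut (lt^~ m)) -> exists i, [/\ ole c (tm i), lt i m & p i = m].
  move=> /(stage_cut ltT CA Cd) [j [k [jm e1]]].
  have [i ji [im pi]] := fs (nx j) (Cnx j jm); exists i; split=> //.
  apply: ole_trans (proj1 e1) (oltW _).
  apply: olt_le_trans (tm_lt k (CA _ (Cnx j jm)) (nx_gt L (not_top L jm))) _.
  case: ji => [->|l]; first exact: ole_refl.
  exact: oltW (tm_lt 0 (CA i im) l).
split.
- move=> b; case: (b =P m) => [->|bm].
    apply/Tr_lim => // c /far [i [ci im pi]].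
    have [_ [_ h _ _ _]] := hF i im; have [|k hk] := h; first by rewrite pi.
    exists (oplus (tm i) k); split; last by rewrite -pi.
      exact: ole_trans ci (oplus_le _ _).
    exact: cut_lt.
  apply: cut_B => //; have [//|l|l] := lt_total L b m; [by left|by right; exists m].
- exact: cut_z.
- case: (m =P 2) => [e2|n2]; last by apply: (@cut_V _ C0 C2 Cnx Cd CA hF m) => //; exact: (lt_2 L).
  apply/Tr_lim => // c /far [i [ci im pi]].
  have [_ [_ _ h _ _]] := hF i im; have [|k hk] := h; first by rewrite pi.
  exists (oplus (tm i) k); split=> //; last exact: cut_lt.
  exact: ole_trans ci (oplus_le _ _).
Qed.

Lemma all_pass j : Acc lt j -> j <> 2 -> passes (tm j) j.
Proof.
move=> hA j2; have [->|j0] := pselect (j = 0); first exact: passes0.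
by apply: stage_passes => //; exact: climb.
Qed.

End Climb.

(** * The three verdicts *)

Lemma scan_R a : rscan 0 (R a) = (Tr a 0 0, Tr a 1 0, R a 2).
Proof.
have g o : o < 18 -> goodo NV o by exact: (goodo_small D10' phi_vars phi_bits phi_dep NV_big).
by rewrite /Tr /trk !g.
Qed.

Lemma limit_halts a : olimit a -> Tr a 0 0 \/ Tr a 1 0 = false ->
  halting machine (run machine x a) /\ written machine (run machine x a) 0 = Tr a 0 0.
Proof.
move=> la h; have he := raw_lim la.
have hr : rrow code (rawc (run machine x a)) = limit_row NV D phi (rscan 0 (R a)).
  by rewrite he.
rewrite halting_code written_code hr -[hpos _]/(rawc (run machine x a)).2.1 he scan_R /limit_row /=.
by case: h => ->; case: (Tr a 0 0).
Qed.

Lemma rejects_after a : orderly a -> (forall b, olt b a -> ~ halting machine (run machine x b)) ->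
  (forall k, ~~ Tr (oplus a k) 0 0) -> (exists k0, forall k, k0 <= k -> ~~ Tr (oplus a k) 1 0) ->
  halts_at machine x (oplusw a) /\ written machine (run machine x (oplusw a)) 0 = false.
Proof.
move=> ho hb hV [k0 hz]; have la := oplusw_limit a.
have dec d k : ole (oplus a k) d -> olt d (oplusw a) -> exists2 k', k <= k' & oeq d (oplus a k').
  move=> h1 [n h2]; have h3 : ole a d by apply: ole_trans h1; exact: oplus_le.
  have [k' e] := between_oplus h3 h2; exists k' => //.
  rewrite leqNgt; apply/negP => l; exact: (olt_irr (ole_lt_trans (ole_trans h1 (proj1 e)) (oplus_ltn _ l))).
have v : Tr (oplusw a) 0 0 = false.
  apply/negP => /Tr_lim -/(_ la) h; have [d [h1 h2]] := h a (oplusw_lt a 0).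
  have [k _ e] := dec d 0 h1 h2; rewrite (Tr_oeq e); exact/negP.
have z : Tr (oplusw a) 1 0 = false.
  apply/negP => /Tr_lim -/(_ la) h; have [d [h1 h2]] := h _ (oplusw_lt a k0).
  have [k kk e] := dec d k0 h1 h2; rewrite (Tr_oeq e); exact/negP/hz.
have [|h1 h2] := limit_halts la; first by right.
split; last by rewrite h2.
split=> // b bl; have [ab|] := ole_total a b; last exact: hb.
have [k _ e] := dec b 0 ab bl; rewrite (run_eq _ _ e); exact: orderly_run.
Qed.

Theorem machine_checks : ~ (Phi phi (Tr ozero) /\ gtotal (Tr ozero)) ->
  halts_at machine x omega /\ written machine (run machine x omega) 0 = false.
Proof.
move=> /start_rejects [_ hV hz]; apply: (@rejects_after ozero) => //; first exact: start_orderly.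
by move=> b /olt0.
Qed.

Theorem machine_accepts lt : ladder lt nx p -> Phi phi (Tr ozero) -> gtotal (Tr ozero) -> Acc lt 2 ->
  halts_at machine x (tm lt 2) /\ written machine (run machine x (tm lt 2)) 0.
Proof.
move=> L hP hg A2; have [la _ _ _ [_ _ v]] := climb L hP hg A2 ltac:(by []).
rewrite eqxx in v; have [|h1 h2] := limit_halts la; first by left.
split; last by rewrite h2.
split=> // b; move=> /(stage_tm (lt_trans L) A2) [j [k [j2 e]]].
have [[ho _] _] := all_pass L hP hg (Acc_inv A2 j2) (not_top L j2).
by rewrite (run_eq _ _ e); exact: orderly_run.
Qed.

(** Each point is accessible or has an inaccessible one below it, so at the end of the well-founded
    part all marks and track 0 are off. The flag is on there, since it is raised in every interval;
    hence one idle interval follows, and the rejection comes after it. *)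
Theorem machine_rejects lt : ladder lt nx p -> Phi phi (Tr ozero) -> gtotal (Tr ozero) -> ~ Acc lt 2 ->
  let k := oplusw (cut lt (Acc lt)) in
  halts_at machine x k /\ written machine (run machine x k) 0 = false.
Proof.
move=> L hP hg A2; set C := Acc lt.
have n2 j : C j -> j <> 2 by move=> h e; apply: A2; rewrite -e.
have Cd i j : C j -> lt i j -> C i by move=> h; exact: Acc_inv.
have C0 : C 0 := Acc_0 L.
have Cn j : C j -> C (nx j) := @Acc_nx _ _ _ L j.
have CF j : C j -> passes (tm lt j) j by move=> h; apply: all_pass => //; exact: n2.
have CA j : C j -> Acc lt j by [].
have [lk hc hh hi] := down_fresh L C0 Cd CA CF.
have below b : ~ C b -> exists2 m, ~ C m & lt m b := @below_wild lt b.
have hz := cut_z L C0 Cd CA CF.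
have hB b : Tr (cut lt C) 12 b = false.
  by apply: (cut_B L C0 A2 Cn Cd CA CF); have [h|/below h] := pselect (C b); [left|right].
have [m nm l] := below 2 A2.
have hV := cut_V L C0 A2 Cn Cd CA CF nm l.
have [ho o1 o2 o3] := ordinary_empty D10 phi_vars phi_bits phi_inputs phi_dep NV_big hc hh hV hz hB.
have he := raw_lim lk.
apply: rejects_after.
- by exists 1.
- exact: (down_running L Cd CA CF).
- by move=> k; rewrite (Tr_oplus he).
- by have [k0 h] := o3; exists k0 => k /h; rewrite (Tr_oplus he).
Qed.

End Machine.

(** * Certificates *)

(* Codes of the symbols read and of the instruction executed: an occupied cell, a move to
   the right are coded by [0], an empty cell, a move to the left by [1], halting by [0] and
   the next state [q] by [q.+1]. *)
Definition rcode (r : triple) : nat :=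
  npair (~~ r.1.1) (npair (~~ r.1.2) (~~ r.2)).
Definition acode n (a : triple * bool * option 'I_n.+2) : nat :=
  npair (~~ a.1.1.1.1) (npair (~~ a.1.1.1.2) (npair (~~ a.1.1.2)
    (npair (~~ a.1.2) (if a.2 is Some q then q.+1 else 0)))).

Section Semantics.
Variable g : nat -> nat.
Definition tg k a := g (npair k a).

(* [L] is the order, [nxt] the next point, [par] the announced point; [ty] tells successor points, with
   predecessor [pd], from limit points, and [fs] finds an announcement.  At the [n]-th stage after the
   point [m], machine [u] (the given one if [u = 0], else the coded one) has the state [st], the head
   position [hd] and the cells [va] (occupied: 0), and executes the instruction [w0], ..., [ns]; it halts
   at [me], [ne].  [Nb], [Nn] is a stage from which the cell [i], empty at [m], is empty; [Db], [Dn] is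
   a stage from ([b], [k]) on at which [i] is occupied; [al], [aln] is the first stage from [m] on at which
   a cell is occupied that is empty in [c], or the top. *)
Definition nxt a := tg 1 a.
Definition par a := tg 2 a.
Definition L a b := tg 3 (npair a b) == 0.
Definition le a b := (a == b) || L a b.
Definition ty a := tg 4 a.
Definition pd a := tg 5 a.
Definition fs a b := tg 6 (npair a b).
Definition st u m n := tg 7 (npair u (npair m n)).
Definition hd u m n := tg 8 (npair u (npair m n)).
Definition va u m n i := tg 9 (npair u (npair m (npair n i))).
Definition w0 u m n := tg 10 (npair u (npair m n)).
Definition w1 u m n := tg 11 (npair u (npair m n)).
Definition w2 u m n := tg 12 (npair u (npair m n)).
Definition di u m n := tg 13 (npair u (npair m n)).
Definition ns u m n := tg 14 (npair u (npair m n)).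
Definition me u := tg 15 u.
Definition ne u := tg 16 u.
Definition Nb u m i := tg 17 (npair u (npair m i)).
Definition Nn u m i := tg 18 (npair u (npair m i)).
Definition Db u i b k := tg 19 (npair u (npair i (npair b k))).
Definition Dn u i b k := tg 20 (npair u (npair i (npair b k))).
Definition al c m := tg 21 (npair c m).
Definition aln c m := tg 22 (npair c m).
Definition rounds c m0 m := tg 23 (npair c (npair m0 m)).

Definition hd3 u m n := hd u m n + (hd u m n + hd u m n).
Definition sc u m n := npair (va u m n (hd3 u m n))
  (npair (va u m n (hd3 u m n + 1)) (va u m n (hd3 u m n + 2))).
Definition ac u m n := npair (w0 u m n) (npair (w1 u m n) (npair (w2 u m n)
  (npair (di u m n) (ns u m n)))).
Definition bf u m n := L m (me u) || (m == me u) && (n < ne u).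

Definition order_ok a b c :=
  ~~ L a a && (L a b && L b c ==> L a c) && ((a == b) || (L a b || L b a))
  && (~~ (a == 0) ==> L 0 a) && (~~ (a == 2) ==> L a 2) && (nxt 0 == 1)
  && (~~ (a == 2) ==> L a (nxt a)) && (L a b ==> (b == nxt a) || L (nxt a) b).
Definition par_ok a b := ~~ (par a == 0) ==>
  L a (par a) && (par a < a) && ((b < a) ==> (L b (par a) ==> L b a)).
Definition kind_ok a b := ~~ (a == 0) ==>
  ((ty a == 0) ==> L (pd a) a && (nxt (pd a) == a))
  && (~~ (ty a == 0) ==> (L b a ==> L (nxt b) a &&
        (le b (fs a b) && L (fs a b) a && (par (fs a b) == a)))).
Definition start_ok u i := (st u 0 0 == 0) && (hd u 0 0 == 0)
  && ~~ (va u 0 0 (i + (i + i)) == 0) && ~~ (va u 0 0 (i + (i + i) + 1) == 0).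
Definition range_ok u m n i := va u m n i < 2.
Definition limit_ok u m i m' n' := ~~ (m == 0) ==>
  (st u m 0 == 1) && (hd u m 0 == 0)
  && (~~ (va u m 0 i == 0) ==> L (Nb u m i) m &&
     (L m' m && (L (Nb u m i) m' || (Nb u m i == m') && ~~ (n' < Nn u m i)) ==> ~~ (va u m' n' i == 0)))
  && ((va u m 0 i == 0) && L m' m ==> L (Db u i m' n') m
     && (L m' (Db u i m' n') || (m' == Db u i m' n') && ~~ (Dn u i m' n' < n'))
     && (va u (Db u i m' n') (Dn u i m' n') i == 0)).
Definition step_ok u m n i := bf u m n ==>
  ~~ (ns u m n == 0) && (st u m (n + 1) + 1 == ns u m n)
  && ((di u m n == 0) ==> (hd u m (n + 1) == hd u m n + 1))
  && (~~ (di u m n == 0) ==> (hd u m (n + 1) == hd u m n - 1))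
  && ((i == hd3 u m n) ==> (va u m (n + 1) i == w0 u m n))
  && ((i == hd3 u m n + 1) ==> (va u m (n + 1) i == w1 u m n))
  && ((i == hd3 u m n + 2) ==> (va u m (n + 1) i == w2 u m n))
  && (~~ (i == hd3 u m n) && ~~ (i == hd3 u m n + 1) && ~~ (i == hd3 u m n + 2) ==>
       (va u m (n + 1) i == va u m n i)).
(** The given machine halts at a limit stage, so its end is the top itself without further steps.
    For the coded machine the last conjunct says that the final value of the first output cell is 0,
    whether or not the last instruction writes there. *)
Definition end_ok u := (me 0 == 2) && (ne 0 == 0)
  && (L (me u) 2 || (me u == 2) && (ne u == 0))
  && (ns u (me u) (ne u) == 0)
  && (~~ (u == 0) ==> ((hd u (me u) (ne u) == 0) ==> ~~ (w0 u (me u) (ne u) == 0))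
      && (~~ (hd u (me u) (ne u) == 0) ==> ~~ (va u (me u) (ne u) 0 == 0))).
(** Only for the given machine, whose table is a constant of the formula. The instructions of the
    coded machine have to be looked up in the input, which is the clause [c_other]. *)
Definition row_ok q r a m n := (st 0 m n == q) && (sc 0 m n == r) ==> (ac 0 m n == a).
Definition al_ok (c : triple) m := let A := al (rcode c) m in let k := aln (rcode c) m in
  le m A && ((A == 2) || (~~ c.1.1 && (va 0 A k 0 == 0) || (~~ c.1.2 && (va 0 A k 1 == 0)
    || ~~ c.2 && (va 0 A k 2 == 0)))).
Definition rounds_ok (c : triple) m0 m m' m1 n1 m2 n2 m3 n3 :=
  le m0 m && L m m' && L m' (al (rcode c) m0)
  && (c.1.1 ==> le m m1 && L m1 m' && (va 0 m1 n1 0 == 0))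
  && (c.1.2 ==> le m m2 && L m2 m' && (va 0 m2 n2 1 == 0))
  && (c.2 ==> le m m3 && L m3 m' && (va 0 m3 n3 2 == 0))
  ==> (rounds (rcode c) m0 m < rounds (rcode c) m0 m').
End Semantics.

(** There are nine variables, numbered from 10 on, so [dim] is 19. The stack of the formula needs at
    most 27 further counters, which makes [NV] 46. A block then has 52 positions, and [half] of
    them, the even ones, carry bits of [x]. *)
Definition half := 26.
Definition NV := 46.
Definition dim := 19.

Record cert (g : nat -> nat) (X : nat -> nat -> bool) n (t : table n) : Prop := Cert {
  c_order : forall a b c, order_ok g a b c;
  c_par : forall a b, par_ok g a b;
  c_kind : forall a b, kind_ok g a b;
  c_start : forall u i, start_ok g u i;
  c_input : forall u b r, r < half -> va g u 0 0 (3 * (half * b + r) + 2) + X r b = 1;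
  c_range : forall u m n i, range_ok g u m n i;
  c_limit : forall u m i m' n', limit_ok g u m i m' n';
  c_step : forall u m n i, step_ok g u m n i;
  c_end : forall u, end_ok g u;
  c_table : forall q r m n, row_ok g (val q) (rcode r) (acode (t (q, r))) m n;
  c_other : forall u m n, u != 0 -> X 0 (npair (npair (st g u m n) (sc g u m n)) (ac g u m n));
  c_al : forall c m, (t (limit_state n, c)).2 = None -> al_ok g c m;
  c_rounds : forall c m0 m m' m1 n1 m2 n2 m3 n3, (t (limit_state n, c)).2 = None ->
    rounds_ok g c m0 m m' m1 n1 m2 n2 m3 n3
}.

(** ** The formula *)

Inductive form :=
  | FEq of expr & expr | FLt of expr & expr | FNot of form | FAnd of form & form
  | FOr of form & form | FImp of form & form | FBool of bool.

(** Truth is the value 0, conjunction is addition, and truncated subtraction from 1 is negation.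
    Both sides of a connective are always evaluated, so every look-up in the formula counts. *)
Fixpoint fexp f : expr := match f with
| FEq a b => EAdd (ESub a b) (ESub b a)
| FLt a b => ESub (ENum 1) (ESub b a)
| FNot a => ESub (ENum 1) (fexp a)
| FAnd a b => EAdd (fexp a) (fexp b)
| FOr a b => ESub (ENum 1) (EAdd (ESub (ENum 1) (fexp a)) (ESub (ENum 1) (fexp b)))
| FImp a b => ESub (ENum 1) (EAdd (fexp a) (ESub (ENum 1) (fexp b)))
| FBool b => ENum (~~ b)
end.
Definition FAll (l : seq form) := foldl FAnd (FBool true) l.
Definition EMul k a := iter k (fun e => EAdd e a) (ENum 0).

Section Holds.
Variables (g : nat -> nat) (T : tracks) (r : vars).
Local Notation ev := (evi g T r).

Fixpoint holds f : bool := match f with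
| FEq a b => ev a == ev b
| FLt a b => ev a < ev b
| FNot a => ~~ holds a
| FAnd a b => holds a && holds b
| FOr a b => holds a || holds b
| FImp a b => holds a ==> holds b
| FBool b => b
end.

Lemma fexpP f : (ev (fexp f) == 0) = holds f.
Proof.
elim: f => //= [a b|a b|a <-|a <- b <-|a <- b <-|a <- b <-|[]] //; lia.
Qed.

Lemma holdsAll l : holds (FAll l) = all holds l.
Proof.
suff h e : holds (foldl FAnd e l) = holds e && all holds l by rewrite h.
by elim: l e => [|a l IH] e /=; rewrite ?andbT // IH /= andbA.
Qed.
Lemma ev_mul k a : ev (EMul k a) = k * ev a.
Proof. by elim: k => //= k ->; rewrite mulSn addnC. Qed.
End Holds.

Definition TG k a := EG (EPair (ENum k) a).
Definition pair2 a b := EPair a b.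
Definition pair3 a b c := EPair a (EPair b c).
Definition pair4 a b c d := EPair a (EPair b (EPair c d)).
Definition Q0 a := FEq a (ENum 0).
Definition N1 a := EAdd a (ENum 1).
Definition fnx a := TG 1 a.
Definition fpar a := TG 2 a.
Definition fL a b := Q0 (TG 3 (pair2 a b)).
Definition fle a b := FOr (FEq a b) (fL a b).
Definition fst3 u m n := TG 7 (pair3 u m n).
Definition fhd u m n := TG 8 (pair3 u m n).
Definition fva u m n i := TG 9 (pair4 u m n i).
Definition fh3 u m n := EAdd (fhd u m n) (EAdd (fhd u m n) (fhd u m n)).
Definition fsc u m n := pair3 (fva u m n (fh3 u m n)) (fva u m n (EAdd (fh3 u m n) (ENum 1)))
  (fva u m n (EAdd (fh3 u m n) (ENum 2))).
Definition fw k u m n := TG k (pair3 u m n).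
Definition fac u m n := EPair (fw 10 u m n) (pair4 (fw 11 u m n) (fw 12 u m n) (fw 13 u m n) (fw 14 u m n)).
Definition fme u := TG 15 u.
Definition fne u := TG 16 u.
Definition fbf u m n := FOr (fL m (fme u)) (FAnd (FEq m (fme u)) (FLt n (fne u))).
Definition v i := EVar (10 + i).

Definition forder (a b c : expr) : form :=
  FAnd (FAnd (FAnd (FAnd (FAnd (FAnd (FAnd
   (FNot (fL a a)) (FImp (FAnd (fL a b) (fL b c)) (fL a c)))
   (FOr (FEq a b) (FOr (fL a b) (fL b a))))
   (FImp (FNot (Q0 a)) (fL (ENum 0) a)))
   (FImp (FNot (FEq a (ENum 2))) (fL a (ENum 2))))
   (FEq (fnx (ENum 0)) (ENum 1)))
   (FImp (FNot (FEq a (ENum 2))) (fL a (fnx a))))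
   (FImp (fL a b) (FOr (FEq b (fnx a)) (fL (fnx a) b))).
Definition frec a b := FImp (FNot (Q0 (fpar a)))
  (FAnd (FAnd (fL a (fpar a)) (FLt (fpar a) a)) (FImp (FLt b a) (FImp (fL b (fpar a)) (fL b a)))).
Definition fkind a b := let f := TG 6 (pair2 a b) in let d := TG 5 a in
  FImp (FNot (Q0 a))
  (FAnd (FImp (Q0 (TG 4 a)) (FAnd (fL d a) (FEq (fnx d) a)))
   (FImp (FNot (Q0 (TG 4 a))) (FImp (fL b a) (FAnd (fL (fnx b) a)
      (FAnd (FAnd (fle b f) (fL f a)) (FEq (fpar f) a)))))).
Definition fstart u i := let z := ENum 0 in let t := EAdd i (EAdd i i) in
  FAnd (FAnd (FAnd (Q0 (fst3 u z z)) (Q0 (fhd u z z)))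
   (FNot (Q0 (fva u z z t)))) (FNot (Q0 (fva u z z (EAdd t (ENum 1))))).
Definition frange u m n i := FLt (fva u m n i) (ENum 2).
Definition flimit u m i m' n' := let b := TG 17 (pair3 u m i) in let k := TG 18 (pair3 u m i) in
  let db := TG 19 (pair4 u i m' n') in let dn := TG 20 (pair4 u i m' n') in
  FImp (FNot (Q0 m))
  (FAnd (FAnd (FAnd (FEq (fst3 u m (ENum 0)) (ENum 1)) (Q0 (fhd u m (ENum 0))))
   (FImp (FNot (Q0 (fva u m (ENum 0) i))) (FAnd (fL b m)
     (FImp (FAnd (fL m' m) (FOr (fL b m') (FAnd (FEq b m') (FNot (FLt n' k)))))
       (FNot (Q0 (fva u m' n' i)))))))
   (FImp (FAnd (Q0 (fva u m (ENum 0) i)) (fL m' m))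
     (FAnd (FAnd (fL db m) (FOr (fL m' db) (FAnd (FEq m' db) (FNot (FLt dn n')))))
        (Q0 (fva u db dn i))))).
Definition fstep u m n i := FImp (fbf u m n)
  (FAnd (FAnd (FAnd (FAnd (FAnd (FAnd (FAnd
    (FNot (Q0 (fw 14 u m n))) (FEq (N1 (fst3 u m (N1 n))) (fw 14 u m n)))
    (FImp (Q0 (fw 13 u m n)) (FEq (fhd u m (N1 n)) (N1 (fhd u m n)))))
    (FImp (FNot (Q0 (fw 13 u m n))) (FEq (fhd u m (N1 n)) (ESub (fhd u m n) (ENum 1)))))
    (FImp (FEq i (fh3 u m n)) (FEq (fva u m (N1 n) i) (fw 10 u m n))))
    (FImp (FEq i (EAdd (fh3 u m n) (ENum 1))) (FEq (fva u m (N1 n) i) (fw 11 u m n))))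
    (FImp (FEq i (EAdd (fh3 u m n) (ENum 2))) (FEq (fva u m (N1 n) i) (fw 12 u m n))))
    (FImp (FAnd (FAnd (FNot (FEq i (fh3 u m n))) (FNot (FEq i (EAdd (fh3 u m n) (ENum 1)))))
        (FNot (FEq i (EAdd (fh3 u m n) (ENum 2)))))
      (FEq (fva u m (N1 n) i) (fva u m n i)))).
Definition fend u := let m := fme u in let n := fne u in
  FAnd (FAnd (FAnd (FAnd (FEq (fme (ENum 0)) (ENum 2)) (Q0 (fne (ENum 0))))
   (FOr (fL m (ENum 2)) (FAnd (FEq m (ENum 2)) (Q0 n))))
   (Q0 (fw 14 u m n)))
   (FImp (FNot (Q0 u)) (FAnd (FImp (Q0 (fhd u m n)) (FNot (Q0 (fw 10 u m n))))
      (FImp (FNot (Q0 (fhd u m n))) (FNot (Q0 (fva u m n (ENum 0))))))).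
Definition frow q r a m n := FImp (FAnd (FEq (fst3 (ENum 0) m n) (ENum q)) (FEq (fsc (ENum 0) m n) (ENum r)))
  (FEq (fac (ENum 0) m n) (ENum a)).
Definition fother u m n := FImp (FNot (Q0 u))
  (FNot (Q0 (EBit 2 (EPair (EPair (fst3 u m n) (fsc u m n)) (fac u m n))))).
Definition finput r u b := FEq
  (EAdd (fva u (ENum 0) (ENum 0) (EAdd (EMul (3 * half) b) (ENum (3 * r + 2)))) (EBit (6 * r + 2) b)) (ENum 1).
Definition fal (c : triple) m := let A := TG 21 (pair2 (ENum (rcode c)) m) in
  let k := TG 22 (pair2 (ENum (rcode c)) m) in let z := ENum 0 in
  FAnd (fle m A) (FOr (FEq A (ENum 2)) (FOr (FAnd (FNot (FBool c.1.1)) (Q0 (fva z A k (ENum 0))))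
   (FOr (FAnd (FNot (FBool c.1.2)) (Q0 (fva z A k (ENum 1)))) (FAnd (FNot (FBool c.2)) (Q0 (fva z A k (ENum 2))))))).
Definition frounds (c : triple) m0 m m' m1 n1 m2 n2 m3 n3 := let z := ENum 0 in let cc := ENum (rcode c) in
  FImp (FAnd (FAnd (FAnd (FAnd (FAnd (fle m0 m) (fL m m')) (fL m' (TG 21 (pair2 cc m0))))
    (FImp (FBool c.1.1) (FAnd (FAnd (fle m m1) (fL m1 m')) (Q0 (fva z m1 n1 (ENum 0))))))
    (FImp (FBool c.1.2) (FAnd (FAnd (fle m m2) (fL m2 m')) (Q0 (fva z m2 n2 (ENum 1))))))
    (FImp (FBool c.2) (FAnd (FAnd (fle m m3) (fL m3 m')) (Q0 (fva z m3 n3 (ENum 2))))))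
  (FLt (TG 23 (pair3 cc m0 m)) (TG 23 (pair3 cc m0 m'))).
(** A trivial equation whose purpose is its evaluation: without failed look-ups it shows that the
    coded function has a value at the first variable. *)
Definition ftotal := FEq (EG (v 0)) (EG (v 0)).

Section Formula.
Variables (n : nat) (t : table n).

Definition halting_triples := [seq c <- enum {: triple} | (t (limit_state n, c)).2 == None].
Definition clauses : seq form :=
  [:: ftotal; forder (v 0) (v 1) (v 2); frec (v 0) (v 1); fkind (v 0) (v 1); fstart (v 0) (v 1);
      frange (v 0) (v 1) (v 2) (v 3); flimit (v 0) (v 1) (v 2) (v 3) (v 4);
      fstep (v 0) (v 1) (v 2) (v 3); fend (v 0); fother (v 0) (v 1) (v 2)]
  ++ [seq finput r (v 0) (v 1) | r <- iota 0 half]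
  ++ [seq frow (val qr.1) (rcode qr.2) (acode (t qr)) (v 0) (v 1) | qr <- enum {: 'I_n.+2 * triple}]
  ++ [seq fal c (v 0) | c <- halting_triples]
  ++ [seq frounds c (v 0) (v 1) (v 2) (v 3) (v 4) (v 5) (v 6) (v 7) (v 8) | c <- halting_triples].
Definition formula := fexp (FAll clauses).

Let asg (l : seq nat) : vars := fun i => nth 0 l (i - 10).

Section At.
Variables (T : tracks) (r : vars).
Let g := gof T.
Local Notation a i := (r (10 + i)).
Local Notation X := (fun r => T (6 * r + 2)).

Lemma holds_formula : evi g T r formula = 0 <->
  [/\ [/\ order_ok g (a 0) (a 1) (a 2), par_ok g (a 0) (a 1), kind_ok g (a 0) (a 1), start_ok g (a 0) (a 1) &
      range_ok g (a 0) (a 1) (a 2) (a 3)],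
    [/\ limit_ok g (a 0) (a 1) (a 2) (a 3) (a 4), step_ok g (a 0) (a 1) (a 2) (a 3), end_ok g (a 0) &
      a 0 != 0 -> X 0 (npair (npair (st g (a 0) (a 1) (a 2)) (sc g (a 0) (a 1) (a 2))) (ac g (a 0) (a 1) (a 2)))],
    forall k, k < half -> va g (a 0) 0 0 (3 * (half * a 1 + k) + 2) + X k (a 1) = 1,
    forall qr, row_ok g (val qr.1) (rcode qr.2) (acode (t qr)) (a 0) (a 1) &
    forall c, (t (limit_state n, c)).2 = None -> al_ok g c (a 0) /\
       rounds_ok g c (a 0) (a 1) (a 2) (a 3) (a 4) (a 5) (a 6) (a 7) (a 8)].
Proof.
have hc c : c \in halting_triples <-> (t (limit_state n, c)).2 = None.
  by rewrite mem_filter mem_enum andbT; split=> /eqP.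
have hi k : holds g T r (finput k (v 0) (v 1)) =
    (va g (a 0) 0 0 (3 * (half * a 1 + k) + 2) + X k (a 1) == 1).
  transitivity (va g (a 0) 0 0 (evi g T r (EMul (3 * half) (v 1)) + (3 * k + 2)) + X k (a 1) == 1).
    by [].
  have -> : 3 * (half * a 1 + k) + 2 = 3 * half * a 1 + (3 * k + 2) by lia.
  by rewrite ev_mul.
have ho : holds g T r (fother (v 0) (v 1) (v 2)) =
  ((a 0 != 0) ==> X 0 (npair (npair (st g (a 0) (a 1) (a 2)) (sc g (a 0) (a 1) (a 2))) (ac g (a 0) (a 1) (a 2)))).
  by rewrite /fother /=; congr (_ ==> _); case: (T _ _).
have -> : evi g T r formula = 0 <-> holds g T r (FAll clauses).
  by rewrite -fexpP; split=> /eqP.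
have all10 (P : pred form) x1 x2 x3 x4 x5 x6 x7 x8 x9 y : all P [:: x1; x2; x3; x4; x5; x6; x7; x8; x9; y] =
  [&& P x1, P x2, P x3, P x4, P x5, P x6, P x7, P x8, P x9, P y & true] by [].
rewrite holdsAll /clauses !all_cat !all_map; split.
  case/and5P => hb /allP h2 /allP h3 /allP h4 /allP h5.
  move: hb; rewrite all10 ho => /andP [_ /and5P [k1 k2 k3 k4 /and5P [k5 k6 k7 k8 /andP [/implyP k9 _]]]].
  split=> //.
  - by move=> k kh; apply/eqP; rewrite -hi; apply: h2; rewrite mem_iota.
  - by move=> qr; apply: h3; rewrite -enumT mem_enum.
  - by move=> c /hc h; split; [exact: h4|exact: h5].
move=> [[k1 k2 k3 k4 k5] [k6 k7 k8 /implyP k9] k10 k11 k12].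
apply/and5P; split.
- rewrite all10 ho; apply/and5P; split=> //; first exact: eqxx.
  by apply/and5P; split=> //; rewrite andbT; apply/andP; split=> //; exact/implyP.
- apply/allP => k; rewrite mem_iota => /andP [_ kh].
  suff h : holds g T r (finput k (v 0) (v 1)) by exact: h.
  by rewrite hi; apply/eqP; exact: k10.
- by apply/allP => qr _; exact: k11.
- by apply/allP => c /hc /k12 [].
- by apply/allP => c /hc /k12 [].
Qed.
End At.

Lemma Phi_cert T : Phi formula T <-> cert (gof T) (fun r => T (6 * r + 2)) t.
Proof.
split=> [hP|[h1 h2 h3 h4 h5 h6 h7 h8 h9 h10 h11 h12 h13] r]; last first.
  apply/holds_formula; split.
  - by split.
  - by split; [exact: h7|exact: h8|exact: h9|exact: h11].
  - by move=> k kh; exact: h5.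
  - by case=> q c; exact: h10.
  - by move=> c hc; split; [exact: h12|exact: h13].
have h l := proj1 (holds_formula T (asg l)) (hP (asg l)).
split.
- by move=> a b c; have [[]] := h [:: a; b; c].
- by move=> a b; have [[]] := h [:: a; b].
- by move=> a b; have [[]] := h [:: a; b].
- by move=> a b; have [[]] := h [:: a; b].
- by move=> u b k kh; have [_ _ hk _ _] := h [:: u; b]; exact: hk.
- by move=> a b c d; have [[]] := h [:: a; b; c; d].
- by move=> a b c d f; have [_ []] := h [:: a; b; c; d; f].
- by move=> a b c d; have [_ []] := h [:: a; b; c; d].
- by move=> a; have [_ []] := h [:: a].
- by move=> q c m k; have [_ _ _ hk _] := h [:: m; k]; exact: hk (q, c).
- by move=> a b c; have [_ []] := h [:: a; b; c].
- by move=> c m hc; have [_ _ _ _ hk] := h [:: m]; have [] := hk c hc.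
- move=> c a0 a1 a2 a3 a4 a5 a6 a7 a8 hc.
  have [_ _ _ _ hk] := h [:: a0; a1; a2; a3; a4; a5; a6; a7; a8].
  by have [] := hk c hc.
Qed.

Lemma formula_total T r : evp T r formula = 0 -> exists j, gbit T (r 10) j.
Proof.
have key l f : evp T r (fexp (foldl FAnd f l)) = 0 -> evp T r (fexp f) = 0.
  by elim: l f => //= a l IH f /IH /=; lia.
move=> h; have h1 : evp T r (fexp ftotal) = 0.
  by have /= := key (behead clauses) (FAnd (FBool true) ftotal) h; lia.
case e : (first (gbit T (r 10)) (r 0)) => [|j]; last by exists j; have [] := firstS e.
by move: h1; rewrite -[evp T r _]/((0 + (first (gbit T (r 10)) (r 0) == 0)) +
  (0 + (first (gbit T (r 10)) (r 0) == 0)) + ((0 + (first (gbit T (r 10)) (r 0) == 0)) +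
  (0 + (first (gbit T (r 10)) (r 0) == 0)))) e.
Qed.

Lemma formula_all (p : expr -> bool) : (forall b, p (ENum b)) ->
  (forall a b, p (EAdd a b) = p a && p b) -> all (p \o fexp) clauses -> p formula.
Proof.
move=> pn pa; rewrite /formula /FAll.
have : p (fexp (FBool true)) by exact: pn.
elim: clauses (FBool true) => //= f l IH e he /andP [hf hl].
by apply: IH => //=; rewrite pa he hf.
Qed.

Lemma all_clauses (p : pred form) : p ftotal -> p (forder (v 0) (v 1) (v 2)) ->
  p (frec (v 0) (v 1)) -> p (fkind (v 0) (v 1)) -> p (fstart (v 0) (v 1)) ->
  p (frange (v 0) (v 1) (v 2) (v 3)) -> p (flimit (v 0) (v 1) (v 2) (v 3) (v 4)) ->
  p (fstep (v 0) (v 1) (v 2) (v 3)) -> p (fend (v 0)) -> p (fother (v 0) (v 1) (v 2)) ->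
  (forall k, k < half -> p (finput k (v 0) (v 1))) ->
  (forall q r a, p (frow q r a (v 0) (v 1))) -> (forall c, p (fal c (v 0))) ->
  (forall c, p (frounds c (v 0) (v 1) (v 2) (v 3) (v 4) (v 5) (v 6) (v 7) (v 8))) ->
  all p clauses.
Proof.
move=> k1 k2 k3 k4 k5 k6 k7 k8 k9 k10 h1 h2 h3 h4.
rewrite /clauses !all_cat !all_map; apply/and5P; split.
- by do ?[apply/andP; split=> //].
- by apply/allP => k; rewrite mem_iota => /andP [_ kh]; exact: h1.
- by apply/allP => qr _; exact: h2.
- by apply/allP => c _; exact: h3.
- by apply/allP => c _; exact: h4.
Qed.

Lemma formula_vars : evr 10 dim formula.
Proof. by apply: formula_all => //; exact: all_clauses. Qed.

Lemma formula_inputs : inputs formula.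
Proof.
apply: formula_all => //; apply: all_clauses => // k kh.
by rewrite /= (_ : (6 * k + 2) %% 3 == 2) //; lia.
Qed.

Lemma formula_bits : bits NV formula.
Proof.
apply: formula_all => //; apply: all_clauses => // k kh.
rewrite /= /goodo /isvar /= (_ : (6 * k + 2) %% 3 = 2); last by lia.
by rewrite andbF !andbT; move: kh; rewrite /half /NV; lia.
Qed.

Lemma formula_dep : dim + dep formula <= NV.
Proof.
suff h : dep formula <= 27 by exact: (leq_add (leqnn 19) h).
rewrite /formula /FAll; have h0 : dep (fexp (FBool true)) <= 27 by [].
have : all (fun f => dep (fexp f) < 27) clauses by exact: all_clauses.
elim: clauses (FBool true) h0 => //= f l IH e he /andP [hf hl].
by apply: IH => //=; rewrite geq_max he.
Qed.
End Formula.

(** * Soundness of certificates *)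

Lemma rcode_inj : injective rcode.
Proof.
move=> [[a b] c] [[a' b'] c'] /pair_inj [h1 /pair_inj [h2 h3]]; move: h1 h2 h3 => /=.
by case: a; case: a'; case: b; case: b'; case: c; case: c'.
Qed.

Section Sound.
Variables (g : nat -> nat) (X : nat -> nat -> bool) (n : nat) (t : table n).
Hypothesis C : cert g X t.
Local Notation L := (L g).
Definition before a b : Prop := L a b.

Lemma order_parts a b c :
  [/\ ~~ L a a, L a b -> L b c -> L a c, [|| a == b, L a b | L b a], a != 0 -> L 0 a &
   [/\ a != 2 -> L a 2, nxt g 0 = 1, a != 2 -> L a (nxt g a) & L a b -> (b == nxt g a) || L (nxt g a) b]].
Proof.
have := c_order C a b c; rewrite /order_ok -!andbA => /and5P [h1 /implyP h2 h3 /implyP h4].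
case/and4P => /implyP h5 /eqP h6 /implyP h7 /implyP h8.
split=> //; by move=> l1 l2; apply: h2; rewrite l1.
Qed.

Lemma cert_ladder : ladder before (nxt g) (par g).
Proof.
split.
- by move=> i; have [/negP h] := order_parts i i i.
- by move=> i j k; have [_ h] := order_parts i j k.
- move=> i j; have [_ _ h _ _] := order_parts i j i.
  by case/or3P: h => [/eqP e|h|h]; [exact: Or31|exact: Or32|exact: Or33].
- by move=> m /eqP h; have [_ _ _ h1 _] := order_parts m m m; exact: h1.
- by move=> m /eqP h; have [_ _ _ _ [h1 _ _ _]] := order_parts m m m; exact: h1.
- by have [_ _ _ _ []] := order_parts 0 0 0.
- by move=> m /eqP h; have [_ _ _ _ [_ _ h1 _]] := order_parts m m m; exact: h1.
- by move=> m i h; have [_ _ _ _ [_ _ _ h1]] := order_parts m i m; case/orP: (h1 h) => [/eqP|]; [left|right].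
- by move=> c /eqP h; have := c_par C c c; rewrite /par_ok h => /andP [/andP []].
- by move=> c /eqP h; have := c_par C c c; rewrite /par_ok h => /andP [/andP []].
- move=> c i /eqP h l1 l2; have := c_par C c i; rewrite /par_ok h => /andP [_].
  by rewrite l1 /= => /implyP h1; exact: h1.
- move=> m /eqP m0; case: (ty g m =P 0) => e; [left|right].
    have := c_kind C m m; rewrite /kind_ok m0 e /= andbT => /andP [h1 /eqP h2].
    by exists (pd g m).
  have k b : L b m -> L (nxt g b) m && (le g b (fs g m b) && L (fs g m b) m && (par g (fs g m b) == m)).
    by have := c_kind C m b; rewrite /kind_ok m0 (introF eqP e) /= => /implyP.
  split=> [j /k /andP [] //|b /k /andP [_ /andP [/andP [h1 h2] /eqP h3]]].
  exists (fs g m b) => //; by case/orP: h1 => [/eqP|]; [left|right].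
Qed.

Let lad := cert_ladder.
Let ltT := lt_trans lad.
Local Notation tm := (tm before).

Variable x : real.
Hypothesis hX : forall r b, r < half -> X r b = x (half * b + r).

Definition matches n' u m k (c : config n') := [/\ st g u m k = val (state c), hd g u m k = hpos c &
  forall i, va g u m k i = ~~ cell c i].

Section Track.
Variables (n' : nat) (t' : table n') (u : nat).
Hypothesis obeys : forall m k q r, st g u m k = val q -> sc g u m k = rcode r ->
  ac g u m k = acode (t' (q, r)).
Local Notation run := (run t' x).

Lemma bool_va m k i : va g u m k i = ~~ (va g u m k i == 0).
Proof. by have := c_range C u m k i; rewrite /range_ok; case: (va _ _ _ _ _) => [|[]]. Qed.

Lemma matches_sc m k (c : config n') : matches u m k c -> sc g u m k = rcode (scan c).
Proof.
move=> [_ h2 h3]; rewrite /sc /rcode /scan !h3 /hd3 h2 /=.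
have -> : hpos c + (hpos c + hpos c) = 3 * hpos c by lia.
by rewrite addn1 addn2.
Qed.

Lemma matches_ac m k (c : config n') : matches u m k c -> let a := instr t' c in
  [/\ w0 g u m k = ~~ a.1.1.1.1, w1 g u m k = ~~ a.1.1.1.2, w2 g u m k = ~~ a.1.1.2,
   di g u m k = ~~ a.1.2 & ns g u m k = if a.2 is Some q then q.+1 else 0].
Proof.
move=> h a; have := obeys (let: And3 h1 _ _ := h in h1) (matches_sc h).
rewrite -/(instr t' c) -/a /ac /acode.
by move=> /pair_inj [e1 /pair_inj [e2 /pair_inj [e3 /pair_inj [e4 e5]]]].
Qed.

Lemma matches_next m k (c : config n') : bf g u m k -> matches u m k c ->
  (instr t' c).2 <> None /\ matches u m k.+1 (nextc t' c).
Proof.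
move=> hb h; have [e0 e1 e2 e3 e4] := matches_ac h.
have hs i := c_step C u m k i; rewrite /step_ok hb /= (addn1 k) in hs.
have [h1 h2 h3] := h.
have [hN hS hR hL] : [/\ ns g u m k != 0, st g u m k.+1 + 1 = ns g u m k,
  di g u m k = 0 -> hd g u m k.+1 = hd g u m k + 1 & di g u m k <> 0 -> hd g u m k.+1 = hd g u m k - 1].
  have := hs 0; rewrite -!andbA => /and5P [-> /eqP -> /implyP r /implyP l _].
  by split=> // [/eqP /r /eqP|/eqP /l /eqP].
have [q eq] : exists q, (instr t' c).2 = Some q.
  by move: hN; rewrite e4; case: (instr t' c).2 => // q _; exists q.
split; first by rewrite eq.
have he : hd3 g u m k = 3 * hpos c by rewrite /hd3 h2; lia.
rewrite /nextc eq; split=> /=.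
- by move: hS; rewrite e4 eq addn1 => -[].
- rewrite /moved; move: hR hL; rewrite e3 h2; case: (instr t' c).1.2 => [hR _|_ hL].
    by rewrite hR // addn1.
  by rewrite hL // subn1.
move=> i; have := hs i; rewrite -!andbA => /and5P [_ _ _ _ /and4P].
rewrite he e0 e1 e2 h3 addn1 addn2 /written; case: (instr t' c).1.1 => [[a b] d] /=.
move=> [/implyP k0 /implyP k1 /implyP k2 /implyP k3].
case: (i =P _) k0 k1 k2 k3 => [_ k0 _ _ _|n0]; first exact/eqP/k0.
case: (i =P _) => [_ _ k1 _ _|n1]; first exact/eqP/k1.
case: (i =P _) => [_ _ _ k2 _|n2 _ _ _ k3]; first exact/eqP/k2.
exact/eqP/k3.
Qed.

Definition upto m := m = me g u \/ L m (me g u).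

Lemma end_parts : [/\ me g 0 = 2, ne g 0 = 0, L (me g u) 2 \/ me g u = 2 /\ ne g u = 0,
  ns g u (me g u) (ne g u) = 0 &
  u <> 0 -> if hd g u (me g u) (ne g u) == 0 then w0 g u (me g u) (ne g u) <> 0
    else va g u (me g u) (ne g u) 0 <> 0].
Proof.
have := c_end C u; rewrite /end_ok -!andbA => /and5P [/eqP h1 /eqP h2 h3 /eqP h4 h5]; split=> //.
  by case/orP: h3 => [|/andP [/eqP ? /eqP ?]]; [left|right].
move=> /eqP u0; move: h5; rewrite u0 /=; case: (hd _ _ _ _ == 0) => /=.
  by rewrite andbT => /eqP.
by move/eqP.
Qed.

Lemma end_tame : Acc before 2 -> Acc before (me g u).
Proof. by move=> h; have [_ _ [l|[-> _]] _ _] := end_parts; [exact: (Acc_inv h l)|]. Qed.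

(** The induction uses only points below [m], so the record is true on the well-founded part of the
    order, whatever is claimed beyond it. *)
Lemma track m : Acc before m -> upto m -> forall k, L m (me g u) \/ k <= ne g u ->
  matches u m k (run (oplus (tm m) k)).
Proof.
elim=> {}m hA IH um; have Am : Acc before m by constructor.
have prev m' k : L m' m -> matches u m' k (run (oplus (tm m') k)).
  move=> l; have l' : L m' (me g u) by case: um => [<-//|l2]; exact: ltT l l2.
  by apply: IH => //; [right|left].
elim=> [_|k IHk hk]; last first.
  rewrite [oplus _ _]/= run_succ; apply: (proj2 (matches_next _ (IHk _))).
    rewrite /bf; case: um => [em|->//]; case: hk => [->//|hk].
    by rewrite -em eqxx hk orbT.
  by case: hk => h; [left|right; exact: ltnW].
have [m0|m0] := pselect (m = 0).
  rewrite m0 (run0 _ _ (tm_0 lad)).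
  have s0 i : st g u 0 0 = 0 /\ hd g u 0 0 = 0 /\ va g u 0 0 (3 * i) = 1 /\ va g u 0 0 (3 * i + 1) = 1.
    have := c_start C u i; rewrite /start_ok (_ : i + (i + i) = 3 * i); last by lia.
    rewrite -!andbA => /and4P [/eqP e1 /eqP e2 e3 e4]; split=> //; split=> //.
    by rewrite (bool_va 0 0 (3 * i)) e3 (bool_va 0 0 (3 * i + 1)) e4.
  have [e1 [e2 _]] := s0 0; split=> // i /=.
  have [_ [_ [e3 e4]]] := s0 (i %/ 3).
  have ei : i = 3 * (i %/ 3) + i %% 3 by lia.
  have : i %% 3 < 3 by lia.
  case e5: (i %% 3) => [|[|[|//]]] _ /=.
  - by rewrite {1}ei e5 addn0 e3.
  - by rewrite {1}ei e5 e4.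
  have hr : (i %/ 3) %% half < half by rewrite ltn_mod.
  have := c_input C u (i %/ 3 %/ half) hr; rewrite hX //.
  have -> : half * (i %/ 3 %/ half) + (i %/ 3) %% half = i %/ 3 by rewrite mulnC -divn_eq.
  have -> : 3 * (i %/ 3) + 2 = i by lia.
  by case: (x _); lia.
have la := tm_limit lad Am m0; rewrite (run_lim _ _ la).
have hl i m' n' := c_limit C u m i m' n'.
have dec d : olt d (tm m) -> exists m' k', L m' m /\ oeq d (oplus (tm m') k').
  by exact: (stage_tm ltT Am).
have lim i m' n' := implyP (hl i m' n') (introN eqP m0).
have [e1 e2] : st g u m 0 = 1 /\ hd g u m 0 = 0.
  by have := lim 0 0 0; rewrite -!andbA => /and4P [/eqP -> /eqP ->].
split=> // i; rewrite [cell _ _]/=.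
(* If the cell is recorded as empty, the record from the stage [Nb], [Nn] on, true by induction,
   keeps it empty. If it is recorded as occupied, [Db], [Dn] yields a true occupied stage after any
   given one. *)
have [hn|hy] := pselect (va g u m 0 i = 0); last first.
  have v1 : va g u m 0 i == 0 = false by apply/eqP.
  case: asboolP => [h|_]; last by rewrite bool_va v1.
  exfalso.
  have lb m' n' := lim i m' n'; rewrite v1 /= in lb.
  have Lb : L (Nb g u m i) m by have := lb 0 0; rewrite -!andbA => /and4P [].
  have [d [cd dm hd]] := h _ (tm_lt (Nn g u m i) Am Lb).
  have [m' [k' [l e]]] := dec d dm.
  have [_ _ hc] := prev m' k' l; move: hd; rewrite (run_eq _ _ e) => hd.
  have cd' := ole_trans cd (proj1 e).
  have := lb m' k'; rewrite -!andbA => /and4P [_ _ _ /andP [/implyP hv _]].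
  have : va g u m' k' i != 0; last by rewrite hc hd.
  apply: hv; rewrite l /=; have [eq|l1|l1] := lt_total lad (Nb g u m i) m'.
  - rewrite eq eqxx /=; apply/orP; right; rewrite -leqNgt leqNgt; apply/negP => kk.
    by rewrite eq in cd'; exact: (olt_irr (ole_lt_trans cd' (oplus_ltn _ kk))).
  - by rewrite [L _ _]l1.
  - case: (@olt_irr (oplus (tm (Nb g u m i)) (Nn g u m i))).
    apply: ole_lt_trans cd' _; apply: olt_le_trans (oplus_le _ _).
    exact: tm_lt (Acc_inv Am Lb) l1.
rewrite hn; apply: esym; apply/eqP; rewrite eqb0 negbK; apply/asboolP => c /dec [m' [k' [l e]]].
have := lim i m' k'; rewrite -!andbA => /and4P [_ _ _ /implyP]; rewrite hn l => /(_ isT).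
set a := Db _ _ _ _ _; set b := Dn _ _ _ _ _; move=> /and3P [l1 l2 /eqP v0].
exists (oplus (tm a) b); split.
- apply: ole_trans (proj1 e) _; case/orP: l2 => [l2|/andP [/eqP -> l2]].
    by apply: ole_trans (oplus_le _ _); exact: oltW (tm_lt k' (Acc_inv Am l1) l2).
  by apply: oplus_leq; rewrite leqNgt.
- exact: tm_lt Am l1.
- by have [_ _ hc] := prev a b l1; move: v0; rewrite hc; case: (cell _ _).
Qed.

Lemma track_bf m k : Acc before m -> upto m -> bf g u m k -> ~ halting t' (run (oplus (tm m) k)).
Proof.
move=> Am um hb; have [h _] : (instr t' (run (oplus (tm m) k))).2 <> None /\ True; last exact: h.
split=> //; apply: (proj1 (matches_next hb (track Am um _))).
by case/orP: hb => [|/andP [_ /ltnW]]; [left|right].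
Qed.

Lemma stops : Acc before (me g u) ->
  let s := oplus (tm (me g u)) (ne g u) in halts_at t' x s /\ (u <> 0 -> written t' (run s) 0 = false).
Proof.
move=> A s; have [_ _ _ hn hw] := end_parts.
have hm : matches u (me g u) (ne g u) (run s) by apply: track => //; [left|right].
have [e0 _ _ _ e4] := matches_ac hm; split; first split.
- by move: e4; rewrite hn /halting; case: (_.2).
- move=> b /olt_oplus [bl|[k kn e]].
    have [m [k [l e]]] := stage_tm ltT A bl; rewrite (run_eq _ _ e).
    by apply: track_bf; [exact: (Acc_inv A l)|right|rewrite /bf [L _ _]l].
  by rewrite (run_eq _ _ e); apply: track_bf => //; [left|rewrite /bf eqxx kn orbT].
move=> /hw; have [h1 h2 h3] := hm; rewrite h2 /written e0; case: (hpos _) => [|j] /=.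
  by case: (instr _ _).1.1 => [[[] b] d].
by rewrite h3; case: (instr _ _).1.1 => [[a b] d] /=; case: (cell _ _).
Qed.

End Track.

(** * Ill-founded certificates *)

Section Bounded.
Hypothesis obeys : forall m k q r, st g 0 m k = val q -> sc g 0 m k = rcode r ->
  ac g 0 m k = acode (t (q, r)).
Local Notation run := (run t x).
Hypothesis wild : ~ Acc before 2.
Let k := cut before (Acc before).

Let me0 : me g 0 = 2. Proof. by have [] := end_parts 0. Qed.

Let tame_lt m : Acc before m -> L m 2.
Proof. by move=> h; apply: (lt_2 lad) => e; apply: wild; rewrite -e. Qed.

Lemma tame_track m j : Acc before m -> matches 0 m j (run (oplus (tm m) j)).
Proof.
by move=> h; apply: (track obeys) => //; rewrite /upto me0; [right|left]; exact: tame_lt.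
Qed.

(** The recorded end of the given machine is the top, which lies above all accessible points, so
    each stage there has a recorded and true next step. *)
Lemma wild_running d : olt d k -> ~ halting t (run d).
Proof.
move=> /(stage_cut ltT (fun _ h => h) (fun i j h => @Acc_inv _ _ j h i)) [m [j [Am e]]].
rewrite (run_eq _ _ e); apply: (track_bf obeys) => //; first by right; rewrite me0; exact: tame_lt.
by rewrite /bf me0 (tame_lt Am).
Qed.

Definition bitof (c : triple) i := if i is 0 then c.1.1 else if i is 1 then c.1.2 else c.2.

Lemma acc_max a b : Acc before a -> Acc before b ->
  exists m, [/\ Acc before m, le g a m & le g b m].
Proof.
move=> ha hb; have [->|l|l] := lt_total lad a b.
- by exists b; rewrite /le eqxx.
- by exists b; rewrite /le eqxx [L a b]l orbT.
- by exists a; rewrite /le eqxx [L b a]l orbT.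
Qed.

Lemma le_trans a b c : le g a b -> le g b c -> le g a c.
Proof.
move=> /orP [/eqP ->//|h1] /orP [/eqP <-|h2]; rewrite /le; first by rewrite h1 orbT.
by rewrite [L _ c](ltT h1 h2) orbT.
Qed.

Lemma le_lt_trans a b c : le g a b -> L b c -> L a c.
Proof. by move=> /orP [/eqP ->//|h1] h2; exact: ltT h1 h2. Qed.

Lemma lt_le_trans a b c : L a b -> le g b c -> L a c.
Proof. by move=> h1 /orP [/eqP <-//|h2]; exact: ltT h1 h2. Qed.

Lemma tame_wild a b : Acc before a -> ~ Acc before b -> L a b.
Proof.
move=> ha hb; have [e|//|l] := lt_total lad a b; first by case: hb; rewrite -e.
by case: hb; exact: (Acc_inv ha l).
Qed.

(* The machine cannot halt at the limit of the well-founded part: the rounds in which all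
   the bits read there are seen would be counted by an unbounded set of numbers below one. *)
Lemma wild_not_halting : ~ halting t (run k).
Proof.
have lk : olimit k := cut_limit before (Acc_0 lad).
have dec d := @stage_cut before ltT (Acc before) d (fun _ h => h) (fun i j h => @Acc_inv _ _ j h i).
move=> hh; pose c := scan (run k).
have ec i : i < 3 -> bitof c i = cell (run k) i.
  by rewrite /c (run_lim _ _ lk) /scan; case: i => [|[|[|]]].
have ht : (t (limit_state n, c)).2 = None.
  by move: hh; rewrite /halting /instr -/c {1}(run_lim _ _ lk).
(* A cell that is empty at the limit [k] is empty from some accessible point on; one that is
   occupied is seen again after every accessible point, which is [on]. *)
have off i : i < 3 -> exists2 m, Acc before m & ~~ bitof c i -> forall m' j, Acc before m' -> le g m m' ->
    va g 0 m' j i <> 0.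
  move=> i3; have [hi|hi] := pselect (cell (run k) i).
    by exists 0; [exact: (Acc_0 lad)|rewrite ec // hi].
  have [b bk hb] : exists2 b, olt b k & forall d, ole b d -> olt d k -> ~ cell (run d) i.
    apply: contrapT => hn; apply: hi; apply/(run_limP _ _ _ lk) => b bk.
    by apply: contrapT => hn'; apply: hn; exists b => // d h1 h2 h3; apply: hn'; exists d.
  have [m [j [Am e]]] := dec b bk.
  exists (nxt g m); first exact: (Acc_nx lad).
  move=> _ m' j' Am' hle v0.
  have [_ _ hc] := tame_track j' Am'.
  have hl : L m m' by apply: (@lt_le_trans m (nxt g m)) hle; apply: (nx_gt lad) => em; apply: wild; rewrite -em.
  apply: (hb (oplus (tm m') j')); last by move: v0; rewrite hc; case: (cell _ _).
    apply: ole_trans (proj1 e) _; apply: ole_trans (oplus_le _ _); exact: oltW (tm_lt j Am' hl).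
  exact: cut_lt.
have on i m : i < 3 -> Acc before m -> exists m' j, [/\ Acc before m', le g m m' &
    bitof c i -> va g 0 m' j i = 0].
  move=> i3 Am; case hb: (bitof c i); last by exists m, 0; rewrite /le eqxx.
  move: hb; rewrite ec // => /(run_limP _ _ _ lk) h.
  have [d [md dk hd]] := h (tm m) (cut_lt before 0 Am).
  have [m' [j [Am' e]]] := dec d dk; exists m', j; split=> //.
    have [->|l|l] := lt_total lad m m'; [by rewrite /le eqxx|by rewrite /le [L _ _]l orbT|].
    by case: (tm_le Am (ole_trans md (proj1 e)) l).
  by move=> _; have [_ _ hc] := tame_track j Am'; rewrite hc -(run_eq _ _ e) hd.
have [a0 A0 f0] := off 0 isT; have [a1 A1 f1] := off 1 isT; have [a2 A2 f2] := off 2 isT.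
have [b0 [B0 l0 l1]] := acc_max A0 A1.
have [m0 [M0 l2 l3]] := acc_max B0 A2.
(* Beyond [m0] no accessible stage shows a cell that is empty in [c], so the recorded first such
   stage lies in the ill-founded part. *)
pose A := al g (rcode c) m0.
have := c_al C m0 ht; rewrite /al_ok -/A => /andP [lA hA].
have nA : ~ Acc before A.
  move=> AA; case/orP: hA => [/eqP e|]; first by apply: wild; rewrite -e.
  case/or3P => /andP [hb /eqP v0].
  - exact: (f0 hb A _ AA (le_trans (le_trans l0 l2) lA) v0).
  - exact: (f1 hb A _ AA (le_trans (le_trans l1 l2) lA) v0).
  - exact: (f2 hb A _ AA (le_trans l3 lA) v0).
(* An inaccessible point still below [A]: the clause on rounds applies up to it, and its value will
   bound all values at accessible points. *)
have [w Aw wA] := below_wild nA.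
have round m : Acc before m -> le g m0 m -> exists2 m', Acc before m' & L m m' /\
    forall w', le g m' w' -> L w' A -> rounds g (rcode c) m0 m < rounds g (rcode c) m0 w'.
  move=> Am lm.
  have [p0 [j0 [P0 q0 e0]]] := on 0 m isT Am.
  have [p1 [j1 [P1 q1 e1]]] := on 1 m isT Am.
  have [p2 [j2 [P2 q2 e2]]] := on 2 m isT Am.
  have [s0 [S0 k0 k1]] := acc_max P0 P1.
  have [s1 [S1 k2 k3]] := acc_max S0 P2.
  have ls : L s1 (nxt g s1) by apply: (nx_gt lad) => e; apply: wild; rewrite -e.
  exists (nxt g s1); first exact: (Acc_nx lad).
  split; first exact: le_lt_trans q2 (le_lt_trans k3 ls).
  move=> w' lw wA'; have := c_rounds C m0 m w' p0 j0 p1 j1 p2 j2 ht.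
  have far p : le g p s1 -> L p w'.
    by move=> lp; have := le_lt_trans lp ls; case/orP: lw => [/eqP <-//|h1 h2]; exact: ltT h2 h1.
  have h0 : c.1.1 ==> (le g m p0 && L p0 w' && (va g 0 p0 j0 0 == 0)).
    by apply/implyP => h; rewrite q0 (far p0 (le_trans k0 k2)) e0.
  have h1 : c.1.2 ==> (le g m p1 && L p1 w' && (va g 0 p1 j1 1 == 0)).
    by apply/implyP => h; rewrite q1 (far p1 (le_trans k1 k2)) e1.
  have h2 : c.2 ==> (le g m p2 && L p2 w' && (va g 0 p2 j2 2 == 0)).
    by apply/implyP => h; rewrite q2 (far p2 k3) e2.
  rewrite /rounds_ok lm h0 h1 h2 -/A wA' /=.
  by rewrite [L m w'](far m (le_trans q2 k3)).
have grow N : exists2 m, Acc before m & le g m0 m /\ N <= rounds g (rcode c) m0 m.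
  elim: N => [|N [m Am [lm hN]]]; first by exists m0; rewrite // /le eqxx.
  have [m' Am' [mm' hr]] := round m Am lm; exists m' => //; split.
    by apply: le_trans lm _; rewrite /le mm' orbT.
  apply: leq_ltn_trans hN (hr m' _ _); first by rewrite /le eqxx.
  exact: tame_wild.
(* The count at an accessible [m] has caught up with that at [w], but the round after [m] is
   finished before [w], so the latter must be larger. *)
have [m Am [lm hN]] := grow (rounds g (rcode c) m0 w).
have [m' Am' [_ hr]] := round m Am lm.
have := hr w _ wA; rewrite ltnNge hN => /(_ _) h.
by have := h (introT orP (or_intror (tame_wild Am' Aw))).
Qed.

(** The halting time is neither below [k] nor equal to it, and a limit beyond [k] is at least [k] +
    ω. *)
Lemma wild_bound nu : halts_at t x nu -> olimit nu -> ole (oplusw k) nu.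
Proof.
move=> [h1 h2] ln; apply: oplusw_le => //.
have [kn|nk] := ole_total k nu; last by case: (wild_running nk).
have [e|//] := ole_eqVlt kn.
by case: wild_not_halting; rewrite (run_eq _ _ e).
Qed.
End Bounded.
End Sound.

(** * Existence of certificates *)

Section Enumerate.
Variables (A : countType) (F : A -> ord -> ord) (top : ord).
Let gen w := foldr F ozero w.
Hypothesis om_top : olt omega top.
Hypothesis gen_top : exists w, oeq (gen w) top.
Hypothesis gen_om : forall n, exists w, oeq (gen w) (iter n oplusw ozero).

Lemma oplusw_iter_lt m n : m < n -> olt (iter m oplusw ozero) (iter n oplusw ozero).
Proof.
have h k : olt (iter k oplusw ozero) (iter k.+1 oplusw ozero) by exact: (oplusw_lt _ 0).
elim: n => // n IH; rewrite ltnS leq_eqVlt => /orP [/eqP -> //|/IH l].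
exact: olt_trans l (h n).
Qed.

(** Values of words may coincide as ordinals, so only first occurrences are kept. The prescribed
    multiples of ω make infinitely many of them, so that every number is the name of a point. *)
Lemma enumeration : exists th : nat -> ord,
  [/\ [/\ oeq (th 0) ozero, oeq (th 1) omega & oeq (th 2) top],
     forall i j, oeq (th i) (th j) -> i = j,
     forall k, exists w, th k = gen w &
     forall w, exists k, oeq (th k) (gen w)].
Proof.
have [w1 h1] := gen_om 1; have [w2 h2] := gen_top.
(* Three words come first, so that 0, 1 and 2 name the ordinals 0, ω and the top. *)
pose word i := if i is j.+3 then odflt [::] (unpickle j) else nth [::] [:: [::]; w1; w2] i.
pose e i := gen (word i).
have e1 : oeq (e 1) omega by exact: h1.
have e2 : oeq (e 2) top by exact: h2.
have eall w : exists i, e i = gen w by exists (pickle w).+3; rewrite /e -[word _]/(odflt [::] (unpickle (pickle w))) pickleK.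
pose new i := `[< forall j, j < i -> ~ oeq (e j) (e i) >].
have old i : exists2 j, j <= i & new j /\ oeq (e j) (e i).
  elim/ltn_ind: i => i IH; have [n|n] := pselect (new i); first by exists i; [|split; [|exact: oeq_refl]].
  have [j ji ej] : exists2 j, j < i & oeq (e j) (e i).
    by apply: contrapT => h; apply/n/asboolP => j ji ej; apply: h; exists j.
  have [k kj [nk ek]] := IH j ji; exists k; first exact: leq_trans kj (ltnW ji).
  by split=> //; exact: oeq_trans ek ej.
(* Pigeonhole: without new indices above [N], the [N.+2] distinct multiples of ω would have first
   occurrences among [N.+1] indices. *)
have more N : exists i, (N < i) && new i.
  apply: contrapT => hn.
  have small n : exists j : 'I_N.+1, oeq (e j) (iter n oplusw ozero).
    have [w hw] := gen_om n; have [i hi] := eall w; have [j _ [nj ej]] := old i.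
    have jN : j < N.+1 by rewrite ltnNge; apply/negP => l; apply: hn; exists j; rewrite l.
    by exists (Ordinal jN); apply: oeq_trans ej _; rewrite hi.
  have [f hf] := boolp.choice small.
  have inj : injective (fun i : 'I_N.+2 => f i).
    move=> i j /= ij; apply/val_inj; have := hf i; rewrite ij => hi.
    have [h _ ] := oeq_trans (oeq_sym hi) (hf j); have [_ h'] := oeq_trans (oeq_sym hi) (hf j).
    case: (ltngtP i j) => // /oplusw_iter_lt l; first by case: (olt_irr (ole_lt_trans h' l)).
    by case: (olt_irr (ole_lt_trans h l)).
  by have := leq_card _ inj; rewrite !card_ord ltnn.
pose next i := ex_minn (more i).
pose pos k := iter k next 0.
have posS k : pos k < pos k.+1 /\ new (pos k.+1) /\ forall i, pos k < i -> new i -> pos k.+1 <= i.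
  rewrite /= /next; case: ex_minnP => m /andP [h3 h4] h5; split=> //; split=> // i l n.
  by apply: h5; rewrite l.
have n0 : new 0 by apply/asboolP.
have npos k : new (pos k) by case: k => // k; have [_ []] := posS k.
have plt i j : i < j -> pos i < pos j.
  elim: j => // j IH; rewrite ltnS leq_eqVlt => /orP [/eqP ->|/IH l]; have [h _] := posS j => //.
  exact: ltn_trans l h.
have ple k : k <= pos k by elim: k => // k IH; exact: leq_ltn_trans IH (plt _ _ (ltnSn k)).
have pex i : new i -> exists k, pos k = i.
  move=> ni; have ex : exists k, i < pos k by exists i.+1; exact: ple.
  case: (ex_minnP ex) => -[//|k] l mn; exists k; apply/eqP; rewrite eqn_leq.
  have le : pos k <= i by rewrite leqNgt; apply/negP => /mn; rewrite ltnn.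
  rewrite le /= leqNgt; apply/negP => l2; have [_ [_ h]] := posS k.
  by have := h i l2 ni; rewrite leqNgt l.
have n1 : new 1.
  apply/asboolP => -[] // _ h; have [_ h'] := oeq_trans h e1.
  by case: (olt_irr (ole_lt_trans h' (proj1 omega_limit))).
have n2 : new 2.
  apply/asboolP => -[|[|//]] _ h; have [_ h'] := oeq_trans h e2.
    exact: (@olt0 _ (olt_le_trans om_top h')).
  exact: (olt_irr (olt_le_trans om_top (ole_trans h' (proj1 e1)))).
have p1 : pos 1 = 1.
  have [h [_ h']] := posS 0; apply/eqP; rewrite eqn_leq h andbT; exact: h'.
have p2 : pos 2 = 2.
  by have [h [_ h']] := posS 1; rewrite p1 in h h'; apply/eqP; rewrite eqn_leq h andbT; exact: h'.
exists (fun k => e (pos k)); split.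
- by rewrite p1 p2; split=> //; exact: oeq_refl.
- move=> i j h; case: (ltngtP i j) => // /plt l.
    by have /asboolP hj := npos j; case: (hj _ l h).
  by have /asboolP hi := npos i; case: (hi _ l (oeq_sym h)).
- by move=> k; exists (word (pos k)).
move=> w; have [i hi] := eall w; have [j _ [nj ej]] := old i; have [k pk] := pex j nj.
by exists k; rewrite pk -hi.
Qed.
End Enumerate.

(** ** Omega powers *)

Lemma oadd_le a b : ole a (oadd a b).
Proof. by case: b => B G; apply/oleP => x; exists (inl x); exact: ole_refl. Qed.

Lemma oadd_mono a b c : ole b c -> ole (oadd a b) (oadd a c).
Proof.
elim: b c => B G IH [C H] /= h [x|y]; first by exists (inl x); exact: ole_refl.
by have [z yz] := h y; exists (inr z); exact: IH.
Qed.

Lemma oadd_succ a b : ole (osucc (oadd a b)) (oadd a (osucc b)).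
Proof. by apply/osucc_le; exists (inr tt); exact: ole_refl. Qed.

Lemma oadd_pos a b : olt ozero b -> ole (osucc a) (oadd a b).
Proof.
case: b => B G [y _]; apply/osucc_le; exists (inr y); exact: oadd_le.
Qed.

Lemma oplusw_oadd a b : ole omega b -> ole (oplusw a) (oadd a b).
Proof.
move=> ob; apply: ole_trans (oadd_mono a ob).
have h n : ole (oplus a n) (oadd a (iter n osucc ozero)).
  elim: n => [|n IH]; first exact: oadd_le.
  exact: ole_trans (osucc_mono IH) (oadd_succ _ _).
by apply/oleP => n; exists (inr n); exact: h.
Qed.

Lemma ole_olub A (f : A -> ord) a : ole (f a) (olub f).
Proof. by apply/oleP => x; exists (existT _ a x); exact: ole_refl. Qed.

Lemma omul_omega c k : ole (oadd (omul c (iter k osucc ozero)) c) (omul c omega).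
Proof. exact: (@ole_olub nat (fun k => oadd (omul c (iter k osucc ozero)) c) k). Qed.

Lemma omul_succ c b : ole (oadd (omul c b) c) (omul c (osucc b)).
Proof. exact: (@ole_olub unit (fun _ => oadd (omul c b) c) tt). Qed.

Lemma omega_omul c : olt ozero c -> ole omega (omul c omega).
Proof.
move=> c0; have h n : ole (iter n osucc ozero) (omul c (iter n osucc ozero)).
  elim: n => [|n IH]; first exact: ole0.
  apply: ole_trans (osucc_mono IH) _; apply: ole_trans (oadd_pos _ c0) _; exact: omul_succ.
apply/oleP => n; apply/osucc_le; apply: ole_trans (osucc_mono (h n)) _.
exact: ole_trans (oadd_pos _ c0) (omul_omega _ _).
Qed.

(** The iterate is ω times [n]. Here the lower bound on the lengths enters: all these multiples lie
    below the halting time, which gives infinitely many points. *)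
Lemma omega_powers n : olt (iter n oplusw ozero) (oexp omega omega).
Proof.
pose d := oexp omega (osucc ozero).
have d0 : olt ozero (oexp omega ozero).
  apply: olt_le_trans (olt_osucc ozero) _.
  exact: (@ole_olub (option void) (fun u => if u is Some y then _ else osucc ozero) None).
have od : ole omega d.
  apply: ole_trans (omega_omul d0) _.
  exact: (@ole_olub (option unit) (fun u => if u is Some y then omul (oexp omega ozero) omega
    else osucc ozero) (Some tt)).
have m k : ole (iter k oplusw ozero) (omul d (iter k osucc ozero)).
  elim: k => [|k IH]; first exact: ole0.
  apply: ole_trans (oplusw_mono IH) _; apply: ole_trans (oplusw_oadd _ od) _; exact: omul_succ.
apply: olt_le_trans (oplusw_lt _ 0) _; apply: ole_trans (oplusw_mono (m n)) _.
apply: ole_trans (oplusw_oadd _ od) _; apply: ole_trans (omul_omega _ _) _.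
exact: (@ole_olub (option nat) (fun u => if u is Some y then omul (oexp omega (iter y osucc ozero)) omega
    else osucc ozero) (Some 1)).
Qed.

(** ** Building the certificate *)

Lemma least (Q : ord -> Prop) : (exists d, Q d) -> exists d, Q d /\ forall d', olt d' d -> ~ Q d'.
Proof.
move=> [d]; elim/(well_founded_ind olt_wf): d => d IH hd.
have [[d' [l h]]|h] := pselect (exists d', olt d' d /\ Q d'); first exact: IH l h.
by exists d; split=> // d' l h'; apply: h; exists d'.
Qed.

Definition pick_ord (Q : ord -> Prop) : ord := if pselect (exists d, Q d) is left h then sval (cid h) else ozero.
Lemma pick_ordP (Q : ord -> Prop) : (exists d, Q d) -> Q (pick_ord Q).
Proof. by rewrite /pick_ord; case: (pselect _) => // h _; exact: svalP. Qed.

Definition base d := sval (cid (ord_decomp d)).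
Definition off d := sval (cid (svalP (cid (ord_decomp d)))).
Lemma base_lim d : olim0 (base d).
Proof. exact: (proj1 (svalP (cid (svalP (cid (ord_decomp d)))))). Qed.
Lemma base_off d : oeq d (oplus (base d) (off d)).
Proof. exact: (proj2 (svalP (cid (svalP (cid (ord_decomp d)))))). Qed.
Lemma base_le d : ole (base d) d.
Proof. exact: ole_trans (oplus_le _ _) (proj2 (base_off d)). Qed.

Lemma olim0_gt a b : olim0 a -> olt b a -> olimit a.
Proof. by case=> // a0 /(olt_oeqr a0) /olt0. Qed.

Lemma olim0_le_base a d : olim0 a -> ole a d -> ole a (base d).
Proof.
move=> la ad; have [//|l] := ole_total a (base d).
have := oplus_limit (off d) (olim0_gt la l) l => l2.
by case: (olt_irr (ole_lt_trans (ole_trans ad (proj1 (base_off d))) l2)).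
Qed.

(** The pairing is not onto; numbers that are no codes are decoded arbitrarily. *)
Definition unp m : nat * nat :=
  if pselect (exists p : nat * nat, npair p.1 p.2 = m) is left h then sval (cid h) else (0, 0).
Lemma unpK a b : unp (npair a b) = (a, b).
Proof.
rewrite /unp; case: (pselect _) => [h|[]]; last by exists (a, b).
by case: (cid h) => -[a' b'] /= /pair_inj [-> ->].
Qed.
Definition unrcode m : triple := odflt (true, true, true) [pick c | rcode c == m].
Lemma rcodeK c : unrcode (rcode c) = c.
Proof.
by rewrite /unrcode; case: pickP => [c' /eqP /rcode_inj //|/(_ c)]; rewrite eqxx.
Qed.

(** * The true computations and their Skolem functions *)

Section Complete.
Variables (x : real) (X : nat -> nat -> bool) (n : nat) (te : table n) (P : program).
Variables (nu mu : ord).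
Hypothesis te_halts : halts_at te x nu.
Hypothesis P_halts : halts_at (projT2 P) x mu.
Hypothesis nu_lim : olimit nu.
Hypothesis om_nu : olt omega nu.
Hypothesis mu_nu : ole mu nu.
Hypothesis P_rejects : written (projT2 P) (run (projT2 P) x mu) 0 = false.
Hypothesis X_input : forall r b, r < half -> X r b = x (half * b + r).
Hypothesis X_table : forall q r, X 0 (npair (npair (val q) (rcode r)) (acode (projT2 P (q, r)))).

Definition mach u : program := if u == 0 then existT table n te else P.
Definition stop u : ord := if u == 0 then nu else mu.
Let rn u d := run (projT2 (mach u)) x d.
Let cl u d i := cell (rn u d) i.
Let ins u d := instr (projT2 (mach u)) (rn u d).

Lemma stop_halts u : halts_at (projT2 (mach u)) x (stop u).
Proof. by rewrite /mach /stop; case: eqP. Qed.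

Lemma stop_nu u : ole (stop u) nu.
Proof. by rewrite /stop; case: eqP => // _; exact: ole_refl. Qed.

Let rn_eq u d d' : oeq d d' -> rn u d = rn u d'. Proof. exact: run_eq. Qed.

Definition bad c d := exists2 i, i < 3 & ~~ bitof c i /\ cl 0 d i.

Definition Nst u a i := pick_ord (fun c => olt c a /\ forall d, ole c d -> olt d a -> ~ cl u d i).
Definition Dst u i a k := pick_ord (fun d => [/\ ole (oplus a k) d, olt d nu, cl u d i &
  forall d', ole (oplus a k) d' -> cl u d' i -> ole d d']).
Definition Ast c a := pick_ord (fun d => [/\ ole a d, ole nu d \/ bad c d, ole d nu &
  forall d', ole a d' -> olt d' d -> ~ bad c d']).

(* The points of the certificate are the values at [ozero] of the words in these letters. *)
Definition letter := (nat * nat * nat * nat * triple)%type.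
(** Each letter is a Skolem function of the clauses: the next limit, the stages that witness a
    limsup or end a zone without bad cells, and the ends of the two runs. Only the zero-or-limit
    part is a point, the remaining number of steps being recorded separately. Choices out of range
    become 0, so the values never exceed [nu]. *)
Definition hull (l : letter) (a : ord) : ord :=
  let: (k, u, i, j, c) := l in
  match k with
  | 0 => if pselect (olt a nu) then oplusw a else nu
  | 1 => base (if pselect (olt (Nst u a i) nu) then Nst u a i else ozero)
  | 2 => base (if pselect (olt (Dst u i a j) nu) then Dst u i a j else ozero)
  | 3 => base (if pselect (ole (Ast c a) nu) then Ast c a else ozero)
  | 4 => base mu
  | _ => nu
  end.

Lemma hull_good l a : olim0 a -> ole a nu -> olim0 (hull l a) /\ ole (hull l a) nu.
Proof.
have nu0 : olim0 nu by right.
have b d : ole d nu -> olim0 (base d) /\ ole (base d) nu.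
  by move=> h; split; [exact: base_lim|exact: ole_trans (base_le d) h].
case: l => -[[[k u] i] j] c la an; case: k => [|[|[|[|[|k]]]]] /=.
- case: (pselect _) => h; last by split=> //; exact: ole_refl.
  by split; [right; exact: oplusw_limit|exact: oplusw_le].
- by apply: b; case: (pselect _) => h; [exact: oltW|exact: ole0].
- by apply: b; case: (pselect _) => h; [exact: oltW|exact: ole0].
- by apply: b; case: (pselect _) => h; [|exact: ole0].
- exact: b.
- by split=> //; exact: ole_refl.
Qed.

Section Rounds.
Variables (c : triple) (a : ord).
Hypothesis c_halts : (te (limit_state n, c)).2 = None.

Definition round d d' := olt d d' /\
  forall i, i < 3 -> bitof c i -> exists s, [/\ ole d s, olt s d' & cl 0 s i].
Fixpoint chain k b : Prop :=
  if k is k'.+1 then exists d d', [/\ chain k' d, round d d' & ole d' b] else ole a b.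

Lemma chain_mono k b b' : ole b b' -> chain k b -> chain k b'.
Proof.
case: k => [|k] bb /=; first by move=> h; exact: ole_trans h bb.
by case=> d [d' [h1 h2 h3]]; exists d, d'; split=> //; exact: ole_trans h3 bb.
Qed.

Lemma chain_ge k b : chain k b -> ole a b.
Proof.
elim: k b => //= k IH b [d [d' [/IH h1 [h2 _] h3]]].
exact: ole_trans h1 (ole_trans (oltW h2) h3).
Qed.

(* At a limit below which all the bits of [c] recur, and no other one, [te] would halt too early. *)
Lemma chain_bound b : olt b nu -> (forall s, ole a s -> olt s b -> ~ bad c s) ->
  exists N, forall k, chain k b -> k <= N.
Proof.
elim/(well_founded_ind olt_wf): b => b IH bn hb.
have sub b' : olt b' b -> exists N, forall k, chain k b' -> k <= N.
  move=> l; apply: IH => //; first exact: olt_trans l bn.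
  by move=> s h1 h2; apply: hb => //; exact: olt_trans h2 l.
have [ba|ab] := ole_total b a.
  exists 0 => -[//|k] /= [d [d' [/chain_ge h1 [h2 _] h3]]].
  by case: (olt_irr (ole_lt_trans h1 (olt_le_trans h2 (ole_trans h3 ba)))).
have [b0|[[b' e]|lb]] := ord_cases b.
- by case: (olt0 (olt_oeqr b0 ab)).
(* At a successor, dropping the last round leaves a chain that ends at the predecessor at the
   latest. *)
- have [|N hN] := sub b'; first exact: olt_oeqr (oeq_sym e) (olt_osucc _).
  exists N.+1 => -[//|k] /= [d [d' [h1 [h2 _] h3]]]; rewrite ltnS; apply: hN.
  by apply: chain_mono h1; apply/olt_succ; exact: olt_le_trans h2 (ole_trans h3 (proj1 e)).
(* If some bit of [c] is last seen before [b'], the last round begins no later than such a sighting,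
   and the chain without it ends by [b']. *)
have [[i [i3 hi [b' b'b hn]]]|hg] := pselect (exists i, [/\ i < 3, bitof c i &
    exists2 b', olt b' b & forall s, ole b' s -> olt s b -> ~ cl 0 s i]).
  have [N hN] := sub b' b'b; exists N.+1 => -[//|k] /= [d [d' [h1 [h2 h4] h3]]].
  rewrite ltnS; apply: hN; have [s [ds sd hs]] := h4 i i3 hi.
  apply: chain_mono h1; apply: ole_trans ds _.
  have [l|l] := ole_total b' s; last exact: oltW.
  by case: (hn s l (olt_le_trans sd h3)).
(* Otherwise all bits of [c] recur below [b] and the other cells are off, so the triple read at [b]
   is [c] and the machine halts before [nu]. *)
have [_ run_on] := te_halts; case: (run_on b bn).
have la := lb; rewrite /halting /instr.
have -> : scan (run te x b) = c.
  have lim i : cell (run te x b) i <-> forall b', olt b' b -> exists d, [/\ ole b' d, olt d b & cl 0 d i].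
    exact: run_limP.
  have bit i : i < 3 -> cell (run te x b) i = bitof c i.
    move=> i3; apply/idP/idP => [/lim h|hi].
      apply: contrapT => /negP nb; have [d [h1 h2 h3]] := h a ab.
      by apply: (hb d h1 h2); exists i.
    apply/lim => b' b'b; apply: contrapT => h; apply: hg; exists i; split=> //.
    by exists b' => // s h1 h2 h3; apply: h; exists s.
  rewrite /scan (run_lim _ _ lb) /=; rewrite (run_lim _ _ lb) /= in bit.
  by rewrite (bit 0) // (bit 1) // (bit 2) //; case: c => [[]].
by rewrite (run_lim _ _ lb).
Qed.

Definition nrounds b := if pselect (exists M, chain M b /\ forall k, chain k b -> k <= M) is left h
  then sval (cid h) else 0.

Lemma nroundsP b : ole a b -> olt b nu -> (forall s, ole a s -> olt s b -> ~ bad c s) ->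
  chain (nrounds b) b /\ forall k, chain k b -> k <= nrounds b.
Proof.
move=> ab bn hb; rewrite /nrounds; case: (pselect _) => [h|[]]; first exact: (svalP (cid h)).
have [N hN] := chain_bound bn hb.
have ex : exists k, `[< chain k b >] by exists 0; apply/asboolP.
have bd k : `[< chain k b >] -> k <= N by move=> /asboolP /hN.
case: (ex_maxnP ex bd) => M /asboolP hM mx; exists M; split=> // k hk.
by apply: mx; apply/asboolP.
Qed.

(** A longest chain up to [b] is prolonged by the round from [b] to [b']. *)
Lemma nrounds_lt b b' : ole a b -> olt b' nu -> round b b' ->
  (forall s, ole a s -> olt s b' -> ~ bad c s) -> nrounds b < nrounds b'.
Proof.
move=> ab bn [bb hr] hb.
have [h1 _] : chain (nrounds b) b /\ forall k, chain k b -> k <= nrounds b.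
  apply: nroundsP => //; first exact: olt_trans bb bn.
  by move=> s h1 h2; apply: hb => //; exact: olt_trans h2 bb.
have [|_ h2] := nroundsP _ bn hb; first exact: ole_trans ab (oltW bb).
by apply: h2; exists b, b'; split=> //; exact: ole_refl.
Qed.
End Rounds.

(** * The certificate read off the points *)

Section Points.
Variable th : nat -> ord.
Hypothesis th0 : oeq (th 0) ozero.
Hypothesis th1 : oeq (th 1) omega.
Hypothesis th2 : oeq (th 2) nu.
Hypothesis th_inj : forall i j, oeq (th i) (th j) -> i = j.
Hypothesis th_lim : forall i, olim0 (th i).
Hypothesis th_le : forall i, ole (th i) nu.
Hypothesis th_hull : forall l i, exists k, oeq (th k) (hull l (th i)).

Definition lt i j : Prop := olt (th i) (th j).
Definition index_of d := if pselect (exists k, oeq (th k) d) is left h then sval (cid h) else 0.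

Lemma index_ofP d : (exists k, oeq (th k) d) -> oeq (th (index_of d)) d.
Proof. by rewrite /index_of; case: (pselect _) => // h _; exact: (svalP (cid h)). Qed.

Lemma lt_tot i j : [\/ i = j, lt i j | lt j i].
Proof.
have [/ole_eqVlt [e|l]|l] := ole_total (th i) (th j).
- by apply: Or31; exact: th_inj.
- exact: Or32.
- exact: Or33.
Qed.

Lemma lt_stage i j k : lt i j -> olt (oplus (th i) k) (th j).
Proof. by move=> l; apply: oplus_limit => //; exact: olim0_gt (th_lim j) l. Qed.

Lemma point_lim m : m <> 0 -> olimit (th m).
Proof.
move=> m0; have [h|//] := th_lim m; case: m0; apply: th_inj.
exact: oeq_trans h (oeq_sym th0).
Qed.

Lemma lt_nu m : m <> 2 -> olt (th m) nu.
Proof.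
move=> m2; have [e|//] := ole_eqVlt (th_le m); case: m2; apply: th_inj.
exact: oeq_trans e (oeq_sym th2).
Qed.

Definition nxi m := index_of (hull (0, 0, 0, 0, (true, true, true)) (th m)).

Lemma nxiP m : m <> 2 -> oeq (th (nxi m)) (oplusw (th m)).
Proof.
move=> m2; have := index_ofP (th_hull (0, 0, 0, 0, (true, true, true)) m).
by rewrite -/(nxi m) /=; case: (pselect _) => // -[]; exact: lt_nu.
Qed.

Definition succ_type m := exists2 j, lt j m & m = nxi j.
(** In the enumeration of the points below a limit point [m], [j] is a new maximum that comes after
    [m] itself. Such [j] are cofinal in [m], while below any earlier point there are only finitely
    many. *)
Definition record j m := [/\ m <> 0, ~ succ_type m, lt j m, m < j & forall i, i < j -> lt i m -> lt i j].

(** If [m] were below [m'], then, being numbered before [j], it would be below [j] as well by the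
    second record, but [j] is below [m]. So a point announces at most one limit point. *)
Lemma record_uniq j m m' : record j m -> record j m' -> m = m'.
Proof.
move=> [_ _ h1 h2 h3] [_ _ h1' h2' h3']; have [//|l|l] := lt_tot m m'.
  by case: (olt_irr (olt_trans h1 (h3' _ h2 l))).
by case: (olt_irr (olt_trans h1' (h3 _ h2' l))).
Qed.

Lemma lt_nxi m j : lt m j -> lt m (nxi m) /\ (j = nxi m \/ lt (nxi m) j).
Proof.
move=> l; have m2 : m <> 2.
  by move=> e; rewrite e in l; case: (olt_irr (olt_le_trans l (ole_trans (th_le j) (proj2 th2)))).
have e := nxiP m2; split; first exact: olt_oeqr (oeq_sym e) (oplusw_lt _ 0).
have h : ole (th (nxi m)) (th j).
  by apply: ole_trans (proj1 e) _; apply: oplusw_le => //; exact: olim0_gt (th_lim j) l.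
by have [e'|l'] := ole_eqVlt h; [left; apply: th_inj; exact: oeq_sym|right].
Qed.

Lemma limit_nxi m j : ~ succ_type m -> lt j m -> lt (nxi j) m.
Proof.
by move=> ns l; have [_ [e|//]] := lt_nxi l; case: ns; exists j.
Qed.

Lemma records_cofinal m b : m <> 0 -> ~ succ_type m -> lt b m ->
  exists c, [/\ b = c \/ lt b c, lt c m & record c m].
Proof.
move=> m0 ns bm.
(* [M] is the largest point below [m] among those numbered up to [m] and [b]. *)
have [M Mm hM] : exists2 M, lt M m & forall i, i <= maxn m b -> lt i m -> i = M \/ lt i M.
  elim: (maxn m b) => [|N [M Mm hM]].
    have l0 : lt 0 m by apply: olt_oeql (oeq_sym th0) _; exact: proj1 (point_lim m0).
    by exists 0 => // i; rewrite leqn0 => /eqP ->; left.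
  have [lN|nN] := pselect (lt N.+1 m); last first.
    by exists M => // i; rewrite leq_eqVlt => /orP [/eqP ->|/hM].
  have [e|l|l] := lt_tot N.+1 M.
  - by exists M => // i; rewrite leq_eqVlt => /orP [/eqP ->|/hM //]; left.
  - by exists M => // i; rewrite leq_eqVlt => /orP [/eqP ->|/hM //]; right.
  - exists N.+1 => // i; rewrite leq_eqVlt => /orP [/eqP ->|/hM h /h [->|h']]; [by left|by right|].
    by right; exact: olt_trans h' l.
have [Mn _] := lt_nxi Mm.
(* The least number of a point between [M] and [m] is the record sought: earlier numbers name points
   below [m] that are at most [M]. *)
have ex : exists c, `[< lt M c /\ lt c m >].
  by exists (nxi M); apply/asboolP; split=> //; exact: limit_nxi.
case: (ex_minnP ex) => c /asboolP [Mc cm] mn.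
have big : maxn m b < c.
  rewrite ltnNge; apply/negP => l; have [e|h] := hM c l cm; first by rewrite e in Mc; case: (olt_irr Mc).
  by case: (olt_irr (olt_trans h Mc)).
have up i : i <= maxn m b -> lt i m -> lt i c.
  by move=> l im; have [->|h] := hM i l im; [|exact: olt_trans h Mc].
exists c; split=> //.
  by right; apply: up => //; exact: leq_maxr.
split=> //; first exact: leq_ltn_trans (leq_maxl _ _) big.
move=> i ic im; have [e|l|l] := lt_tot i M; [by rewrite e|exact: olt_trans l Mc|].
by have := mn i (introT (asboolP _) (conj l im)); rewrite leqNgt ic.
Qed.

Definition kindi m : nat := if pselect (exists j, lt j m /\ m = nxi j) is left _ then 0 else 1.
Definition pdi m : nat := if pselect (exists j, lt j m /\ m = nxi j) is left h then sval (cid h) else 0.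
Definition pari j : nat := if pselect (exists m, record j m) is left h then sval (cid h) else 0.
Definition fsi m b : nat :=
  if pselect (exists c, [/\ b = c \/ lt b c, lt c m & record c m]) is left h then sval (cid h) else 0.
Definition stage m k := oplus (th m) k.

Definition lookup k a : nat :=
  let a1 := (unp a).1 in let r1 := (unp a).2 in let a2 := (unp r1).1 in let r2 := (unp r1).2 in
  let a3 := (unp r2).1 in let r3 := (unp r2).2 in
  match k with
  | 1 => nxi a | 2 => pari a | 3 => ~~ `[< lt a1 r1 >] | 4 => kindi a | 5 => pdi a | 6 => fsi a1 r1
  | 7 => val (state (rn a1 (stage a2 r2))) | 8 => hpos (rn a1 (stage a2 r2))
  | 9 => ~~ cl a1 (stage a2 a3) r3
  | 10 => ~~ (ins a1 (stage a2 r2)).1.1.1.1 | 11 => ~~ (ins a1 (stage a2 r2)).1.1.1.2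
  | 12 => ~~ (ins a1 (stage a2 r2)).1.1.2 | 13 => ~~ (ins a1 (stage a2 r2)).1.2
  | 14 => if (ins a1 (stage a2 r2)).2 is Some q then q.+1 else 0
  | 15 => index_of (base (stop a)) | 16 => off (stop a)
  | 17 => index_of (base (Nst a1 (th a2) r2)) | 18 => off (Nst a1 (th a2) r2)
  | 19 => index_of (base (Dst a1 a2 (th a3) r3)) | 20 => off (Dst a1 a2 (th a3) r3)
  | 21 => index_of (base (Ast (unrcode a1) (th r1))) | 22 => off (Ast (unrcode a1) (th r1))
  | _ => nrounds (unrcode a1) (th a2) (th r2)
  end.
Definition table_of m := lookup (unp m).1 (unp m).2.
Local Notation g := table_of.

Lemma tgE k a : tg g k a = lookup k a.
Proof. by rewrite /tg /g unpK. Qed.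

Lemma LE i j : L g i j = `[< lt i j >].
Proof. by rewrite /L tgE /= unpK; case: asboolP. Qed.
Lemma nxtE m : nxt g m = nxi m. Proof. exact: tgE. Qed.
Lemma parE m : par g m = pari m. Proof. exact: tgE. Qed.
Lemma stE u m k : st g u m k = val (state (rn u (stage m k))).
Proof. by rewrite /st tgE /= !unpK. Qed.
Lemma hdE u m k : hd g u m k = hpos (rn u (stage m k)).
Proof. by rewrite /hd tgE /= !unpK. Qed.
Lemma vaE u m k i : va g u m k i = ~~ cl u (stage m k) i.
Proof. by rewrite /va tgE /= !unpK. Qed.
Lemma w0E u m k : w0 g u m k = ~~ (ins u (stage m k)).1.1.1.1.
Proof. by rewrite /w0 tgE /= !unpK. Qed.
Lemma w1E u m k : w1 g u m k = ~~ (ins u (stage m k)).1.1.1.2.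
Proof. by rewrite /w1 tgE /= !unpK. Qed.
Lemma w2E u m k : w2 g u m k = ~~ (ins u (stage m k)).1.1.2.
Proof. by rewrite /w2 tgE /= !unpK. Qed.
Lemma diE u m k : di g u m k = ~~ (ins u (stage m k)).1.2.
Proof. by rewrite /di tgE /= !unpK. Qed.
Lemma nsE u m k : ns g u m k = if (ins u (stage m k)).2 is Some q then q.+1 else 0.
Proof. by rewrite /ns tgE /= !unpK. Qed.
Lemma meE u : me g u = index_of (base (stop u)). Proof. exact: tgE. Qed.
Lemma neE u : ne g u = off (stop u). Proof. exact: tgE. Qed.
Lemma NbE u m i : Nb g u m i = index_of (base (Nst u (th m) i)).
Proof. by rewrite /Nb tgE /= !unpK. Qed.
Lemma NnE u m i : Nn g u m i = off (Nst u (th m) i).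
Proof. by rewrite /Nn tgE /= !unpK. Qed.
Lemma DbE u i b k : Db g u i b k = index_of (base (Dst u i (th b) k)).
Proof. by rewrite /Db tgE /= !unpK. Qed.
Lemma DnE u i b k : Dn g u i b k = off (Dst u i (th b) k).
Proof. by rewrite /Dn tgE /= !unpK. Qed.
Lemma alE c m : al g (rcode c) m = index_of (base (Ast c (th m))).
Proof. by rewrite /al tgE /= !unpK rcodeK. Qed.
Lemma alnE c m : aln g (rcode c) m = off (Ast c (th m)).
Proof. by rewrite /aln tgE /= !unpK rcodeK. Qed.
Lemma roundsE c m0 m : rounds g (rcode c) m0 m = nrounds c (th m0) (th m).
Proof. by rewrite /rounds tgE /= !unpK rcodeK. Qed.

Lemma leE i j : le g i j <-> ole (th i) (th j).
Proof.
rewrite /le LE; split=> [/orP [/eqP ->|/asboolP /oltW //]|]; first exact: ole_refl.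
by case/ole_eqVlt => [/th_inj ->|l]; [rewrite eqxx|apply/orP; right; apply/asboolP].
Qed.

Lemma acE u m k : ac g u m k = acode (ins u (stage m k)).
Proof. by rewrite /ac w0E w1E w2E diE nsE. Qed.

Lemma scE u m k : sc g u m k = rcode (scan (rn u (stage m k))).
Proof.
rewrite /sc /hd3 hdE; set p := hpos _.
have -> : p + (p + p) = 3 * p by lia.
by rewrite !vaE addn1 addn2.
Qed.

Lemma top_lt a : a <> 2 -> lt a 2.
Proof. by move=> /lt_nu h; exact: olt_oeqr (oeq_sym th2) h. Qed.

Lemma cert_order a b c : order_ok g a b c.
Proof.
have nx0 : nxi 0 = 1.
  apply: th_inj; have h0 : 0 <> 2 by [].
  apply: oeq_trans (nxiP h0) _; apply: oeq_trans (oeq_sym th1); split; apply: oplusw_mono; exact: (proj1 th0) || exact: ole0.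
rewrite /order_ok !LE !nxtE nx0; apply/andP; split; last first.
  by apply/implyP => /asboolP /lt_nxi [_ [->|h]]; rewrite ?eqxx //; apply/orP; right; apply/asboolP.
apply/andP; split; last by apply/implyP => /eqP /top_lt /lt_nxi [h _]; apply/asboolP.
rewrite eqxx andbT; apply/andP; split; last by apply/implyP => /eqP /top_lt h; apply/asboolP.
apply/andP; split; last by apply/implyP => /eqP /point_lim [h _]; apply/asboolP; exact: olt_oeql (oeq_sym th0) h.
apply/andP; split; last by have [->|h|h] := lt_tot a b; rewrite ?eqxx //; apply/orP; right; apply/orP; [left|right]; apply/asboolP.
apply/andP; split; first by apply/asboolP => h; exact: (olt_irr h).
by apply/implyP => /andP [/asboolP h1 /asboolP h2]; apply/asboolP; exact: olt_trans h1 h2.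
Qed.

Lemma pariP j : pari j <> 0 -> record j (pari j).
Proof. by rewrite /pari; case: (pselect _) => // h _; exact: (svalP (cid h)). Qed.

Lemma record_pari j m : record j m -> pari j = m.
Proof.
move=> h; rewrite /pari; case: (pselect _) => [h'|[]]; last by exists m.
exact: record_uniq (svalP (cid h')) h.
Qed.

Lemma cert_par a b : par_ok g a b.
Proof.
rewrite /par_ok !parE !LE; apply/implyP => /eqP /pariP [h0 h1 h2 h3 h4].
apply/andP; split; first by rewrite h3 andbT; apply/asboolP.
by apply/implyP => ba; apply/implyP => /asboolP h; apply/asboolP; exact: h4.
Qed.

Lemma cert_kind a b : kind_ok g a b.
Proof.
rewrite /kind_ok; apply/implyP => /eqP a0.
have -> : ty g a = kindi a by exact: tgE.
have -> : pd g a = pdi a by exact: tgE.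
have -> : fs g a b = fsi a b by rewrite /fs tgE /= unpK.
rewrite !LE !nxtE parE /kindi /pdi; case: (pselect _) => [h|nh] /=.
  by have [h1 h2] := svalP (cid h); rewrite andbT -h2 eqxx andbT; apply/asboolP.
apply/implyP => /asboolP ba.
have ns : ~ succ_type a by move=> [j h1 h2]; apply: nh; exists j.
apply/andP; split; first by apply/asboolP; exact: limit_nxi.
rewrite /fsi; case: (pselect _) => [h|[]]; last exact: records_cofinal.
have [h1 h2 h3] := svalP (cid h); rewrite (record_pari h3) eqxx andbT.
apply/andP; split; last by apply/asboolP.
rewrite /le LE; case: h1 => [<-|h1]; first by rewrite eqxx.
by apply/orP; right; apply/asboolP.
Qed.

Lemma rn0 u k : rn u (stage 0 k) = rn u (oplus ozero k).
Proof. by apply: rn_eq; exact: oplus_oeq. Qed.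

Lemma cert_start u i : start_ok g u i.
Proof.
rewrite /start_ok stE hdE !vaE /cl rn0 /rn (run0 _ _ (oeq_refl _)) /=.
have -> : (i + (i + i)) %% 3 = 0 by lia.
by have -> : (i + (i + i) + 1) %% 3 = 1 by lia.
Qed.

Lemma cert_input u b r : r < half -> va g u 0 0 (3 * (half * b + r) + 2) + X r b = 1.
Proof.
move=> hr; rewrite vaE /cl rn0 /rn (run0 _ _ (oeq_refl _)) X_input //=.
have -> : (3 * (half * b + r) + 2) %% 3 = 2 by lia.
have -> : (3 * (half * b + r) + 2) %/ 3 = half * b + r by lia.
by case: (x _).
Qed.

Lemma cert_range u m k i : range_ok g u m k i.
Proof. by rewrite /range_ok vaE; case: (cl _ _ _). Qed.

Lemma cert_row q r m k : row_ok g (val q) (rcode r) (acode (te (q, r))) m k.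
Proof.
rewrite /row_ok stE scE acE; apply/implyP => /andP [/eqP e1 /eqP /rcode_inj e2].
apply/eqP; congr acode; rewrite /ins /instr e2; congr (te (_, _)); exact: val_inj.
Qed.

Lemma cert_other u m k : u != 0 -> X 0 (npair (npair (st g u m k) (sc g u m k)) (ac g u m k)).
Proof.
rewrite stE scE acE /ins /rn /mach /instr => /negbTE ->; exact: X_table.
Qed.

Lemma index_of_base u : oeq (th (index_of (base (stop u)))) (base (stop u)).
Proof.
apply: index_ofP; rewrite /stop; case: eqP => _; last exact: th_hull (4, 0, 0, 0, (true, true, true)) 0.
exists 2; apply: oeq_trans th2 _; split; last exact: base_le.
by apply: olim0_le_base; [right|exact: ole_refl].
Qed.

Lemma stop_stage u : oeq (stop u) (stage (me g u) (ne g u)).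
Proof.
rewrite meE neE /stage; apply: oeq_trans (base_off _) _.
by apply: oplus_oeq; exact: oeq_sym (index_of_base u).
Qed.

Lemma me_ne u : me g u = 2 -> ne g u = 0.
Proof.
move=> e; have := stop_stage u; rewrite e => h.
case: (ne g u) h => // k h.
have l := ole_trans (proj2 h) (stop_nu u).
by case: (olt_irr (olt_le_trans (oplusS_lt (th 2) k) (ole_trans l (proj2 th2)))).
Qed.

Lemma bf_lt u m k : bf g u m k -> olt (stage m k) (stop u).
Proof.
move=> h; apply: olt_le_trans (proj2 (stop_stage u)); move: h; rewrite /bf LE.
case/orP => [/asboolP l|/andP [/eqP -> l]]; last exact: oplus_ltn.
by apply: olt_le_trans (oplus_le _ _); exact: lt_stage.
Qed.

Lemma me0 : me g 0 = 2.
Proof.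
apply: th_inj; rewrite meE; apply: oeq_trans (index_of_base 0) _; apply: oeq_trans (oeq_sym th2).
rewrite /stop eqxx; split; first exact: base_le.
by apply: olim0_le_base; [right|exact: ole_refl].
Qed.

Lemma cert_end u : end_ok g u.
Proof.
rewrite /end_ok me0 (me_ne me0) !eqxx /=.
have [hh hb] := stop_halts u; have e := stop_stage u.
have -> : ns g u (me g u) (ne g u) = 0.
  by rewrite nsE /ins /rn -(run_eq _ _ e); move: hh; rewrite /halting => ->.
rewrite eqxx /=; apply/andP; split.
  have [m2|m2] := pselect (me g u = 2); first by rewrite (me_ne m2) m2 !eqxx orbT.
  by rewrite LE (introT (asboolP _) (top_lt m2)).
apply/implyP => u0; rewrite hdE w0E vaE /ins /cl /rn -(run_eq _ _ e) /stop /mach (negbTE u0).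
move: P_rejects; rewrite /written; case: (instr _ _).1.1 => [[a b] d] /=.
by case: (hpos _) => [|p] /= ->; rewrite ?eqxx.
Qed.

Lemma cert_step u m k i : step_ok g u m k i.
Proof.
rewrite /step_ok; apply/implyP => /bf_lt l; have [_ hb] := stop_halts u.
have hs : rn u (stage m (k + 1)) = nextc (projT2 (mach u)) (rn u (stage m k)).
  by rewrite addn1 /rn /stage [oplus _ _]/= run_succ.
have nh := hb _ l; rewrite nsE.
case eq : (ins u (stage m k)).2 => [q|]; last by case: nh.
have {}hs : rn u (stage m (k + 1)) = Config q (moved (projT2 (mach u)) (rn u (stage m k)))
    (written (projT2 (mach u)) (rn u (stage m k))).
  by rewrite hs /nextc [(instr _ _).2]eq.
rewrite stE !hdE !diE !vaE w0E w1E w2E /hd3 hdE /cl hs /= addn1 eqxx /=.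
rewrite /moved /written -/(ins u (stage m k)); set p := hpos _.
have -> : p + (p + p) = 3 * p by lia.
case: (ins u (stage m k)).1 => [[[a b] d] dir] /=; rewrite !addn1 !addn2 subn1.
have [e1 e2 e3] : [/\ (3 * p == (3 * p).+1) = false, (3 * p == (3 * p).+2) = false &
    ((3 * p).+1 == (3 * p).+2) = false] by split; lia.
have -> : (~~ dir == 0 :> nat) = dir by case: dir.
have -> b1 b2 : (~~ b1 == ~~ b2 :> nat) = (b1 == b2) by case: b1; case: b2.
have -> b1 b2 : (~~ b1 == ~~ b2 :> nat) = (b1 == b2) by case: b1; case: b2.
have -> b1 b2 : (~~ b1 == ~~ b2 :> nat) = (b1 == b2) by case: b1; case: b2.
have -> b1 b2 : (~~ b1 == ~~ b2 :> nat) = (b1 == b2) by case: b1; case: b2.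
case: dir; rewrite ?eqxx ?andbT /=.
all: case: (i =P 3 * p) => [->|n0]; rewrite ?e1 ?e2 ?eqxx //=.
all: case: (i =P (3 * p).+1) => [->|n1]; rewrite ?e3 ?eqxx //=.
all: by case: (i =P (3 * p).+2) => [->|n2]; rewrite ?eqxx.
Qed.

Lemma run_limit u m i : m <> 0 -> cl u (th m) i <->
  forall b, olt b (th m) -> exists d, [/\ ole b d, olt d (th m) & cl u d i].
Proof. by move=> m0; apply: run_limP; exact: point_lim. Qed.

Lemma NstP u m i : m <> 0 -> ~~ cl u (th m) i -> let s := Nst u (th m) i in
  [/\ olt s (th m), forall d, ole s d -> olt d (th m) -> ~ cl u d i &
   oeq s (stage (Nb g u m i) (Nn g u m i))].
Proof.
move=> m0 /negP hn s.
have [h1 h2] : olt s (th m) /\ forall d, ole s d -> olt d (th m) -> ~ cl u d i.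
  suff ex : exists s, olt s (th m) /\ forall d, ole s d -> olt d (th m) -> ~ cl u d i by exact: (pick_ordP ex).
  apply: contrapT => h; apply: hn; apply/(run_limit _ _ m0) => b bm.
  apply: contrapT => h'; apply: h; exists b; split=> // d bd dm hd.
  by apply: h'; exists d.
split=> //; apply: oeq_trans (base_off s) _; rewrite /stage NbE NnE; apply: oplus_oeq; apply: oeq_sym.
apply: index_ofP; have [k e] := th_hull (1, u, i, 0, (true, true, true)) m; exists k.
apply: oeq_trans e _ => /=; case: (pselect _) => h; first exact: oeq_refl.
by case: h; exact: olt_le_trans h1 (th_le m).
Qed.

Lemma DstP u i b k d : ole (stage b k) d -> olt d nu -> cl u d i -> let s := Dst u i (th b) k in
  [/\ ole (stage b k) s, ole s d, cl u s i & oeq s (stage (Db g u i b k) (Dn g u i b k))].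
Proof.
move=> bd dn hd s.
have [h1 h2 h3 h4] : [/\ ole (stage b k) s, olt s nu, cl u s i &
    forall d', ole (stage b k) d' -> cl u d' i -> ole s d'].
  suff ex : exists s, [/\ ole (stage b k) s, olt s nu, cl u s i &
    forall d', ole (stage b k) d' -> cl u d' i -> ole s d'] by exact: (pick_ordP ex).
  have [|q [[q1 q2] q3]] := @least (fun d => ole (stage b k) d /\ cl u d i).
    by exists d.
  have min d' : ole (stage b k) d' -> cl u d' i -> ole q d'.
    by move=> h h'; apply/oleNgt => l; exact: (q3 d').
  by exists q; split=> //; exact: ole_lt_trans (min d bd hd) dn.
split=> //; first exact: h4.
apply: oeq_trans (base_off s) _; rewrite /stage DbE DnE; apply: oplus_oeq; apply: oeq_sym.
apply: index_ofP; have [j e] := th_hull (2, u, i, k, (true, true, true)) b; exists j.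
by apply: oeq_trans e _ => /=; case: (pselect _) => h; [exact: oeq_refl|case: h].
Qed.

Lemma AstP c m : let s := Ast c (th m) in
  [/\ ole (th m) s, ole nu s \/ bad c s, ole s nu & forall d, ole (th m) d -> olt d s -> ~ bad c d] /\
  oeq s (stage (al g (rcode c) m) (aln g (rcode c) m)).
Proof.
move=> s; have h : [/\ ole (th m) s, ole nu s \/ bad c s, ole s nu &
    forall d, ole (th m) d -> olt d s -> ~ bad c d].
  suff ex : exists s, [/\ ole (th m) s, ole nu s \/ bad c s, ole s nu &
    forall d, ole (th m) d -> olt d s -> ~ bad c d] by exact: (pick_ordP ex).
  have [|q [[q1 q2] q3]] := @least (fun d => ole (th m) d /\ (ole nu d \/ bad c d)).
    by exists nu; split=> //; left; exact: ole_refl.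
  exists q; split=> //; last by move=> d h1 h2 h3; apply: (q3 d h2); split=> //; right.
  by apply/oleNgt => l; apply: (q3 nu l); split=> //; left; exact: ole_refl.
split=> //; apply: oeq_trans (base_off s) _; rewrite /stage alE alnE; apply: oplus_oeq; apply: oeq_sym.
apply: index_ofP; have [j e] := th_hull (3, 0, 0, 0, c) m; exists j.
by apply: oeq_trans e _ => /=; case: (pselect _) => h'; [exact: oeq_refl|case: h'; case: h].
Qed.

Lemma stage_le i k j k' : ole (stage i k) (stage j k') -> lt i j \/ (i = j /\ k <= k').
Proof.
move=> h; have [e|l|l] := lt_tot i j; [right|by left|].
  split=> //; rewrite leqNgt; apply/negP => kk; rewrite e in h.
  exact: (olt_irr (ole_lt_trans h (oplus_ltn _ kk))).
have l2 := lt_stage k' l.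
by case: (olt_irr (ole_lt_trans h (olt_le_trans l2 (oplus_le _ _)))).
Qed.

Lemma stage_in i k m : olt (stage i k) (th m) -> lt i m.
Proof. by move=> h; exact: ole_lt_trans (oplus_le _ _) h. Qed.

Lemma cert_limit u m i m' n' : limit_ok g u m i m' n'.
Proof.
rewrite /limit_ok; apply/implyP => /eqP m0; have la := point_lim m0.
rewrite !LE stE hdE !vaE /rn (run_lim _ _ la) !eqxx /=.
have e0 b : (~~ b == 0 :> nat) = b by case: b.
rewrite !e0; apply/andP; split.
  apply/implyP => hn; have [h1 h2 h3] := NstP m0 hn.
  apply/andP; split; first by apply/asboolP; exact: stage_in (olt_oeql h3 h1).
  apply/implyP => /andP [/asboolP l hor]; apply/negP; apply: h2; last exact: lt_stage.
  apply: ole_trans (proj1 h3) _; case/orP: hor => [/asboolP l2|/andP [/eqP -> l2]].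
    by apply: ole_trans (oplus_le _ _); exact: oltW (lt_stage _ l2).
  by apply: oplus_leq; rewrite leqNgt.
apply/implyP => /andP [hy /asboolP l].
have [d [h1 h2 h3]] := proj1 (run_limit _ _ m0) hy _ (lt_stage n' l).
have [k1 k2 k3 k4] := DstP h1 (olt_le_trans h2 (th_le m)) h3.
have eD : cl u (stage (Db g u i m' n') (Dn g u i m' n')) i by rewrite /cl -(rn_eq u k4).
rewrite eD andbT; apply/andP; split.
  by apply/asboolP; exact: stage_in (olt_oeql k4 (ole_lt_trans k2 h2)).
case: (stage_le (ole_trans k1 (proj1 k4))) => [h|[e h]]; first by apply/orP; left; apply/asboolP.
by apply/orP; right; rewrite -leqNgt h andbT; apply/eqP.
Qed.

Lemma cert_al c m : al_ok g c m.
Proof.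
rewrite /al_ok; have [[h1 h2 h3 h4] h5] := AstP c m.
set A := al _ _ _ in h5 *; set k := aln _ _ _ in h5 *.
apply/andP; split.
  apply/leE; have [//|l] := ole_total (th m) (th A).
  by case: (olt_irr (ole_lt_trans (ole_trans h1 (proj1 h5)) (lt_stage k l))).
case: h2 => [hn|[i i3 [hi hb]]].
  apply/orP; left; apply/eqP; apply: contrapT => A2.
  have l := lt_stage k (top_lt A2).
  by case: (olt_irr (ole_lt_trans (ole_trans hn (proj1 h5)) (olt_le_trans l (proj1 th2)))).
have e0 b : (~~ b == 0 :> nat) = b by case: b.
rewrite !vaE !e0; have hb' : cl 0 (stage A k) i by rewrite /cl -(rn_eq 0 h5).
by apply/orP; right; case: i i3 hi hb' {hb} => [|[|[|//]]] _ /= -> ->; rewrite ?orbT.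
Qed.

Lemma cert_rounds c m0 m m' m1 n1 m2 n2 m3 n3 : (te (limit_state n, c)).2 = None ->
  rounds_ok g c m0 m m' m1 n1 m2 n2 m3 n3.
Proof.
move=> hc; rewrite /rounds_ok; apply/implyP => /andP [/andP [/andP [/andP [/andP [h0 h1] h2] k1] k2] k3].
rewrite !LE in h1 h2 k1 k2 k3; move/asboolP: h1 => h1; move/asboolP: h2 => h2.
have [[q1 q2 q3 q4] q5] := AstP c m0.
have l0 := proj1 (leE _ _) h0.
have lA : olt (th m') (Ast c (th m0)).
  by apply: olt_le_trans h2 _; apply: ole_trans (oplus_le _ _) (proj2 q5).
have e0 b : (~~ b == 0 :> nat) = b by case: b.
rewrite !roundsE; apply: nrounds_lt => //.
- exact: olt_le_trans lA q3.
- split=> // i i3 hi.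
  have key p j : le g m p -> lt p m' -> va g 0 p j i == 0 -> exists s, [/\ ole (th m) s, olt s (th m') & cl 0 s i].
    move=> /leE r1 r2; rewrite vaE e0 => r3; exists (stage p j); split=> //; last exact: lt_stage.
    exact: ole_trans r1 (oplus_le _ _).
  case: i i3 hi key => [|[|[|//]]] _ /= hi key.
  + by move: k1; rewrite hi /= => /andP [/andP [r1 /asboolP r2] r3]; exact: key r1 r2 r3.
  + by move: k2; rewrite hi /= => /andP [/andP [r1 /asboolP r2] r3]; exact: key r1 r2 r3.
  + by move: k3; rewrite hi /= => /andP [/andP [r1 /asboolP r2] r3]; exact: key r1 r2 r3.
- by move=> s s1 s2; apply: q4 => //; exact: olt_trans s2 lA.
Qed.

Lemma points_cert : cert g X te /\ well_founded (before g).
Proof.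
split.
  split.
  - exact: cert_order.
  - exact: cert_par.
  - exact: cert_kind.
  - exact: cert_start.
  - exact: cert_input.
  - exact: cert_range.
  - exact: cert_limit.
  - exact: cert_step.
  - exact: cert_end.
  - exact: cert_row.
  - exact: cert_other.
  - by move=> c m _; exact: cert_al.
  - exact: cert_rounds.
suff key b : forall a, oeq (th a) b -> Acc (before g) a by move=> a; exact: key (oeq_refl _).
elim/(well_founded_ind olt_wf): b => b IH a e.
constructor => j; rewrite /before LE => /asboolP l.
exact: IH (th j) (olt_oeqr e l) j (oeq_refl _).
Qed.
End Points.

Hypothesis powers : forall k, olt (iter k oplusw ozero) nu.

Lemma certificate_exists : exists g, cert g X te /\ well_founded (before g).
Proof.
have good w : olim0 (foldr hull ozero w) /\ ole (foldr hull ozero w) nu.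
  elim: w => [|l w [h1 h2]] /=; last exact: hull_good.
  by split; [left; exact: oeq_refl|exact: ole0].
pose s : letter := (0, 0, 0, 0, (true, true, true)).
have gen k : foldr hull ozero (nseq k s) = iter k oplusw ozero.
  by elim: k => //= k ->; case: (pselect _) => // -[].
have [||th [[h0 h1 h2] hi hw hk]] := @enumeration letter hull nu om_nu.
- by exists [:: (5, 0, 0, 0, (true, true, true))]; exact: oeq_refl.
- by move=> k; exists (nseq k s); rewrite gen; exact: oeq_refl.
exists (table_of th); apply: points_cert => //.
- by move=> i; have [w ->] := hw i; have [] := good w.
- by move=> i; have [w ->] := hw i; have [] := good w.
- by move=> l i; have [w ->] := hw i; exact: hk (l :: w).
Qed.
End Complete.

(** * Ignoring half of the input *)

Section Doubled.
Variables (n : nat) (t : table n).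

(* The block at position [l] is kept at position [2 * l], where the input [join x y] has [x l]; every
   instruction takes two steps, the second one in the state [n.+2 + 2 * q + d], which repeats the
   move [d] and enters [q]. *)
Definition drow i : row := if i < n.+2
  then fun s => let a := t (inord i, s) in
    (a.1.1, a.1.2, omap (fun q : 'I_n.+2 => n.+2 + (2 * q + a.1.2)) a.2)
  else fun s => (s, odd (i - n.+2), Some (i - n.+2)./2).
Definition dcode := mkseq drow (3 * n.+2).
Definition dstates := n + 2 * n.+2.

Lemma nth_dcode i : i < 3 * n.+2 -> nth row0 dcode i = drow i.
Proof. by move=> h; rewrite nth_mkseq. Qed.

Lemma dcode_ok i s q : (nth row0 dcode i s).2 = Some q -> q < dstates.+2.
Proof.
case: (ltnP i (3 * n.+2)) => h; last by rewrite nth_default ?size_mkseq.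
rewrite nth_dcode // /drow; case: ltnP => h2 /=.
  case: (t _).2 => //= q' [<-]; have := ltn_ord q'; rewrite /dstates; case: (t _).1.2 => /=; lia.
by case=> <-; rewrite /dstates; lia.
Qed.

Definition dtable : table dstates := code_table dcode dstates.
Definition emb i := 6 * (i %/ 3) + i %% 3.

Definition mimics (c : config n) (s : rconf) :=
  [/\ s.1 = val (state c), s.2.1 = 2 * hpos c & forall i, s.2.2 (emb i) = cell c i].

Lemma mimics_scan c s : mimics c s -> rscan s.2.1 s.2.2 = scan c.
Proof.
move=> [_ h2 h3]; rewrite /rscan /scan h2 -!h3 /emb.
have e0 : 6 * (3 * hpos c %/ 3) + (3 * hpos c) %% 3 = 3 * (2 * hpos c) by lia.
have e1 : 6 * ((3 * hpos c).+1 %/ 3) + (3 * hpos c).+1 %% 3 = (3 * (2 * hpos c)).+1 by lia.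
have e2 : 6 * ((3 * hpos c).+2 %/ 3) + (3 * hpos c).+2 %% 3 = (3 * (2 * hpos c)).+2 by lia.
by rewrite e0 e1 e2.
Qed.

Lemma mimics_row c s : mimics c s -> rrow dcode s = let a := instr t c in
  (a.1.1, a.1.2, omap (fun q : 'I_n.+2 => n.+2 + (2 * q + a.1.2)) a.2).
Proof.
move=> h; rewrite /rrow (mimics_scan h); have [h1 _ _] := h.
have l := ltn_ord (state c); rewrite h1 nth_dcode; last exact: (leq_trans l (leq_pmull _ (isT : 0 < 3))).
by rewrite /drow l inord_val.
Qed.

Lemma mimics_written c s : mimics c s -> forall i,
  rput s.2.1 s.2.2 (rrow dcode s).1.1 (emb i) = written t c i.
Proof.
move=> h i; rewrite (mimics_row h) /= /rput /written; have [_ h2 h3] := h.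
rewrite h2 h3; case: (instr t c).1.1 => [[u v] w] /=; rewrite /emb.
have -> : (6 * (i %/ 3) + i %% 3 == 3 * (2 * hpos c)) = (i == 3 * hpos c) by lia.
have -> : (6 * (i %/ 3) + i %% 3 == (3 * (2 * hpos c)).+1) = (i == (3 * hpos c).+1) by lia.
by have -> : (6 * (i %/ 3) + i %% 3 == (3 * (2 * hpos c)).+2) = (i == (3 * hpos c).+2) by lia.
Qed.

Lemma mimics_step c s : mimics c s -> (instr t c).2 <> None ->
  [/\ mimics (nextc t c) (rstep dcode (rstep dcode s)),
     (rrow dcode (rstep dcode s)).2 <> None &
     forall i, (rstep dcode s).2.2 (emb i) = cell (nextc t c) i].
Proof.
move=> h; case e: (instr t c).2 => [q|] // _.
have hw := mimics_written h; have hr := mimics_row h; rewrite /= e /= in hr.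
set d := (instr t c).1.2 in hr.
have nE : nextc t c = Config q (moved t c) (written t c) by rewrite /nextc e.
have [h1 h2 h3] := h.
have s1 : rstep dcode s = (n.+2 + (2 * q + d), (rmove s.2.1 d, rput s.2.1 s.2.2 (rrow dcode s).1.1)).
  by rewrite /rstep hr.
have lq := ltn_ord q.
have r1 : rrow dcode (rstep dcode s) = (rscan (rmove s.2.1 d) (rput s.2.1 s.2.2 (rrow dcode s).1.1), d, Some (val q)).
  rewrite /rrow s1 nth_dcode /=; last by case: (d); lia.
  rewrite /drow ltnNge leq_addr /= addKn oddD oddM /= oddb.
  by congr (_, _, Some _); case: (d) => /=; lia.
split; last 1 first.
- by move=> i; rewrite s1 nE /= hw.
- rewrite nE.
  have -> : rstep dcode (rstep dcode s) = (val q, (rmove (rmove s.2.1 d) d, rput s.2.1 s.2.2 (rrow dcode s).1.1)).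
    by rewrite {1}/rstep r1 s1 /= rput_scan.
  split=> //=; rewrite h2 /moved -/d /rmove; case: (d); lia.
- by rewrite r1.
Qed.

Lemma join_even x y i : join x y (2 * i) = x i.
Proof. by rewrite /join mul2n odd_double doubleK. Qed.

(** Doubling affects only the finite part of a stage. This carries the cofinality in a limsup from
    the slow machine back to the fast one. *)
Lemma halve_stage a b j m : olim0 a -> olim0 b -> ole (oplus b (2 * j)) (oplus a m) ->
  ole (oplus b j) (oplus a m./2).
Proof.
move=> la lb h.
have over c d k : olim0 c -> olt d c -> olt (oplus d k) c.
  by case=> [c0 /(olt_oeqr c0) /olt0 //|lc]; exact: oplus_limit.
have [l|l] := ole_total b a; last first.
  case: (olt_irr (ole_lt_trans h (olt_le_trans (over _ _ m lb l) (oplus_le _ _)))).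
have [e|l2] := ole_eqVlt l; last exact: ole_trans (oltW (over _ _ j la l2)) (oplus_le _ _).
apply: ole_trans (oplus_mono j (proj1 e)) _; apply: oplus_leq.
have : 2 * j <= m; last by lia.
rewrite leqNgt; apply/negP => l3.
exact: (olt_irr (ole_lt_trans (ole_trans (oplus_mono _ (proj2 e)) h) (oplus_ltn _ l3))).
Qed.

Section Simulate.
Variables (x y : real) (nu : ord).
Hypothesis halts_nu : halts_at t x nu.
Let c a := run t x a.
Let s a := rawc (run dtable (join x y) a).

Let s_succ a : s (osucc a) = rstep dcode (s a).
Proof. by rewrite /s run_succ nextc_code //; exact: dcode_ok. Qed.

(** The first of the two steps already writes and the second only moves, so after an odd number of
    steps the cells agree with the later of the two neighbouring stages, whence [uphalf]. *)
Lemma mimics_phase a : mimics (c a) (s a) -> forall m, ole (oplus a (uphalf m)) nu ->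
  (forall i, (s (oplus a m)).2.2 (emb i) = cell (c (oplus a (uphalf m))) i) /\
  if odd m then (rrow dcode (s (oplus a m))).2 <> None else mimics (c (oplus a m./2)) (s (oplus a m)).
Proof.
move=> h0.
have even k : ole (oplus a k) nu -> mimics (c (oplus a k)) (s (oplus a k.*2)).
  elim: k => [//|k IH] l; have l' : olt (oplus a k) nu by exact/osucc_le.
  have [_ nh] := halts_nu.
  have [h1 _ _] := mimics_step (IH (oltW l')) (nh _ l').
  by rewrite doubleS [oplus _ k.*2.+2]/= !s_succ [oplus _ k.+1]/= /c run_succ.
move=> m; have [k em] : exists k, m = k.*2 \/ m = k.*2.+1.
  by exists m./2; have := odd_double_half m; case: (odd m) => /= h; [right|left]; lia.
case: em => -> {m}.
  rewrite uphalf_double odd_double doubleK => l; have h := even _ l; split=> //.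
  by have [_ _] := h.
have -> : uphalf k.*2.+1 = k.+1 by rewrite /= doubleK.
rewrite [odd _]/= odd_double [~~ false]/= => l.
have l' : olt (oplus a k) nu by exact/osucc_le.
have [_ nh] := halts_nu; have [_ h2 h3] := mimics_step (even _ (oltW l')) (nh _ l').
by rewrite [oplus _ k.*2.+1]/= s_succ [oplus _ k.+1]/= /c run_succ; split.
Qed.

Lemma mimics_point a : olim0 a -> ole a nu -> mimics (c a) (s a).
Proof.
elim/(well_founded_ind olt_wf): a => a IH la an.
case: (la) => [a0|lim].
  rewrite /c /s !(run0 _ _ a0); split=> // i /=.
  have -> : emb i %% 3 = i %% 3 by rewrite /emb; lia.
  have -> : emb i %/ 3 = 2 * (i %/ 3) by rewrite /emb; lia.
  by rewrite join_even.
have dec d : olt d a -> exists a' k, [/\ olim0 a', oeq d (oplus a' k), olt a' a &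
    forall m, olt (oplus a' m) a /\ forall i, (s (oplus a' m)).2.2 (emb i) = cell (c (oplus a' (uphalf m))) i].
  move=> da; have [a' [k [la' e]]] := ord_decomp d.
  have l : olt a' a by apply: ole_lt_trans da; exact: ole_trans (oplus_le _ _) (proj2 e).
  exists a', k; split=> // m; split; first exact: oplus_limit.
  have l' k' : ole (oplus a' k') nu by apply: ole_trans an; apply: oltW; exact: oplus_limit.
  by have [] := mimics_phase (IH a' l la' (ole_trans (oltW l) an)) (l' (uphalf m)).
have limc i := run_limP t x i lim.
have lims i := run_limP dtable (join x y) i lim.
split; [by rewrite /c /s !(run_lim _ _ lim)|by rewrite /c /s !(run_lim _ _ lim)|].
move=> i; apply/idP/idP => [/lims h|/limc h].
  apply/limc => b /dec [b' [j [lb' eb _ hb]]].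
  have [d [bd da hd]] := h _ (proj1 (hb (2 * j))).
  have [a' [m [la' e _ ha]]] := dec d da; exists (oplus a' (uphalf m)); split.
  - apply: ole_trans (proj1 eb) _; apply: ole_trans (halve_stage la' lb' (ole_trans bd (proj1 e))) _.
    by apply: oplus_leq; rewrite uphalf_half; exact: leq_addl.
  - exact: (proj1 (ha _)).
  - by rewrite -[cell _ _]/(cell (c _) i) -(proj2 (ha m)) /s -(run_eq _ _ e).
apply/lims => b ba; have [d [bd da hd]] := h b ba.
have [a' [k [la' e _ ha]]] := dec d da; exists (oplus a' k.*2); split.
- apply: ole_trans bd _; apply: ole_trans (proj1 e) _; apply: oplus_leq; rewrite -addnn; exact: leq_addr.
- exact: (proj1 (ha _)).
- suff h2 : (s (oplus a' k.*2)).2.2 (emb i) by exact: h2.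
  by have := proj2 (ha k.*2) i; rewrite uphalf_double /c -(run_eq _ _ e) => ->.
Qed.

(** A halting time that is a limit plus [k] becomes the same limit plus twice [k]. A limit bound
    that admits the first admits the second, which is why bounds that are limits matter for the
    inclusion. *)
Lemma doubled_halts : exists nu', [/\ halts_at dtable (join x y) nu',
  written dtable (run dtable (join x y) nu') 0 = written t (run t x nu) 0 &
  forall b, olimit b -> ole nu b -> ole nu' b].
Proof.
have [a [k [la e]]] := ord_decomp nu; have [hh nh] := halts_nu.
have an : ole a nu by exact: ole_trans (oplus_le _ _) (proj2 e).
have h0 := mimics_point la an.
have hk : mimics (c (oplus a k)) (s (oplus a k.*2)).
  have l : ole (oplus a (uphalf k.*2)) nu by rewrite uphalf_double; exact: proj2 e.
  by have [_] := mimics_phase h0 l; rewrite odd_double doubleK.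
exists (oplus a k.*2); split.
- split.
    apply/halting_code; rewrite -/(s _) (mimics_row hk) /=.
    by rewrite /c -(run_eq _ _ e); move: hh; rewrite /halting => ->.
  move=> d dl.
  have [a' [m [la' e' l]]] : exists a' m, [/\ olim0 a', oeq d (oplus a' m) & olt (oplus a' m./2) nu].
    have [da|[m mk e']] := olt_oplus dl; last first.
      exists a, m; split=> //; apply: olt_oeqr (oeq_sym e) _; apply: oplus_ltn; lia.
    have [a' [m [la' e']]] := ord_decomp d; exists a', m; split=> //.
    apply: olt_le_trans an; apply: ole_lt_trans da; apply: ole_trans (proj2 e').
    by apply: oplus_leq; lia.
  have l2 : ole (oplus a' (uphalf m)) nu.
    rewrite uphalf_half; case: (odd m) => /=; last exact: oltW.
    exact/osucc_le.
  have h1 := mimics_point la' (ole_trans (oplus_le _ _) l2).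
  move/halting_code; rewrite -/(s _) /s (run_eq _ _ e') -/(s _).
  have [_] := mimics_phase h1 l2; case: ifP => _ h2 //.
  rewrite (mimics_row h2) /=; have := nh _ l; rewrite /halting -/(c _).
  by case: (_.2).
- have := mimics_written hk 0; rewrite written_code -/(s _) /c -(run_eq _ _ e).
  by rewrite -[emb 0]/0 => <-.
move=> b lb nb; have [l|l] := ole_total b (oplus a k); last first.
  apply: oltW; apply: oplus_limit => //; exact: ole_lt_trans (oplus_le _ _) l.
have : oeq (oplus a k) b by split=> //; exact: ole_trans (proj2 e) nb.
case: k {e hk l} => [|k] e'; first exact: (proj1 e').
by case: (@olimit_not_succ b (oplus a k) lb); exact: oeq_sym e'.
Qed.
End Simulate.
End Doubled.

(** * The verifier *)

Lemma haltsP e n (t : table n) x nu : prog e = existT table n t -> halts_in e x nu <-> halts_at t x nu.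
Proof. by move=> h; have := @halts_inP e x nu; rewrite h. Qed.

Lemma accepts_atP e n (t : table n) x : prog e = existT table n t ->
  accepts e x <-> exists2 nu, halts_at t x nu & written t (run t x nu) 0.
Proof. by move=> h; have := @acceptsP e x; rewrite h. Qed.

Lemma accepts_uniq e n (t : table n) x nu : prog e = existT table n t -> halts_at t x nu ->
  accepts e x <-> written t (run t x nu) 0.
Proof.
move=> h hh; split=> [/(accepts_atP _ h) [mu hm]|w]; last by apply/(accepts_atP _ h); exists nu.
by rewrite (run_eq _ _ (halts_at_uniq hm hh)).
Qed.

Lemma Pclass_sub (f : real -> ord) (A : real -> Prop) : (forall x, olimit (f x)) -> Pclass f A -> NPclass f A.
Proof.
move=> fl [e [hA hw]]; case ep: (prog e) => [n t].
have [d dp] := prog_onto (dtable t).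
have hx x y : exists nu nu', [/\ halts_at t x nu, halts_at (dtable t) (join x y) nu',
    written (dtable t) (run (dtable t) (join x y) nu') 0 = written t (run t x nu) 0 & ole nu' (f x)].
  have [nu /(haltsP _ _ ep) hh l] := hw x.
  by have [nu' [h1 h2 h3]] := doubled_halts y hh; exists nu, nu'; split=> //; exact: h3.
exists d; split=> [x|x y].
  split=> [/hA a|[y a]].
    (* The witness is never read, so any real serves. *)
    have [nu [nu' [h1 h2 h3 _]]] := hx x x; exists x; apply/(accepts_uniq dp h2).
    by rewrite h3; exact/(accepts_uniq ep h1).
  have [nu [nu' [h1 h2 h3 _]]] := hx x y; apply/hA/(accepts_uniq ep h1); rewrite -h3.
  exact/(accepts_uniq dp h2).
by have [nu [nu' [h1 h2 h3 h4]]] := hx x y; exists nu' => //; exact/(haltsP _ _ dp).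
Qed.

Section Verifier.
Variables (n : nat) (t : table n).
Notation K := (NV + 6).

Definition verifier := machine NV dim (formula t).
Definition tape z := trk NV (cell (run verifier z ozero)).

Lemma tape_good z o b : o < 3 * K -> o %% 3 = 2 -> tape z o b = z (b * K + o %/ 3).
Proof.
move=> l o2; have e : idx NV b o = b * K * 3 + o by rewrite /idx mulnCA mulnC.
have -> : tape z o b = (idx NV b o %% 3 == 2) && z (idx NV b o %/ 3).
  by rewrite /tape /trk /goodo l /isvar o2 andbF (run0 _ _ (oeq_refl _)).
by rewrite e modnMDl o2 divnMDl.
Qed.

Lemma tape_input x y r b : r < half -> tape (join x y) (6 * r + 2) b = x (half * b + r).
Proof.
rewrite /half => hr; rewrite tape_good; [|by rewrite /NV; lia|lia].
have -> : b * K + (6 * r + 2) %/ 3 = 2 * (26 * b + r) by rewrite /NV; lia.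
exact: join_even.
Qed.

Lemma tape_witness x y b : tape (join x y) 11 b = y (half * b + 1).
Proof.
rewrite tape_good //; have -> : b * K + 11 %/ 3 = (half * b + 1).*2.+1 by rewrite /NV /half; lia.
by rewrite /join /= odd_double uphalf_double.
Qed.

Let D : 10 < dim. Proof. by []. Qed.
Let NVb : 20 <= NV. Proof. by []. Qed.

Variables (x : real) (nu : ord).
Hypothesis t_halts : halts_at t x nu.
Hypothesis nu_lim : olimit nu.

Lemma obeys0 g X : cert g X t -> forall m k q r, st g 0 m k = val q -> sc g 0 m k = rcode r ->
  ac g 0 m k = acode (t (q, r)).
Proof.
by move=> C m k q r h1 h2; have := c_table C q r m k; rewrite /row_ok h1 h2 !eqxx => /eqP.
Qed.

(** A bad certificate is rejected at ω. With a well-founded one, soundness makes the given machine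
    halt at the stage of the top, so the climb ends exactly at [nu]. With an ill-founded one,
    [wild_bound] leaves room for the rejection. Only the second case accepts. *)
Lemma verifier_halts y : exists nu', [/\ halts_at verifier (join x y) nu', ole nu' nu &
  written verifier (run verifier (join x y) nu') 0 -> exists g X,
    [/\ cert g X t, forall r b, r < half -> X r b = x (half * b + r) & Acc (before g) 2]].
Proof.
set z := join x y; pose g := gof (tape z); pose X r b := tape z (6 * r + 2) b.
have hX r b : r < half -> X r b = x (half * b + r) by exact: tape_input.
have [[hP hg]|hn] := pselect (Phi (formula t) (tape z) /\ gtotal (tape z)); last first.
  have [h1 h2] := machine_checks D (formula_vars t) (formula_bits t) (formula_inputs t)
    (formula_dep t) NVb (@formula_total _ t) hn.
  by exists omega; split=> //; [exact: limit_omega_le|rewrite h2].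
have C : cert g X t by exact/Phi_cert.
have L := cert_ladder C; have ob := obeys0 C.
have [A2|W2] := pselect (Acc (before g) 2).
  have [h1 _] := machine_accepts D (formula_vars t) (formula_bits t) (formula_inputs t)
    (formula_dep t) NVb (@formula_total _ t) L hP hg A2.
  have [m0 n0 _ _ _] := end_parts C 0.
  have := stops C hX ob; rewrite m0 n0 => /(_ A2) [h2 _].
  exists (tm (before g) 2); split=> //; first exact: (proj1 (halts_at_uniq h2 t_halts)).
  by exists g, X.
have [h1 h2] := machine_rejects D (formula_vars t) (formula_bits t) (formula_inputs t)
    (formula_dep t) NVb (@formula_total _ t) L hP hg W2.
exists (oplusw (cut (before g) (Acc (before g)))); split=> //; last by rewrite h2.
exact: (wild_bound C hX ob W2 t_halts nu_lim).
Qed.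

Lemma verifier_accepts g : cert g (fun r b => x (half * b + r)) t -> well_founded (before g) ->
  exists y, exists2 nu', halts_at verifier (join x y) nu' & written verifier (run verifier (join x y) nu') 0.
Proof.
move=> C wf.
(* The graph of [g] is placed at the residue 1 modulo [half], which is where track 11 of each block
   takes its bit from the witness. *)
pose y i := `[< exists a j, i = half * npair a j + 1 /\ g a = j >].
have hy a j : gbit (tape (join x y)) a j = (g a == j).
  rewrite /gbit tape_witness; apply/asboolP/eqP => [[a' [j' [e h]]]|<-]; last by exists a, (g a).
  have /pair_inj [-> ->] // : npair a j = npair a' j' by move: e; rewrite /half; lia.
have hg : gtotal (tape (join x y)) by move=> a; exists (g a); rewrite hy.
have eg : gof (tape (join x y)) = g.
  apply/funext => a; rewrite /gof; case: (pselect _) => [h|[]]; last by exists (g a); rewrite hy.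
  by case: ex_minnP => j; rewrite hy => /eqP.
have C' : cert (gof (tape (join x y))) (fun r => tape (join x y) (6 * r + 2)) t.
  rewrite eg; case: C => h1 h2 h3 h4 h5 h6 h7 h8 h9 h10 h11 h12 h13; split=> //.
    by move=> u b r hr; rewrite tape_input // h5.
  by move=> u m k u0; rewrite tape_input //; exact: h11.
have hP : Phi (formula t) (tape (join x y)) by exact/Phi_cert.
have L := cert_ladder C'.
have A2 : Acc (before (gof (tape (join x y)))) 2 by rewrite eg; exact: wf.
have [h1 h2] := machine_accepts D (formula_vars t) (formula_bits t) (formula_inputs t)
    (formula_dep t) NVb (@formula_total _ t) L hP hg A2.
by exists y, (tm (before (gof (tape (join x y)))) 2).
Qed.

End Verifier.

(** ** Diagonalization *)

Definition table_bit (P : program) c := `[< exists q r,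
  c = npair (npair (val q) (rcode r)) (acode (projT2 P (q, r))) >].
(** The bits at multiples of [half] fill the first input cell of each block, so block [c] tells
    whether [c] codes an instruction of [P]. *)
Definition coded (P : program) : real := fun i => (i %% half == 0) && table_bit P (i %/ half).

Lemma coded_bit P c : coded P (half * c + 0) = table_bit P c.
Proof. by rewrite /coded addn0 modnMr eqxx mulKn. Qed.

Lemma diagonal_obeys n (t : table n) g X (P : program) u : cert g X t ->
  (forall r b, r < half -> X r b = coded P (half * b + r)) -> u != 0 ->
  forall m k q r, st g u m k = val q -> sc g u m k = rcode r -> ac g u m k = acode (projT2 P (q, r)).
Proof.
move=> C hX u0 m k q r h1 h2; have := c_other C m k u0; rewrite hX // coded_bit => /asboolP.
move=> [q' [r' /pair_inj [/pair_inj [e1 e2] ->]]].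
rewrite h1 in e1; rewrite h2 in e2.
by rewrite (val_inj e1) (rcode_inj e2).
Qed.

Local Open Scope classical_set_scope.

Theorem theorem1p9 (e : nat)
  (e_total : forall x : real, halts e x)
  (e_length : forall (x : real) (nu : ord), halts_in e x nu ->
     olimit nu /\ ole (oexp omega omega) nu)
  (f : real -> ord)
  (f_length : forall x : real, halts_in e x (f x)) :
  Pclass f `<=` NPclass f /\ Pclass f <> NPclass f.
Proof.
have fl x : olimit (f x) := proj1 (e_length _ _ (f_length x)).
split=> [A|]; first exact: Pclass_sub.
case ep: (prog e) => [n t].
have ht x : halts_at t x (f x) by apply/(haltsP _ _ ep).
have [v vp] := prog_onto (verifier t).
pose A : set real := [set x | exists y, accepts v (join x y)].
have NA : NPclass f A.
  exists v; split=> // x y; have [nu [h1 h2 _]] := verifier_halts (ht x) (fl x) y.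
  by exists nu => //; exact/(haltsP _ _ vp).
move=> eq; have [d [hA hd]] : Pclass f A by rewrite eq.
case dp: (prog d) => [k td]; pose P : program := existT table k td; pose x := coded P.
have [mu /(haltsP _ _ dp) hmu mul] := hd x.
have acc := accepts_uniq dp hmu.
(* If [P] accepts its own code, there is an accepted certificate, in which the machine 1 obeys the
   table of [P] and rejects. If [P] rejects, its run is no longer than that of the given machine and
   can be recorded, so the verifier accepts some witness and [P] should have accepted. *)
have [w|/negP w] := pselect (written td (run td x mu) 0).
  have [y ay] : A x by apply/hA/acc.
  have [nu [h1 h2 h3]] := verifier_halts (ht x) (fl x) y.
  have [g [X [C hX A2]]] := h3 (proj1 (accepts_uniq vp h1) ay).
  have ob := @diagonal_obeys _ _ _ _ P 1 C hX isT.
  (* An accepted certificate has an accessible top, so the end recorded for machine 1 is accessible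
     too and its halting is real. *)
  have [h4 h5] := stops C hX ob (end_tame C 1 A2).
  by move: w; rewrite (run_eq _ _ (halts_at_uniq hmu h4)) h5.
have om : olt omega (f x).
  exact: olt_le_trans (omega_powers 1) (proj2 (e_length _ _ (f_length x))).
have pw i : olt (iter i oplusw ozero) (f x).
  exact: olt_le_trans (omega_powers i) (proj2 (e_length _ _ (f_length x))).
have hX q r : coded P (half * npair (npair (val q) (rcode r)) (acode (projT2 P (q, r))) + 0).
  by rewrite coded_bit; apply/asboolP; exists q, r.
have w0 : written (projT2 P) (run (projT2 P) x mu) 0 = false by exact: negbTE w.
have [g [C wf]] := @certificate_exists x (fun r b => x (half * b + r)) n t P (f x) mu
  (ht x) hmu (fl x) om mul w0 (fun _ _ _ => erefl) hX pw.
have [y [nu h1 h2]] := verifier_accepts C wf.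
case/negP: w; apply/acc/hA; exists y; exact/(accepts_uniq vp h1).
Qed.
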